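(* If $\varphi$ is a tame, discrete, regular Langlands parameter for the quasi-split ramified unitary group $\mathbf{G}$, then the character $\chi_\varphi$ of $\mathbf{T}(K)^0$ has depth zero. In particular, it induces a character on the $k$-points $\bar{\mathbf{T}}(k)=\mathbf{T}(K)^0/\mathbf{T}(K)^{0+}$ of the special fiber of the Néron model of $\mathbf{T}$.
   Context: $K/\mathbb{Q}_p$ is a finite extension, $p\neq2$, with residue field $k$; $E/K$ is a ramified quadratic extension, $\mathrm{Gal}(E/K)=\{1,\tau\}$; $\mathbf{G}=\mathrm{U}(V)$ is a quasi-split unitary group of an $n$-dimensional Hermitian space $V$ over $E$; $\mathbf{S}$ is the centralizer of a maximal $K$-split torus, a maximal torus of $\mathbf{G}$ defined over $K$; $W$ is its Weyl group. $\hat{\mathbf{G}}=\mathrm{GL}_n(\mathbb{C})$ is the dual group, with maximal torus $\hat{\mathbf{S}}$ dual to $\mathbf{S}$; $\tau$ acts on it by a pinned automorphism; ${}^L\mathbf{G}=\hat{\mathbf{G}}\rtimes\mathrm{Gal}(E/K)$; $W=N_{\hat{\mathbf{G}}}(\hat{\mathbf{S}})/\hat{\mathbf{S}}$. $\tilde\tau$ is a topological generator of tame inertia mapping to $\tau$; $\mathrm{Fr}$ is a Frobenius element acting trivially on $E$. A Langlands parameter $\varphi\colon\mathcal{W}_K\to{}^L\mathbf{G}$ (a homomorphism from the Weil group compatible with the projections to $\mathrm{Gal}(E/K)$) is tame if it factors through the quotient of $\mathcal{W}_K$ by wild inertia; discrete if the centralizer of $\varphi$ in $\hat{\mathbf{G}}$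 is finite modulo the center of ${}^L\mathbf{G}$; regular if the image of inertia is generated by a semisimple element of ${}^L\mathbf{G}$ whose centralizer in $\hat{\mathbf{G}}$ is a maximal torus. After conjugating $\varphi$ by an element of $\hat{\mathbf{G}}$ one has $\varphi(\tilde\tau)=z\tau$ with $z\in\hat{\mathbf{S}}^\tau$, and then $\varphi(\mathrm{Fr})\in N_{\hat{\mathbf{G}}}(\hat{\mathbf{S}})$, with image $\omega\in W^\tau$. $\mathbf{T}$ is the $K$-torus with $X^*(\mathbf{T})=X^*(\mathbf{S})$, inertia acting as on $X^*(\mathbf{S})$ and $\mathrm{Fr}$ acting by $\omega$. $M$ is its splitting field and $K_f$ the maximal unramified subextension of $M/K$. For $N/K$ finite unramified, $\mathbf{T}(N)^0$ is the group of integral points of the identity component of the Néron model of $\mathbf{T}$, with Moy–Prasad filtration $\mathbf{T}(N)^r$ ($r\geq0$), and $\mathbf{T}(K)^{0+}=\bigcup_{r>0}\mathbf{T}(K)^r$. Identify $\hat{\mathbf{T}}=\hat{\mathbf{S}}$. The restriction of $\varphi$ to $\mathcal{W}_{K_f}$ takes values in $\hat{\mathbf{T}}\rtimes\mathrm{Gal}(E/K)\cong\hat{\mathbf{T}}\rtimes\mathrm{Gal}(M/K_f)$ and so defines a class in $H^1(\mathcal{W}_{K_f},\hat{\mathbf{T}})^{\mathrm{Gal}(K_f/K)}$, hence by the local Langlands correspondence for tori a $\mathrm{Gal}(K_f/K)$-invariant character of $\mathbf{T}(K_f)$. Its restriction to $\mathbf{T}(K_f)^0$ descends to the coinvariants $\mathbf{T}(K_f)^0_{\mathrm{Gal}(K_f/K)}$,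 which the norm map identifies with $\mathbf{T}(K)^0$; the resulting character of $\mathbf{T}(K)^0$ is $\chi_\varphi$. A character of $\mathbf{T}(K)^0$ has depth zero if it is trivial on $\mathbf{T}(K)^{0+}$.
   Formalization: ''Regular'' is read as: the centralizer lies in a maximal torus (being one is impossible, as scalars do not centralize zτ). The equality T̄(k)=T(K)^0/T(K)^{0+}, false for the special fiber (n=1: k versus trivial), is not asserted; characters are induced on both groups. *)

(* Defs.v *)
From HB Require Import structures.
From mathcomp Require Import all_boot all_order all_algebra perm.
From mathcomp Require Import complex.
From mathcomp Require Import boolp classical_sets reals exp.

Set Implicit Arguments.
Unset Strict Implicit.
Unset Printing Implicit Defensive.

Import Order.TTheory GRing.Theory Num.Theory.
Local Open Scope ring_scope.
Local Open Scope classical_set_scope.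

(** * Local fields

    All fields live in one algebraic closure [Omega] of [Q_p], with absolute
    value [abs].  A field is a set [F : set Omega], and an element of a Galois
    or Weil group is a plain map [Omega -> Omega]. *)

Section LocalFields.
Variables (R : realType) (Omega : closedFieldType) (abs : Omega -> R).
Implicit Types (F L : set Omega) (x y : Omega) (s t u v : Omega -> Omega).

Definition is_subfield F : Prop :=
  [/\ F 1, forall x y, F x -> F y -> F (x - y)
     & forall x y, F x -> F y -> F (x / y)].

Definition finite_ext F L : Prop :=
  [/\ is_subfield F, is_subfield L, F `<=` L
    & exists b : seq Omega, forall x, L x ->
        exists2 c : nat -> Omega, forall i, F (c i)
          & x = \sum_(i < size b) c i * b`_i].

(* [Omega] is an algebraic closure of the completion [Qp] of the rational
   numbers for the p-adic absolute value.  The normalisation of [abs] at [p]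
   forces [Omega] to have characteristic 0, so that [ratr] is an embedding. *)
Record padic_closure (p : nat) (Qp : set Omega) : Prop := PadicClosure {
  abs_ge0 : forall x, 0 <= abs x;
  abs_eq0 : forall x, abs x = 0 <-> x = 0;
  absM : forall x y, abs (x * y) = abs x * abs y;
  abs_ultra : forall x y, abs (x + y) <= Num.max (abs x) (abs y);
  abs_p : abs p%:R = p%:R^-1;
  Qp_subfield : is_subfield Qp;
  Qp_dense : forall x, Qp x -> forall e : R, 0 < e ->
    exists r : rat, abs (x - ratr r) < e;
  Qp_complete : forall a : nat -> Omega, (forall i, Qp (a i)) ->
    (forall e : R, 0 < e -> exists N, forall i j,
       (N <= i)%N -> (N <= j)%N -> abs (a i - a j) < e) ->
    exists2 l, Qp l & forall e : R, 0 < e -> exists N, forall i,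
       (N <= i)%N -> abs (a i - l) < e;
  Omega_algebraic : forall x, exists P : {poly Omega},
    [/\ P != 0, forall i, Qp P`_i & root P x]
}.

Definition unramified F L : Prop :=
  finite_ext F L /\ forall x, L x -> exists2 y, F y & abs y = abs x.

Definition ramified_quadratic F L : Prop :=
  [/\ is_subfield L, F `<=` L,
      exists e, [/\ L e, ~ F e & forall x, L x ->
        exists a b, [/\ F a, F b & x = a + b * e]]
    & exists2 x, L x & forall y, F y -> abs y <> abs x].

Definition uniformizer F x : Prop :=
  [/\ F x, x != 0, abs x < 1 & forall y, F y -> abs y < 1 -> abs y <= abs x].

Definition residue_card F (q : nat) : Prop :=
  exists r : seq Omega,
    [/\ size r = q,
        forall i, (i < q)%N -> F r`_i /\ abs r`_i <= 1,
        forall i j, (i < j < q)%N -> ~ abs (r`_i - r`_j) < 1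
      & forall x, F x -> abs x <= 1 ->
          exists2 i, (i < q)%N & abs (x - r`_i) < 1].

Definition Gal F : set (Omega -> Omega) :=
  [set s | [/\ forall x y, s (x + y) = s x + s y,
               forall x y, s (x * y) = s x * s y,
               bijective s & forall x, F x -> s x = x]].

Definition fixes L s : Prop := forall x, L x -> s x = x.

Definition inertia F : set (Omega -> Omega) :=
  [set s | Gal F s /\ forall x, abs x <= 1 -> abs (s x - x) < 1].

(* The ramification group: trivial action on the graded pieces of [Omega]. *)
Definition wild_inertia F : set (Omega -> Omega) :=
  [set s | Gal F s /\ forall x, x != 0 -> abs (s x - x) < abs x].

Definition frobenius F s : Prop :=
  Gal F s /\ exists2 q, residue_card F q
    & forall x, abs x <= 1 -> abs (s x - x ^+ q) < 1.

(* Automorphisms acting on the residue field of [Omega] by an integral power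
   (positive or negative) of the Frobenius of the residue field of [F]. *)
Definition weil F : set (Omega -> Omega) :=
  [set s | Gal F s /\ exists q k : nat, residue_card F q /\
     ((forall x, abs x <= 1 -> abs (s x - x ^+ (q ^ k)) < 1) \/
      (forall x, abs x <= 1 -> abs ((s x) ^+ (q ^ k) - x) < 1))].

(* [tt] generates tame inertia topologically. *)
Definition tame_generator F (tt : Omega -> Omega) : Prop :=
  inertia F tt /\
  forall s, inertia F s -> forall X : seq Omega,
    exists (k : nat) (v : Omega -> Omega), wild_inertia F v /\
      forall x, x \in X -> s x = iter k tt (v x).

(* [ws] represents the right cosets [H w] in [G]; for normal [H] these are
   also the left cosets. *)
Definition coset_reps (G H : set (Omega -> Omega)) (d : nat)
    (ws : 'I_d -> Omega -> Omega) : Prop :=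
  (forall i, G (ws i)) /\
  forall g, G g -> exists! i, exists2 h, H h & g = h \o ws i.

(* The maps [u'] and [v'] are the inverses of [u] and [v]. *)
Inductive commutators (G : set (Omega -> Omega)) : set (Omega -> Omega) :=
| Comm1 : commutators G id
| CommS u u' v v' c : G u -> G u' -> G v -> G v' ->
    u \o u' = id -> v \o v' = id -> commutators G c ->
    commutators G (u \o v \o u' \o v' \o c).

(* Equality modulo the closure of the commutator subgroup of [G]. *)
Definition eq_ab (G : set (Omega -> Omega)) s t : Prop :=
  forall X : seq Omega, exists2 c, commutators G c
    & forall x, x \in X -> s x = t (c x).

(* The Artin map of [F]: an isomorphism from [F^*] onto the abelianised Weil
   group, given by representatives [art x] in [weil F], where only the class of
   [art x] modulo the closure of the commutators matters.  The conditions on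
   uniformizers and on norms characterise it; uniformizers go to arithmetic
   Frobenius elements.  The last condition is its Galois equivariance. *)
Record artin_map F (art : Omega -> Omega -> Omega) : Prop := ArtinMap {
  art_weil : forall x, F x -> x != 0 -> weil F (art x);
  artM : forall x y, F x -> x != 0 -> F y -> y != 0 ->
    eq_ab (weil F) (art (x * y)) (art x \o art y);
  art_inj : forall x y, F x -> x != 0 -> F y -> y != 0 ->
    eq_ab (weil F) (art x) (art y) -> x = y;
  art_surj : forall s, weil F s ->
    exists x, [/\ F x, x != 0 & eq_ab (weil F) s (art x)];
  art_uniformizer : forall x, uniformizer F x -> frobenius F (art x);
  art_norm : forall L, finite_ext F L ->
    (forall s x, Gal F s -> L x -> L (s x)) ->
    (forall s t x, Gal F s -> Gal F t -> L x -> s (t x) = t (s x)) ->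
    forall d (ws : 'I_d -> Omega -> Omega), coset_reps (Gal F) (Gal L) ws ->
    forall y, L y -> y != 0 -> fixes L (art (\prod_i ws i y));
  art_equivariant : forall D s s', finite_ext D F -> Gal D s -> Gal D s' ->
    s \o s' = id -> (forall x, F x -> F (s x)) ->
    forall x, F x -> x != 0 -> eq_ab (weil F) (art (s x)) (s \o art x \o s')
}.

End LocalFields.

(** * The unitary group and its maximal torus

    A Hermitian form over [E] is given by its Gram matrix [h], as
    [x^T h tau(y)].  Over [Omega] its unitary group becomes [GL_n], with the
    Galois action twisted by [unitary_act]: the fixed points of [Gal K] are the
    matrices [g] over [E] with [g^T h tau(g) = h]. *)

Section Unitary.
Variables (Omega : closedFieldType) (n : nat).
Implicit Types (K E : set Omega) (h g : 'M[Omega]_n) (s : Omega -> Omega).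

(* [h] is Hermitian and non-degenerate, and the basis is a Witt basis (the
   form is anti-diagonal).  Such a basis exists precisely when the unitary
   group is quasi-split, and then the diagonal matrices are the centralizer
   of a maximal [K]-split torus. *)
Definition quasi_split_hermitian K E h : Prop :=
  [/\ forall i j, E (h i j),
      forall i j, h i j != 0 <-> j = rev_ord i
    & forall s, Gal K s -> ~ fixes E s -> (map_mx s h)^T = h].

Definition unitary_act E h s g : 'M[Omega]_n :=
  if `[< fixes E s >] then map_mx s g
  else map_mx s (invmx h *m (invmx g)^T *m h).

Definition diag_char (l : 'cV[int]_n) (g : 'M[Omega]_n) : Omega :=
  \prod_i g i i ^ l i 0.

(* [m] is the matrix by which [s] acts on the characters of the diagonal
   torus [S] of the unitary group: (s l)(s g) = s (l g). *)
Definition acts_on_XS E h s (m : 'M[int]_n) : Prop :=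
  forall (l : 'cV[int]_n) g, is_diag_mx g -> g \in unitmx ->
    diag_char (m *m l) (unitary_act E h s g) = s (diag_char l g).

End Unitary.

Section LGroup.
Variables (R : realType) (n : nat).
Notation C := R[i].

(* The second component is the element of [Gal(E/K)], with [true] for the
   non-trivial one. *)
Definition LG : Type := ('M[C]_n * bool)%type.
Implicit Types (a b : LG) (g x : 'M[C]_n).

Definition Jmx : 'M[C]_n :=
  \matrix_(i, j) (if j == rev_ord i then (-1) ^+ i else 0).

(* The outer automorphism preserving the standard pinning of [GL_n]. *)
Definition theta g : 'M[C]_n := Jmx *m (invmx g)^T *m invmx Jmx.

Definition Lgroup : set LG := [set a | a.1 \in unitmx].

Definition Lmul a b : LG :=
  (a.1 *m (if a.2 then theta b.1 else b.1), a.2 (+) b.2).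

Definition Lone : LG := (1%:M, false).

Fixpoint Lpow a (k : nat) : LG := if k is k'.+1 then Lmul a (Lpow a k') else Lone.

(* A faithful algebraic representation of the L-group, used to define
   semisimplicity. *)
Definition Lrep a : 'M[C]_(n + n) :=
  if a.2 then block_mx 0 a.1 (theta a.1) 0 else block_mx a.1 0 0 (theta a.1).

Definition Lsemisimple a : Prop := diagonalizable (Lrep a).

Definition Lcenter : set LG :=
  [set a | Lgroup a /\ forall b, Lgroup b -> Lmul a b = Lmul b a].

Definition centralizes x a : Prop :=
  x \in unitmx /\ Lmul (x, false) a = Lmul a (x, false).

Variables (Omega : closedFieldType) (abs : Omega -> R) (K E : set Omega).
Implicit Types (phi : (Omega -> Omega) -> LG) (s t : Omega -> Omega).

Definition langlands_parameter phi : Prop :=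
  [/\ forall s, weil abs K s -> Lgroup (phi s),
      forall s t, weil abs K s -> weil abs K t ->
        phi (s \o t) = Lmul (phi s) (phi t),
      forall s, weil abs K s -> (phi s).2 = ~~ `[< fixes E s >]
    &
      forall e : C, 0 < e -> exists2 L, finite_ext K L
        & forall s, inertia abs K s -> fixes L s ->
            forall i j, `|(phi s).1 i j - (i == j)%:R| < e].

Definition tame phi : Prop :=
  forall s, wild_inertia abs K s -> phi s = Lone.

Definition discrete phi : Prop :=
  exists l : seq 'M[C]_n, forall x,
    (forall s, weil abs K s -> centralizes x (phi s)) ->
    exists y z, [/\ y \in l, Lcenter (z, false) & x = y *m z].

(* Inertia surjects onto [Gal(E/K)], so its generator [a] lies in the
   non-identity component and its centralizer in [GL_n] has rank [n./2] only.
   Hence the centralizer is asked to be as large as a maximal torus allows: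
   all of it lies in a maximal torus [g S g^-1].  For [a] in the identity
   component this would say that the centralizer is a maximal torus. *)
Definition regular phi : Prop :=
  exists a, [/\ exists2 s, inertia abs K s & phi s = a,
      forall s, inertia abs K s -> exists k,
        phi s = Lpow a k \/ Lmul (phi s) (Lpow a k) = Lone,
      Lsemisimple a
    & exists2 g, g \in unitmx & forall x, centralizes x a ->
        is_diag_mx (invmx g *m x *m g)].

Definition Lconj g phi : (Omega -> Omega) -> LG :=
  fun s => Lmul (Lmul (g, false) (phi s)) (invmx g, false).

Definition fixed_torus z : Prop :=
  [/\ is_diag_mx z, z \in unitmx & theta z = z].

(* [g] normalises the diagonal torus and induces the permutation [w]. *)
Definition weyl_image g (w : 'S_n) : Prop :=
  g \in unitmx /\ forall i j, g i j != 0 <-> i = w j.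

End LGroup.

(** * Tori

    A torus split over [Omega] with character lattice [Z^n] is given by the
    action [rho] of the Galois group on the lattice.  Its points over [Omega]
    are the vectors [t] with non-zero entries. *)

Section Tori.
Variables (R : realType) (Omega : closedFieldType) (abs : Omega -> R) (n : nat).
Variable rho : (Omega -> Omega) -> 'M[int]_n.
Implicit Types (F L K : set Omega) (s : Omega -> Omega) (t : 'rV[Omega]_n).

Definition torus : set 'rV[Omega]_n := [set t | forall i, t 0 i != 0].

Definition tmul t (t' : 'rV[Omega]_n) : 'rV[Omega]_n := \row_i (t 0 i * t' 0 i).
Definition tinv t : 'rV[Omega]_n := \row_i (t 0 i)^-1.
Definition tone : 'rV[Omega]_n := const_mx 1.

Definition tchar (l : 'cV[int]_n) t : Omega := \prod_i t 0 i ^ l i 0.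

(* (s t)(l) = s (t (s^-1 l)) on the basis of the character lattice. *)
Definition gact s t : 'rV[Omega]_n :=
  \row_i s (tchar (invmx (rho s) *m delta_mx i 0) t).

Definition points F : set 'rV[Omega]_n :=
  [set t | torus t /\ forall s, Gal F s -> gact s t = t].

(* The norm T(L) -> T(F), [ws] representing [Gal(L/F)]. *)
Definition tnorm (d : nat) (ws : 'I_d -> Omega -> Omega) t : 'rV[Omega]_n :=
  \row_i \prod_(j < d) gact (ws j) t 0 i.

Definition galois_action K : Prop :=
  [/\ forall s, Gal K s -> rho s \in unitmx,
      forall s s', Gal K s -> Gal K s' -> rho (s \o s') = rho s *m rho s'
    & exists2 L, finite_ext K L & forall s, Gal K s -> fixes L s -> rho s = 1%:M].

Definition splitting_field K : set Omega :=
  [set x | forall s, Gal K s -> rho s = 1%:M -> s x = x].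

Definition max_unramified K L : set Omega :=
  [set x | exists F, [/\ unramified abs K F, F `<=` L & F x]].

(* [OK] is the ring of integers of [K], embedded in [Omega] by [iota]. *)

Variables (K : set Omega) (OK : comNzRingType) (iota : {rmorphism OK -> Omega}).

Definition ring_of_integers : Prop :=
  injective iota /\ forall x, (exists c, iota c = x) <-> K x /\ abs x <= 1.

Definition algebra_generated (B : comAlgType OK) : Prop :=
  exists b : seq B, forall P : set B,
    (forall x, x \in b -> P x) -> P 1 ->
    (forall x y, P x -> P y -> P (x + y)) ->
    (forall x y, P x -> P y -> P (x * y)) ->
    (forall c x, P x -> P (c *: x)) -> forall x, P x.

(* Infinitesimal lifting; [OK] is noetherian, so that finite generation is
   finite presentation. *)
Definition smooth (B : comAlgType OK) : Prop :=
  algebra_generated B /\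
  forall (C D : comAlgType OK) (f : {lrmorphism C -> D}),
    (forall d, exists c, f c = d) ->
    (forall c c', f c = 0 -> f c' = 0 -> c * c' = 0) ->
    forall g : {lrmorphism B -> D},
    exists g' : {lrmorphism B -> C}, forall b, f (g' b) = g b.

Definition special_fibre_nonempty (B : comAlgType OK) : Prop :=
  forall w, uniformizer abs K (iota w) -> forall b : B, w *: b <> 1.

Definition special_fibre_connected (B : comAlgType OK) : Prop :=
  special_fibre_nonempty B /\
  forall w, uniformizer abs K (iota w) ->
  forall e : B, (exists b, e * e - e = w *: b) ->
    (exists b, e = w *: b) \/ (exists b, 1 - e = w *: b).

(* [BK] is [B] tensored with [K]; injectivity of [j] is flatness of [B]. *)
Definition generic_fibre (B BK : comAlgType OK) (j : {lrmorphism B -> BK}) : Prop :=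
  [/\ injective j,
      forall c : OK, c != 0 -> exists d : BK, (c *: 1) * d = 1
    & forall y : BK, exists2 c : OK, c != 0 & exists b, c *: y = j b].

(* The coordinate ring of the torus over [K]. *)
Definition regular_function (f : 'rV[Omega]_n -> Omega) : Prop :=
  (exists m (c : 'I_m -> Omega) (l : 'I_m -> 'cV[int]_n),
     forall t, torus t -> f t = \sum_i c i * tchar (l i) t) /\
  (forall s t, Gal K s -> torus t -> f (gact s t) = s (f t)).

(* [Spec A] is a model of the torus over [OK]: [ev] identifies [A] tensored
   with [K] with the coordinate ring. *)
Definition torus_model (A : comAlgType OK) (ev : A -> 'rV[Omega]_n -> Omega) : Prop :=
  [/\ forall t, torus t ->
        [/\ ev 1 t = 1, forall a b, ev (a + b) t = ev a t + ev b t,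
            forall a b, ev (a * b) t = ev a t * ev b t
          & forall c a, ev (c *: a) t = iota c * ev a t],
      forall a b, (forall t, torus t -> ev a t = ev b t) -> a = b,
      forall a, regular_function (ev a)
    & forall f, regular_function f -> exists2 c : OK, c != 0
        & exists a, forall t, torus t -> iota c * f t = ev a t].

Definition comultiplication (A : comAlgType OK)
    (ev : A -> 'rV[Omega]_n -> Omega) (a : A) (D : seq (A * A)) : Prop :=
  forall t t', torus t -> torus t' ->
    ev a (tmul t t') = \sum_(b <- D) ev b.1 t * ev b.2 t'.

Definition group_model (A : comAlgType OK) (ev : A -> 'rV[Omega]_n -> Omega) : Prop :=
  [/\ torus_model ev,
      forall a, exists D, comultiplication ev a D,
      forall a, exists b, forall t, torus t -> ev a (tinv t) = ev b t
    & forall a, exists c, ev a tone = iota c].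

(* [Spec A] is the identity component of the Neron model N of the torus: the
   smooth group model with connected fibres having the mapping property
   induced by that of N.  Indeed, let Y = [Spec B] be smooth over [OK] with
   connected special fibre.  A morphism [u] from its generic fibre to the
   torus extends to Y -> N by the Neron property; the extension lands in the
   open subscheme N^0 as soon as it sends one point of the special fibre
   there.  Such a point is supplied by [v : Spec C -> Y], with [C] flat and
   Spec C having a special fibre, for which [u o v] extends to
   [x : Spec C -> N^0]. *)
Definition connected_neron_model (A : comAlgType OK)
    (ev : A -> 'rV[Omega]_n -> Omega) : Prop :=
  [/\ group_model ev, smooth A, special_fibre_connected A
    & forall (B BK : comAlgType OK) (j : {lrmorphism B -> BK})
             (u : {lrmorphism A -> BK}) (C : comAlgType OK)
             (v : {lrmorphism B -> C}) (x : {lrmorphism A -> C}),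
        smooth B -> special_fibre_connected B -> generic_fibre j ->
        (forall (c : OK) (y : C), c != 0 -> c *: y = 0 -> y = 0) ->
        special_fibre_nonempty C ->
        (forall (c : OK) a b, c *: u a = j b -> c *: x a = v b) ->
        exists u' : {lrmorphism A -> B}, forall a, u a = j (u' a)].

Variables (A : comAlgType OK) (ev : A -> 'rV[Omega]_n -> Omega).

(* T(F)^0: the points of [Spec A] with values in the integers of [F]. *)
Definition points0 F : set 'rV[Omega]_n :=
  [set t | points F t /\ forall a, abs (ev a t) <= 1].

(* The Moy-Prasad filtration, for the valuation taking the value 1 at the
   uniformizers [w] of [K]: [val (l t - 1) >= r] for all characters [l]. *)
Definition moy_prasad F (r : R) : set 'rV[Omega]_n :=
  [set t | points0 F t /\ forall w l, uniformizer abs K w ->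
     abs (tchar l t - 1) <= powR (abs w) r].

Definition points0plus F : set 'rV[Omega]_n :=
  [set t | exists2 r, 0 < r & moy_prasad F r t].

Definition is_character (G : set 'rV[Omega]_n) (chi : 'rV[Omega]_n -> R[i]) : Prop :=
  (forall t, G t -> chi t != 0) /\
  (forall t t', G t -> G t' -> chi (tmul t t') = chi t * chi t').

Definition depth_zero (chi : 'rV[Omega]_n -> R[i]) : Prop :=
  forall t, points0plus K t -> chi t = 1.

Definition coset0plus t : set 'rV[Omega]_n :=
  [set t' | exists2 t1, points0plus K t1 & t' = tmul t t1].

(* [chi] induces a character of T(K)^0 / T(K)^{0+}, a set of cosets. *)
Definition induces_on_quotient (chi : 'rV[Omega]_n -> R[i]) : Prop :=
  exists2 chibar : set 'rV[Omega]_n -> R[i],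
    forall t, points0 K t -> chibar (coset0plus t) = chi t
  & forall t t', points0 K t -> points0 K t' ->
      chibar (coset0plus t) != 0 /\
      chibar (coset0plus (tmul t t'))
        = chibar (coset0plus t) * chibar (coset0plus t').

Variables (k : finFieldType) (res : {rmorphism OK -> k}).

Definition residue_field : Prop :=
  (forall y, exists c, res c = y) /\
  (forall c, res c = 0 <-> abs (iota c) < 1).

Definition special_points : set (A -> k) :=
  [set f : A -> k | (exists g : {rmorphism A -> k}, f = g :> (A -> k))
           /\ forall c a, f (c *: a) = res c * f a].

Definition special_mul (f f' f'' : A -> k) : Prop :=
  forall a D, comultiplication ev a D -> f'' a = \sum_(b <- D) f b.1 * f' b.2.

Definition reduces_to t (f : A -> k) : Prop :=
  forall a c, ev a t = iota c -> f a = res c.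

Definition induces_on_special_fibre (chi : 'rV[Omega]_n -> R[i]) : Prop :=
  exists chibar : (A -> k) -> R[i],
    [/\ forall f, special_points f -> chibar f != 0,
        forall f f' f'', special_points f -> special_points f' ->
          special_points f'' -> special_mul f f' f'' ->
          chibar f'' = chibar f * chibar f'
      & forall t f, points0 K t -> special_points f -> reduces_to t f ->
          chibar f = chi t].

End Tori.

Section LLC.
Variables (R : realType) (Omega : closedFieldType) (abs : Omega -> R) (n : nat).
Variable rho : (Omega -> Omega) -> 'M[int]_n.
Implicit Types (F L : set Omega).
Notation C := R[i].

(* Action on the cocharacter lattice, dual to [rho]. *)
Definition corho (s : Omega -> Omega) (x : 'cV[int]_n) : 'cV[int]_n :=
  (invmx (rho s))^T *m x.

(* Langlands' description, for a torus T over [F] with cocharacter lattice Y,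
   split by the Galois extension [L].  A class in H_1(W_F, Y) is given by a
   cycle: the formal sum of the [w j] with coefficients [x j].  Its transfer to
   W_L, followed by the inverse of the Artin map, is a point [t] of T(F) in the
   tensor product of [L]^x and Y.  The transfer is an isomorphism from
   H_1(W_{L/F}, Y) onto T(F), so the character [psi] of T(F) attached to a
   cocycle [a] with values in the dual torus is determined by
   [psi t = prod_j <a (w j), x j>]. *)
Definition llc_torus F L (art : Omega -> Omega -> Omega)
    (a : (Omega -> Omega) -> 'I_n -> C) (psi : 'rV[Omega]_n -> C) : Prop :=
  is_character (points rho F) psi /\
  forall (d m : nat) (ws : 'I_d -> Omega -> Omega)
         (w : 'I_m -> Omega -> Omega) (x : 'I_m -> 'cV[int]_n)
         (b : 'I_d -> 'I_m -> Omega) (t : 'rV[Omega]_n),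
    coset_reps (weil abs F) (weil abs L) ws ->
    (forall j, weil abs F (w j)) ->
    \sum_j ((rho (w j))^T *m x j - x j) = 0 ->
    (forall i j, [/\ L (b i j), b i j != 0
       & exists i' h, [/\ weil abs L h, ws i \o w j = h \o ws i'
           & eq_ab (weil abs L) h (art (b i j))]]) ->
    (forall l, t 0 l = \prod_i \prod_j b i j ^ (corho (ws i) (x j)) l 0) ->
    psi t = \prod_j \prod_l a (w j) l ^ (x j) l 0.

Variables (K : set Omega) (OK : comNzRingType) (A : comAlgType OK).
Variable ev : A -> 'rV[Omega]_n -> Omega.

(* [chi] is the character of T(K)^0 attached to [phi], the restriction of
   which to the Weil group of [Kf] takes diagonal values. *)
Definition attached_character Kf M (art : Omega -> Omega -> Omega)
    (phi : (Omega -> Omega) -> LG R n) (chi : 'rV[Omega]_n -> C) : Prop :=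
  is_character (points0 abs rho ev K) chi /\
  exists2 psi, llc_torus Kf M art (fun s i => (phi s).1 i i) psi
    & forall (d : nat) (ws : 'I_d -> Omega -> Omega),
        coset_reps (Gal K) (Gal Kf) ws ->
        forall t, points0 abs rho ev Kf t -> chi (tnorm rho ws t) = psi t.

End LLC.

(* The torus T: inertia acts on [Z^n] as on the characters of S, and [Fr] by
   the permutation [w]. *)
Definition twisted_torus (R : realType) (Omega : closedFieldType)
    (abs : Omega -> R) (n : nat) (K E : set Omega) (h : 'M[Omega]_n)
    (Fr : Omega -> Omega) (w : 'S_n) (rho : (Omega -> Omega) -> 'M[int]_n) : Prop :=
  [/\ galois_action rho K,
      forall s, inertia abs K s -> acts_on_XS E h s (rho s)
    & rho Fr = \matrix_(i, j) (i == w j)%:R].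

(* Main.v *)
Require Import Defs.
From HB Require Import structures.
From mathcomp Require Import all_boot all_order all_algebra perm.
From mathcomp Require Import complex.
From mathcomp Require Import boolp classical_sets reals exp.
From mathcomp Require Import fingroup cyclic separable finfield cyclotomic.
From mathcomp Require Import generic_quotient ring_quotient.
From mathcomp Require Import zify ring lra.

(* Idea.  The restriction of the parameter to the Weil group of the splitting
   field M is diagonal, and tameness makes it trivial on wild inertia, so that
   its values on inertia are roots of unity of order prime to p.  Langlands'
   transfer formula, evaluated at the square root of a point (p is odd), shows
   that the local Langlands character psi of T(K_f) is trivial on principal
   points, those with all coordinates congruent to 1.

   To pass from psi to chi, let t in T(K) be principal, with principal square
   root s.  The rational curve c(x)_i = (1 + x(s_i - 1)) / (1 + x(s_i^-1 - 1))
   in T is defined over K and joins 1 to t.  The mapping property of the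
   Neron model shows that it consists of integral points for |x| <= 1.  If theta
   in K_f is integral of trace 1, then the norm of c(theta) agrees with t to
   second order, and chi of it is psi(c(theta)) = 1.  Iterating, t may be taken
   so close to 1 that it is the [K_f : K]-th power of a principal point of T(K),
   hence a norm.  So chi is trivial on all principal points, which gives depth
   zero.

   For the special fibre, smoothness lifts its rational points to T(K)^0, and
   the kernel of reduction consists of principal points, since t^(q^j) tends to
   1 for t in that kernel. *)

Set Implicit Arguments.
Unset Strict Implicit.
Unset Printing Implicit Defensive.

Import Order.TTheory GRing.Theory Num.Theory.
Local Open Scope ring_scope.
Local Open Scope classical_set_scope.

(** * The ultrametric absolute value *)

(** The character [chi] is known only on norms of integral points over $K_f$, and integrality only
    through the mapping property, which concerns smooth schemes over the integers of $K$ with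
    connected special fibre and asks for one point already in the identity component. A principal
    point is therefore not tested alone: it is joined to the unit by a curve over $K$, and the
    points over $K_f$ that are needed are taken on the same curve. The trace condition on $\theta$
    comes from the first-order expansion $\prod_j(1+\mathrm{Fr}^j\theta\,(t-1))\approx
    1+\mathrm{Tr}(\theta)(t-1)=t$; such a $\theta$ exists because $K_f/K$ is unramified. On the side
    of the parameter, the order prime to $p$ is $q^m-1$ with $m$ the order of $\omega$: conjugation
    by Frobenius raises tame inertia to the power $q$ and permutes the diagonal entries by $\omega$.
    Units of $M$ correspond to inertia under the Artin map, and principal units are $(q^m-1)$-th
    powers. Hensel's lemma is replaced throughout by estimates on the roots of polynomials, which
    all lie in [Omega]. *)

Section AbsoluteValue.
Variables (R : realType) (Omega : closedFieldType) (abs : Omega -> R).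
Variables (p : nat) (Qp : set Omega).
Hypothesis cP : padic_closure abs p Qp.
Implicit Types x y z : Omega.

Lemma abs0 : abs 0 = 0.
Proof. by apply/(abs_eq0 cP). Qed.

Lemma abs_gt0 x : x != 0 -> 0 < abs x.
Proof.
move=> x0; rewrite lt0r (abs_ge0 cP) andbT; apply: contra x0 => /eqP.
by move/(abs_eq0 cP) => ->.
Qed.

Lemma abs_neq0 x : x != 0 -> abs x != 0.
Proof. by move=> /abs_gt0; rewrite lt0r => /andP[]. Qed.

Lemma abs1 : abs 1 = 1.
Proof.
have := absM cP 1 1; rewrite mulr1 => h.
have n0 := abs_neq0 (oner_neq0 Omega).
by apply: (mulIf n0); rewrite mul1r -h.
Qed.

Lemma absX x n : abs (x ^+ n) = abs x ^+ n.
Proof.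
elim: n => [|n IH]; first by rewrite !expr0 abs1.
by rewrite !exprS (absM cP) IH.
Qed.

Lemma absV x : abs x^-1 = (abs x)^-1.
Proof.
have [->|x0] := eqVneq x 0; first by rewrite invr0 abs0 invr0.
apply: (mulfI (abs_neq0 x0)).
by rewrite -(absM cP) !divff ?abs_neq0 // abs1.
Qed.

Lemma absN1 : abs (-1) = 1.
Proof.
have h : abs (-1) ^+ 2 = 1 by rewrite -absX sqrrN expr1n abs1.
apply/eqP; rewrite -(@eqrXn2 _ 2) // ?ler01 ?(abs_ge0 cP) // h expr1n //.
Qed.

Lemma absN x : abs (- x) = abs x.
Proof. by rewrite -mulN1r (absM cP) absN1 mul1r. Qed.

Lemma absB_sym x y : abs (x - y) = abs (y - x).
Proof. by rewrite -opprB absN. Qed.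

Lemma abs_prod I (r : seq I) (P : pred I) (F : I -> Omega) :
  abs (\prod_(i <- r | P i) F i) = \prod_(i <- r | P i) abs (F i).
Proof.
apply: (big_morph abs _ abs1); exact: (absM cP).
Qed.

Lemma absD_le (e : R) x y : abs x <= e -> abs y <= e -> abs (x + y) <= e.
Proof.
by move=> hx hy; apply: le_trans (abs_ultra cP _ _) _; rewrite ge_max hx.
Qed.

Lemma absD_lt (e : R) x y : abs x < e -> abs y < e -> abs (x + y) < e.
Proof.
by move=> hx hy; apply: le_lt_trans (abs_ultra cP _ _) _; rewrite gt_max hx.
Qed.

Lemma absB_le (e : R) x y : abs x <= e -> abs y <= e -> abs (x - y) <= e.
Proof. by move=> hx hy; apply: absD_le; rewrite ?absN. Qed.

Lemma absB_lt (e : R) x y : abs x < e -> abs y < e -> abs (x - y) < e.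
Proof. by move=> hx hy; apply: absD_lt; rewrite ?absN. Qed.

Lemma absB_trans_lt (e : R) y x z :
  abs (x - y) < e -> abs (y - z) < e -> abs (x - z) < e.
Proof. by move=> hx hy; rewrite -(subrKA y); exact: absD_lt. Qed.

Lemma absB_trans_le (e : R) y x z :
  abs (x - y) <= e -> abs (y - z) <= e -> abs (x - z) <= e.
Proof. by move=> hx hy; rewrite -(subrKA y); exact: absD_le. Qed.

Lemma abs_sum_le (e : R) I (r : seq I) (P : pred I) (F : I -> Omega) :
  0 <= e -> (forall i, P i -> abs (F i) <= e) ->
  abs (\sum_(i <- r | P i) F i) <= e.
Proof.
move=> e0 h; elim/big_ind: _ => //; first by rewrite abs0.
by move=> x y; exact: absD_le.
Qed.

Lemma abs_sum_lt (e : R) I (r : seq I) (P : pred I) (F : I -> Omega) :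
  0 < e -> (forall i, P i -> abs (F i) < e) ->
  abs (\sum_(i <- r | P i) F i) < e.
Proof.
move=> e0 h; elim/big_ind: _ => //; first by rewrite abs0.
by move=> x y; exact: absD_lt.
Qed.

Lemma abs_addl x y : abs y < abs x -> abs (x + y) = abs x.
Proof.
move=> h; apply/eqP; rewrite eq_le; apply/andP; split.
  by apply: absD_le => //; exact: ltW.
rewrite leNgt; apply/negP => h1.
by have := absB_lt h1 h; rewrite addrK ltxx.
Qed.

Lemma abs_eq_close x y : abs (x - y) < abs x -> abs y = abs x.
Proof.
move=> h; have : abs (x + (y - x)) = abs x by apply: abs_addl; rewrite absB_sym.
by rewrite addrC subrK.
Qed.

Lemma abs_nat_le1 n : abs n%:R <= 1.
Proof.
elim: n => [|n IH]; first by rewrite abs0.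
by rewrite -addn1 natrD; apply: absD_le => //; rewrite abs1.
Qed.

Lemma absM_le1 x y : abs x <= 1 -> abs y <= 1 -> abs (x * y) <= 1.
Proof.
by move=> hx hy; rewrite (absM cP) mulr_ile1 ?(abs_ge0 cP).
Qed.

Lemma absM_lt1 x y : abs x <= 1 -> abs y < 1 -> abs (x * y) < 1.
Proof.
move=> hx hy; rewrite (absM cP); apply: le_lt_trans hy.
by rewrite ler_piMl ?(abs_ge0 cP).
Qed.

Lemma absMr_lt1 x y : abs x < 1 -> abs y <= 1 -> abs (x * y) < 1.
Proof. by move=> hx hy; rewrite mulrC absM_lt1. Qed.

Lemma absX_le1 x n : abs x <= 1 -> abs (x ^+ n) <= 1.
Proof. by move=> hx; rewrite absX exprn_ile1 ?(abs_ge0 cP). Qed.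

Lemma abs_prod_le1 I (r : seq I) (P : pred I) (F : I -> Omega) :
  (forall i, P i -> abs (F i) <= 1) -> abs (\prod_(i <- r | P i) F i) <= 1.
Proof.
move=> h; elim/big_ind: _ => //; first by rewrite abs1.
exact: absM_le1.
Qed.

Lemma abs_princ_unit x : abs (x - 1) < 1 -> abs x = 1.
Proof.
by move=> h; rewrite -abs1; apply: abs_eq_close; rewrite abs1 absB_sym.
Qed.

Lemma abs_princ_neq0 x : abs (x - 1) < 1 -> x != 0.
Proof.
move=> /abs_princ_unit h; apply/eqP => x0.
by move: h; rewrite x0 abs0 => /eqP; rewrite eq_sym oner_eq0.
Qed.

Lemma abs_congM (e : R) x x' y y' : abs x <= 1 -> abs y' <= 1 ->
  abs (x - x') <= e -> abs (y - y') <= e -> abs (x * y - x' * y') <= e.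
Proof.
move=> hx hy' h1 h2.
have -> : x * y - x' * y' = x * (y - y') + (x - x') * y' by ring.
apply: absD_le; rewrite (absM cP).
  by apply: le_trans h2; rewrite ler_piMl ?(abs_ge0 cP).
by apply: le_trans h1; rewrite ler_piMr ?(abs_ge0 cP).
Qed.

Lemma abs_congM_lt x x' y y' : abs x <= 1 -> abs y' <= 1 ->
  abs (x - x') < 1 -> abs (y - y') < 1 -> abs (x * y - x' * y') < 1.
Proof.
move=> hx hy' h1 h2.
have -> : x * y - x' * y' = x * (y - y') + (x - x') * y' by ring.
by apply: absD_lt; [exact: absM_lt1 | exact: absMr_lt1].
Qed.

Lemma abs_le1_close x y : abs (x - y) < 1 -> abs x <= 1 -> abs y <= 1.
Proof.
move=> h hx; have -> : y = x - (x - y) by ring.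
by apply: absB_le => //; exact: ltW.
Qed.

Lemma abs1_close x y : abs (x - y) < 1 -> abs x = 1 -> abs y = 1.
Proof. by move=> h hx; rewrite -hx; apply: abs_eq_close; rewrite hx. Qed.

Lemma abs_congX_lt x y n : abs x <= 1 -> abs (x - y) < 1 ->
  abs (x ^+ n - y ^+ n) < 1.
Proof.
move=> hx h; have hy := abs_le1_close h hx.
elim: n => [|n IH]; first by rewrite subrr abs0 ltr01.
by rewrite !exprS abs_congM_lt // absX_le1.
Qed.

Lemma abs_cong_prod_le (e : R) I (r : seq I) (F G : I -> Omega) : 0 <= e ->
  (forall i, abs (F i) <= 1) -> (forall i, abs (G i) <= 1) ->
  (forall i, abs (F i - G i) <= e) ->
  abs (\prod_(i <- r) F i - \prod_(i <- r) G i) <= e.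
Proof.
move=> e0 hF hG h; elim: r => [|i r IH]; first by rewrite !big_nil subrr abs0.
by rewrite !big_cons abs_congM // abs_prod_le1.
Qed.

Hypothesis p_prime : prime p.

Lemma abs_p_lt1 : abs p%:R < 1.
Proof.
rewrite (abs_p cP) invf_lt1 ?ltr0n ?prime_gt0 //.
by rewrite ltr1n prime_gt1.
Qed.

Lemma p_neq0 : p%:R != 0 :> Omega.
Proof.
apply/eqP => h; have := abs_p cP; rewrite h abs0 => /eqP.
by rewrite eq_sym invr_eq0 pnatr_eq0; case: (p) p_prime.
Qed.

(** If $|m|<1$, a Bézout relation $1=um-vp$ would give $|1|<1$. *)
Lemma abs_nat_coprime m : coprime p m -> abs m%:R = 1.
Proof.
move=> co; apply/eqP; rewrite eq_le abs_nat_le1 leNgt /=; apply/negP => hm.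
have m0 : (0 < m)%N.
  rewrite lt0n; apply/eqP => m0; move: co; rewrite m0 /coprime gcdn0.
  by move/eqP=> p1; move: p_prime; rewrite p1.
have [u v e _] := egcdnP p m0.
have {}e : (u * m = v * p + 1)%N.
  by rewrite e; move: co; rewrite coprime_sym /coprime => /eqP->.
have : (1 : Omega) = u%:R * m%:R - v%:R * p%:R.
  by rewrite -!natrM e natrD addrC addrA addNr add0r.
move=> h1; have : abs 1 < 1.
  by rewrite h1; apply: absB_lt; apply: absM_lt1; rewrite ?abs_nat_le1 // abs_p_lt1.
by rewrite abs1 ltxx.
Qed.

(** Characteristic $0$ comes from the normalisation: $|p|=p^{-1}$ is non-zero, and the part of $m$
    prime to $p$ is a unit. *)
Lemma natr_Omega_neq0 m : (0 < m)%N -> m%:R != 0 :> Omega.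
Proof.
move=> m0; apply/eqP => h.
have [m' h1 h2] := pfactor_coprime p_prime m0.
move: h; rewrite h2 natrM => /eqP; rewrite mulf_eq0 => /orP[] /eqP.
  move=> h; have := abs_nat_coprime h1; rewrite h abs0 => /eqP.
  by rewrite eq_sym oner_eq0.
by rewrite natrX => /eqP; rewrite expf_eq0 (negPf p_neq0) andbF.
Qed.

Lemma natr_inj m n : (m%:R : Omega) = n%:R -> m = n.
Proof.
wlog mn : m n / (m <= n)%N => [hw h|h].
  by case/orP: (leq_total m n) => mn; [exact: hw | apply/esym/hw].
apply/eqP; rewrite eqn_leq mn /= leqNgt; apply/negP => lt.
have := @natr_Omega_neq0 (n - m); rewrite subn_gt0 lt => /(_ isT).
by rewrite natrB // h subrr eqxx.
Qed.

Lemma abs_natE m : (0 < m)%N -> exists j, abs m%:R = (p%:R : R) ^- j.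
Proof.
move=> m0; have [m' h1 h2] := pfactor_coprime p_prime m0.
exists (logn p m); rewrite {1}h2 natrM natrX (absM cP) absX (abs_p cP).
by rewrite abs_nat_coprime // mul1r exprVn.
Qed.

Lemma abs_ratE (r : rat) : (ratr r : Omega) != 0 ->
  exists z : int, abs (ratr r) = (p%:R : R) ^ z.
Proof.
rewrite /ratr => r0.
have [n0 d0] : ((numq r)%:~R != 0 :> Omega) /\ ((denq r)%:~R != 0 :> Omega).
  by move: r0; rewrite mulf_eq0 invr_eq0 negb_or => /andP.
have absz (z : int) : (z%:~R != 0 :> Omega) ->
    exists j, abs z%:~R = (p%:R : R) ^- j.
  case: z => m.
    rewrite pmulrn => m0; apply: abs_natE; rewrite lt0n.
    by apply: contra m0 => /eqP->.
  by rewrite NegzE mulrNz absN => _; apply: abs_natE.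
have [i hi] := absz _ n0; have [j hj] := absz _ d0.
exists (j%:Z - i%:Z); rewrite (absM cP) absV hi hj invrK expfzDr.
  by rewrite mulrC -exprnN -exprnP.
by rewrite pnatr_eq0 -lt0n prime_gt0.
Qed.

(** A rational number closer to $x$ than $|x|$ has the same absolute value, so the value group of
    $\mathbb{Q}_p$ is that of $\mathbb{Q}$. *)
Lemma abs_QpE x : Qp x -> x != 0 -> exists z : int, abs x = (p%:R : R) ^ z.
Proof.
move=> hx x0; have [r hr] := Qp_dense cP hx (abs_gt0 x0).
have e := abs_eq_close hr.
have r0 : ratr r != 0 :> Omega.
  by apply/eqP => r0; move: e; rewrite r0 abs0 => /esym/eqP; rewrite (negPf (abs_neq0 x0)).
by rewrite -e; exact: abs_ratE.
Qed.

End AbsoluteValue.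

(** * Extension of automorphisms *)

Section Automorphisms.
Variable Omega : closedFieldType.
Implicit Types (F : set Omega) (x y : Omega) (s t : Omega -> Omega).

Lemma is_subfield0 F : is_subfield F -> F 0.
Proof. by case=> h1 hB _; rewrite -(subrr 1); exact: hB. Qed.

Lemma is_subfield1 F : is_subfield F -> F 1.
Proof. by case. Qed.

Lemma is_subfieldB F x y : is_subfield F -> F x -> F y -> F (x - y).
Proof. by case=> _ h _; exact: h. Qed.

Lemma is_subfieldN F x : is_subfield F -> F x -> F (- x).
Proof.
by move=> hF hx; rewrite -sub0r; apply: is_subfieldB => //; exact: is_subfield0.
Qed.

Lemma is_subfieldD F x y : is_subfield F -> F x -> F y -> F (x + y).
Proof.
move=> hF hx hy; rewrite -[y]opprK; apply: is_subfieldB => //.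
exact: is_subfieldN.
Qed.

Lemma is_subfieldV F x : is_subfield F -> F x -> F x^-1.
Proof. by case=> h1 _ hV hx; rewrite -[x^-1]mul1r; exact: hV. Qed.

Lemma is_subfieldM F x y : is_subfield F -> F x -> F y -> F (x * y).
Proof.
move=> hF hx hy; rewrite -[y]invrK; case: (hF) => _ _; apply => //.
exact: is_subfieldV.
Qed.

Lemma is_subfieldX F x n : is_subfield F -> F x -> F (x ^+ n).
Proof.
move=> hF hx; elim: n => [|n IH]; first exact: is_subfield1.
by rewrite exprS; exact: is_subfieldM.
Qed.

Lemma is_subfield_sum F I (r : seq I) (P : pred I) (f : I -> Omega) :
  is_subfield F -> (forall i, P i -> F (f i)) -> F (\sum_(i <- r | P i) f i).
Proof.
move=> hF h; elim/big_ind: _ => //; first exact: is_subfield0.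
by move=> x y; exact: is_subfieldD.
Qed.

Lemma is_subfield_nat F n : is_subfield F -> F n%:R.
Proof.
move=> hF; elim: n => [|n IH]; first exact: is_subfield0.
by rewrite -addn1 natrD; apply: is_subfieldD => //; exact: is_subfield1.
Qed.

(** Elements of Galois groups are bare maps; rewriting with this equation makes the algebra of ring
    morphisms available for them. *)
Lemma Gal_rmorphism F s : Gal F s ->
  exists f : {rmorphism Omega -> Omega}, s = f :> (Omega -> Omega).
Proof.
case=> hD hM hb hF.
have h0 : s 0 = 0.
  by apply: (@addrI _ (s 0)); rewrite -hD !addr0.
have hN x : s (- x) = - s x.
  by apply/eqP; rewrite -addr_eq0 -hD addNr h0.
have zm : zmod_morphism s by move=> x y; rewrite hD hN.
have h1 : s 1 = 1.
  have n0 : s 1 != 0 by rewrite -h0; apply/eqP => /(bij_inj hb)/eqP; rewrite oner_eq0.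
  by apply: (mulfI n0); rewrite -hM !mulr1.
have mm : monoid_morphism s by split.
pose sa := GRing.isZmodMorphism.Build _ _ s zm.
pose sm := GRing.isMonoidMorphism.Build _ _ s mm.
pose f : {rmorphism Omega -> Omega} := HB.pack s sa sm.
by exists f.
Qed.

Lemma Gal_fix F s x : Gal F s -> F x -> s x = x.
Proof. by case=> _ _ _; apply. Qed.

Lemma Gal_id F : Gal F id.
Proof. by split => //; exists id. Qed.

Lemma Gal_comp F s t : Gal F s -> Gal F t -> Gal F (s \o t).
Proof.
case=> h1 h2 h3 h4 [k1 k2 k3 k4]; split.
- by move=> x y /=; rewrite k1 h1.
- by move=> x y /=; rewrite k2 h2.
- exact: bij_comp.
- by move=> x hx /=; rewrite k4 // h4.
Qed.

Lemma Gal_iter F s n : Gal F s -> Gal F (iter n s).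
Proof.
move=> hs; elim: n => [|n IH]; first exact: Gal_id.
exact: (Gal_comp hs IH).
Qed.

Lemma Gal_sub F F' s : F `<=` F' -> Gal F' s -> Gal F s.
Proof. by move=> h [h1 h2 h3 h4]; split => // x /h; exact: h4. Qed.

(** [Gal] gives bijectivity only as an existence statement, so the inverse is picked by choice; the
    default [0] is not reached on elements of a Galois group. *)
Definition ginv s : Omega -> Omega := fun y => xget 0 [set x | s x = y].

Lemma ginvKV F s : Gal F s -> cancel (ginv s) s.
Proof.
case=> _ _ [s' h1 h2] _ y; rewrite /ginv.
by case: xgetP => [x -> //|/(_ (s' y))]; rewrite /= h2.
Qed.

Lemma ginvK F s : Gal F s -> cancel s (ginv s).
Proof.
move=> hs x; case: (hs) => _ _ /bij_inj inj _; apply: inj.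
exact: (ginvKV hs).
Qed.

Lemma Gal_ginv F s : Gal F s -> Gal F (ginv s).
Proof.
move=> hs; have K1 := ginvK hs; have K2 := ginvKV hs.
case: (hs) => hD hM _ hF; split.
- by move=> x y; rewrite -{1}(K2 x) -{1}(K2 y) -hD K1.
- by move=> x y; rewrite -{1}(K2 x) -{1}(K2 y) -hM K1.
- by exists s.
- by move=> x hx; rewrite -{1}(hF x hx) K1.
Qed.

Lemma ginv_comp F s : Gal F s -> ginv s \o s = id.
Proof. by move=> hs; apply/funext => x /=; exact: (ginvK hs). Qed.

Lemma comp_ginv F s : Gal F s -> s \o ginv s = id.
Proof. by move=> hs; apply/funext => x /=; exact: (ginvKV hs). Qed.

Lemma Gal_inj F s : Gal F s -> injective s.
Proof. by case=> _ _ /bij_inj. Qed.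

Lemma fixed_subfield F (H : set (Omega -> Omega)) : H `<=` Gal F ->
  is_subfield [set x | forall s, H s -> s x = x].
Proof.
move=> hH; split => /=.
- by move=> s /hH/Gal_rmorphism[f ->]; rewrite rmorph1.
- move=> x y hx hy s hs; have := hx _ hs; have := hy _ hs.
  by have [f ->] := Gal_rmorphism (hH _ hs); rewrite rmorphB => -> ->.
- move=> x y hx hy s hs; have := hx _ hs; have := hy _ hs.
  by have [f ->] := Gal_rmorphism (hH _ hs); rewrite fmorph_div => -> ->.
Qed.

Lemma Gal_map_poly F s (P : {poly Omega}) : Gal F s -> (forall i, F P`_i) ->
  map_poly s P = P.
Proof.
move=> hs hP; have [f e] := Gal_rmorphism hs.
by rewrite e; apply/polyP => i; rewrite coef_map /= -[RHS](Gal_fix hs) // e.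
Qed.

Lemma Gal_root F s (P : {poly Omega}) x : Gal F s -> (forall i, F P`_i) ->
  root P x -> root P (s x).
Proof.
move=> hs hP /rootP hx; apply/rootP; rewrite -(Gal_map_poly hs hP).
by have [f ->] := Gal_rmorphism hs; rewrite horner_map hx rmorph0.
Qed.

End Automorphisms.

(** * Extension of embeddings to the algebraic closure *)

Section ExtensionOfEmbeddings.
Variable Omega : closedFieldType.
Notation OO := (Omega * Omega)%type.
Variable F : set Omega.
Hypothesis F_field : is_subfield F.
Hypothesis F_alg : forall x, exists P : {poly Omega},
  [/\ P != 0, forall i, F P`_i & root P x].
Hypothesis natr_neq0 : forall n, (0 < n)%N -> n%:R != 0 :> Omega.

(* Graphs of the F-embeddings of the subrings of [Omega] containing [F]. *)
Record embedding_graph (G : set OO) : Prop := EmbeddingGraph {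
  graph_diag : forall c, F c -> G (c, c);
  graphB : forall u v, G u -> G v -> G (u - v);
  graphM : forall u v, G u -> G v -> G (u * v);
  graph_fun : forall b, G (0, b) -> b = 0
}.

Implicit Types (G : set OO) (P Q M : {poly OO}).

(** A graph is a subring of the product ring [OO]. A polynomial over it has two components: one over
    the domain of the embedding, and its image under the embedding. *)
Let fp P : {poly Omega} := map_poly fst P.
Let sp P : {poly Omega} := map_poly snd P.

Lemma graph0 G : embedding_graph G -> G 0.
Proof. by move=> hG; apply: (graph_diag hG); exact: is_subfield0. Qed.

Lemma graph1 G : embedding_graph G -> G 1.
Proof. by move=> hG; apply: (graph_diag hG); exact: is_subfield1. Qed.

Lemma graphD G u v : embedding_graph G -> G u -> G v -> G (u + v).
Proof.
move=> hG hu hv; rewrite -[v]opprK; apply: (graphB hG) => //.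
by rewrite -sub0r; apply: (graphB hG) => //; exact: graph0.
Qed.

Lemma graph_sum G I (r : seq I) (f : I -> OO) : embedding_graph G ->
  (forall i, G (f i)) -> G (\sum_(i <- r) f i).
Proof.
move=> hG h; elim/big_ind: _ => //; first exact: graph0.
by move=> x y; exact: graphD.
Qed.

Lemma graphX G u n : embedding_graph G -> G u -> G (u ^+ n).
Proof.
move=> hG hu; elim: n => [|n IH]; first exact: graph1.
by rewrite exprS; exact: (graphM hG).
Qed.

Lemma horner_pair P x y : P.[(x, y)] = ((fp P).[x], (sp P).[y]).
Proof.
rewrite /fp /sp [LHS]surjective_pairing.
by rewrite -(horner_map (@fst Omega Omega)) -(horner_map (@snd Omega Omega)).
Qed.

Lemma diag_poly (Q : {poly Omega}) : (forall i, F Q`_i) ->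
  exists P, [/\ forall G, embedding_graph G -> forall i, G P`_i,
                fp P = Q & sp P = Q].
Proof.
move=> hQ; exists (\poly_(i < size Q) (Q`_i, Q`_i)); split.
- move=> G hG i; rewrite coef_poly; case: ifP => _; last exact: graph0.
  exact: (graph_diag hG).
- apply/polyP => i; rewrite coef_map coef_poly /=.
  by case: ltnP => // h; rewrite nth_default.
- apply/polyP => i; rewrite coef_map coef_poly /=.
  by case: ltnP => // h; rewrite nth_default.
Qed.

(** Factors $X$ are divided out until the constant term survives; that term is the denominator in
    [graph_inv]. *)
Lemma alg_const_neq0 x : x != 0 -> exists Q : {poly Omega},
  [/\ Q`_0 != 0, forall i, F Q`_i & root Q x].
Proof.
move=> x0; have [P [P0 hP rP]] := F_alg x.
elim: {P}(size P) {-2}P (leqnn (size P)) P0 hP rP => [|m IH] P.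
  by rewrite leqn0 size_poly_eq0 => ->.
move=> sP P0 hP rP.
have [h0|h0] := eqVneq P`_0 0; last by exists P.
pose Q := \poly_(i < (size P).-1) P`_(i.+1).
have PE : P = Q * 'X.
  apply/polyP => i; rewrite coefMX; case: i => [|i] //=.
  rewrite coef_poly; case: ltnP => // h; rewrite nth_default //.
  by move: h; case: (size P).
have Q0 : Q != 0 by apply: contra P0; rewrite PE => /eqP->; rewrite mul0r.
apply: (IH Q) => //.
- by move: sP; rewrite PE size_mulX // ltnS.
- move=> i; rewrite coef_poly; case: ifP => // _; exact: is_subfield0.
- by move: rP; rewrite PE rootM rootX (negPf x0) orbF.
Qed.

(** From $Q(u)=0$ with $Q$ over $F$ one reads off $u^{-1}=-Q(0)^{-1}\sum_i Q_{i+1}u^i$, a polynomial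
    in $u$. Both coordinates of $u$ are roots of $Q$, the second one because the graph is
    functional. *)
Lemma graph_inv G u : embedding_graph G -> G u -> u.1 != 0 ->
  exists2 v, G v & v * u = 1.
Proof.
case: u => a b /= hG hu a0.
have [Q [Q0 hQ rQ]] := alg_const_neq0 a0.
have [P [hP fpP spP]] := diag_poly hQ; have {}hP := hP _ hG.
have rb : Q.[b] = 0.
  apply: (graph_fun hG); have : G P.[(a, b)].
    rewrite horner_coef; apply: graph_sum => // i; apply: (graphM hG) => //.
    exact: graphX.
  by rewrite horner_pair fpP spP (rootP rQ).
pose w := - (Q`_0)^-1.
pose S := \sum_(i < (size P).-1) P`_(i.+1) * (a, b) ^+ i.
have GS : G S.
  by apply: graph_sum => // i; apply: (graphM hG) => //; exact: graphX.
have E : S * (a, b) = - (Q`_0, Q`_0).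
  have : P.[(a, b)] = 0 by rewrite horner_pair fpP spP (rootP rQ) rb.
  have P0 : P`_0 = (Q`_0, Q`_0).
    by rewrite [LHS]surjective_pairing -{1}fpP -spP !coef_map.
  have : (0 < size P)%N.
    rewrite lt0n size_poly_eq0; apply/eqP => P00; move: Q0.
    by rewrite -fpP P00 /fp rmorph0 coef0 eqxx.
  rewrite horner_coef /S; case: (size P) => // m _ /=.
  rewrite big_ord_recl expr0 mulr1 P0 /= => /eqP; rewrite addrC addr_eq0 => /eqP <-.
  by rewrite mulr_suml; apply: eq_bigr => i _; rewrite /bump /= exprSr mulrA.
exists ((w, w) * S).
  apply: (graphM hG) => //; apply: (graph_diag hG).
  by apply: is_subfieldN => //; exact: is_subfieldV.
rewrite -mulrA E mulrN; congr (_, _); rewrite /w /=.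
  by rewrite mulNr opprK mulVf.
by rewrite mulNr opprK mulVf.
Qed.

(** [fp M] is the minimal polynomial of [x] over the domain of the graph; the roots of [sp M] are
    the admissible images of [x]. *)
Definition min_graph_poly G x M : Prop :=
  [/\ M \is monic, forall i, G M`_i, root (fp M) x
    & forall P, P != 0 -> (forall i, G P`_i) -> root (fp P) x ->
        (size M <= size P)%N].

Lemma graph_coef_fst0 G u : embedding_graph G -> G u -> u.1 = 0 -> u = 0.
Proof.
by move=> hG; case: u => a b /= hu a0; move: hu; rewrite a0 => /(graph_fun hG) ->.
Qed.

Lemma min_graph_poly_exists G x : embedding_graph G ->
  exists M, min_graph_poly G x M.
Proof.
move=> hG.
pose good m := `[< exists P, [/\ P != 0, forall i, G P`_i, root (fp P) x
                              & size P = m] >].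
have ex : exists m, good m.
  have [Q [Q0 hQ rQ]] := F_alg x; have [P [hP fpP _]] := diag_poly hQ.
  exists (size P); apply/asboolP; exists P; split => //; last by rewrite fpP.
    by apply/eqP => P0; move: Q0; rewrite -fpP P0 /fp rmorph0 eqxx.
  exact: hP.
case: (ex_minnP ex) => m /asboolP[P [P0 hP rP sP]] min.
have l1 : (lead_coef P).1 != 0.
  apply/eqP => h; move: P0; rewrite -lead_coef_eq0.
  by rewrite (graph_coef_fst0 hG _ h) ?eqxx //; exact: hP.
have [v hv vE] := graph_inv hG (hP _) l1.
have Mm : v *: P \is monic.
  have sz : size (v *: P) = size P.
    apply/eqP; rewrite eqn_leq size_scale_leq /= leqNgt; apply/negP => h.
    have sP0 : (0 < size P)%N by rewrite lt0n size_poly_eq0.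
    have h1 : (v *: P)`_(size P).-1 = 0 by rewrite nth_default // -ltnS prednK.
    by move/eqP: h1; rewrite coefZ vE oner_eq0.
  by rewrite monicE /lead_coef sz coefZ vE.
exists (v *: P); split => //.
- by move=> i; rewrite coefZ; apply: (graphM hG).
- by rewrite /fp linearZ /= rootE hornerZ (rootP rP) mulr0.
- move=> Q Q0 hQ rQ; apply: leq_trans (size_scale_leq _ _) _; rewrite sP.
  by apply: min; apply/asboolP; exists Q.
Qed.

(** Division by [M], carried out one leading term at a time in the product ring, which is possible
    because [M] is monic; what remains has smaller degree and still annihilates [x]. *)
Lemma min_graph_poly_root G x y M P : embedding_graph G ->
  min_graph_poly G x M -> root (sp M) y -> (forall i, G P`_i) ->
  (fp P).[x] = 0 -> (sp P).[y] = 0.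
Proof.
move=> hG [Mm hM rM min] ry.
elim: {P}(size P) {-2}P (leqnn (size P)) => [|m IH] P.
  by rewrite leqn0 size_poly_eq0 => /eqP-> _ _; rewrite /sp rmorph0 horner0.
move=> sP hP rP; have [->|P0] := eqVneq P 0; first by rewrite /sp rmorph0 horner0.
have le := min _ P0 hP (introT rootP rP).
have M0 : M != 0 by exact: monic_neq0.
pose Q := P - lead_coef P *: M * 'X^(size P - size M).
have sQ : (size Q <= m)%N.
  rewrite -ltnS; apply: leq_trans sP.
  have sP0 : (0 < size P)%N by rewrite lt0n size_poly_eq0.
  have sM0 : (0 < size M)%N by rewrite lt0n size_poly_eq0.
  rewrite -[X in (_ < X)%N]prednK // ltnS; apply/leq_sizeP => j hj.
  rewrite coefB coefMXn coefZ.
  have [->|ne] := eqVneq j (size P).-1.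
    have -> : ((size P).-1 < size P - size M)%N = false by lia.
    have -> : ((size P).-1 - (size P - size M) = (size M).-1)%N by lia.
    by rewrite -/(lead_coef P) -/(lead_coef M) (monicP Mm) mulr1 subrr.
  have hj' : (size P <= j)%N by move: hj ne sP0; lia.
  rewrite nth_default //; case: ifP => _; first by rewrite subr0.
  by rewrite (@nth_default _ _ M) ?mulr0 ?subr0 //; lia.
have PE : P = Q + lead_coef P *: M * 'X^(size P - size M) by rewrite subrK.
have hQ i : G Q`_i.
  rewrite coefB coefMXn coefZ; apply: (graphB hG) => //.
  case: ifP => _; first exact: graph0.
  by apply: (graphM hG); [rewrite lead_coefE; exact: hP | exact: hM].
have rQ : (fp Q).[x] = 0.
  rewrite /Q /fp rmorphB rmorphM /= linearZ /= hornerD hornerN hornerM hornerZ.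
  by rewrite rP (rootP rM) mulr0 mul0r subrr.
have -> : sp P = sp Q + (lead_coef P).2 *: sp M * 'X^(size P - size M).
  by rewrite {1}PE /sp raddfD /= rmorphM /= linearZ /= map_polyXn.
rewrite hornerD hornerM hornerZ.
by rewrite (rootP ry) mulr0 mul0r addr0 IH.
Qed.

(** The new graph consists of the values at $(x,y)$ of polynomials over the old one; that it is
    still functional is [min_graph_poly_root]. *)
Lemma graph_extend G x y M : embedding_graph G -> min_graph_poly G x M ->
  root (sp M) y ->
  exists G', [/\ embedding_graph G', G `<=` G' & G' (x, y)].
Proof.
move=> hG hM ry.
exists [set z | exists2 P : {poly OO}, forall i, G P`_i & z = P.[(x, y)]].
have sub : G `<=` [set z | exists2 P : {poly OO}, forall i, G P`_i & z = P.[(x, y)]].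
  move=> u hu; exists (u%:P); last by rewrite hornerC.
  by move=> i; rewrite coefC; case: ifP => // _; exact: graph0.
split => //; first split.
- by move=> c hc; apply: sub; exact: (graph_diag hG).
- move=> u v [P hP ->] [Q hQ ->]; exists (P - Q).
    by move=> i; rewrite coefB; exact: (graphB hG).
  by rewrite hornerD hornerN.
- move=> u v [P hP ->] [Q hQ ->]; exists (P * Q); last by rewrite hornerM.
  by move=> i; rewrite coefM; apply: graph_sum => // j; exact: (graphM hG).
- move=> b [P hP]; rewrite horner_pair => -[h ->].
  exact: (min_graph_poly_root hG hM).
- exists 'X; last by rewrite hornerX.
  by move=> i; rewrite coefX; case: eqP => _; [exact: graph1|exact: graph0].
Qed.

Lemma size_sp_monic M : M \is monic -> size (sp M) = size M.
Proof. by move=> Mm; rewrite size_map_poly_id0 // (monicP Mm) oner_eq0. Qed.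

Lemma size_fp_monic M : M \is monic -> size (fp M) = size M.
Proof. by move=> Mm; rewrite size_map_poly_id0 // (monicP Mm) oner_eq0. Qed.

Lemma min_graph_poly_size G x M : min_graph_poly G x M -> (1 < size M)%N.
Proof.
case=> Mm _ rM _; rewrite -(size_fp_monic Mm); apply: (root_size_gt1 _ rM).
by rewrite -size_poly_eq0 size_fp_monic // size_poly_eq0 monic_neq0.
Qed.

Lemma embedding_total G : embedding_graph G ->
  exists G', [/\ embedding_graph G', G `<=` G' & forall x, exists y, G' (x, y)].
Proof.
move=> hG.
pose P A := A = set0 \/ (embedding_graph A /\ G `<=` A).
have [|A [PA maxA]] := @Zorn_bigcup OO P.
  move=> C CP tot.
  have [[X0 [CX0 [hX0 GX0]]]|no] :=
      pselect (exists X, C X /\ (embedding_graph X /\ G `<=` X)); last first.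
    left; apply/seteqP; split => // u [X CX Xu].
    by case: (CP _ CX) => [X0|h]; [move: Xu; rewrite X0 | case: no; exists X].
  right; split; last by move=> u hu; exists X0 => //; exact: GX0.
  have two u v : (\bigcup_(X in C) X) u -> (\bigcup_(X in C) X) v ->
      exists X, [/\ C X, embedding_graph X, X u & X v].
    have eg X w : C X -> X w -> embedding_graph X.
      by move=> CX Xw; case: (CP _ CX) => [X00|[]//]; move: Xw; rewrite X00.
    move=> [X CX Xu] [Y CY Yv]; case: (tot _ _ CX CY) => h.
      by exists Y; split => //; [exact: (eg _ _ CY Yv) | exact: h].
    by exists X; split => //; [exact: (eg _ _ CX Xu) | exact: h].
  split.
  - by move=> c hc; exists X0 => //; exact: (graph_diag hX0).
  - move=> u v hu hv; have [X [CX hX Xu Xv]] := two _ _ hu hv.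
    by exists X => //; exact: (graphB hX).
  - move=> u v hu hv; have [X [CX hX Xu Xv]] := two _ _ hu hv.
    by exists X => //; exact: (graphM hX).
  - move=> b hb; have [X [CX hX Xu _]] := two _ _ hb hb.
    exact: (graph_fun hX).
have [hA GA] : embedding_graph A /\ G `<=` A.
  case: PA => // A0; exfalso; apply: (maxA G); last by apply: or_intror; split.
  rewrite A0; split; first exact: sub0set.
  by move=> /(_ _ (graph0 hG)).
exists A; split => // x.
have [M hM] := min_graph_poly_exists x hA.
have [y ry] : exists y, root (sp M) y.
  apply/closed_rootP; rewrite size_sp_monic; last by case: hM.
  by have := min_graph_poly_size hM; case: (size M) => [|[]].
have [G' [hG' AG' Gxy]] := graph_extend hA hM ry.
exists y; apply: contrapT => nA; apply: (maxA G'); last first.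
  by apply: or_intror; split => //; exact: subset_trans AG'.
by split => // /(_ _ Gxy).
Qed.

Lemma embedding_Gal G : embedding_graph G -> (forall x, exists y, G (x, y)) ->
  exists2 s, Gal F s & forall x y, G (x, y) -> s x = y.
Proof.
move=> hG tot.
pose s x := xget 0 [set y | G (x, y)].
have sP x : G (x, s x).
  by rewrite /s; case: xgetP => [y -> //|h]; have [y /h] := tot x.
have sE x y : G (x, y) -> s x = y.
  move=> h; apply/eqP; rewrite -subr_eq0; apply/eqP; apply: (graph_fun hG).
  by rewrite -(subrr x); exact: (graphB hG (sP x) h).
have sD x y : s (x + y) = s x + s y.
  by apply: sE; exact: (graphD hG (sP x) (sP y)).
have sM x y : s (x * y) = s x * s y.
  by apply: sE; exact: (graphM hG (sP x) (sP y)).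
have sF x : F x -> s x = x by move=> hx; apply: sE; exact: (graph_diag hG).
have s0 : s 0 = 0 by apply: sF; exact: is_subfield0.
have s1 : s 1 = 1 by apply: sF; exact: is_subfield1.
have sN x : s (- x) = - s x.
  by apply/eqP; rewrite -addr_eq0 -sD addNr s0.
have inj : injective s.
  move=> x y e; apply/eqP; rewrite -subr_eq0; apply/eqP.
  apply: contrapT => /eqP n0; have : s ((x - y) / (x - y)) = 0.
    by rewrite sM sD sN e subrr mul0r.
  by rewrite divff // s1 => /eqP; rewrite oner_eq0.
have zm : zmod_morphism s by move=> x y; rewrite sD sN.
pose sa := GRing.isZmodMorphism.Build _ _ s zm.
have mm : monoid_morphism s by split.
pose sm := GRing.isMonoidMorphism.Build _ _ s mm.
pose f : {rmorphism Omega -> Omega} := HB.pack s sa sm.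
(* The injective map [s] sends the finite set of roots of a polynomial over $F$ into itself, hence
   onto itself. *)
have surj y : exists x, s x = y.
  have [P [P0 hP rP]] := F_alg y.
  have fix_P : map_poly f P = P.
    by apply/polyP => i; rewrite coef_map /= sF.
  have [r rE] := closed_field_poly_normal P.
  have lP0 : lead_coef P != 0 by rewrite lead_coef_eq0.
  have rootE z : root P z = (z \in r).
    by rewrite rE rootZ // root_prod_XsubC.
  have stab z : root P z -> root P (s z).
    by move=> /rootP h; apply/rootP; rewrite -fix_P horner_map h rmorph0.
  have sub : {subset map s (undup r) <= undup r}.
    move=> _ /mapP[z hz ->]; rewrite mem_undup -rootE stab // rootE.
    by rewrite -mem_undup.
  have um : uniq (map s (undup r)) by rewrite map_inj_uniq ?undup_uniq.
  have [_ eqm] := uniq_min_size um sub (eq_leq (esym (size_map _ _))).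
  have : y \in undup r by rewrite mem_undup -rootE.
  by rewrite -eqm => /mapP[x _ ->]; exists x.
exists s => //; split => //.
pose s' y := xget 0 [set x | s x = y].
have K : cancel s' s.
  move=> y; rewrite /s'; case: xgetP => [x -> //|h]; have [x /h] := surj y => //.
exists s' => // x; apply: inj; exact: K.
Qed.

Theorem Gal_moves x : ~ F x -> exists2 s, Gal F s & s x <> x.
Proof.
move=> nFx.
pose G0 : set OO := [set u | F u.1 /\ u.1 = u.2].
have hG0 : embedding_graph G0.
  split; rewrite /G0 /=.
  - by [].
  - move=> [a b] [c d] /= [ha <-] [hc <-]; split => //.
    exact: is_subfieldB.
  - move=> [a b] [c d] /= [ha <-] [hc <-]; split => //.
    exact: is_subfieldM.
  - by move=> b [_ <-].
have [M hM] := min_graph_poly_exists x hG0.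
have [Mm cM rM _] := hM.
have fsM : fp M = sp M.
  by apply/polyP => i; rewrite !coef_map; case: (cM i).
have sM1 := min_graph_poly_size hM.
(* If [x] were the only root, [sp M] would be $(X-x)^r$ with coefficient $-rx$ in degree $r-1$; this
   coefficient lies in $F$ and $r$ is invertible, so $x$ would lie in $F$. *)
have [y ry yx] : exists2 y, root (sp M) y & y != x.
  apply: contrapT => no; apply: nFx.
  have [r rE] := closed_field_poly_normal (sp M).
  have lc : lead_coef (sp M) = 1.
    by rewrite lead_coefE size_sp_monic // coef_map -lead_coefE (monicP Mm).
  rewrite lc scale1r in rE.
  have rx : r = nseq (size r) x.
    apply/all_pred1P/allP => z hz /=; apply: contrapT => /negP zx; apply: no.
    by exists z => //; rewrite rE root_prod_XsubC.
  have sr : (size (sp M)).-1 = size r by rewrite rE size_prod_XsubC.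
  have r0 : (0 < size r)%N by rewrite -sr size_sp_monic //; lia.
  have : (sp M)`_(size r).-1 = - (x *+ size r).
    rewrite rE coefPn_prod_XsubC -?lt0n //; congr (- _).
    by rewrite {1}rx big_nseq; elim: (size r) => //= m ->; rewrite mulrS.
  have Fc : F ((sp M)`_(size r).-1).
    by rewrite coef_map /=; case: (cM (size r).-1) => h <-.
  move=> e; move: Fc; rewrite e => Fc.
  have : F (x *+ size r) by rewrite -[x *+ _]opprK; exact: is_subfieldN.
  rewrite -mulr_natr => h.
  have n0 := natr_neq0 r0.
  rewrite -(mulfK n0 x); apply: is_subfieldM => //; apply: is_subfieldV => //.
  exact: is_subfield_nat.
have [G1 [hG1 _ G1xy]] := graph_extend hG0 hM ry.
have [G2 [hG2 G12 tot]] := embedding_total hG1.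
have [s hs sE] := embedding_Gal hG2 tot.
exists s => //; rewrite (sE _ _ (G12 _ G1xy)); exact/eqP.
Qed.

End ExtensionOfEmbeddings.

(** Bernoulli's inequality makes $(a/b)^k$ exceed every bound if $a>b$. A comparison up to a
    constant, once known for all powers, thus loses its constant. Taken with $a=1$, it also shows
    that the powers of a number below $1$ become arbitrarily small. *)
Lemma expr_le_bound (R : realType) (a b C : R) : 0 <= a -> 0 <= b ->
  (forall k, a ^+ k <= C * b ^+ k) -> a <= b.
Proof.
move=> a0 b0 h; rewrite leNgt; apply/negP => ba.
have a_gt0 : 0 < a by exact: le_lt_trans ba.
have C0 : 0 < C by have := h 0%N; rewrite !expr0 mulr1; exact: lt_le_trans.
have [b00|bn0] := eqVneq b 0.
  by have := h 1%N; rewrite !expr1 b00 mulr0 leNgt a_gt0.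
have bp : 0 < b by rewrite lt0r bn0.
pose d := a / b - 1.
have dp : 0 < d by rewrite subr_gt0 ltr_pdivlMr // mul1r.
have ab : 1 + d = a / b by rewrite /d addrC subrK.
have bern k : 1 + d *+ k <= (1 + d) ^+ k.
  elim: k => [|k IH]; first by rewrite mulr0n addr0 expr0.
  rewrite exprS; apply: (@le_trans _ _ ((1 + d) * (1 + d *+ k))).
    rewrite mulrDr mulr1 mulrDl mul1r mulrS.
    have : 0 <= d * d *+ k by rewrite mulrn_wge0 // mulr_ge0 // ltW.
    rewrite -mulrnAr; lra.
  by rewrite ler_wpM2l //; lra.
have [n hn] : exists n : nat, C / d < n%:R.
  exists (Num.bound (C / d)); apply: archi_boundP.
  by rewrite divr_ge0 // ltW.
have := h n; have := bern n; rewrite ab expr_div_n => h1 h2.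
have h3 : a ^+ n / b ^+ n <= C by rewrite ler_pdivrMr ?exprn_gt0.
have h4 : C < d *+ n by rewrite -mulr_natr mulrC -ltr_pdivrMr.
by lra.
Qed.

(** * Galois invariance of the absolute value *)

Section GaloisInvariance.
Variables (R : realType) (Omega : closedFieldType) (abs : Omega -> R).
Variables (p : nat) (Qp : set Omega).
Hypothesis cP : padic_closure abs p Qp.
Hypothesis p_prime : prime p.
Implicit Types (x y z : Omega) (F : set Omega) (b : seq Omega).

Definition tends (y : nat -> Omega) l : Prop :=
  forall e : R, 0 < e -> exists N, forall k, (N <= k)%N -> abs (y k - l) < e.

(** For an ultrametric absolute value this is the Cauchy condition. *)
Definition small_steps (y : nat -> Omega) : Prop :=
  forall e : R, 0 < e -> exists N, forall k, (N <= k)%N -> abs (y k.+1 - y k) < e.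

Lemma steps_cauchy (y : nat -> Omega) (e : R) N : 0 < e ->
  (forall k, (N <= k)%N -> abs (y k.+1 - y k) < e) ->
  forall i j, (N <= i)%N -> (N <= j)%N -> abs (y i - y j) < e.
Proof.
move=> e0 h.
have base i : (N <= i)%N -> abs (y i - y N) < e.
  move=> /subnK <-; elim: (i - N)%N => [|m IH]; first by rewrite add0n subrr (abs0 cP).
  by rewrite addSn; apply: (absB_trans_lt cP) IH; apply: h; rewrite leq_addl.
move=> i j hi hj; apply: (absB_trans_lt cP) (base _ hi) _.
by rewrite (absB_sym cP) base.
Qed.

Definition qspan b x : Prop := exists2 c : nat -> Omega,
  forall i, Qp (c i) & x = \sum_(i < size b) c i * b`_i.

(** One half of the equivalence of norms on a space of finite dimension. The family [b] may be
    dependent, so that only one suitable choice of coordinates is bounded. *)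
Definition qspan_bounded b : Prop := exists2 C : R, 0 < C &
  forall x, qspan b x -> exists c : nat -> Omega,
    [/\ forall i, Qp (c i), x = \sum_(i < size b) c i * b`_i
      & forall i, abs (c i) <= C * abs x].

Let QpF := Qp_subfield cP.

Lemma qspanB b x y : qspan b x -> qspan b y -> qspan b (x - y).
Proof.
move=> [c hc ->] [d hd ->]; exists (fun i => c i - d i).
  by move=> i; exact: is_subfieldB.
by rewrite -sumrB; apply: eq_bigr => i _; rewrite mulrBl.
Qed.

Lemma qspanZ b a x : Qp a -> qspan b x -> qspan b (a * x).
Proof.
move=> ha [c hc ->]; exists (fun i => a * c i).
  by move=> i; exact: is_subfieldM.
by rewrite mulr_sumr; apply: eq_bigr => i _; rewrite mulrA.
Qed.

(** Bounded coordinates are chosen for the differences $y_{k+1}-y_k$ and then summed; coordinates of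
    the terms themselves, chosen separately, need not converge. *)
Lemma qspan_complete b (y : nat -> Omega) : qspan_bounded b ->
  (forall k, qspan b (y k)) -> small_steps y ->
  exists2 l, qspan b l & tends y l.
Proof.
move=> [C C0 hC] hy steps.
have [c0 hc0 y0E] := hy 0%N.
have /choice[e he] k := hC _ (qspanB (hy k.+1) (hy k)).
pose c k i := c0 i + \sum_(j < k) e j i.
have Qc k i : Qp (c k i).
  apply: is_subfieldD => //; apply: is_subfield_sum => // j _.
  by case: (he j).
have yE k : y k = \sum_(i < size b) c k i * b`_i.
  elim: k => [|k IH].
    by rewrite y0E; apply: eq_bigr => i _; rewrite /c big_ord0 addr0.
  rewrite -[LHS](subrK (y k)); case: (he k) => _ -> _; rewrite {}IH.
  rewrite -big_split; apply: eq_bigr => i _ /=.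
  by rewrite -mulrDl /c big_ord_recr /= [in RHS]addrA [in LHS]addrC.
have cauchy i : forall d : R, 0 < d -> exists N, forall k j,
    (N <= k)%N -> (N <= j)%N -> abs (c k i - c j i) < d.
  move=> d d0; have [N hN] := steps _ (divr_gt0 d0 C0).
  exists N; apply: (@steps_cauchy (fun k => c k i)) => // k /hN h.
  have -> : c k.+1 i - c k i = e k i.
    by rewrite /c big_ord_recr /=; ring.
  case: (he k) => _ _ /(_ i) h1; apply: le_lt_trans h1 _.
  by rewrite mulrC -ltr_pdivlMr.
have /choice[l hl] i : exists l, Qp l /\ tends (fun k => c k i) l.
  by have [l h1 h2] := Qp_complete cP (fun k => Qc k i) (cauchy i); exists l.
exists (\sum_(i < size b) l i * b`_i).
  by exists l => // i; case: (hl i).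
move=> d d0.
have bd : forall m : nat, exists N, forall k, (N <= k)%N ->
    forall i, (i < m)%N -> abs ((c k i - l i) * b`_i) < d.
  elim=> [|m [N hN]]; first by exists 0%N.
  have [b0|b0] := eqVneq (b`_m) 0.
    exists N => k hk i; rewrite ltnS leq_eqVlt => /orP[/eqP->|]; last exact: hN.
    by rewrite b0 mulr0 (abs0 cP).
  have bp := abs_gt0 cP b0.
  have [N' hN'] := (hl m).2 _ (divr_gt0 d0 bp).
  exists (maxn N N') => k; rewrite geq_max => /andP[h1 h2] i.
  rewrite ltnS leq_eqVlt => /orP[/eqP->|]; last exact: hN.
  by rewrite (absM cP) -ltr_pdivlMr // hN'.
have [N hN] := bd (size b); exists N => k hk.
rewrite yE -sumrB; apply: (abs_sum_lt cP) => // i _.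
by rewrite -mulrBl; apply: hN.
Qed.

Lemma qspan_cons (b0 : Omega) b x : qspan (b0 :: b) x <->
  exists c y, [/\ Qp c, qspan b y & x = c * b0 + y].
Proof.
split.
  move=> [c hc ->]; rewrite big_ord_recl /=.
  exists (c 0%N), (\sum_(i < size b) c i.+1 * b`_i); split => //.
  by exists (fun i => c i.+1).
move=> [c [y [hc [d hd ->] ->]]].
exists (fun i => if i is i'.+1 then d i' else c); first by case.
by rewrite big_ord_recl.
Qed.

(** Induction on the family. If [b0] is not in the span of [b], this span is complete by induction,
    hence closed, and [b0] has a positive distance [d] from it. Then $|c|\,d\le|c\,b_0+y|$ bounds
    the new coordinate. *)
Theorem qspan_bound b : qspan_bounded b.
Proof.
elim: b => [|b0 b IH].
  exists 1 => // x [c hc ->]; exists (fun _ => 0); split.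
  - by move=> _; exact: is_subfield0.
  - by rewrite !big_ord0.
  - by move=> _; rewrite (abs0 cP) mul1r (abs_ge0 cP).
have [[c0 hc0 b0E]|nb] := pselect (qspan b b0).
  have [C C0 hC] := IH; exists C => // x /qspan_cons[c [y [hc hy xE]]].
  have hx : qspan b x.
    rewrite xE -[y]opprK; apply: qspanB; first by apply: qspanZ => //; exists c0.
    by rewrite -mulN1r; apply: qspanZ => //; apply: is_subfieldN => //; exact: is_subfield1.
  have [d [hd dE bd]] := hC _ hx.
  exists (fun i => if i is i'.+1 then d i' else 0); split.
  - by case=> [|i] //; exact: is_subfield0.
  - by rewrite big_ord_recl /= mul0r add0r.
  - by case=> [|i] //; rewrite (abs0 cP) mulr_ge0 ?(abs_ge0 cP) // ltW.
have [d d0 hd] : exists2 d : R, 0 < d & forall y, qspan b y -> d <= abs (b0 + y).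
  apply: contrapT => no.
  have /choice[y hy] (k : nat) : exists y, qspan b y /\ abs (b0 + y) < k.+1%:R^-1.
    apply: contrapT => no'; apply: no; exists (k.+1%:R^-1); first by rewrite invr_gt0.
    move=> y hy; rewrite leNgt; apply/negP => h; apply: no'; by exists y.
  have small e : 0 < e -> exists N, forall k, (N <= k)%N -> abs (b0 + y k) < e.
    move=> e0; exists (Num.bound e^-1) => k hk.
    apply: lt_trans (hy k).2 _; rewrite invf_plt ?posrE //.
    have h1 : e^-1 < (Num.bound e^-1)%:R by apply: archi_boundP; rewrite invr_ge0 ltW.
    apply: lt_le_trans h1 _; rewrite ler_nat; exact: leq_trans hk _.
  have [l hl tl] : exists2 l, qspan b l & tends y l.
    apply: qspan_complete => // [k|e e0]; first by case: (hy k).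
    have [N hN] := small e e0; exists N => k hk.
    have -> : y k.+1 - y k = (b0 + y k.+1) - (b0 + y k) by ring.
    by apply: (absB_lt cP); apply: hN => //; exact: leqW.
  apply: nb; have -> : b0 = 0 - l; last first.
    apply: qspanB => //; exists (fun _ => 0); first by move=> _; exact: is_subfield0.
    by rewrite big1 // => i _; rewrite mul0r.
  apply/eqP; rewrite sub0r -addr_eq0; apply/eqP/(abs_eq0 cP)/eqP.
  rewrite eq_le (abs_ge0 cP) andbT leNgt; apply/negP => e0.
  have [N1 h1] := small _ e0; have [N2 h2] := tl _ e0.
  have : abs (b0 + l) < abs (b0 + l).
    have {1}-> : b0 + l = (b0 + y (maxn N1 N2)) - (y (maxn N1 N2) - l) by ring.
    by apply: (absB_lt cP); [apply: h1|apply: h2]; rewrite ?leq_maxl ?leq_maxr.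
  by rewrite ltxx.
have [C C0 hC] := IH.
exists (Num.max (d^-1) (C * Num.max 1 (d^-1 * abs b0))).
  by rewrite lt_max invr_gt0 d0.
move=> x /qspan_cons[c [y [hc hy xE]]].
have cx : abs c <= d^-1 * abs x.
  have [->|c0] := eqVneq c 0.
    by rewrite (abs0 cP) mulr_ge0 ?(abs_ge0 cP) // invr_ge0 ltW.
  have := hd _ (qspanZ (is_subfieldV QpF hc) hy).
  have -> : b0 + c^-1 * y = c^-1 * x by rewrite xE mulrDr mulKf.
  rewrite (absM cP) (absV cP) ler_pdivlMl ?(abs_gt0 cP) // => h.
  by rewrite ler_pdivlMl // mulrC.
have [e [he eE be]] := hC _ hy.
have yx : abs y <= Num.max 1 (d^-1 * abs b0) * abs x.
  have -> : y = x - c * b0 by rewrite xE addrC addKr.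
  apply: (absB_le cP).
    by rewrite ler_peMl ?(abs_ge0 cP) // le_max lexx.
  rewrite (absM cP); apply: (@le_trans _ _ (d^-1 * abs x * abs b0)).
    by rewrite ler_wpM2r ?(abs_ge0 cP).
  by rewrite mulrAC ler_wpM2r ?(abs_ge0 cP) // le_max lexx orbT.
exists (fun i => if i is i'.+1 then e i' else c); split.
- by case.
- by rewrite big_ord_recl /= -eE.
- case=> [|i].
    by apply: le_trans cx _; rewrite ler_wpM2r ?(abs_ge0 cP) // le_max lexx.
  apply: le_trans (be i) _.
  apply: (@le_trans _ _ (C * Num.max 1 (d^-1 * abs b0) * abs x)).
    by rewrite -mulrA ler_wpM2l // ltW.
  by rewrite ler_wpM2r ?(abs_ge0 cP) // le_max lexx orbT.
Qed.

Lemma power_qspan x : exists m, forall k, qspan (mkseq (fun i => x ^+ i) m) (x ^+ k).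
Proof.
have [P [P0 hP rP]] := Omega_algebraic cP x.
have sP : (1 < size P)%N by exact: root_size_gt1 rP.
pose m := (size P).-1; exists m.
have m0 : (0 < m)%N by rewrite /m; case: (size P) sP => [|[]].
have l0 : P`_m != 0 by rewrite -lead_coefE lead_coef_eq0.
have xm : x ^+ m = \sum_(i < m) - (P`_i / P`_m) * x ^+ i.
  apply: (mulfI l0); move/rootP: rP; rewrite horner_coef.
  have -> : size P = m.+1 by rewrite prednK // ltnW.
  rewrite big_ord_recr /= => /eqP; rewrite addrC addr_eq0 => /eqP ->.
  rewrite mulr_sumr -sumrN; apply: eq_bigr => i _.
  by rewrite mulNr mulrN mulrA mulrCA divff // mulr1.
suff h k : exists2 c : nat -> Omega, forall i, Qp (c i) &
    x ^+ k = \sum_(i < m) c i * x ^+ i.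
  move=> k; have [c hc E] := h k; exists c => //.
  by rewrite size_mkseq E; apply: eq_bigr => i _; rewrite nth_mkseq.
elim: k => [|k [c hc E]].
  exists (fun i => if i == 0%N then 1 else 0).
    by move=> i; case: ifP => _; [exact: is_subfield1|exact: is_subfield0].
  rewrite expr0 (bigD1 (Ordinal m0)) //= mul1r expr0 big1 ?addr0 // => i.
  by rewrite -val_eqE /= => /negPf->; rewrite mul0r.
exists (fun i => (if i is i'.+1 then c i' else 0) - c m.-1 * (P`_i / P`_m)).
  move=> i; apply: is_subfieldB => //; first by case: i => [|i] //; exact: is_subfield0.
  apply: is_subfieldM => //; apply: is_subfieldM => //; exact: is_subfieldV.
rewrite exprS E mulr_sumr.
under [RHS]eq_bigr do rewrite mulrBl.
rewrite sumrB.
have -> : \sum_(i < m) c m.-1 * (P`_i / P`_m) * x ^+ i = - (c m.-1 * x ^+ m).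
  rewrite xm mulr_sumr -sumrN; apply: eq_bigr => i _.
  by rewrite mulNr mulrN opprK mulrA.
rewrite opprK; case: (m) m0 => // m' _ /=.
rewrite big_ord_recr [in RHS]big_ord_recl /= mul0r add0r; congr (_ + _).
  by apply: eq_bigr => i _; rewrite mulrCA /bump /= exprS.
by rewrite mulrCA exprS.
Qed.

(** All powers of $x$ have coordinates in one finite family, bounded by a multiple of $|x|^k$.
    Applying $s$ to the expansion gives $|s x|^k\le C'|x|^k$ for every $k$, and the constant is
    removed by [expr_le_bound]. *)
Lemma abs_Gal_le s x : Gal Qp s -> abs (s x) <= abs x.
Proof.
move=> hs; have [m hm] := power_qspan x.
have [C C0 hC] := qspan_bound (mkseq (fun i => x ^+ i) m).
pose B := \sum_(i < m) abs (s x ^+ i).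
apply: (@expr_le_bound _ _ _ (C * B)); rewrite ?(abs_ge0 cP) // => k.
have [c [Qc E bc]] := hC _ (hm k).
rewrite -!(absX cP).
have -> : s x ^+ k = \sum_(i < m) c i * s x ^+ i.
  have : s (x ^+ k) = s (\sum_(i < m) c i * x ^+ i).
    rewrite E size_mkseq; congr s; apply: eq_bigr => i _; by rewrite nth_mkseq.
  have sc i : s (c i) = c i by apply: (Gal_fix hs).
  have [f fE] := Gal_rmorphism hs; move: sc; rewrite fE => sc.
  rewrite rmorphXn rmorph_sum => ->; apply: eq_bigr => i _.
  by rewrite rmorphM rmorphXn sc.
have B0 (P : pred 'I_m) : 0 <= \sum_(i < m | P i) abs (s x ^+ i).
  by apply: sumr_ge0 => i _; exact: (abs_ge0 cP).
apply: (abs_sum_le cP) => [|i _]; first by rewrite mulr_ge0 ?(abs_ge0 cP) // mulr_ge0 ?(ltW C0) //; exact: B0.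
rewrite (absM cP) mulrAC; apply: ler_pM; rewrite ?(abs_ge0 cP) //.
by rewrite /B (bigD1 i) //= lerDl.
Qed.

Theorem abs_Gal s x : Gal Qp s -> abs (s x) = abs x.
Proof.
move=> hs; apply/eqP; rewrite eq_le abs_Gal_le //=.
by rewrite -{1}(ginvK hs x) abs_Gal_le //; exact: Gal_ginv.
Qed.

End GaloisInvariance.

(** * Finite extensions of Q_p *)

Section PadicFields.
Variables (R : realType) (Omega : closedFieldType) (abs : Omega -> R).
Variables (p : nat) (Qp : set Omega).
Hypothesis cP : padic_closure abs p Qp.
Hypothesis p_prime : prime p.
Implicit Types (x y z : Omega) (F K L : set Omega) (b r : seq Omega).
Implicit Types (s t : Omega -> Omega).

Let QpF := Qp_subfield cP.

Theorem Gal_fixed F x : is_subfield F -> Qp `<=` F ->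
  (forall s, Gal F s -> s x = x) -> F x.
Proof.
move=> hF QF h; apply: contrapT => nF.
have alg y : exists P : {poly Omega}, [/\ P != 0, forall i, F P`_i & root P y].
  by have [P [P0 hP rP]] := Omega_algebraic cP y; exists P; split=> // i; exact: QF.
have [s hs] := Gal_moves hF alg (natr_Omega_neq0 cP p_prime) nF.
by case; exact: h.
Qed.

Lemma abs_GalF F s x : Qp `<=` F -> Gal F s -> abs (s x) = abs x.
Proof. by move=> QF hs; apply: (abs_Gal cP); apply: Gal_sub hs. Qed.

Lemma abs_GalB F s x y : Qp `<=` F -> Gal F s -> abs (s x - s y) = abs (x - y).
Proof.
move=> QF hs; rewrite -[RHS](abs_GalF _ QF hs).
by have [f ->] := Gal_rmorphism hs; rewrite rmorphB.
Qed.

(** The limit exists because a finite span over $\mathbb{Q}_p$ is complete; it lies in $K$ because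
    automorphisms are isometries, so that it is fixed by $\mathrm{Gal}(K)$. *)
Lemma finite_ext_complete K (y : nat -> Omega) : finite_ext Qp K ->
  (forall k, K (y k)) -> small_steps abs y -> exists2 l, K l & tends abs y l.
Proof.
move=> [_ KF QK [b hb]] hy steps.
have hspan k : qspan Qp b (y k) by have [c hc E] := hb _ (hy k); exists c.
have [l _ tl] := qspan_complete cP (qspan_bound cP b) hspan steps.
exists l => //; apply: Gal_fixed => // s hs.
apply/eqP; rewrite -subr_eq0; apply/eqP/(abs_eq0 cP)/eqP.
rewrite eq_le (abs_ge0 cP) andbT leNgt; apply/negP => e0.
have [N hN] := tl _ e0; have h := hN N (leqnn _).
suff : abs (s l - l) < abs (s l - l) by rewrite ltxx.
apply: (absB_trans_lt cP) h; rewrite -{1}(Gal_fix hs (hy N)).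
by rewrite (abs_GalB _ _ QK hs) (absB_sym cP); exact: hN.
Qed.

Lemma orbit_seq (H : set (Omega -> Omega)) x : H `<=` Gal Qp ->
  exists2 r, uniq r & forall y, y \in r <-> exists2 s, H s & y = s x.
Proof.
move=> hH; have [P [P0 hP rP]] := Omega_algebraic cP x.
have [rs rsE] := closed_field_poly_normal P.
have lP0 : lead_coef P != 0 by rewrite lead_coef_eq0.
pose Q y := `[< exists2 s, H s & y = s x >].
exists (filter Q (undup rs)); first by rewrite filter_uniq ?undup_uniq.
move=> y; rewrite mem_filter mem_undup; split; first by case/andP => /asboolP.
move=> h; apply/andP; split; first exact/asboolP.
have [s hs ->] := h; have : root P (s x) by exact: (Gal_root (hH _ hs) hP rP).
by rewrite rsE rootZ // root_prod_XsubC.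
Qed.

Lemma nat_notin r : exists m, (m%:R : Omega) \notin r.
Proof.
apply: contrapT => no.
have sub : {subset [seq (m%:R : Omega) | m <- iota 0 (size r).+1] <= r}.
  move=> _ /mapP[m _ ->]; apply: contrapT => /negP h; apply: no; by exists m.
have u : uniq [seq (m%:R : Omega) | m <- iota 0 (size r).+1].
  rewrite map_inj_uniq ?iota_uniq // => m m'; exact: (natr_inj cP p_prime).
by have := uniq_leq_size u sub; rewrite size_map size_iota ltnn.
Qed.

Lemma separating_element b : exists theta,
  (forall F, is_subfield F -> (forall x, x \in b -> F x) -> F theta) /\
  (forall s s', Gal Qp s -> Gal Qp s' -> s theta = s' theta ->
     forall x, x \in b -> s x = s' x).
Proof.
elim: b => [|b0 b [th [th1 th2]]].
  by exists 0; split => // F hF _; exact: is_subfield0.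
have [r1 _ hr1] := @orbit_seq (Gal Qp) th (@subset_refl _ _).
have [r2 _ hr2] := @orbit_seq (Gal Qp) b0 (@subset_refl _ _).
have [m hm] := nat_notin
  [seq u / w | u <- [seq u1 - u2 | u1 <- r1, u2 <- r1],
               w <- [seq w1 - w2 | w1 <- r2, w2 <- r2]].
exists (th + m%:R * b0); split.
  move=> F hF h; apply: is_subfieldD => //.
    by apply: th1 => // x hx; apply: h; rewrite inE hx orbT.
  apply: is_subfieldM => //; first exact: is_subfield_nat.
  by apply: h; rewrite inE eqxx.
move=> s s' hs hs' e.
have eth : s th - s' th = m%:R * (s' b0 - s b0).
  move: e; have [f ->] := Gal_rmorphism hs; have [f' ->] := Gal_rmorphism hs'.
  rewrite !rmorphD !rmorphM !rmorph_nat => e.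
  have -> : f th = f' th + m%:R * f' b0 - m%:R * f b0 by rewrite -e addrK.
  by ring.
have eb : s b0 = s' b0.
  apply: contrapT => ne; move/negP: hm; apply.
  have n0 : s' b0 - s b0 != 0 by rewrite subr_eq0; apply/eqP => h; apply: ne.
  have -> : m%:R = (s th - s' th) / (s' b0 - s b0) by rewrite eth mulfK.
  apply: allpairs_f; apply: allpairs_f.
  - by apply/hr1; exists s.
  - by apply/hr1; exists s'.
  - by apply/hr2; exists s'.
  - by apply/hr2; exists s.
move=> x; rewrite inE => /orP[/eqP-> //|]; apply: th2 => //.
by apply/eqP; rewrite -subr_eq0 eth eb subrr mulr0.
Qed.

Definition determined_by b L : Prop := forall s s', Gal Qp s -> Gal Qp s' ->
  (forall x, x \in b -> s x = s' x) -> forall x, L x -> s x = s' x.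

(** This stands in for finite degree; a determining family of a field serves at once for every
    smaller field. *)
Definition finitely_determined L : Prop := exists b, determined_by b L.

Lemma finite_ext_extend F L b s s' : finite_ext F L ->
  Gal Qp s -> Gal Qp s' -> (forall x, F x -> s x = s' x) ->
  (forall b', (forall x, L x -> exists2 c : nat -> Omega, forall i, F (c i)
          & x = \sum_(i < size b') c i * b'`_i) ->
     b = b' -> (forall x, x \in b' -> s x = s' x) ->
  forall x, L x -> s x = s' x).
Proof.
move=> _ hs hs' hF b' hb' _ h x /hb'[c hc ->].
have hc' i : s (c i) = s' (c i) by exact: hF.
have hbi (i : 'I_(size b')) : s b'`_i = s' b'`_i by apply: h; rewrite mem_nth.
move: hc' hbi.
have [f ->] := Gal_rmorphism hs; have [f' ->] := Gal_rmorphism hs' => hc' hbi.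
by rewrite !rmorph_sum; apply: eq_bigr => i _; rewrite !rmorphM hc' hbi.
Qed.

Lemma finite_ext_determined F L : finite_ext F L -> finitely_determined F ->
  finitely_determined L.
Proof.
move=> hL [b0 h0]; case: (hL) => _ _ _ [b hb]; exists (b0 ++ b) => s s' hs hs' h.
apply: (@finite_ext_extend F L b) => //.
- by apply: h0 => // x hx; apply: h; rewrite mem_cat hx.
- exact: hb.
- by move=> x hx; apply: h; rewrite mem_cat hx orbT.
Qed.

Lemma Qp_determined : finitely_determined Qp.
Proof.
by exists [::] => s s' hs hs' _ x hx; rewrite (Gal_fix hs hx) (Gal_fix hs' hx).
Qed.

Lemma determined_sub L L' : L' `<=` L -> finitely_determined L ->
  finitely_determined L'.
Proof. by move=> sub [b h]; exists b => s s' hs hs' e x /sub; exact: h. Qed.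

(** The product of the conjugates of $x$ lies in $\mathbb{Q}_p$ and has absolute value $|x|^r$, with
    $r$ their number. Since $r$ is at most the number of conjugates of a separating element, the
    factorial of the latter is an exponent valid for all $x$. *)
Lemma value_group L : finitely_determined L ->
  exists2 e, (0 < e)%N & forall x, L x -> x != 0 ->
    exists z : int, abs x ^+ e = (p%:R : R) ^ z.
Proof.
move=> [b hb]; have [th [_ th2]] := separating_element b.
have [rt _ hrt] := @orbit_seq (Gal Qp) th (@subset_refl _ _).
exists (size rt)`!; first exact: fact_gt0.
move=> x hx x0.
have [r ur hr] := @orbit_seq (Gal Qp) x (@subset_refl _ _).
pose sel o := xget (id : Omega -> Omega) [set s | Gal Qp s /\ o = s th].
have sr : (size r <= size rt)%N.
  rewrite -(size_map (fun o => sel o x) rt); apply: uniq_leq_size => // y.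
  move/hr => [s hs ->].
  have hin : s th \in rt by apply/hrt; exists s.
  apply/mapP; exists (s th) => //.
  rewrite /sel; case: xgetP => [t _ [ht et]|no]; last by case: (no s).
  by apply: hb => //; apply: th2.
have r0 : (0 < size r)%N.
  have : x \in r by apply/hr; exists id => //; exact: Gal_id.
  by case: (r).
have : Qp (\prod_(y <- r) y).
  apply: Gal_fixed => // s hs; have inj := Gal_inj hs.
  have -> : s (\prod_(y <- r) y) = \prod_(y <- map s r) y.
    by have [f ->] := Gal_rmorphism hs; rewrite rmorph_prod big_map.
  apply: perm_big; rewrite perm_sym.
  have um : uniq (map s r) by rewrite map_inj_uniq.
  have sub : {subset map s r <= r}.
    move=> _ /mapP[y /hr[t ht ->] ->]; apply/hr; exists (s \o t) => //.
    exact: Gal_comp.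
  have [_ eqm] := uniq_min_size um sub (eq_leq (esym (size_map _ _))).
  by apply: uniq_perm => // y; rewrite eqm.
have absy y : y \in r -> abs y = abs x by move/hr => [s hs ->]; rewrite (abs_Gal cP).
have pE : abs (\prod_(y <- r) y) = abs x ^+ size r.
  rewrite (abs_prod cP) big_seq (eq_bigr (fun=> abs x)); last by move=> y /absy.
  by rewrite -big_seq big_const_seq count_predT iter_mulr_1.
move/(abs_QpE cP p_prime).
have -> : \prod_(y <- r) y != 0.
  rewrite prodf_seq_neq0; apply/allP => y /absy e /=; apply: contraTneq isT => y0.
  by move: e (abs_neq0 cP x0); rewrite y0 (abs0 cP) => <-; rewrite eqxx.
move=> /(_ isT)[z hz].
have /dvdnP[m ->] : (size r %| (size rt)`!)%N by rewrite dvdn_fact // r0.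
exists (z * m); by rewrite mulnC exprM -pE hz exprnP exprz_exp.
Qed.

(** Raised to the exponent of [value_group], non-zero absolute values below $1$ become $p^{-m}$ with
    $m>0$; a uniformizer is an element with the least such $m$. *)
Lemma uniformizer_exists L : is_subfield L -> Qp `<=` L ->
  finitely_determined L -> exists w, uniformizer abs L w.
Proof.
move=> hL QL /value_group[e e0 he].
have p1 : 1 < (p%:R : R) by rewrite ltr1n prime_gt1.
have val x : L x -> x != 0 -> abs x < 1 ->
    exists2 m, (0 < m)%N & abs x ^+ e = p%:R ^- m.
  move=> hx x0 x1; have [z hz] := he _ hx x0.
  have : abs x ^+ e < 1 by rewrite exprn_ilt1 ?(abs_ge0 cP) // -lt0n.
  rewrite hz; case: z hz => [m|m] hz.
    by rewrite -exprnP ltNge exprn_ege1 // ltW.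
  by move=> _; exists m.+1 => //; rewrite hz NegzE -exprnN.
pose good m := (0 < m)%N && `[< exists x, [/\ L x, x != 0, abs x < 1 & abs x ^+ e = p%:R ^- m] >].
have ex : exists m, good m.
  have Lp : L p%:R by exact: is_subfield_nat.
  have pn0 := p_neq0 cP p_prime; have plt := abs_p_lt1 cP p_prime.
  have [m m0 hm] := val _ Lp pn0 plt.
  by exists m; rewrite /good m0; apply/asboolP; exists p%:R.
case: (ex_minnP ex) => m /andP[m0 /asboolP[w [hw w0 w1 wE]]] min.
exists w; split => // y hy y1.
have [->|y0] := eqVneq y 0; first by rewrite (abs0 cP) (abs_ge0 cP).
have [m' m'0 yE] := val _ hy y0 y1.
have le : (m <= m')%N.
  by apply: min; rewrite /good m'0; apply/asboolP; exists y.
rewrite -(@ler_pXn2r _ e) ?nnegrE ?(abs_ge0 cP) // wE yE.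
rewrite lef_pV2 ?posrE ?exprn_gt0 ?(lt_trans ltr01) //.
by rewrite ler_weXn2l // ltW.
Qed.

Definition incongruent r : Prop :=
  forall i j, (i < j < size r)%N -> ~ abs (r`_i - r`_j) < 1.

Lemma incongruent_size r a : incongruent r ->
  (forall i, (i < size r)%N -> exists2 j, (j < size a)%N & abs (r`_i - a`_j) < 1) ->
  (size r <= size a)%N.
Proof.
move=> hr near.
have /choice[f hf] i : exists j, (i < size r)%N ->
    (j < size a)%N /\ abs (r`_i - a`_j) < 1.
  have [hi|_] := boolP (i < size r)%N; last by exists 0%N.
  by have [j h1 h2] := near _ hi; exists j.
have sub : {subset map f (iota 0 (size r)) <= iota 0 (size a)}.
  move=> y /mapP[i hi ->]; move: hi.
  by rewrite !mem_iota !add0n /= => /hf[].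
suff um : uniq (map f (iota 0 (size r))).
  by have := uniq_leq_size um sub; rewrite size_map !size_iota.
rewrite map_inj_in_uniq ?iota_uniq // => i j.
rewrite !mem_iota !add0n /= => hi hj e.
apply/eqP; apply: contrapT => /negP ne.
have close : abs (r`_i - r`_j) < 1.
  have [_ h1] := hf _ hi; have [_ h2] := hf _ hj.
  by apply: (absB_trans_lt cP h1); rewrite e (absB_sym cP).
have [lt|ge] := ltnP i j; first by apply: (hr i j) => //; rewrite lt.
by apply: (hr j i); [rewrite ltn_neqAle eq_sym ne ge | rewrite (absB_sym cP)].
Qed.

Lemma residue_card_unique F q q' :
  residue_card abs F q -> residue_card abs F q' -> q = q'.
Proof.
move=> [r [sr r1 r2 r3]] [r' [sr' r1' r2' r3']].
suff [h1 h2] : (size r <= size r')%N /\ (size r' <= size r)%N.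
  by rewrite -sr -sr'; apply/eqP; rewrite eqn_leq h1.
split.
  apply: incongruent_size; first by rewrite /incongruent sr.
  by move=> i; rewrite sr sr' => /r1[h1 h2]; exact: r3'.
apply: incongruent_size; first by rewrite /incongruent sr'.
by move=> i; rewrite sr sr' => /r1'[h1 h2]; exact: r3.
Qed.

(** Over [Omega] the value $|P(y)|$ is the product of the distances from $y$ to the roots, so that
    $|P(y)|<1$ puts $y$ in the residue class of a root; there are fewer roots than classes. *)
Lemma few_residue_roots (P : {poly Omega}) r : abs (lead_coef P) = 1 ->
  (size P <= size r)%N -> incongruent r ->
  exists2 i, (i < size r)%N & 1 <= abs P.[r`_i].
Proof.
move=> lP sP hr; apply: contrapT => no.
have P0 : P != 0.
  rewrite -lead_coef_eq0; apply/eqP => h; move: lP.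
  by rewrite h (abs0 cP) => /eqP; rewrite eq_sym oner_eq0.
have [a aE] := closed_field_poly_normal P.
have sa : (size a < size P)%N.
  by rewrite aE size_scale ?lead_coef_eq0 // size_prod_XsubC.
suff h : (size r <= size a)%N by move: sP; rewrite leqNgt (leq_ltn_trans h).
apply: incongruent_size => // i hi.
apply: contrapT => far; apply: no; exists i => //.
rewrite aE hornerZ (absM cP) lP mul1r horner_prod (abs_prod cP).
rewrite big_seq; elim/big_ind: _ => // [x y h1 h2|y hy].
  by rewrite -[1]mulr1 ler_pM.
rewrite hornerXsubC leNgt; apply/negP => h; apply: far.
by exists (index y a); rewrite ?index_mem ?nth_index.
Qed.

(** The distances from $1$ to the $d$ roots of $X^d-u$ have product $|u-1|<|d|^d$, so one of them is
    below $|d|$. *)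
Lemma root_near1 u d : (0 < d)%N -> abs (u - 1) < abs d%:R ^+ d ->
  exists2 v, v ^+ d = u & abs (v - 1) < abs d%:R.
Proof.
move=> d0 hu; pose P : {poly Omega} := 'X^d - u%:P.
have [a] := closed_field_poly_normal P.
rewrite (monicP (monicXnsubC _ d0)) scale1r => aE.
have sa : size a = d by have := size_XnsubC u d0; rewrite -/P aE size_prod_XsubC => -[].
have P1 : abs P.[1] < abs d%:R ^+ d.
  by rewrite hornerD hornerN hornerXn hornerC expr1n (absB_sym cP).
have [v va hv] : exists2 v, v \in a & abs (1 - v) < abs d%:R.
  apply: contrapT => far; move: P1; rewrite ltNge => /negP; apply.
  rewrite aE horner_prod (abs_prod cP) -sa -{2}(count_predT a) -iter_mulr_1.
  rewrite -big_const_seq big_seq [X in _ <= X]big_seq.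
  apply: ler_prod => y hy; rewrite (abs_ge0 cP) hornerXsubC leNgt sa /=.
  by apply/negP => h; apply: far; exists y.
exists v; last by rewrite (absB_sym cP).
have : root P v by rewrite aE root_prod_XsubC.
by rewrite rootE hornerD hornerN hornerXn hornerC subr_eq0 => /eqP.
Qed.

(** If $z=v/v'$ were a $d$-th root of unity other than $1$, the sum of the $z^i$ for $i<d$ would
    vanish, but it differs from $d$ by less than $|d|$. *)
Lemma root_near1_unique v v' d : (0 < d)%N ->
  abs (v - 1) < abs d%:R -> abs (v' - 1) < abs d%:R ->
  v ^+ d = v' ^+ d -> v = v'.
Proof.
move=> d0 hv hv' e.
have d1 : abs d%:R <= 1 by exact: (abs_nat_le1 cP).
have v'1 : abs v' = 1 by apply: (abs_princ_unit cP); exact: lt_le_trans d1.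
have v'0 : v' != 0 by apply: (abs_princ_neq0 cP); exact: lt_le_trans d1.
pose z := v / v'; have z1 : abs (z - 1) < abs d%:R.
  have -> : z - 1 = (v - v') / v' by rewrite mulrBl divff.
  rewrite (absM cP) (absV cP) v'1 invr1 mulr1.
  by apply: (absB_trans_lt cP hv); rewrite (absB_sym cP).
have zd : z ^+ d = 1 by rewrite expr_div_n e divff // expf_neq0.
suff : z = 1 by move/(congr1 ( *%R^~ v')); rewrite mul1r divfK.
have zn i : abs (z ^+ i - 1) < abs d%:R.
  elim: i => [|i IH]; first by rewrite subrr (abs0 cP) (abs_gt0 cP) // (natr_Omega_neq0 cP p_prime).
  have -> : z ^+ i.+1 - 1 = z * (z ^+ i - 1) + (z - 1) by rewrite exprS; ring.
  apply: (absD_lt cP) => //; rewrite (absM cP).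
  apply: le_lt_trans IH; rewrite ler_piMl ?(abs_ge0 cP) //.
  by rewrite (abs_princ_unit cP) //; exact: lt_le_trans d1.
have dn0 : abs (d%:R : Omega) != 0 by rewrite (abs_neq0 cP) // (natr_Omega_neq0 cP p_prime).
have S : abs (\sum_(i < d) z ^+ i) = abs d%:R.
  have -> : \sum_(i < d) z ^+ i = d%:R + \sum_(i < d) (z ^+ i - 1).
    by rewrite sumrB sumr_const card_ord addrC subrK.
  apply: (abs_addl cP); apply: (abs_sum_lt cP) => //.
  by rewrite (abs_gt0 cP) // (natr_Omega_neq0 cP p_prime).
have := subrX1 z d; rewrite zd subrr => /esym/eqP; rewrite mulf_eq0 => /orP[].
  by rewrite subr_eq0 => /eqP.
by move=> /eqP h; move: S; rewrite h (abs0 cP) => /esym/eqP; rewrite (negPf dn0).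
Qed.

Lemma abs_two_unit : p != 2 -> abs 2%:R = 1.
Proof.
move=> p2; apply: (abs_nat_coprime cP p_prime).
by rewrite prime_coprime // dvdn_prime2.
Qed.

End PadicFields.

(** The translation $x\mapsto x+1$ permutes [k], and so preserves the sum of all elements. *)
Lemma card_natr_eq0 (k : finFieldType) : #|k|%:R = 0 :> k.
Proof.
have e : \sum_(x : k) x = \sum_(x : k) x + #|k|%:R.
  rewrite {1}(reindex_inj (addIr 1)) /= big_split /=; congr (_ + _).
  by rewrite sumr_const.
by apply: (@addrI _ (\sum_(x : k) x)); rewrite -e addr0.
Qed.

Lemma exists_prim_root (F : closedFieldType) m : m%:R != 0 :> F ->
  exists z : F, m.-primitive_root z.
Proof.
move=> m0; have mp : (0 < m)%N by rewrite lt0n; apply: contra m0 => /eqP->.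
have [a] := closed_field_poly_normal ('X^m - 1 : {poly F}).
rewrite (monicP (monicXnsubC _ mp)) scale1r => aE.
have ua : uniq a by rewrite -separable_prod_XsubC -aE separable_Xn_sub_1.
have sa : (m <= size a)%N.
  by have := size_XnsubC (1 : F) mp; rewrite aE size_prod_XsubC => -[->].
have al : all m.-unity_root a.
  by apply/allP => x hx; rewrite /root_of_unity aE root_prod_XsubC.
by have /hasP[z _ hz] := has_prim_root mp al ua sa; exists z.
Qed.

(** * Frobenius and inertia *)

Section FrobeniusAndInertia.
Variables (R : realType) (Omega : closedFieldType) (abs : Omega -> R).
Variables (p : nat) (Qp K : set Omega).
Hypothesis cP : padic_closure abs p Qp.
Hypothesis p_prime : prime p.
Hypothesis K_finite : finite_ext Qp K.
Variables (OK : comNzRingType) (iota : {rmorphism OK -> Omega}).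
Hypothesis OK_integers : ring_of_integers abs K iota.
Variables (k : finFieldType) (res : {rmorphism OK -> k}).
Hypothesis k_residue : residue_field abs iota res.
Implicit Types (x y z : Omega) (s t g h : Omega -> Omega).

Let q := #|k|.

Lemma base_field : is_subfield K.
Proof. by case: K_finite. Qed.

Lemma base_sub : Qp `<=` K.
Proof. by case: K_finite. Qed.

Let KF := base_field.
Let QK := base_sub.

Lemma card_k_gt1 : (1 < q)%N.
Proof.
exact: card_finNzRing_gt1.
Qed.

Lemma iota_int c : K (iota c) /\ abs (iota c) <= 1.
Proof. by case: OK_integers => _ h; apply/h; exists c. Qed.

Lemma iota_surj x : K x -> abs x <= 1 -> exists c, iota c = x.
Proof. by case: OK_integers => _ h hx h1; apply/h. Qed.

Lemma res_cong c c' : res c = res c' <-> abs (iota c - iota c') < 1.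
Proof.
case: k_residue => _ h; rewrite -rmorphB; rewrite -h rmorphB; split.
  by move=> ->; rewrite subrr.
by move/eqP; rewrite subr_eq0 => /eqP.
Qed.

Lemma residue_card_base : residue_card abs K q.
Proof.
have /choice[l hl] (y : k) : exists c, res c = y by case: k_residue.
have [ek [sek uek mek]] : exists ek : seq k, [/\ size ek = q, uniq ek & forall y : k, y \in ek].
  by exists (enum predT); rewrite -cardE enum_uniq; split => // y; rewrite mem_enum.
have nthE i : (i < q)%N -> (map (iota \o l) ek)`_i = iota (l ek`_i).
  by move=> hi; rewrite (nth_map 0) ?sek.
exists (map (iota \o l) ek); split.
- by rewrite size_map.
- by move=> i hi; rewrite nthE //; exact: iota_int.
- move=> i j /andP[ij jq]; have iq := ltn_trans ij jq.
  rewrite !nthE // => /res_cong; rewrite !hl => /eqP.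
  by rewrite nth_uniq ?sek // => /eqP e; move: ij; rewrite e ltnn.
- move=> x hx x1; have [c cE] := iota_surj hx x1.
  have hi : (index (res c) ek < q)%N by rewrite -sek index_mem.
  exists (index (res c) ek) => //; rewrite nthE // nth_index // -cE.
  by apply/res_cong; rewrite hl.
Qed.

Lemma abs_card_lt1 : abs (q%:R : Omega) < 1.
Proof.
rewrite -[q%:R]subr0 -(rmorph_nat iota) -(rmorph0 iota); apply/res_cong.
by rewrite rmorph_nat rmorph0 card_natr_eq0.
Qed.

Lemma abs_card_pred m : (0 < m)%N -> abs ((q ^ m).-1%:R : Omega) = 1.
Proof.
move=> m0; apply: (@abs1_close _ _ abs p Qp cP (-1)); last by rewrite (absN1 cP).
have q0 : (0 < q ^ m)%N by rewrite expn_gt0 ltnW // card_k_gt1.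
have -> : -1 - (q ^ m).-1%:R = - ((q ^ m)%:R : Omega).
  by rewrite -{2}(prednK q0) -natr1; ring.
rewrite (absN cP) natrX (absX cP) exprn_ilt1 ?(abs_ge0 cP) ?abs_card_lt1 //.
by rewrite -lt0n.
Qed.

Lemma residue_fixed x : K x -> abs x <= 1 -> abs (x ^+ q - x) < 1.
Proof.
move=> hx x1; have [c <-] := iota_surj hx x1.
by rewrite -rmorphXn; apply/res_cong; rewrite rmorphXn expf_card.
Qed.

(** A further residue class fixed by the $q$-th power would be root number $q+1$ of $X^q-X$ modulo
    the maximal ideal. *)
Lemma fixed_residue x : abs x <= 1 -> abs (x ^+ q - x) < 1 ->
  exists2 c, K c /\ abs c <= 1 & abs (x - c) < 1.
Proof.
move=> x1 hx; have [r [sr r1 r2 r3]] := residue_card_base.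
apply: contrapT => no.
pose P : {poly Omega} := 'X^q - 'X.
have sP : size P = q.+1 by rewrite size_addl ?size_polyXn // size_opp size_polyX ltnS card_k_gt1.
have cP0 : lead_coef P = 1.
  rewrite lead_coefDl ?lead_coefXn // size_opp size_polyX size_polyXn ltnS.
  exact: card_k_gt1.
have [||/=|i hi] := @few_residue_roots _ _ abs p Qp cP P (x :: r).
- by rewrite cP0 (abs1 cP).
- by rewrite sP /= sr.
- move=> [|i] [|j] //=; rewrite !ltnS sr => hij.
    move=> h; apply: no; exists r`_j => //; exact: r1.
  exact: r2.
rewrite hornerD hornerN hornerXn hornerX leNgt => /negP; apply.
case: i hi => [|i] //=; rewrite ltnS sr => /r1[h1 h2].
exact: residue_fixed.
Qed.

Variable Fr : Omega -> Omega.
Hypothesis Fr_frobenius : frobenius abs K Fr.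

Lemma Fr_Gal : Gal K Fr.
Proof. by case: Fr_frobenius. Qed.

Let FrG := Fr_Gal.

Lemma Fr_cong x : abs x <= 1 -> abs (Fr x - x ^+ q) < 1.
Proof.
case: Fr_frobenius => _ [q' hq' h].
by rewrite (residue_card_unique cP residue_card_base hq'); exact: h.
Qed.

Lemma Frn_Gal i : Gal K (iter i Fr).
Proof. exact: Gal_iter. Qed.

Lemma Frn_cong i x : abs x <= 1 -> abs (iter i Fr x - x ^+ (q ^ i)) < 1.
Proof.
move=> x1; elim: i => [|i IH]; first by rewrite expr1 subrr (abs0 cP).
have hi : abs (iter i Fr x) <= 1 by rewrite (abs_GalF cP _ QK (Frn_Gal i)).
rewrite iterS expnS mulnC exprM; apply: (absB_trans_lt cP (Fr_cong hi)).
exact: (abs_congX_lt cP).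
Qed.

(** On residues the $q^i$-th power is the action of $\mathrm{Fr}^i$, and $\mathrm{Fr}^i$ is an
    isometry. *)
Lemma cong_q_inj i x y : abs x <= 1 -> abs y <= 1 ->
  abs (x ^+ (q ^ i) - y ^+ (q ^ i)) < 1 -> abs (x - y) < 1.
Proof.
move=> x1 y1 h; rewrite -(abs_GalB cP _ _ QK (Frn_Gal i)).
apply: (absB_trans_lt cP (Frn_cong i x1)).
by apply: (absB_trans_lt cP h); rewrite (absB_sym cP) Frn_cong.
Qed.

Lemma unity_root_cong m x y : (0 < m)%N -> abs (m%:R : Omega) = 1 ->
  x ^+ m = 1 -> y ^+ m = 1 -> abs (x - y) < 1 -> x = y.
Proof.
move=> m0 m1 hx hy h.
have y0 : y != 0.
  by apply/eqP => y0; move/eqP: hy; rewrite y0 expr0n gtn_eqF // eq_sym oner_eq0.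
have ay : abs y = 1.
  apply/eqP; rewrite -(@eqrXn2 _ m) ?ler01 ?(abs_ge0 cP) //.
  by rewrite -(absX cP) hy (abs1 cP) expr1n.
suff e : x / y = 1 by rewrite -[x](divfK y0) e mul1r.
apply: (@root_near1_unique _ _ abs p Qp cP p_prime (x / y) 1 m) => //.
- have -> : x / y - 1 = (x - y) / y by rewrite mulrBl divff.
  by rewrite (absM cP) (absV cP) ay invr1 mulr1 m1.
- by rewrite subrr (abs0 cP) m1.
- by rewrite expr_div_n hx hy invr1 mulr1 expr1n.
Qed.

Section FiniteLevel.
Variables (N : nat) (zeta : Omega).
Hypothesis N_gt0 : (0 < N)%N.
Let m := (q ^ N).-1.
Hypothesis prim : m.-primitive_root zeta.

Lemma level_gt0 : (0 < m)%N.
Proof. exact: prim_order_gt0 prim. Qed.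

Let m0 := level_gt0.
Let m1 : abs (m%:R : Omega) = 1 := abs_card_pred N_gt0.
Let zm : zeta ^+ m = 1 := prim_expr_order prim.

Let z1 : abs zeta = 1.
Proof.
apply/eqP; rewrite -(@eqrXn2 _ m) ?ler01 ?(abs_ge0 cP) //.
by rewrite -(absX cP) zm (abs1 cP) expr1n.
Qed.

Let unity_le x : x ^+ m = 1 -> abs x <= 1.
Proof.
move=> h; suff : abs x == 1 by move/eqP->.
rewrite -(@eqrXn2 _ m) ?ler01 ?(abs_ge0 cP) //.
by rewrite -(absX cP) h (abs1 cP) expr1n.
Qed.

Let zN : zeta ^+ (q ^ N) = zeta.
Proof.
have q0 : (0 < q ^ N)%N by rewrite expn_gt0 ltnW // card_k_gt1.
by rewrite -(prednK q0) exprS zm mulr1.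
Qed.

Let Gal_unity g x : Gal K g -> x ^+ m = 1 -> g x ^+ m = 1.
Proof.
by move=> hg h; have [f ->] := Gal_rmorphism hg; rewrite -rmorphXn h rmorph1.
Qed.

Lemma Fr_zeta : Fr zeta = zeta ^+ q.
Proof.
apply: (unity_root_cong m0 m1); first exact: Gal_unity.
  by rewrite exprAC zm expr1n.
exact: Fr_cong (unity_le zm).
Qed.

(** The product of the $X-\zeta^{q^j}$ is fixed by Frobenius, so its coefficients are congruent to
    elements of $K$, by [fixed_residue]. Hence $g\zeta$ is a root of it modulo the maximal ideal, is
    congruent to some $\zeta^{q^j}$, and is equal to it since roots of unity of order prime to $p$
    are determined by their residues. *)
Lemma Gal_zeta g : Gal K g -> exists2 i, (i < N)%N & g zeta = zeta ^+ (q ^ i).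
Proof.
move=> hg.
pose P : {poly Omega} := \prod_(j < N) ('X - (zeta ^+ (q ^ j))%:P).
have FrP : map_poly Fr P = P.
  have [f fE] := Gal_rmorphism FrG; rewrite fE rmorph_prod.
  have fz : f zeta = zeta ^+ q by rewrite -fE Fr_zeta.
  rewrite (eq_bigr (fun j : 'I_N => 'X - (zeta ^+ (q ^ j.+1))%:P)); last first.
    by move=> j _; rewrite rmorphB /= map_polyX map_polyC /= rmorphXn fz -exprM -expnS.
  rewrite /P; case: (N) N_gt0 zN => // n _ zn.
  by rewrite big_ord_recr [RHS]big_ord_recl /= zn expr1 mulrC.
have sP : size P = N.+1.
  by rewrite /P size_prod_XsubC /index_enum -enumT -cardE card_ord.
have intP j : abs P`_j <= 1.
  move: j; apply: (big_ind (fun P1 : {poly Omega} => forall j, abs P1`_j <= 1)).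
  - by move=> j; rewrite coef1; case: eqP; rewrite ?(abs0 cP) ?(abs1 cP).
  - move=> P1 P2 h1 h2 j.
    by rewrite coefM; apply: (abs_sum_le cP) => // i _; exact: (absM_le1 cP).
  - move=> i _ j; rewrite coefB coefX coefC; apply: (absB_le cP).
      by case: eqP; rewrite ?(abs0 cP) ?(abs1 cP).
    case: eqP; rewrite ?(abs0 cP) // => _.
    by rewrite (absX_le1 cP) // z1.
have /choice[c hc] j : exists c, (K c /\ abs c <= 1) /\ abs (P`_j - c) < 1.
  have [|c h1 h2] := fixed_residue (intP j); last by exists c.
  have {1}-> : P`_j ^+ q - P`_j = - (Fr P`_j - P`_j ^+ q).
    suff -> : Fr P`_j = P`_j by ring.
    have := congr1 (fun P : {poly Omega} => P`_j) FrP.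
    by have [f ->] := Gal_rmorphism FrG; rewrite coef_map.
  by rewrite (absN cP); exact: Fr_cong.
have gz : g zeta ^+ m = 1 by exact: Gal_unity.
have gz1 := unity_le gz.
have close x : abs x <= 1 ->
    abs (\sum_(j < N.+1) c j * x ^+ j - P.[x]) < 1.
  move=> x1; rewrite horner_coef sP -sumrB; apply: (abs_sum_lt cP) => // j _.
  rewrite -mulrBl; apply: (absMr_lt1 cP); last exact: (absX_le1 cP).
  by rewrite (absB_sym cP); case: (hc j).
have Pz : P.[zeta] = 0.
  rewrite /P horner_prod (bigD1 (Ordinal N_gt0)) //= expn0 expr1.
  by rewrite hornerXsubC subrr mul0r.
have Pgz : abs P.[g zeta] < 1.
  rewrite -[P.[_]](subrK (\sum_(j < N.+1) c j * g zeta ^+ j)).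
  apply: (absD_lt cP); first by rewrite (absB_sym cP) close.
  have -> : \sum_(j < N.+1) c j * g zeta ^+ j = g (\sum_(j < N.+1) c j * zeta ^+ j).
    have gc j : g (c j) = c j by apply: (Gal_fix hg); case: (hc j) => -[].
    move: gc; have [f ->] := Gal_rmorphism hg => gc.
    by rewrite rmorph_sum; apply: eq_bigr => j _; rewrite rmorphM rmorphXn gc.
  by rewrite (abs_GalF cP _ QK hg); have := close _ (unity_le zm); rewrite Pz subr0.
apply: contrapT => no; move: Pgz; rewrite ltNge => /negP; apply.
rewrite /P horner_prod (abs_prod cP).
elim/big_ind: _ => // [x y h1 h2|j _]; first by rewrite -[1]mulr1 ler_pM.
rewrite hornerXsubC leNgt; apply/negP => h; apply: no; exists j => //.
apply: (unity_root_cong m0 m1) h => //.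
by rewrite exprAC zm expr1n.
Qed.

Lemma level_residues x : abs x <= 1 -> abs (x ^+ (q ^ N) - x) < 1 ->
  abs x < 1 \/ exists2 j, (j < m)%N & abs (x - zeta ^+ j) < 1.
Proof.
move=> x1 hx; have [lt|ge] := ltP (abs x) 1; [by left|right].
have {ge x1} x1 : abs x = 1 by apply/eqP; rewrite eq_le x1.
have q0 : (0 < q ^ N)%N by rewrite expn_gt0 ltnW // card_k_gt1.
have : abs (x ^+ m - 1) < 1.
  move: hx; rewrite -{1}(prednK q0) exprS -/m.
  have -> : x * x ^+ m - x = x * (x ^+ m - 1) by ring.
  by rewrite (absM cP) x1 mul1r.
have -> : x ^+ m - 1 = ('X^m - 1).[x] by rewrite hornerD hornerN hornerXn hornerC.
rewrite -(factor_Xn_sub_1 prim) big_mkord horner_prod (abs_prod cP).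
move=> lt; apply: contrapT => no; move: lt; rewrite ltNge => /negP; apply.
elim/big_ind: _ => // [y y' h1 h2|j _]; first by rewrite -[1]mulr1 ler_pM.
by rewrite hornerXsubC leNgt; apply/negP => h; apply: no; exists j.
Qed.

Lemma zeta_power_inj i j : (i < N)%N -> (j < N)%N ->
  zeta ^+ (q ^ i) = zeta ^+ (q ^ j) -> i = j.
Proof.
move=> hi hj /eqP; rewrite (eq_prim_root_expr prim).
have q1 := card_k_gt1.
have small l : (l < N)%N -> (1 < N)%N -> (q ^ l < m)%N.
  move=> hl N1; have : (q ^ l <= q ^ N.-1)%N by rewrite leq_exp2l //; lia.
  have : (q ^ N = q * q ^ N.-1)%N by rewrite -expnS prednK.
  have : (q ^ 1 <= q ^ N.-1)%N by rewrite leq_exp2l //; lia.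
  rewrite expn1 /m; nia.
have [N1|N1] := ltnP 1 N; last by move=> _; lia.
by rewrite !modn_small ?small // eqn_exp2l // => /eqP.
Qed.

Lemma zeta_power_cong i j :
  zeta ^+ (q ^ i) = zeta ^+ (q ^ j) -> i = j %[mod N].
Proof.
have red l : zeta ^+ (q ^ l) = zeta ^+ (q ^ (l %% N)).
  rewrite {1}(divn_eq l N) expnD exprM; congr (_ ^+ _).
  elim: (l %/ N)%N => [|n IH]; first by rewrite mul0n expr1.
  by rewrite mulSn expnD exprM zN.
rewrite red (red j); apply: zeta_power_inj; exact: ltn_pmod.
Qed.

End FiniteLevel.

Lemma level_exists N : (0 < N)%N -> exists z, (q ^ N).-1.-primitive_root z.
Proof.
move=> N0; have := @abs_card_pred N N0 => h; have [|z hz] := @exists_prim_root Omega (q ^ N).-1.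
  by apply/eqP => e; move/eqP: h; rewrite e (abs0 cP) eq_sym oner_eq0.
by exists z.
Qed.

Lemma Gal_residue_action N g : (0 < N)%N -> Gal K g ->
  exists2 i, (i < N)%N & forall x, abs x <= 1 -> abs (x ^+ (q ^ N) - x) < 1 ->
    abs (g x - x ^+ (q ^ i)) < 1.
Proof.
move=> N0 hg; have [z hz] := level_exists N0; have [i hi gz] := Gal_zeta N0 hz hg.
exists i => // x x1 hx.
have [lt|[j _ xz]] := level_residues hz x1 hx.
  apply: (absB_lt cP); first by rewrite (abs_GalF cP _ QK hg).
  rewrite (absX cP) exprn_ilt1 ?(abs_ge0 cP) // expn_eq0 negb_and.
  by rewrite gtn_eqF // ltnW // card_k_gt1.
have := xz; rewrite -(abs_GalB cP _ _ QK hg) => h.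
apply: (absB_trans_lt cP h).
have -> : g (z ^+ j) = (z ^+ j) ^+ (q ^ i).
  by move: gz; have [f ->] := Gal_rmorphism hg => gz; rewrite rmorphXn gz -!exprM mulnC.
rewrite (absB_sym cP); exact: (abs_congX_lt cP).
Qed.

Lemma residue_action_unique N i j : (0 < N)%N ->
  (forall x, abs x <= 1 -> abs (x ^+ (q ^ N) - x) < 1 ->
     abs (x ^+ (q ^ i) - x ^+ (q ^ j)) < 1) -> i = j %[mod N].
Proof.
move=> N0 h; have [z hz] := level_exists N0; apply: (zeta_power_cong N0 hz).
have m0 := level_gt0 hz; have zm := prim_expr_order hz.
have q0 : (0 < q ^ N)%N by rewrite expn_gt0 ltnW // card_k_gt1.
apply: (unity_root_cong m0 (abs_card_pred N0)).
- by rewrite exprAC zm expr1n.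
- by rewrite exprAC zm expr1n.
apply: h; last by rewrite -{1}(prednK q0) exprS zm mulr1 subrr (abs0 cP).
suff : abs z == 1 by move/eqP->.
rewrite -(@eqrXn2 _ (q ^ N).-1) ?ler01 ?(abs_ge0 cP) //.
by rewrite -(absX cP) zm (abs1 cP) expr1n.
Qed.

Lemma Fr_period x : exists2 N, (0 < N)%N & iter N Fr x = x.
Proof.
have [|r _ hr] := @orbit_seq _ _ abs p Qp cP [set s | exists i, s = iter i Fr] x.
  by move=> _ [i ->]; apply: Gal_sub (Frn_Gal i).
have sub : {subset [seq iter i Fr x | i <- seq.iota 0 (size r).+1] <= r}.
  by move=> _ /mapP[i _ ->]; apply/hr; exists (iter i Fr) => //; exists i.
have : ~~ uniq [seq iter i Fr x | i <- seq.iota 0 (size r).+1].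
  apply/negP => u; have := uniq_leq_size u sub.
  by rewrite size_map size_iota ltnn.
move=> nu; apply: contrapT => no; move/negP: nu; apply.
rewrite map_inj_in_uniq ?iota_uniq // => i j _ _.
wlog ij : i j / (i <= j)%N => [hw e|].
  by case/orP: (leq_total i j) => ij; [exact: hw | exact/esym/hw].
rewrite -(subnKC ij) iterD => e; have {}e := Gal_inj (Frn_Gal i) e.
case: (posnP (j - i)) => [->|h]; first by rewrite addn0.
by case: no; exists (j - i)%N.
Qed.

Lemma iter_period N i j x : iter N Fr x = x -> i = j %[mod N] ->
  iter i Fr x = iter j Fr x.
Proof.
move=> hN; have red l : iter l Fr x = iter (l %% N) Fr x.
  rewrite {1}(divn_eq l N) addnC iterD; congr (iter _ _ _).
  elim: (l %/ N)%N => [|n IH] //.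
  by rewrite mulSn iterD IH hN.
by move=> e; rewrite red e -red.
Qed.

Lemma iter_period_mul N d x : iter N Fr x = x -> iter (N * d) Fr x = x.
Proof.
move=> h; rewrite -[RHS]/(iter 0 Fr x); apply: (iter_period h).
by rewrite modnMr mod0n.
Qed.

(** Modulo the maximal ideal $g$ acts at each level $N$ as the power $q^{e(N)}$, and the exponents
    are compatible: they form a profinite integer $e$. The map $h=\mathrm{Fr}^e$ makes sense because
    every element has a finite period under Frobenius, and $gh^{-1}$ is trivial on residues. *)
Theorem Gal_decomposition g : Gal K g -> exists s h,
  [/\ inertia abs K s, Gal K h, g = s \o h &
      forall N, (0 < N)%N -> exists2 i, (i < N)%N &
        forall x, iter N Fr x = x -> h x = iter i Fr x].
Proof.
move=> hg.
have /choice[e he] N : exists i, (0 < N)%N -> (i < N)%N /\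
    forall x, abs x <= 1 -> abs (x ^+ (q ^ N) - x) < 1 ->
    abs (g x - x ^+ (q ^ i)) < 1.
  have [->|N0] := posnP N; first by exists 0%N.
  by have [i h1 h2] := Gal_residue_action N0 hg; exists i.
have e_mod N d : (0 < N)%N -> (0 < d)%N -> e (N * d)%N = e N %[mod N].
  move=> N0 d0; have [_ h1] := he _ N0.
  have Nd0 : (0 < N * d)%N by rewrite muln_gt0 N0.
  have [_ h2] := he _ Nd0.
  apply: residue_action_unique => // x x1 hx.
  apply: (absB_trans_lt cP) (h1 _ x1 hx); rewrite (absB_sym cP).
  apply: h2 => //; elim: (d) => [|d' IH]; first by rewrite muln0 expr1 subrr (abs0 cP).
  rewrite mulnS expnD exprM; apply: (absB_trans_lt cP) IH.
  by apply: (abs_congX_lt cP) => //; exact: (absX_le1 cP).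
have /choice[m hm] x : exists N, (0 < N)%N /\ iter N Fr x = x.
  by have [N h1 h2] := Fr_period x; exists N.
pose h x := iter (e (m x)) Fr x.
have hE N x : (0 < N)%N -> iter N Fr x = x -> h x = iter (e N) Fr x.
  move=> N0 hN; have [mx0 mxE] := hm x.
  rewrite /h -(iter_period mxE (e_mod _ _ mx0 N0)).
  by rewrite mulnC (iter_period hN (e_mod _ _ N0 mx0)).
have common x y : exists N, [/\ (0 < N)%N, iter N Fr x = x & iter N Fr y = y].
  have [mx0 mxE] := hm x; have [my0 myE] := hm y.
  exists (m x * m y)%N; rewrite muln_gt0 mx0 my0 iter_period_mul //.
  by rewrite mulnC iter_period_mul.
have hG : Gal K h.
  split.
  - move=> x y; have [N [N0 hx hy]] := common x y.
    rewrite (hE N x) // (hE N y) // (hE N (x + y)) //.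
      by have [f ->] := Gal_rmorphism (Frn_Gal (e N)); rewrite rmorphD.
    by move: hx hy; have [f ->] := Gal_rmorphism (Frn_Gal N); rewrite rmorphD => -> ->.
  - move=> x y; have [N [N0 hx hy]] := common x y.
    rewrite (hE N x) // (hE N y) // (hE N (x * y)) //.
      by have [f ->] := Gal_rmorphism (Frn_Gal (e N)); rewrite rmorphM.
    by move: hx hy; have [f ->] := Gal_rmorphism (Frn_Gal N); rewrite rmorphM => -> ->.
  - have inj : injective h.
      move=> x y; have [N [N0 hx hy]] := common x y.
      by rewrite (hE N x) // (hE N y) // => /(Gal_inj (Frn_Gal _)).
    pose h' y := iter (m y - e (m y)) Fr y.
    have K' : cancel h' h.
      move=> y; have [my0 myE] := hm y; have [le _] := he _ my0.
      rewrite (hE (m y)) //; last by rewrite /h' -iterD addnC iterD myE.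
      by rewrite /h' -iterD subnKC // ltnW.
    by exists h' => // x; apply: inj; exact: K'.
  - by move=> x hx; rewrite /h (Gal_fix (Frn_Gal _)).
have gh x : abs x <= 1 -> abs (g x - h x) < 1.
  move=> x1; have [mx0 mxE] := hm x; have [_ h1] := he _ mx0.
  apply: (absB_trans_lt cP (h1 _ x1 _)).
    by rewrite (absB_sym cP) -{1}mxE Frn_cong.
  by rewrite (absB_sym cP) /h Frn_cong.
exists (g \o ginv h), h; split => //.
- split; first by apply: Gal_comp => //; exact: Gal_ginv.
  move=> x x1; rewrite -{2}(ginvKV hG x); apply: gh.
  by rewrite (abs_GalF cP _ QK (Gal_ginv hG)).
- by rewrite -compA (ginv_comp hG).
- by move=> N N0; have [h1 _] := he _ N0; exists (e N) => // x /(hE _ _ N0).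
Qed.

Lemma fixed_inertia_Fr x : (forall s, inertia abs K s -> s x = x) -> Fr x = x ->
  K x.
Proof.
move=> hI hF; apply: (Gal_fixed cP p_prime) => // g hg.
have [s [h [hs _ -> hh]]] := Gal_decomposition hg.
have [i _ hi] := hh 1%N isT.
rewrite /= (hi x) //; have -> : iter i Fr x = x by elim: i {hi} => //= i ->.
exact: hI.
Qed.

End FrobeniusAndInertia.

(** * The action on the character lattice *)

Section SignedPermutations.
Variable n : nat.
Implicit Types (e : bool) (w : 'S_n).

(** Frobenius permutes the standard basis of the characters and inertia acts by $1$ or by minus the
    reversal, so that all [rho s] have this form and the action on points can be computed by
    coordinates. *)
Definition signed_perm_mx e w : 'M[int]_n :=
  \matrix_(i, j) ((-1) ^+ e * (i == w j)%:R).

(** The order of the permutations is reversed since [permM] composes from left to right. *)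
Lemma signed_perm_mul e w e' w' :
  signed_perm_mx e w *m signed_perm_mx e' w' = signed_perm_mx (e (+) e') (w' * w)%g.
Proof.
apply/matrixP => i j; rewrite !mxE (bigD1 (w' j)) //= !mxE eqxx permM mulr1.
rewrite big1 => [|l /negPf ne]; last by rewrite !mxE ne !mulr0.
by rewrite addr0 mulrAC signr_addb.
Qed.

Lemma signed_perm_1 : signed_perm_mx false 1%g = 1%:M.
Proof. by apply/matrixP => i j; rewrite !mxE mul1r perm1. Qed.

Lemma signed_perm_inv e w : invmx (signed_perm_mx e w) = signed_perm_mx e w^-1%g.
Proof.
have h : signed_perm_mx e w *m signed_perm_mx e w^-1%g = 1%:M.
  by rewrite signed_perm_mul addbb mulVg signed_perm_1.
have [u _] := mulmx1_unit h.
by rewrite -[RHS]mul1mx -(mulVmx u) -mulmxA h mulmx1.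
Qed.

Lemma signed_perm_delta e w i :
  signed_perm_mx e w *m delta_mx i 0 = (-1) ^+ e *: delta_mx (w i) 0 :> 'cV_n.
Proof.
apply/matrixP => a b; rewrite ord1 !mxE (bigD1 i) //= !mxE !eqxx mulr1.
rewrite big1 => [|l /negPf ne]; last by rewrite !mxE ne mulr0.
by rewrite addr0 andbT.
Qed.

Lemma signed_perm_neg e w : (0 < n)%N -> signed_perm_mx e w = 1%:M ->
  e = false /\ w = 1%g.
Proof.
move=> n0 h.
have ij (i j : 'I_n) : (-1) ^+ e * (i == w j)%:R = (i == j)%:R :> int.
  by have := congr1 (fun m : 'M_n => m i j) h; rewrite !mxE.
split.
  case: e h ij => // _ /(_ (w (Ordinal n0)) (Ordinal n0)).
  by rewrite eqxx expr1 mulr1; case: eqP.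
apply/permP => j; rewrite perm1; apply/eqP.
have := ij (w j) j; rewrite eqxx mulr1; case: eqP => // _.
by case: (e).
Qed.

End SignedPermutations.

Lemma geometric_bound_eq0 (R : realType) (a C r : R) : 0 <= a -> 0 <= r -> r < 1 ->
  (forall j, a <= C * r ^+ j) -> a = 0.
Proof.
move=> a0 r0 r1 h; apply/eqP; rewrite eq_le a0 andbT leNgt; apply/negP => ap.
have : 1 <= r; last by rewrite leNgt r1.
apply: (@expr_le_bound R 1 r (C / a)) => // j.
by rewrite expr1n mulrAC ler_pdivlMr // mul1r.
Qed.

Section PadicGeneral.
Variables (R : realType) (Omega : closedFieldType) (abs : Omega -> R).
Variables (p : nat) (Qp : set Omega).
Hypothesis cP : padic_closure abs p Qp.
Hypothesis p_prime : prime p.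
Implicit Types (x y z : Omega) (s t g : Omega -> Omega).

(* Artin's theorem for the group of restrictions of [H] to the field generated
   by [b]: a separating element has the same image under [g] as under some
   element of [H]. *)
Lemma artin_agree K (H : set (Omega -> Omega)) (b : seq Omega) g : Qp `<=` K ->
  H `<=` Gal K -> H id -> (forall s t, H s -> H t -> H (s \o t)) ->
  Gal K g -> (forall x, (forall s, H s -> s x = x) -> g x = x) ->
  exists2 s, H s & forall x, x \in b -> g x = s x.
Proof.
move=> QK HK H1 HM hg fixg.
have HQ : H `<=` Gal Qp by move=> s /HK; apply: Gal_sub.
have gQ : Gal Qp g by apply: Gal_sub hg.
have [th [_ th2]] := separating_element cP p_prime b.
have [r ur hr] := @orbit_seq _ _ abs p Qp cP H th HQ.
pose P : {poly Omega} := \prod_(y <- r) ('X - y%:P).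
have fixP s : H s -> map_poly s P = P.
  move=> hs; have inj := Gal_inj (HK _ hs).
  have -> : map_poly s P = \prod_(y <- map s r) ('X - y%:P).
    have [f ->] := Gal_rmorphism (HK _ hs).
    rewrite rmorph_prod big_map; apply: eq_bigr => y _.
    by rewrite rmorphB /= map_polyX map_polyC.
  apply: perm_big; have um : uniq (map s r) by rewrite map_inj_uniq.
  have sub : {subset map s r <= r}.
    move=> _ /mapP[y /hr[t ht ->] ->]; apply/hr; exists (s \o t) => //.
    exact: HM.
  have [_ eqm] := uniq_min_size um sub (eq_leq (esym (size_map _ _))).
  by apply: uniq_perm => // y; rewrite eqm.
have gP : map_poly g P = P.
  have coef i : g P`_i = P`_i.
    apply: fixg => s hs; have := congr1 (fun Q : {poly Omega} => Q`_i) (fixP _ hs).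
    by have [f ->] := Gal_rmorphism (HK _ hs); rewrite coef_map.
  apply/polyP => i; rewrite -[RHS]coef.
  by have [f ->] := Gal_rmorphism hg; rewrite coef_map.
have : root P (g th).
  apply/rootP; rewrite -gP; have : root P th.
    by rewrite root_prod_XsubC; apply/hr; exists id.
  by move/rootP; have [f ->] := Gal_rmorphism hg => h; rewrite horner_map h rmorph0.
rewrite root_prod_XsubC => /hr[s hs e]; exists s => // x hx.
by apply: th2 => //; exact: HQ.
Qed.

Lemma exprz_p_inj (z z' : int) :
  (p%:R : Omega) ^ z = (p%:R : Omega) ^ z' -> z = z'.
Proof.
have p0 := p_neq0 cP p_prime.
have nz (m : nat) : (p%:R : Omega) ^+ m = 1 -> m = 0%N.
  move=> h; have := congr1 abs h; rewrite (absX cP) (abs1 cP) => /eqP.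
  case: (posnP m) => // m0; rewrite lt_eqF //.
  by rewrite exprn_ilt1 ?(abs_ge0 cP) ?(abs_p_lt1 cP) // -lt0n.
move=> h; apply/eqP; rewrite -subr_eq0.
have : (p%:R : Omega) ^ (z - z') = 1.
  by rewrite expfzDr // h -expfzDr // subrr expr0z.
case: (z - z') => m; first by rewrite -exprnP => /nz ->.
by rewrite NegzE -exprnN => /(congr1 (fun x => x^-1)); rewrite invrK invr1 => /nz.
Qed.

End PadicGeneral.

Section InertiaAction.
Variables (R : realType) (Omega : closedFieldType) (abs : Omega -> R).
Variables (p : nat) (Qp K E : set Omega).
Hypothesis cP : padic_closure abs p Qp.
Hypothesis p_prime : prime p.
Variables (n : nat) (h : 'M[Omega]_n).
Hypothesis V_quasi_split : quasi_split_hermitian K E h.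
Implicit Types (s : Omega -> Omega) (m : 'M[int]_n).

(** Diagonal test matrices with one entry $p$: since $p$ is not a root of unity, the entries of an
    integral matrix can be read off as exponents of $p$. *)
Let two_diag (i : 'I_n) : 'rV[Omega]_n := \row_j (if j == i then p%:R else 1).

Let pn0 : p%:R != 0 :> Omega := p_neq0 cP p_prime.

Let two_diag_unit i : diag_mx (two_diag i) \in unitmx.
Proof.
rewrite unitmxE det_diag unitfE prodf_seq_neq0; apply/allP => j _ /=.
by rewrite mxE; case: ifP => _; rewrite ?oner_neq0.
Qed.

Let diag_char_two (i j : 'I_n) :
  diag_char (delta_mx j 0) (diag_mx (two_diag i)) = (p%:R : Omega) ^ (i == j).
Proof.
rewrite /diag_char (bigD1 j) //= big1 ?mulr1 => [|l /negPf ne].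
  by rewrite !mxE !eqxx mulr1n eq_sym; case: eqP => _; rewrite ?exp1rz.
by rewrite !mxE ne expr0z.
Qed.

Lemma acts_on_XS_id s m : Gal K s -> fixes E s -> acts_on_XS E h s m ->
  m = 1%:M.
Proof.
move=> hs hE hm; apply/matrixP => i j; rewrite mxE.
have := hm (delta_mx j 0) _ (diag_mx_is_diag (two_diag i)) (two_diag_unit i).
rewrite /unitary_act asboolT // diag_char_two /diag_char.
have [f ->] := Gal_rmorphism hs.
rewrite (bigD1 i) //= big1 ?mulr1 => [|l /negPf ne].
  rewrite !mxE eqxx mulr1n rmorph_nat fmorphXz rmorph_nat.
  rewrite (bigD1 j) //= big1 => [|l /negPf ne]; last by rewrite !mxE ne mulr0.
  by rewrite !mxE !eqxx mulr1 addr0 => /(exprz_p_inj cP p_prime) ->; case: (i == j).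
by rewrite !mxE eqxx ne mulr1n rmorph1 exp1rz.
Qed.

Lemma hermitian_unit : h \in unitmx.
Proof.
case: V_quasi_split => _ hh _.
pose h' : 'M[Omega]_n := \matrix_(a, j) (if j == rev_ord a then (h j a)^-1 else 0).
have : h *m h' = 1%:M.
  apply/matrixP => i j; rewrite !mxE (bigD1 (rev_ord i)) //= big1 => [|l ne].
    rewrite addr0 mxE rev_ordK eq_sym; case: eqP => [->|_]; last by rewrite mulr0.
    by rewrite divff //; apply/hh.
  suff -> : h i l = 0 by rewrite mul0r.
  by apply/eqP; apply: contraNT ne => /hh ->.
by case/mulmx1_unit.
Qed.

(** Since $h$ is anti-diagonal, $g\mapsto h^{-1}\,{}^tg^{-1}h$ inverts a diagonal matrix and
    reverses the order of its entries. *)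
Lemma acts_on_XS_neg s m : Gal K s -> ~ fixes E s -> acts_on_XS E h s m ->
  m = signed_perm_mx true (perm (@rev_ord_inj n)).
Proof.
move=> hs hE hm; apply/matrixP => i j; rewrite mxE permE expr1.
pose d := two_diag (rev_ord i).
have := hm (delta_mx j 0) _ (diag_mx_is_diag d) (two_diag_unit (rev_ord i)).
rewrite /unitary_act asboolF // diag_char_two.
have dinv : invmx (diag_mx d) = diag_mx (\row_j (d 0 j)^-1).
  have e : diag_mx d *m diag_mx (\row_j (d 0 j)^-1) = 1%:M.
    rewrite mulmx_diag -diag_const_mx; congr diag_mx; apply/rowP => l; rewrite !mxE.
    by rewrite divff //; case: ifP; rewrite ?oner_neq0.
  by rewrite -[RHS]mul1mx -(mulVmx (two_diag_unit (rev_ord i))) -mulmxA e mulmx1.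
have -> : invmx h *m (invmx (diag_mx d))^T *m h
    = diag_mx (\row_j (d 0 (rev_ord j))^-1).
  rewrite dinv tr_diag_mx -mulmxA -[RHS](mulKmx hermitian_unit); congr (_ *m _).
  apply/matrixP => a b; rewrite mul_diag_mx mul_mx_diag !mxE.
  have [e|ne] := eqVneq b (rev_ord a); first by rewrite e rev_ordK mulrC.
  case: V_quasi_split => _ hh _.
  suff -> : h a b = 0 by rewrite mulr0 mul0r.
  by apply/eqP; apply: contraNT ne => /hh ->.
have [f ->] := Gal_rmorphism hs; rewrite /diag_char.
rewrite (bigD1 i) //= big1 ?mulr1 => [|l /negPf ne]; last first.
  by rewrite !mxE eqxx (inj_eq rev_ord_inj) ne mulr1n invr1 rmorph1 exp1rz.
rewrite !mxE !eqxx mulr1n fmorphV rmorph_nat fmorphXz rmorph_nat.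
rewrite (bigD1 j) //= big1 => [|l /negPf ne]; last by rewrite !mxE ne mulr0.
rewrite !mxE !eqxx mulr1 addr0 exprz_inv => /(exprz_p_inj cP p_prime) e.
rewrite -[m i j]opprK e mulN1r; congr (- _).
by rewrite (can2_eq (@rev_ordK n) (@rev_ordK n)); case: (_ == _).
Qed.

End InertiaAction.

(** The hypotheses on the fields, the form, the torus and the Artin map, without the parameter and
    the Néron model, gathered so that each section carries a single one. *)
Record torus_setting (R : realType) (Omega : closedFieldType) (abs : Omega -> R)
  (p : nat) (Qp K E : set Omega) (OK : comNzRingType) (iota : {rmorphism OK -> Omega})
  (k : finFieldType) (res : {rmorphism OK -> k}) (n : nat) (h : 'M[Omega]_n)
  (tt Fr : Omega -> Omega) (omega : 'S_n) (rho : (Omega -> Omega) -> 'M[int]_n)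
  (art : Omega -> Omega -> Omega) : Prop := TorusSetting {
  ts_closure : padic_closure abs p Qp;
  ts_prime : prime p;
  ts_odd : p != 2%N;
  ts_finite : finite_ext Qp K;
  ts_integers : ring_of_integers abs K iota;
  ts_residue : residue_field abs iota res;
  ts_dim : (0 < n)%N;
  ts_form : quasi_split_hermitian K E h;
  ts_tt : inertia abs K tt;
  ts_tt_E : ~ fixes E tt;
  ts_Fr : frobenius abs K Fr;
  ts_Fr_E : fixes E Fr;
  ts_rho : twisted_torus abs K E h Fr omega rho;
  ts_art : artin_map abs (splitting_field rho K) art
}.

(** * The Galois group and the splitting field of the torus *)

Section GaloisStructure.
Variables (R : realType) (Omega : closedFieldType) (abs : Omega -> R).
Variables (p : nat) (Qp K E : set Omega).
Variables (OK : comNzRingType) (iota : {rmorphism OK -> Omega}).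
Variables (k : finFieldType) (res : {rmorphism OK -> k}).
Variables (n : nat) (h : 'M[Omega]_n) (tt Fr : Omega -> Omega) (omega : 'S_n).
Variables (rho : (Omega -> Omega) -> 'M[int]_n) (art : Omega -> Omega -> Omega).
Hypothesis S :
  torus_setting abs p Qp K E iota res h tt Fr omega rho art.
Implicit Types (x y z : Omega) (s t g : Omega -> Omega).

Let cP := ts_closure S.
Let p_prime := ts_prime S.
Let q := #|k|.
Let KF : is_subfield K := base_field (ts_finite S).
Let QK : Qp `<=` K := base_sub (ts_finite S).
Let M := splitting_field rho K.
Let Fr_frob := ts_Fr S.
Let FrG : Gal K Fr := Fr_Gal (ts_Fr S).
Let FrnG i : Gal K (iter i Fr) := Gal_iter i FrG.
Let ttG : Gal K tt. Proof. by case: (ts_tt S). Qed.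
Let J := signed_perm_mx true (perm (@rev_ord_inj n)).
Let gact_action : galois_action rho K. Proof. by case: (ts_rho S). Qed.

Lemma rho_comp s t : Gal K s -> Gal K t -> rho (s \o t) = rho s *m rho t.
Proof. by case: gact_action => _ hM _; exact: hM. Qed.

Lemma rho_unit s : Gal K s -> rho s \in unitmx.
Proof. by case: gact_action => hu _ _; exact: hu. Qed.

Lemma rho_id : rho id = 1%:M.
Proof.
have u := rho_unit (Gal_id K).
have /(congr1 (mulmx (invmx (rho id)))) := rho_comp (Gal_id K) (Gal_id K).
by rewrite mulmxA mulVmx // mul1mx => ->.
Qed.

Lemma rho_ginv s : Gal K s -> rho (ginv s) = invmx (rho s).
Proof.
move=> hs; have hi := Gal_ginv hs; have := rho_comp hi hs.
rewrite (ginv_comp hs) rho_id => e.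
by rewrite -[RHS]mul1mx e -mulmxA mulmxV ?mulmx1 // rho_unit.
Qed.

Lemma rho_FrE : rho Fr = signed_perm_mx false omega.
Proof.
by case: (ts_rho S) => _ _ ->; apply/matrixP => i j; rewrite !mxE mul1r.
Qed.

Lemma rho_Frn i : rho (iter i Fr) = signed_perm_mx false (omega ^+ i)%g.
Proof.
elim: i => [|i IH]; first by rewrite expg0 signed_perm_1; exact: rho_id.
rewrite -[iter i.+1 Fr]/(Fr \o iter i Fr) rho_comp // IH rho_FrE.
by rewrite signed_perm_mul expgSr.
Qed.

Lemma rho_inertia_id s : inertia abs K s -> fixes E s -> rho s = 1%:M.
Proof.
move=> hs hE; apply: (@acts_on_XS_id _ _ abs p Qp K E cP p_prime n h s) => //.
  by case: hs.
by case: (ts_rho S) => _ hI _; exact: hI.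
Qed.

Lemma rho_inertia_neg s : inertia abs K s -> ~ fixes E s -> rho s = J.
Proof.
move=> hs hE; apply: (@acts_on_XS_neg _ _ abs p Qp K E cP p_prime n h (ts_form S) s) => //.
  by case: hs.
by case: (ts_rho S) => _ hI _; exact: hI.
Qed.

Lemma rho_tt : rho tt = J.
Proof. exact: (rho_inertia_neg (ts_tt S) (ts_tt_E S)). Qed.

Lemma J_neq1 : J <> 1%:M.
Proof. by move/(signed_perm_neg (ts_dim S)) => []. Qed.

Lemma JJ : J *m J = 1%:M.
Proof.
rewrite signed_perm_mul /= -signed_perm_1; congr signed_perm_mx.
by apply/permP => i; rewrite permM !permE rev_ordK.
Qed.

Lemma rho_inertia s : inertia abs K s -> rho s = 1%:M \/ rho s = J.
Proof.
move=> hs; have [hE|hE] := pselect (fixes E s); [left|right].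
  exact: rho_inertia_id.
exact: rho_inertia_neg.
Qed.

Lemma inertia_fixes s : inertia abs K s -> rho s = 1%:M -> fixes E s.
Proof.
move=> hs h1; apply: contrapT => hE; apply: J_neq1.
by rewrite -h1 rho_inertia_neg.
Qed.

Lemma splitting_finite : exists L, [/\ finite_ext K L, M `<=` L &
  forall s t, Gal K s -> Gal K t -> (forall x, L x -> s x = t x) -> rho s = rho t].
Proof.
case: gact_action => _ _ [L hL hfix]; exists L; split => //.
  move=> x hx; case: (hL) => _ LF KL _.
  apply: (Gal_fixed cP p_prime) => //; first exact: subset_trans KL.
  move=> s hs; apply: hx; first exact: Gal_sub hs.
  by apply: hfix => //; [exact: Gal_sub hs | case: hs].
move=> s t hs ht e.
have : rho (ginv t \o s) = 1%:M.
  apply: hfix => [|x hx /=]; first by apply: Gal_comp => //; exact: Gal_ginv.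
  by rewrite e // (ginvK ht).
rewrite rho_comp // ?rho_ginv //; last exact: Gal_ginv.
by move/(congr1 (mulmx (rho t))); rewrite mulmxA mulmxV ?rho_unit // mul1mx mulmx1.
Qed.

Lemma Gal_eq_gens : exists b : seq Omega,
  (forall x, M x -> exists2 c : nat -> Omega, forall i, K (c i) &
     x = \sum_(i < size b) c i * b`_i) /\
  (forall s t, Gal K s -> Gal K t -> (forall x, x \in b -> s x = t x) ->
     rho s = rho t).
Proof.
have [L [[_ LF KL [b hb]] ML hL]] := splitting_finite; exists b; split.
  by move=> x /ML; exact: hb.
move=> s t hs ht e; apply: hL => // x hx; have [c hc ->] := hb _ hx.
have sc i : s (c i) = c i by exact: (Gal_fix hs).
have tc i : t (c i) = c i by exact: (Gal_fix ht).
have eb (i : 'I_(size b)) : s b`_i = t b`_i by apply: e; rewrite mem_nth.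
move: sc tc eb; have [f ->] := Gal_rmorphism hs; have [f' ->] := Gal_rmorphism ht.
move=> sc tc eb; rewrite !rmorph_sum; apply: eq_bigr => i _.
by rewrite !rmorphM sc tc eb.
Qed.

Lemma common_period (b : seq Omega) :
  exists2 N, (0 < N)%N & forall x, x \in b -> iter N Fr x = x.
Proof.
elim: b => [|x b [N N0 IH]]; first by exists 1%N.
have [m m0 hm] := Fr_period cP (ts_finite S) Fr_frob x.
exists (m * N)%N; first by rewrite muln_gt0 m0.
move=> y; rewrite inE => /orP[/eqP->|/IH hy]; first exact: iter_period_mul.
by rewrite mulnC; exact: iter_period_mul.
Qed.

Let decomp g (hg : Gal K g) := Gal_decomposition cP p_prime (ts_finite S)
  (ts_integers S) (ts_residue S) Fr_frob hg.

(** By [Gal_decomposition], up to inertia $g$ is a limit of powers of Frobenius, and [rho] is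
    determined by the action on finitely many elements, where the limit agrees with one of the
    powers. *)
Lemma rho_decomposition g : Gal K g -> exists s i,
  inertia abs K s /\ rho g = rho s *m rho (iter i Fr).
Proof.
move=> hg; have [s [t [hs ht -> H]]] := decomp hg.
have [b [_ hb]] := Gal_eq_gens; have [N N0 hN] := common_period b.
have [i _ hi] := H _ N0; exists s, i; split => //.
rewrite rho_comp //; last by case: hs.
by congr (_ *m _); apply: hb => // x hx; apply: hi; exact: hN.
Qed.

Lemma rho_signed_perm g : Gal K g -> exists e w, rho g = signed_perm_mx e w.
Proof.
move=> /rho_decomposition[s [i [hs ->]]]; rewrite rho_Frn.
case: (rho_inertia hs) => ->.
  by exists false, (omega ^+ i)%g; rewrite mul1mx.
by rewrite signed_perm_mul; do 2!eexists.
Qed.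

(* The subgroup of [Gal K] generated by inertia and the kernel of [rho]; its
   fixed field turns out to be the maximal unramified subextension of [M]. *)
Definition Gal_ram : set (Omega -> Omega) :=
  [set s | Gal K s /\ (rho s = 1%:M \/ rho s = J)].

Definition Mur : set Omega := [set x | forall s, Gal_ram s -> s x = x].

Lemma Gal_ram_comp s t : Gal_ram s -> Gal_ram t -> Gal_ram (s \o t).
Proof.
move=> [hs h1] [ht h2]; split; first exact: Gal_comp.
rewrite rho_comp //; case: h1 => ->; case: h2 => ->;
  rewrite ?mul1mx ?mulmx1 ?JJ; by [left|right].
Qed.

Lemma Gal_ram_inertia s : inertia abs K s -> Gal_ram s.
Proof. by move=> hs; split; [case: hs | exact: rho_inertia]. Qed.

Lemma M_subfield : is_subfield M.
Proof.
have := @fixed_subfield _ K [set s | Gal K s /\ rho s = 1%:M].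
have -> : [set x | forall s, [set s | Gal K s /\ rho s = 1%:M] s -> s x = x] = M.
  apply/seteqP; split => x hx s.
    by move=> hs h1; apply: hx; split.
  by case; exact: hx.
by apply=> s [].
Qed.

Lemma Mur_subfield : is_subfield Mur.
Proof. by apply: (@fixed_subfield _ K) => s []. Qed.

Lemma K_M : K `<=` M.
Proof. by move=> x hx s hs _; exact: (Gal_fix hs). Qed.

Lemma K_Mur : K `<=` Mur.
Proof. by move=> x hx s [hs _]; exact: (Gal_fix hs). Qed.

Lemma Mur_M : Mur `<=` M.
Proof. by move=> x hx s hs h1; apply: hx; split => //; left. Qed.

Let QM : Qp `<=` M := subset_trans QK K_M.
Let QMur : Qp `<=` Mur := subset_trans QK K_Mur.

(** An element with [rho s = J] differs from [tt] by the kernel of [rho], which fixes $M$; so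
    invariance under inertia suffices. *)
Lemma MurP x : Mur x <-> M x /\ forall s, inertia abs K s -> s x = x.
Proof.
split.
  by move=> hx; split; [exact: Mur_M | move=> s hs; apply: hx; exact: Gal_ram_inertia].
move=> [hM hI] s [hs [h1|h1]]; first exact: hM.
have : (ginv tt \o s) x = x.
  apply: hM; first by apply: Gal_comp => //; exact: Gal_ginv.
  rewrite rho_comp //; last exact: Gal_ginv.
  by rewrite rho_ginv // h1 -rho_tt mulVmx // rho_unit.
by move/(congr1 tt); rewrite /= (ginvKV ttG) (hI _ (ts_tt S)).
Qed.

Lemma conj_Gal s t : Gal K s -> Gal K t -> Gal K (ginv s \o t \o s).
Proof. by move=> hs ht; do !apply: Gal_comp => //; exact: Gal_ginv. Qed.

Lemma M_stable s x : Gal K s -> M x -> M (s x).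
Proof.
move=> hs hx t ht h1; have hg := conj_Gal hs ht.
have : (ginv s \o t \o s) x = x.
  apply: (hx _ hg).
  rewrite (rho_comp (Gal_comp (Gal_ginv hs) ht) hs) (rho_comp (Gal_ginv hs) ht).
  by rewrite h1 mulmx1 rho_ginv // mulVmx // rho_unit.
by move/(congr1 s); rewrite /= (ginvKV hs).
Qed.

Lemma Gal_M_rho s : Gal K s -> rho s = 1%:M -> Gal M s.
Proof. by move=> hs h1; case: (hs) => a b c d; split => // x hx; exact: hx. Qed.

(** $M$ is defined as a fixed field. By Artin's theorem an automorphism over $M$ agrees, on a finite
    family that determines [rho], with an element of the kernel of [rho]. *)
Lemma Gal_M s : Gal M s <-> Gal K s /\ rho s = 1%:M.
Proof.
split; last by case; exact: Gal_M_rho.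
move=> hs; have hK : Gal K s by apply: Gal_sub hs; exact: K_M.
split => //; have [b [_ hb]] := Gal_eq_gens.
have [|||||t [ht h1] e] := @artin_agree _ _ abs p Qp cP p_prime K
    [set s | Gal K s /\ rho s = 1%:M] b s QK.
- by move=> t [].
- by split; [exact: Gal_id | exact: rho_id].
- move=> t t' [h1 h2] [h3 h4]; split; first exact: Gal_comp.
  by rewrite rho_comp // h2 h4 mulmx1.
- exact: hK.
- by move=> x hx; apply: (Gal_fix hs) => t ht h1; apply: hx; split.
by rewrite (hb s t).
Qed.

Lemma Gal_Mur s : Gal Mur s <-> Gal_ram s.
Proof.
split; last first.
  by move=> [hs h1]; case: (hs) => a b c d; split => // x hx; apply: hx; split.
move=> hs; have hK : Gal K s by apply: Gal_sub hs; exact: K_Mur.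
split => //; have [b [_ hb]] := Gal_eq_gens.
have [|||||t [ht h1] e] := @artin_agree _ _ abs p Qp cP p_prime K Gal_ram b s QK.
- by move=> t [].
- by split; [exact: Gal_id | left; exact: rho_id].
- exact: Gal_ram_comp.
- exact: hK.
- by move=> x hx; exact: (Gal_fix hs).
by rewrite (hb s t).
Qed.

Lemma tt_Gal_Mur : Gal Mur tt.
Proof. by apply/Gal_Mur/Gal_ram_inertia; exact: ts_tt S. Qed.

Lemma Mur_Gal_stable s x : Gal K s -> Mur x -> Mur (s x).
Proof.
move=> hs /MurP[hM hI]; apply/MurP; split; first exact: M_stable.
move=> t ht; have hg : inertia abs K (ginv s \o t \o s).
  case: ht => htG ht; split; first exact: conj_Gal.
  move=> y y1 /=; rewrite -{2}(ginvK hs y) (abs_GalB cP _ _ QK (Gal_ginv hs)).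
  by apply: ht; rewrite (abs_GalF cP _ QK hs).
by have := hI _ hg; move/(congr1 s); rewrite /= (ginvKV hs).
Qed.

Lemma M_determined : finitely_determined Qp M.
Proof.
have [L [hL ML _]] := splitting_finite.
apply: (determined_sub ML); apply: (finite_ext_determined hL).
exact: (finite_ext_determined (ts_finite S) (Qp_determined Qp)).
Qed.

Lemma K_uniformizer : exists w, uniformizer abs K w.
Proof.
apply: (uniformizer_exists cP p_prime) => //.
exact: (finite_ext_determined (ts_finite S) (Qp_determined Qp)).
Qed.

Lemma M_uniformizer : exists w, uniformizer abs M w.
Proof.
apply: (uniformizer_exists cP p_prime) => //; first exact: M_subfield.
exact: M_determined.
Qed.

Lemma abs2 : abs (2%:R : Omega) = 1.
Proof. exact: (abs_two_unit cP p_prime (ts_odd S)). Qed.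

Lemma two_neq0 : 2%:R != 0 :> Omega.
Proof. exact: (natr_Omega_neq0 cP p_prime). Qed.

Lemma tt_involutive x : M x -> tt (tt x) = x.
Proof.
move=> hx; apply: (hx (tt \o tt)); first exact: Gal_comp.
by rewrite rho_comp // rho_tt JJ.
Qed.

Lemma Mur_tt x : M x -> tt x = x -> Mur x.
Proof.
move=> hM e; apply/MurP; split => // s hs.
have hsG : Gal K s by case: hs.
case: (rho_inertia hs) => h1; first exact: hM.
have : (ginv tt \o s) x = x.
  apply: hM; first by apply: Gal_comp => //; exact: Gal_ginv.
  rewrite rho_comp //; last exact: Gal_ginv.
  by rewrite rho_ginv // h1 -rho_tt mulVmx // rho_unit.
by move/(congr1 tt); rewrite /= (ginvKV ttG) e.
Qed.

(** $M$ has the residue field of its subfield [Mur]: [tt] lies in inertia and preserves residue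
    classes, and $2$ is a unit, so the mean of $x$ and [tt x] is congruent to $x$. *)
Lemma M_residue_Mur x : M x -> abs x <= 1 ->
  exists2 y, Mur y /\ abs y <= 1 & abs (x - y) < 1.
Proof.
move=> hx x1; pose y := (x + tt x) / 2%:R.
have xt : abs (tt x - x) < 1 by case: (ts_tt S) => _; apply.
have hy : abs (x - y) < 1.
  have -> : x - y = - ((tt x - x) / 2%:R) by rewrite /y; field; exact: two_neq0.
  by rewrite (absN cP) (absM cP) (absV cP) abs2 invr1 mulr1.
exists y => //; split; last exact: (abs_le1_close cP hy).
apply: Mur_tt.
  rewrite /y; apply: (is_subfieldM M_subfield).
    by apply: (is_subfieldD M_subfield) => //; exact: M_stable.
  by apply: (is_subfieldV M_subfield); apply: is_subfield_nat; exact: M_subfield.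
have := tt_involutive hx; rewrite /y; have [f ->] := Gal_rmorphism ttG => e.
by rewrite fmorph_div rmorphD rmorph_nat e addrC.
Qed.

Let res_card := residue_card_base (ts_integers S) (ts_residue S).
Let q_gt1 := card_k_gt1 k.

(** The Artin symbol of a uniformizer of $M$ is a Frobenius element and brings with it the
    cardinality $Q$ of the residue field. On a root of unity of order $q^N-1$ it acts both as the
    power $Q$ and as some power $q^i$, whence $Q=q^i$. *)
Lemma M_frobenius : exists d g0, [/\ (0 < d)%N, residue_card abs M (q ^ d),
  Gal M g0 & forall x, abs x <= 1 -> abs (g0 x - x ^+ (q ^ d)) < 1].
Proof.
have [w hw] := M_uniformizer.
have [hG [Q hQ hf]] := art_uniformizer (ts_art S) hw.
have hGK : Gal K (art w) by case/Gal_M: hG.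
(* Large enough for both $Q$ and $q^i$ to be smaller than the order $q^N-1$ of the root of unity, so
   that congruent exponents are equal. *)
pose N := Q.+2.
have N0 : (0 < N)%N by [].
have [z hz] := level_exists cP (ts_residue S) N0.
have [i hi gz] := Gal_zeta cP p_prime (ts_finite S) (ts_integers S) (ts_residue S) Fr_frob N0 hz hGK.
have m1 := abs_card_pred cP (ts_residue S) N0.
have zm := prim_expr_order hz.
have z1 : abs z <= 1.
  suff : abs z == 1 by move/eqP->.
  rewrite -(@eqrXn2 _ (q ^ N).-1) ?ler01 ?(abs_ge0 cP) ?(level_gt0 hz) //.
  by rewrite -(absX cP) zm (abs1 cP) expr1n.
have e : z ^+ Q = z ^+ (q ^ i).
  apply: (unity_root_cong cP p_prime (level_gt0 hz) m1).
  - by rewrite exprAC zm expr1n.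
  - by rewrite exprAC zm expr1n.
  - by rewrite -gz (absB_sym cP); exact: hf.
have big : (N < q ^ N)%N by exact: ltn_expl.
have QE : Q = (q ^ i)%N.
  move/eqP: e; rewrite (eq_prim_root_expr hz).
  have hiN : (q ^ i <= q ^ N.-1)%N by rewrite leq_exp2l // -ltnS.
  have e1 : (q ^ N = q * q ^ N.-1)%N by rewrite -expnS.
  have b2 : (2 <= q ^ N.-1)%N.
    by apply: (@leq_trans (q ^ 1)); [rewrite expn1 | rewrite leq_exp2l].
  have l1 : (Q < (q ^ N).-1)%N by rewrite -ltnS prednK ?expn_gt0 ?(ltnW q_gt1) //; apply: leq_trans big; rewrite /N.
  have l2 : (q ^ i < (q ^ N).-1)%N by nia.
  by rewrite !modn_small // => /eqP.
exists i, (art w); rewrite -QE; split => //.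
rewrite lt0n; apply/eqP => i0; move: QE; rewrite i0 expn0 => Q1.
move: hQ => [r [sr _ _ r3]]; rewrite Q1 in r3.
have [j0 hj0 h0] := r3 0 (is_subfield0 M_subfield) (eq_ind_r (fun v => v <= 1) ler01 (abs0 cP)).
have [j1 hj1 h1] := r3 1 (is_subfield1 M_subfield) (eq_ind_r (fun v => v <= 1) (lexx _) (abs1 cP)).
move: h0 h1; move: hj0 hj1; rewrite !ltnS !leqn0 => /eqP -> /eqP -> h0 h1.
have : abs (0 - 1) < 1 by apply: (absB_trans_lt cP h0); rewrite (absB_sym cP).
by rewrite sub0r (absN cP) (abs1 cP) ltxx.
Qed.

End GaloisStructure.

(** * The maximal unramified subextension *)

Section UnramifiedPart.
Variables (R : realType) (Omega : closedFieldType) (abs : Omega -> R).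
Variables (p : nat) (Qp K E : set Omega).
Variables (OK : comNzRingType) (iota : {rmorphism OK -> Omega}).
Variables (k : finFieldType) (res : {rmorphism OK -> k}).
Variables (n : nat) (h : 'M[Omega]_n) (tt Fr : Omega -> Omega) (omega : 'S_n).
Variables (rho : (Omega -> Omega) -> 'M[int]_n) (art : Omega -> Omega -> Omega).
Hypothesis S :
  torus_setting abs p Qp K E iota res h tt Fr omega rho art.
Implicit Types (x y z : Omega) (s t g : Omega -> Omega).

Let cP := ts_closure S.
Let p_prime := ts_prime S.
Let q := #|k|.
Let KF : is_subfield K := base_field (ts_finite S).
Let QK : Qp `<=` K := base_sub (ts_finite S).
Let M := splitting_field rho K.
Let Fr_frob := ts_Fr S.
Let FrG : Gal K Fr := Fr_Gal (ts_Fr S).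
Let FrnG i : Gal K (iter i Fr) := Gal_iter i FrG.
Let ttG : Gal K tt. Proof. by case: (ts_tt S). Qed.
Let q_gt1 : (1 < q)%N := card_k_gt1 k.
Let Mur := Mur K rho.
Let QMur : Qp `<=` Mur := subset_trans QK (@K_Mur _ K _ rho).
Let QM : Qp `<=` M := subset_trans QK (@K_M _ K _ rho).
Let MurF : is_subfield Mur := @Mur_subfield _ K _ rho.
Let MF : is_subfield M := @M_subfield _ K _ rho.

Let Frn_cong' := Frn_cong cP (ts_finite S) (ts_integers S) (ts_residue S) Fr_frob.
Let q_inj := cong_q_inj cP (ts_finite S) (ts_integers S) (ts_residue S) Fr_frob.

(** Positive and negative powers of Frobenius are covered by one congruence, with a power of $q$ on
    each side, and in this form composition and inversion are immediate. *)
Lemma weilP s : weil abs K s <-> Gal K s /\ exists i j, forall x, abs x <= 1 ->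
  abs ((s x) ^+ (q ^ i) - x ^+ (q ^ j)) < 1.
Proof.
have rc := residue_card_base (ts_integers S) (ts_residue S).
split.
  move=> [hs [q' [m [hq' hm]]]]; split => //.
  rewrite -(residue_card_unique cP rc hq') in hm.
  case: hm => hm; [exists 0%N, m | exists m, 0%N] => x x1.
    by rewrite expn0 expr1; exact: hm.
  by rewrite expn0 expr1; exact: hm.
move=> [hs [i [j hij]]]; split => //; exists q.
have sx1 x : abs x <= 1 -> abs (s x) <= 1 by rewrite (abs_GalF cP _ QK hs).
have [le|le] := leqP i j.
  exists (j - i)%N; split => //; left => x x1; apply: (q_inj (i := i)).
  - exact: sx1.
  - exact: (absX_le1 cP).
  - by rewrite -exprM -expnD subnK //; exact: hij.
exists (i - j)%N; split => //; right => x x1; apply: (q_inj (i := j)) => //.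
- by apply: (absX_le1 cP); exact: sx1.
- by rewrite -exprM -expnD subnK 1?ltnW //; exact: hij.
Qed.

Lemma weil_comp s t : weil abs K s -> weil abs K t -> weil abs K (s \o t).
Proof.
move=> /weilP[hs [i [j hij]]] /weilP[ht [i' [j' hij']]]; apply/weilP.
split; first exact: Gal_comp.
exists (i + i')%N, (j' + j)%N => x x1 /=.
have tx1 : abs (t x) <= 1 by rewrite (abs_GalF cP _ QK ht).
have stx1 : abs (s (t x)) <= 1 by rewrite (abs_GalF cP _ QK hs).
have -> : s (t x) ^+ (q ^ (i + i')) = (s (t x) ^+ (q ^ i)) ^+ (q ^ i').
  by rewrite expnD exprM.
have -> : x ^+ (q ^ (j' + j)) = (x ^+ (q ^ j')) ^+ (q ^ j) by rewrite expnD exprM.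
apply: (@absB_trans_lt _ _ abs p Qp cP _ ((t x ^+ (q ^ j)) ^+ (q ^ i'))).
  apply: (abs_congX_lt cP); last exact: hij.
  exact: (absX_le1 cP).
have -> : (t x ^+ (q ^ j)) ^+ (q ^ i') = (t x ^+ (q ^ i')) ^+ (q ^ j) by rewrite exprAC.
apply: (abs_congX_lt cP); last exact: hij'.
exact: (absX_le1 cP).
Qed.

Lemma weil_ginv s : weil abs K s -> weil abs K (ginv s).
Proof.
move=> /weilP[hs [i [j hij]]]; apply/weilP; split; first exact: Gal_ginv.
exists j, i => x x1; rewrite (absB_sym cP) -{1}(ginvKV hs x); apply: hij.
by rewrite (abs_GalF cP _ QK (Gal_ginv hs)).
Qed.

Lemma inertia_weil s : inertia abs K s -> weil abs K s.
Proof.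
move=> [hs hI]; apply/weilP; split => //; exists 0%N, 0%N => x x1.
by rewrite !expr1; exact: hI.
Qed.

Lemma weil_id : weil abs K id.
Proof.
apply: inertia_weil; split; first exact: Gal_id.
by move=> x _; rewrite subrr (abs0 cP) ltr01.
Qed.

Lemma Frn_weil i : weil abs K (iter i Fr).
Proof.
apply/weilP; split => //; exists 0%N, i => x x1; rewrite expr1.
exact: Frn_cong'.
Qed.

Lemma inertia_comp s t : inertia abs K s -> inertia abs K t ->
  inertia abs K (s \o t).
Proof.
move=> [hs h1] [ht h2]; split; first exact: Gal_comp.
move=> x x1 /=; apply: (@absB_trans_lt _ _ abs p Qp cP _ (t x)); last exact: h2.
by apply: h1; rewrite (abs_GalF cP _ QK ht).
Qed.

Lemma inertia_ginv s : inertia abs K s -> inertia abs K (ginv s).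
Proof.
move=> [hs h1]; split; first exact: Gal_ginv.
move=> x x1; rewrite (absB_sym cP) -{1}(ginvKV hs x); apply: h1.
by rewrite (abs_GalF cP _ QK (Gal_ginv hs)).
Qed.

Lemma weil_inertia_Fr s : weil abs K s -> exists i,
  inertia abs K (s \o ginv (iter i Fr)) \/ inertia abs K (s \o iter i Fr).
Proof.
have rc := residue_card_base (ts_integers S) (ts_residue S).
move=> [hs [q' [m [hq' hm]]]]; exists m.
rewrite -(residue_card_unique cP rc hq') in hm.
case: hm => hm; [left|right].
  split; first by apply: Gal_comp => //; exact: Gal_ginv.
  move=> x x1 /=; rewrite -{2}(ginvKV (FrnG m) x).
  have gx1 : abs (ginv (iter m Fr) x) <= 1 by rewrite (abs_GalF cP _ QK (Gal_ginv (FrnG m))).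
  apply: (absB_trans_lt cP (hm _ gx1)); rewrite (absB_sym cP); exact: Frn_cong'.
split; first exact: Gal_comp.
move=> x x1; apply: (q_inj (i := m)) => //.
  by rewrite /= !(abs_GalF cP _ QK) //.
apply: (@absB_trans_lt _ _ abs p Qp cP _ (iter m Fr x)).
  by apply: hm; rewrite (abs_GalF cP _ QK (FrnG m)).
exact: Frn_cong'.
Qed.

Variables (d : nat) (g0 : Omega -> Omega).
Hypothesis d_gt0 : (0 < d)%N.
Hypothesis M_card : residue_card abs M (q ^ d).
Hypothesis g0_Gal : Gal M g0.
Hypothesis g0_cong : forall x, abs x <= 1 -> abs (g0 x - x ^+ (q ^ d)) < 1.

Lemma M_residue_fixed x : M x -> abs x <= 1 -> abs (x ^+ (q ^ d) - x) < 1.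
Proof.
by move=> hx x1; rewrite (absB_sym cP) -{1}(Gal_fix g0_Gal hx); exact: g0_cong.
Qed.

(** $\mathrm{Fr}^d$ and [g0] act alike on residues, so they differ by inertia, which is trivial on
    [Mur], while [g0] fixes $M$. *)
Lemma Frd_Mur x : Mur x -> iter d Fr x = x.
Proof.
have g0K : Gal K g0 by case/(Gal_M S): g0_Gal.
move=> hx; have hI : inertia abs K (iter d Fr \o ginv g0).
  split; first by apply: Gal_comp => //; exact: Gal_ginv.
  move=> y y1 /=; have gy1 : abs (ginv g0 y) <= 1 by rewrite (abs_GalF cP _ QK (Gal_ginv g0K)).
  apply: (absB_trans_lt cP (Frn_cong' d gy1)).
  by rewrite -{2}(ginvKV g0K y) (absB_sym cP); exact: g0_cong.
have [hM hi] := (MurP S x).1 hx; have := hi _ hI => /=.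
by rewrite -{1}(Gal_fix g0_Gal hM) (ginvK g0K).
Qed.

(** The $q^d$ residue classes of $M$ are represented in [Mur], and a polynomial of degree less than
    $q^d$ with unit leading coefficient is small on fewer classes than that. *)
Lemma Mur_poly (P : {poly Omega}) : abs (lead_coef P) = 1 ->
  (forall i, abs P`_i <= 1) -> (size P <= q ^ d)%N ->
  exists y, [/\ Mur y, abs y <= 1 & 1 <= abs P.[y]].
Proof.
move=> lP cPle sP; have [r [sr r1 r2 r3]] := M_card.
have [i hi P1] : exists2 i, (i < size r)%N & 1 <= abs P.[r`_i].
  by apply: (few_residue_roots cP) => //; rewrite ?sr // /incongruent sr.
rewrite sr in hi; have [hM r_le] := r1 _ hi.
have [y [hy y1] ry] := M_residue_Mur S hM r_le.
exists y; split => //; rewrite leNgt; apply/negP => h1.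
move: P1; rewrite leNgt => /negP; apply.
rewrite -[P.[_]](subrK P.[y]); apply: (absD_lt cP) => //.
rewrite !horner_coef -sumrB; apply: (abs_sum_lt cP) => // j _.
by rewrite -mulrBr; apply: (absM_lt1 cP) => //; exact: (abs_congX_lt cP).
Qed.

(** Modulo the maximal ideal, the operator $\sum_i e_i\,\mathrm{Fr}^i$ is given by this polynomial,
    whose degree is at most $q^{m-1}$. *)
Definition frob_poly (e : nat -> Omega) m : {poly Omega} :=
  \sum_(i < m) e i *: 'X^(q ^ i).

Lemma coef_frob_poly e m j : (frob_poly e m)`_j = \sum_(i < m) e i * (j == q ^ i)%N%:R.
Proof. by rewrite coef_sum; apply: eq_bigr => i _; rewrite coefZ coefXn. Qed.

Lemma horner_frob_poly e m x : (frob_poly e m).[x] = \sum_(i < m) e i * x ^+ (q ^ i).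
Proof. by rewrite horner_sum; apply: eq_bigr => i _; rewrite hornerZ hornerXn. Qed.

Lemma size_frob_poly e m : (size (frob_poly e m) <= q ^ m)%N.
Proof.
apply/leq_sizeP => j hj; rewrite coef_frob_poly big1 // => i _.
suff /negPf-> : (j != q ^ i)%N by rewrite mulr0.
by rewrite gtn_eqF // (leq_trans _ hj) // ltn_exp2l.
Qed.

Lemma lead_frob_poly e m : (0 < m)%N -> e m.-1 != 0 ->
  lead_coef (frob_poly e m) = e m.-1.
Proof.
case: m => // m _ /= em; rewrite /frob_poly big_ord_recr /=.
have sX : size (e m *: 'X^(q ^ m)) = (q ^ m).+1 by rewrite size_scale // size_polyXn.
rewrite lead_coefDr; first by rewrite lead_coefZ lead_coefXn mulr1.
by rewrite sX ltnS; exact: size_frob_poly.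
Qed.

(** Linear independence of the powers of Frobenius on the residue field of [Mur], by comparing a
    degree with its cardinality. *)
Lemma Mur_frob_poly (e : nat -> Omega) : (forall i, abs (e i) = 1) ->
  exists y, [/\ Mur y, abs y <= 1 & abs (\sum_(i < d) e i * iter i Fr y) = 1].
Proof.
move=> he; have e0 i : e i != 0.
  by apply/eqP => h0; move: (he i); rewrite h0 (abs0 cP) => /eqP; rewrite eq_sym oner_eq0.
have [|j||y [hy y1 Py]] := @Mur_poly (frob_poly e d).
- by rewrite lead_frob_poly.
- rewrite coef_frob_poly; apply: (abs_sum_le cP) => // i _.
  by rewrite (absM cP) he mul1r (abs_nat_le1 cP).
- exact: size_frob_poly.
exists y; split => //; apply/eqP; rewrite eq_le; apply/andP; split.
  apply: (abs_sum_le cP) => // i _; rewrite (absM cP) he mul1r.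
  by rewrite (abs_GalF cP _ QK (FrnG i)).
move: Py; rewrite horner_frob_poly !leNgt => /negP nP; apply/negP => lt; apply: nP.
rewrite -[\sum_(i < d) _ * _ ^+ _](subrK (\sum_(i < d) e i * iter i Fr y)).
apply: (absD_lt cP) => //; rewrite -sumrB; apply: (abs_sum_lt cP) => // i _.
rewrite -mulrBr (absM cP) he mul1r (absB_sym cP); exact: Frn_cong'.
Qed.

Lemma Mur_Frn x i : Mur x -> Mur (iter i Fr x).
Proof. by move=> hx; exact: (Mur_Gal_stable S). Qed.

Lemma Mur_fixed_Fr x : Mur x -> Fr x = x -> K x.
Proof.
move=> /(MurP S)[_ hI] hF.
exact: (fixed_inertia_Fr cP p_prime (ts_finite S) (ts_integers S) (ts_residue S) Fr_frob).
Qed.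

Lemma Mur_trace x : Mur x -> K (\sum_(i < d) iter i Fr x).
Proof.
move=> hx; apply: Mur_fixed_Fr.
  by apply: is_subfield_sum => // i _; exact: Mur_Frn.
have -> : Fr (\sum_(i < d) iter i Fr x) = \sum_(i < d) iter i.+1 Fr x.
  have [f fE] := Gal_rmorphism FrG; rewrite {1}fE rmorph_sum.
  by apply: eq_bigr => i _; rewrite iterS -fE.
have := Frd_Mur hx; case: (d) d_gt0 => // m _ /= e.
by rewrite big_ord_recr [RHS]big_ord_recl /= e addrC.
Qed.

(* The Hilbert 90 resolvent [sum Fr^i (r y)] is an element of [K] with the
   absolute value of [y] for a suitable unit [r]. *)
Lemma Mur_values y : Mur y -> exists2 c, K c & abs c = abs y.
Proof.
move=> hy; have [->|y0] := eqVneq y 0; first by exists 0 => //; exact: is_subfield0.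
have [|r [hr r1 hS]] := @Mur_frob_poly (fun i => iter i Fr y / y).
  move=> i; rewrite (absM cP) (absV cP) (abs_GalF cP _ QK (FrnG i)) divff //.
  exact: (abs_neq0 cP).
exists (\sum_(i < d) iter i Fr (r * y)).
  by apply: Mur_trace; exact: (is_subfieldM MurF).
have -> : \sum_(i < d) iter i Fr (r * y) = y * \sum_(i < d) iter i Fr y / y * iter i Fr r.
  rewrite mulr_sumr; apply: eq_bigr => i _.
  have [f ->] := Gal_rmorphism (FrnG i); rewrite rmorphM.
  by field.
by rewrite (absM cP) hS mulr1.
Qed.

(** With all coefficients $1$, [Mur_frob_poly] gives an integral element whose trace is a unit,
    which is then divided by its trace. *)
Lemma trace_one : exists theta, [/\ Mur theta, abs theta <= 1 &
  \sum_(i < d) iter i Fr theta = 1].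
Proof.
have [|r [hr r1 hS]] := @Mur_frob_poly (fun=> 1); first by move=> _; exact: (abs1 cP).
pose T := \sum_(i < d) iter i Fr r.
have TE : abs T = 1 by rewrite -hS; congr abs; apply: eq_bigr => i _; rewrite mul1r.
have T0 : T != 0.
  by apply/eqP => h0; move: TE; rewrite h0 (abs0 cP) => /eqP; rewrite eq_sym oner_eq0.
have KT : K T by exact: Mur_trace.
exists (r / T); split.
- by apply: (is_subfieldM MurF) => //; apply: (is_subfieldV MurF); apply: (@K_Mur _ K _ rho).
- by rewrite (absM cP) (absV cP) TE invr1 mulr1.
have -> : \sum_(i < d) iter i Fr (r / T) = T / T; last by rewrite divff.
rewrite mulr_suml; apply: eq_bigr => i _.
have e : iter i Fr T = T by exact: (Gal_fix (FrnG i)).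
by move: e; have [f ->] := Gal_rmorphism (FrnG i) => e; rewrite fmorph_div e.
Qed.

Lemma finite_ext_Mur : finite_ext K Mur.
Proof.
split => //; first exact: (@K_Mur _ K _ rho).
have [b [hb _]] := Gal_eq_gens S; exists b => x hx; apply: hb.
exact: (@Mur_M _ K _ rho).
Qed.

Lemma finite_ext_Mur_M : finite_ext Mur M.
Proof.
split => //; first exact: (@Mur_M _ K _ rho).
have [b [hb _]] := Gal_eq_gens S; exists b => x /hb[c hc ->].
by exists c => // i; apply: (@K_Mur _ K _ rho).
Qed.

Lemma unramified_Mur : unramified abs K Mur.
Proof. by split; [exact: finite_ext_Mur | exact: Mur_values]. Qed.

Section FixUnramified.
Variable F : set Omega.
Hypotheses (F_unr : unramified abs K F) (FM : F `<=` M).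

Let FF : is_subfield F. Proof. by case: F_unr => -[]. Qed.
Let KsubF : K `<=` F. Proof. by case: F_unr => -[]. Qed.

(** With $v$ the principal root of order $q^d-1$ of $x^{q^d-1}$, the quotient $x/v$ is the
    Teichmüller representative of $x$. Inertia preserves its residue class, hence fixes this root of
    unity. *)
Lemma unramified_teichmuller x : F x -> abs x = 1 ->
  exists z, [/\ F z, abs (x - z) < 1 & forall s, inertia abs K s -> s z = z].
Proof.
move=> hx x1; pose N := (q ^ d).-1.
have x0 : x != 0.
  by apply/eqP => h0; move: x1; rewrite h0 (abs0 cP) => /eqP; rewrite eq_sym oner_eq0.
have N1 : abs (N%:R : Omega) = 1 by exact: (abs_card_pred cP (ts_residue S) d_gt0).
have qd : (1 < q ^ d)%N by apply: leq_trans (ltn_expl d q_gt1).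
have N0 : (0 < N)%N by rewrite /N -subn1 subn_gt0.
have close : abs (x ^+ N - 1) < 1.
  have := M_residue_fixed (FM hx) (eq_ind_r (fun v => v <= 1) (lexx 1) x1).
  have -> : x ^+ (q ^ d) - x = x * (x ^+ N - 1).
    by rewrite mulrBr mulr1 -exprS /N prednK // ltnW.
  by rewrite (absM cP) x1 mul1r.
have [|v vN v1] := @root_near1 _ _ abs p Qp cP (x ^+ N) N N0.
  by rewrite N1 expr1n.
rewrite N1 in v1.
have v0 : v != 0 by exact: (abs_princ_neq0 cP v1).
have hv : F v.
  apply: (Gal_fixed cP p_prime) => //; first exact: subset_trans KsubF.
  move=> s hs; have QF : Qp `<=` F by exact: subset_trans KsubF.
  apply: (@root_near1_unique _ _ abs p Qp cP p_prime _ _ N N0); rewrite ?N1 //.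
    rewrite -(abs_GalB cP _ _ QF hs) in v1.
    by move: v1; have [f ->] := Gal_rmorphism hs; rewrite rmorph1.
  have sx : s x = x by exact: (Gal_fix hs).
  move: sx; have [f ->] := Gal_rmorphism hs => sx.
  by rewrite -rmorphXn vN rmorphXn sx.
have zN : (x / v) ^+ N = 1 by rewrite expr_div_n vN divff // expf_neq0.
exists (x / v); split.
- by apply: (is_subfieldM FF) => //; exact: (is_subfieldV FF).
- have -> : x - x / v = x * (v - 1) / v by field.
  by rewrite !(absM cP) (absV cP) (abs_princ_unit cP v1) x1 invr1 mulr1 mul1r.
- move=> s [hs hI].
  apply: (unity_root_cong cP p_prime N0 N1) => //.
    by move: zN; have [f ->] := Gal_rmorphism hs => zN; rewrite -rmorphXn zN rmorph1.
  apply: hI; rewrite (absM cP) (absV cP) (abs_princ_unit cP v1) x1 invr1 mulr1 //.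
Qed.

(** One Teichmüller digit per step: the remainder is scaled to a unit by an element of $K$,
    available because $F/K$ is unramified, and its digit is subtracted. The new remainder again has
    the absolute value of an element of $K$, so it is smaller by a factor $|w|$ at least. *)
Lemma unramified_approx w y j : uniformizer abs K w -> F y ->
  exists y1, [/\ F y1, abs (y - y1) <= abs y * abs w ^+ j &
                 forall s, inertia abs K s -> s y1 = y1].
Proof.
move=> [hw w0 w1 wmax] hy; elim: j => [|j [y1 [hy1 le fix1]]].
  exists 0; split; first exact: (is_subfield0 FF).
    by rewrite subr0 expr0 mulr1.
  by move=> s [hs _]; have [f ->] := Gal_rmorphism hs; rewrite rmorph0.
have [e|ne] := eqVneq (y - y1) 0.
  by exists y1; split => //; rewrite e (abs0 cP) mulr_ge0 ?exprn_ge0 ?(abs_ge0 cP).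
case: F_unr => _ vals.
have hz : F (y - y1) by exact: (is_subfieldB FF).
have [c hc cE] := vals _ hz.
have c0 : c != 0 by apply/eqP => c0; move: cE; rewrite c0 (abs0 cP) => /esym/eqP; rewrite (negPf (abs_neq0 cP ne)).
have Fc : F c by exact: KsubF.
have u1 : abs ((y - y1) / c) = 1.
  by rewrite (absM cP) (absV cP) -cE divff // (abs_neq0 cP).
have Fu : F ((y - y1) / c) by apply: (is_subfieldM FF) => //; exact: (is_subfieldV FF).
have [z [Fz uz fixz]] := unramified_teichmuller Fu u1.
have Fz' : F (y - y1 - c * z) by apply: (is_subfieldB FF) => //; exact: (is_subfieldM FF).
exists (y1 + c * z); split.
- by apply: (is_subfieldD FF) => //; exact: (is_subfieldM FF).
- have -> : y - (y1 + c * z) = y - y1 - c * z by ring.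
  have [c' hc' c'E] := vals _ Fz'.
  rewrite -c'E; have : abs (c' / c) <= abs w.
    apply: wmax; first by apply: (is_subfieldM KF) => //; exact: (is_subfieldV KF).
    rewrite (absM cP) (absV cP) c'E -(absV cP) -(absM cP).
    by have -> : (y - y1 - c * z) / c = (y - y1) / c - z by field.
  rewrite (absM cP) (absV cP) ler_pdivrMr ?(abs_gt0 cP) // => h1.
  apply: le_trans h1 _; rewrite exprSr mulrA mulrC cE.
  by rewrite ler_wpM2r ?(abs_ge0 cP).
- move=> s hs; have f1 := fix1 _ hs; have fz := fixz _ hs.
  case: hs => hs _; have fc : s c = c by exact: (Gal_fix hs).
  move: f1 fz fc; have [f ->] := Gal_rmorphism hs => f1 fz fc.
  by rewrite rmorphD rmorphM f1 fz fc.
Qed.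

Lemma unramified_sub_Mur : F `<=` Mur.
Proof.
move=> y hy; apply/(MurP S); split; first exact: FM.
move=> s hs; have hsG : Gal K s by case: hs.
have [w hw] := K_uniformizer S.
apply/eqP; rewrite -subr_eq0; apply/eqP/(abs_eq0 cP).
apply: (@geometric_bound_eq0 _ _ (abs y) (abs w)); rewrite ?(abs_ge0 cP) //.
  by case: hw.
move=> j; have [y1 [_ le fix1]] := unramified_approx j hw hy.
apply: (@absB_trans_le _ _ abs p Qp cP _ y1); last by rewrite (absB_sym cP).
by rewrite -(fix1 _ hs) (abs_GalB cP _ _ QK hsG).
Qed.

End FixUnramified.

Theorem max_unramifiedE : max_unramified abs K M = Mur.
Proof.
apply/seteqP; split => x.
  by move=> [F [hF FM hx]]; exact: (unramified_sub_Mur hF FM).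
by move=> hx; exists Mur; split => //; [exact: unramified_Mur | exact: (@Mur_M _ K _ rho)].
Qed.

(** $X^{q^i}-X$ has degree less than $q^d$ and cannot vanish on all residue classes. *)
Lemma Frn_Mur_inj i : (0 < i < d)%N -> exists2 x, Mur x & iter i Fr x <> x.
Proof.
move=> /andP[i0 id]; pose P : {poly Omega} := 'X^(q ^ i) - 'X.
have qi : (1 < q ^ i)%N by apply: leq_trans (ltn_expl i q_gt1).
have sP : size P = (q ^ i).+1 by rewrite size_addl ?size_polyXn // size_opp size_polyX ltnS.
have [|j||y [hy y1 Py]] := @Mur_poly P.
- by rewrite lead_coefDl ?lead_coefXn ?(abs1 cP) // size_opp size_polyX size_polyXn ltnS.
- rewrite coefB coefXn coefX; apply: (absB_le cP); exact: (abs_nat_le1 cP).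
- by rewrite sP ltn_exp2l.
exists y => // e; move: Py; rewrite hornerD hornerN hornerXn hornerX leNgt.
by rewrite -{2}e (absB_sym cP) Frn_cong'.
Qed.

Lemma Gal_on_Mur g : Gal K g -> exists2 i, (i < d)%N &
  forall x, Mur x -> g x = iter i Fr x.
Proof.
move=> hg; have [s [t [hs ht -> H]]] := Gal_decomposition cP p_prime (ts_finite S)
  (ts_integers S) (ts_residue S) Fr_frob hg.
have [i hi hi'] := H _ d_gt0; exists i => // x hx.
rewrite /= (hi' x); last exact: Frd_Mur.
by apply: ((MurP S _).1 _).2 => //; exact: Mur_Frn.
Qed.

Lemma coset_reps_Mur :
  coset_reps (Gal K) (Gal Mur) (fun i : 'I_d => iter i Fr).
Proof.
split => [i|g hg]; first exact: FrnG.
have [i hi gi] := Gal_on_Mur hg; exists (Ordinal hi); split.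
  exists (g \o ginv (iter i Fr)).
    apply/(Gal_Mur S).
    have hG : Gal K (g \o ginv (iter i Fr)) by apply: Gal_comp => //; exact: Gal_ginv.
    suff : Gal Mur (g \o ginv (iter i Fr)) by move/(Gal_Mur S).
    case: (hG) => a b c _; split => // x hx /=.
    rewrite gi ?(ginvKV (FrnG i)) //; apply: (Mur_Gal_stable S) => //.
    exact: Gal_ginv.
  by rewrite -compA (ginv_comp (FrnG i)).
move=> [j hj] [g' hg' gE]; apply/val_inj => /=.
have Fij x : Mur x -> iter i Fr x = iter j Fr x.
  move=> hx; rewrite -gi // gE /=; apply: (Gal_fix hg'); exact: Mur_Frn.
case: (ltngtP i j) => // lt; exfalso.
  have [x hx] : exists2 x, Mur x & iter (j - i) Fr x <> x.
    by apply: Frn_Mur_inj; rewrite subn_gt0 lt /= (leq_ltn_trans (leq_subr _ _)).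
  apply; apply: (Gal_inj (FrnG i)); rewrite -iterD subnKC ?(ltnW lt) //.
  by rewrite Fij.
have [x hx] : exists2 x, Mur x & iter (i - j) Fr x <> x.
  by apply: Frn_Mur_inj; rewrite subn_gt0 lt /= (leq_ltn_trans (leq_subr _ _)).
apply; apply: (Gal_inj (FrnG j)); rewrite -iterD subnKC ?(ltnW lt) //.
by rewrite -Fij.
Qed.

Lemma Mur_card : residue_card abs Mur (q ^ d).
Proof.
have [r [sr r1 r2 r3]] := M_card.
have /choice[l hl] i : exists y, (i < q ^ d)%N -> [/\ Mur y, abs y <= 1 & abs (r`_i - y) < 1].
  have [hi|_] := boolP (i < q ^ d)%N; last by exists 0.
  by have [h1 h2] := r1 _ hi; have [y [h3 h4] h5] := M_residue_Mur S h1 h2; exists y.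
exists (mkseq l (q ^ d)); split.
- by rewrite size_mkseq.
- by move=> i hi; rewrite nth_mkseq //; have [] := hl _ hi.
- move=> i j /andP[ij jq]; have iq := ltn_trans ij jq.
  rewrite !nth_mkseq // => lt; apply: (r2 i j); first by rewrite ij.
  have [_ _ h1] := hl _ iq; have [_ _ h2] := hl _ jq.
  apply: (absB_trans_lt cP h1); apply: (absB_trans_lt cP lt); by rewrite (absB_sym cP).
- move=> x hx x1; have hM : M x by exact: (@Mur_M _ K _ rho).
  have [i hi xi] := r3 _ hM x1.
  exists i => //; rewrite nth_mkseq //; have [_ _ h1] := hl _ hi.
  exact: (absB_trans_lt cP xi).
Qed.

Lemma weil_M_Mur s : weil abs M s -> weil abs Mur s.
Proof.
move=> [hs [Q [m [hQ hm]]]]; split.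
  by apply: Gal_sub hs; exact: (@Mur_M _ K _ rho).
exists (q ^ d)%N, m; split; first exact: Mur_card.
by rewrite (residue_card_unique cP M_card hQ).
Qed.

Lemma weil_M_K s : weil abs M s -> weil abs K s /\ rho s = 1%:M.
Proof.
move=> [hs [Q [m [hQ hm]]]]; have [hK h1] := (Gal_M S s).1 hs; split => //.
apply/weilP; split => //.
rewrite -(residue_card_unique cP M_card hQ) in hm.
case: hm => hm; [exists 0%N, (d * m)%N | exists (d * m)%N, 0%N] => x x1.
  by rewrite expn0 expr1 expnM; exact: hm.
by rewrite expn0 expr1 expnM; exact: hm.
Qed.

Lemma weil_M_conj s : weil abs M s -> weil abs M (tt \o s \o ginv tt).
Proof.
have [_ ttI] := ts_tt S.
have gttG := Gal_ginv ttG.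
move=> [hs [Q [m [hQ hm]]]]; have [hK h1] := (Gal_M S s).1 hs; split.
  apply/(Gal_M S); split; first by do 2!apply: Gal_comp => //.
  rewrite (rho_comp S (Gal_comp ttG hK) gttG) (rho_comp S ttG hK) h1 mulmx1.
  by rewrite (rho_ginv S) // mulmxV // (rho_unit S).
exists Q, m; split => //.
have small x : abs x <= 1 -> abs (ginv tt x) <= 1 by rewrite (abs_GalF cP _ QK gttG).
have ginvI x : abs x <= 1 -> abs (ginv tt x - x) < 1.
  by move=> x1; rewrite (absB_sym cP) -{1}(ginvKV ttG x); apply: ttI; exact: small.
have sx1 x : abs x <= 1 -> abs (s (ginv tt x)) <= 1.
  by move=> x1; rewrite (abs_GalF cP _ QK hK) small.
case: hm => hm; [left|right] => x x1 /=.
  apply: (absB_trans_lt cP (ttI _ (sx1 _ x1))).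
  apply: (absB_trans_lt cP (hm _ (small _ x1))).
  by apply: (abs_congX_lt cP); [exact: small | exact: ginvI].
apply: (@absB_trans_lt _ _ abs p Qp cP _ (s (ginv tt x) ^+ (Q ^ m))).
  apply: (abs_congX_lt cP); last exact/ttI/sx1.
  by rewrite (abs_GalF cP _ QK ttG) sx1.
by apply: (absB_trans_lt cP (hm _ (small _ x1))); exact: ginvI.
Qed.

Lemma coset_reps_weil : coset_reps (weil abs Mur) (weil abs M)
  (fun i : 'I_2 => if i == 0 then id else tt).
Proof.
have [_ ttI] := ts_tt S; have gttG := Gal_ginv ttG.
have small x : abs x <= 1 -> abs (ginv tt x) <= 1 by rewrite (abs_GalF cP _ QK gttG).
have ginvI x : abs x <= 1 -> abs (ginv tt x - x) < 1.
  by move=> x1; rewrite (absB_sym cP) -{1}(ginvKV ttG x); apply: ttI; exact: small.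
split.
  move=> i; case: ifP => _.
    split; first exact: Gal_id.
    exists (q ^ d)%N, 0%N; split; [exact: Mur_card | left => x x1].
    by rewrite expn0 expr1 subrr (abs0 cP).
  split; first exact: (tt_Gal_Mur S).
  exists (q ^ d)%N, 0%N; split; [exact: Mur_card | left => x x1].
  by rewrite expn0 expr1; exact: ttI.
move=> g [hg [Q [m [hQ hm]]]].
have [gK rg] := (Gal_Mur S g).1 hg.
rewrite -(residue_card_unique cP Mur_card hQ) in hm.
have tt0 : ~ (tt = id).
  move=> e; apply: (J_neq1 S); rewrite -(rho_tt S) e; exact: (rho_id S).
case: rg => rg.
  have gM : weil abs M g.
    split; first by apply/(Gal_M S).
    by exists (q ^ d)%N, m.
  exists 0; split; first by exists g.
  move=> i [g' [hg' _] gE]; apply/val_inj; case: i gE => -[|[|//]] hi //= gE.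
  have [g'K g'1] := (Gal_M S g').1 hg'.
  exfalso; apply: (J_neq1 S); rewrite -rg gE (rho_comp S g'K ttG) g'1 mul1mx.
  by rewrite (rho_tt S).
exists 1; split.
  exists (g \o ginv tt); last by rewrite -compA (ginv_comp ttG).
  split.
    apply/(Gal_M S); split; first exact: Gal_comp.
    rewrite (rho_comp S gK gttG) (rho_ginv S ttG) rg -(rho_tt S) mulmxV //.
    exact: (rho_unit S).
  exists (q ^ d)%N, m; split => //.
  case: hm => hm; [left|right] => x x1 /=.
    apply: (absB_trans_lt cP (hm _ (small _ x1))).
    by apply: (abs_congX_lt cP); [exact: small | exact: ginvI].
  by apply: (absB_trans_lt cP (hm _ (small _ x1))); exact: ginvI.
move=> i [g' [hg' _] gE]; apply/val_inj; case: i gE => -[|[|//]] hi //= gE.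
have [g'K g'1] := (Gal_M S g').1 hg'.
by exfalso; apply: (J_neq1 S); rewrite -rg gE; exact: g'1.
Qed.

End UnramifiedPart.

(** * The parameter on tame inertia *)

Section OuterAutomorphism.
Variables (R : realType) (n : nat).
Notation C := R[i].
Implicit Types A B : 'M[C]_n.

Let J : 'M[C]_n := Jmx R n.

Lemma Jmx_tr : J^T = (-1) ^+ n.-1 *: J.
Proof.
apply/matrixP => i j; rewrite !mxE [i == _]eq_sym (can2_eq (@rev_ordK n) (@rev_ordK n)).
case: eqP => [->|_]; last by rewrite mulr0.
have -> : (-1) ^+ n.-1 = (-1) ^+ (i + rev_ord i) :> C.
  by congr (_ ^+ _); have := ltn_ord i => /= hi; lia.
by rewrite exprD mulrAC -exprD addnn -mul2n exprM sqrrN expr1n expr1n mul1r.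
Qed.

Lemma Jmx_mul_tr : J *m J^T = 1%:M.
Proof.
apply/matrixP => i j; rewrite !mxE (bigD1 (rev_ord i)) //= !mxE eqxx big1 => [|l ne].
  rewrite addr0 (inj_eq rev_ord_inj) eq_sym; case: eqP => [->|_]; last by rewrite mulr0.
  by rewrite -exprD addnn -mul2n exprM sqrrN expr1n expr1n.
by rewrite !mxE (negPf ne) mul0r.
Qed.

Lemma Jmx_unit : J \in unitmx.
Proof. by case/mulmx1_unit: Jmx_mul_tr. Qed.

Lemma invmx_unique A B : A *m B = 1%:M -> invmx A = B.
Proof.
move=> h; have [u _] := mulmx1_unit h.
by rewrite -[LHS]mulmx1 -h mulmxA mulVmx // mul1mx.
Qed.

Lemma thetaE A : theta A = J *m (invmx A)^T *m J^T.
Proof. by rewrite /theta -/J (invmx_unique Jmx_mul_tr). Qed.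

Let JtJ : J^T *m J = 1%:M.
Proof. by rewrite -(invmx_unique Jmx_mul_tr) mulVmx // Jmx_unit. Qed.

Lemma invmxM A B : A \in unitmx -> B \in unitmx ->
  invmx (A *m B) = invmx B *m invmx A.
Proof.
move=> uA uB; apply: invmx_unique.
by rewrite mulmxA -(mulmxA A) mulmxV // mulmx1 mulmxV.
Qed.

Lemma thetaM A B : A \in unitmx -> B \in unitmx ->
  theta (A *m B) = theta A *m theta B.
Proof.
move=> uA uB; rewrite !thetaE invmxM // trmx_mul.
move: (invmx A)^T (invmx B)^T => X Y.
by rewrite -!mulmxA (mulmxA J^T) JtJ mul1mx.
Qed.

Lemma theta_unit A : A \in unitmx -> theta A \in unitmx.
Proof.
by move=> uA; rewrite thetaE !unitmx_mul Jmx_unit unitmx_tr unitmx_inv uA unitmx_tr Jmx_unit.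
Qed.

Lemma theta1 : theta (1%:M : 'M[C]_n) = 1%:M.
Proof. by rewrite thetaE invmx1 trmx1 mulmx1 Jmx_mul_tr. Qed.

(** The squares of $J$ and ${}^tJ$ are both the scalar $(-1)^{n-1}$, and the two signs cancel. *)
Lemma thetaK A : A \in unitmx -> theta (theta A) = A.
Proof.
move=> uA; have e : invmx (theta A) = J *m A^T *m J^T.
  apply: invmx_unique; rewrite thetaE !mulmxA -(mulmxA _ J^T J) JtJ mulmx1.
  rewrite -(mulmxA J _ A^T) -trmx_mul mulmxV // trmx1 mulmx1; exact: Jmx_mul_tr.
rewrite thetaE e !trmx_mul !trmxK !mulmxA.
have JJ : J *m J = (-1) ^+ n.-1 *: 1%:M.
  rewrite -Jmx_mul_tr Jmx_tr -scalemxAr scalerA -exprD addnn -mul2n exprM.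
  by rewrite sqrrN expr1n expr1n scale1r.
have JtJt : J^T *m J^T = (-1) ^+ n.-1 *: 1%:M.
  by rewrite -trmx_mul JJ linearZ /= trmx1.
rewrite -mulmxA JtJt JJ -scalemxAl mul1mx -scalemxAr mulmx1 scalerA -exprD addnn.
by rewrite -mul2n exprM sqrrN expr1n expr1n scale1r.
Qed.

Definition theta_if (b : bool) A := if b then theta A else A.

Lemma theta_ifM b A B : A \in unitmx -> B \in unitmx ->
  theta_if b (A *m B) = theta_if b A *m theta_if b B.
Proof. by case: b => //=; exact: thetaM. Qed.

Lemma theta_if_unit b A : A \in unitmx -> theta_if b A \in unitmx.
Proof. by case: b => //=; exact: theta_unit. Qed.

Lemma theta_if_add b c A : A \in unitmx ->
  theta_if b (theta_if c A) = theta_if (b (+) c) A.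
Proof. by case: b; case: c => //=; exact: thetaK. Qed.

Lemma LconjE (X : Type) g (phi : X -> LG R n) s : Lmul (Lmul (g, false) (phi s)) (invmx g, false)
  = (g *m (phi s).1 *m theta_if (phi s).2 (invmx g), (phi s).2).
Proof. by rewrite /Lmul /= addbF. Qed.

Lemma conj_Lmul g (a b : LG R n) : g \in unitmx -> a.1 \in unitmx -> b.1 \in unitmx ->
  Lmul (Lmul (g, false) (Lmul a b)) (invmx g, false) =
  Lmul (Lmul (Lmul (g, false) a) (invmx g, false))
       (Lmul (Lmul (g, false) b) (invmx g, false)).
Proof.
case: a b => [A b] [A' b'] /= ug uA uA'; rewrite /Lmul /= !addbF; congr (_, _).
rewrite -!/(theta_if _ _) !theta_ifM ?unitmx_mul ?uA' ?ug ?theta_if_unit ?unitmx_inv //.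
rewrite theta_if_add ?unitmx_inv // !mulmxA; congr (_ *m _ *m _).
rewrite -(mulmxA _ (theta_if b (invmx g))) -theta_ifM ?unitmx_inv // mulVmx //.
by case: (b) => /=; rewrite ?theta1 mulmx1.
Qed.

End OuterAutomorphism.

Lemma small_eq0 (F : numFieldType) (x c : F) : 0 <= c ->
  (forall e, 0 < e -> `|x| <= c * e) -> x = 0.
Proof.
move=> c0 h; apply/eqP; rewrite -normr_eq0; apply: contraT => x0.
have xp : 0 < `|x| by rewrite lt0r x0 normr_ge0.
have c1 : 0 < c + 1 by rewrite ltr_wpDl.
have e0 : 0 < `|x| / (c + 1) / 2%:R by rewrite !divr_gt0.
have := h _ e0; rewrite !mulrA ler_pdivlMr // ler_pdivlMr // => h1.
have : `|x| * (2%:R * (c + 1)) <= `|x| * c by rewrite mulrA (mulrC `|x| c).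
rewrite ler_pM2l // => h2.
have : c < 2%:R * (c + 1).
  rewrite mulrDr mulr1 mulr_natl mulr2n -addrA ltrDl; apply: ltr_wpDl => //.
by move=> h3; have := lt_le_trans h3 h2; rewrite ltxx.
Qed.

Section DiagonalMatrices.
Variables (F : fieldType) (n : nat).
Implicit Types A B : 'M[F]_n.

Lemma diag_mul A B i : is_diag_mx A -> is_diag_mx B ->
  is_diag_mx (A *m B) /\ (A *m B) i i = A i i * B i i.
Proof.
move=> /is_diag_mxP dA /is_diag_mxP dB; split.
  apply/is_diag_mxP => a b ab; rewrite mxE big1 // => l _.
  have [e|ne] := eqVneq a l; first by rewrite -e dB // mulr0.
  by rewrite dA ?mul0r.
rewrite mxE (bigD1 i) //= big1 ?addr0 // => l ne.
by rewrite dA ?mul0r // eq_sym.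
Qed.

Lemma diag_unit_neq0 A i : is_diag_mx A -> A \in unitmx -> A i i != 0.
Proof.
move=> /is_diag_mxP dA uA; apply/eqP => h0.
have := congr1 (fun B : 'M_n => B i i) (mulmxV uA); rewrite !mxE eqxx => /eqP.
rewrite (bigD1 i) //= h0 mul0r add0r big1 => [|l ne]; first by rewrite eq_sym oner_eq0.
by rewrite dA ?mul0r // eq_sym.
Qed.

Lemma diag_inv A B : is_diag_mx A -> A *m B = 1%:M -> is_diag_mx B.
Proof.
move=> dA AB; have [uA _] := mulmx1_unit AB; apply/is_diag_mxP => i j ij.
have := congr1 (fun B : 'M_n => B i j) AB; rewrite !mxE.
move/is_diag_mxP: (dA) => dA'.
rewrite (bigD1 i) //= big1 => [|l ne]; last by rewrite dA' ?mul0r // eq_sym.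
rewrite addr0 => /eqP; have /negPf-> : i != j by [].
by rewrite mulf_eq0 (negPf (diag_unit_neq0 i dA uA)) => /eqP.
Qed.

Lemma diag_comm A B : is_diag_mx A -> is_diag_mx B -> A *m B = B *m A.
Proof.
move=> dA dB; apply/matrixP => i j; have [<-|ij] := eqVneq i j.
  by rewrite (diag_mul i dA dB).2 (diag_mul i dB dA).2 mulrC.
by rewrite (is_diag_mxP (diag_mul i dA dB).1) ?(is_diag_mxP (diag_mul i dB dA).1).
Qed.

Lemma diag_iter A m i : is_diag_mx A ->
  is_diag_mx (iter m (mulmx A) 1%:M) /\ (iter m (mulmx A) 1%:M) i i = A i i ^+ m.
Proof.
move=> dA; elim: m => [|m [d1 e1]] /=.
  by split; [exact: scalar_mx_is_diag | rewrite mxE eqxx].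
have [d2 e2] := diag_mul i dA d1; split => //.
by rewrite e2 e1 exprS.
Qed.

End DiagonalMatrices.

Section TameParameter.
Variables (R : realType) (Omega : closedFieldType) (abs : Omega -> R).
Variables (p : nat) (Qp K E : set Omega).
Variables (OK : comNzRingType) (iota : {rmorphism OK -> Omega}).
Variables (k : finFieldType) (res : {rmorphism OK -> k}).
Variables (n : nat) (h : 'M[Omega]_n) (tt Fr : Omega -> Omega) (omega : 'S_n).
Variables (rho : (Omega -> Omega) -> 'M[int]_n) (art : Omega -> Omega -> Omega).
Hypothesis S :
  torus_setting abs p Qp K E iota res h tt Fr omega rho art.
Implicit Types (x y z : Omega) (s t g : Omega -> Omega).

Let cP := ts_closure S.
Let q := #|k|.
Let QK : Qp `<=` K := base_sub (ts_finite S).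
Let M := splitting_field rho K.
Let Fr_frob := ts_Fr S.
Let FrG : Gal K Fr := Fr_Gal (ts_Fr S).
Let FrnG i : Gal K (iter i Fr) := Gal_iter i FrG.
Let q_gt1 : (1 < q)%N := card_k_gt1 k.
Notation C := R[i].
Variables (phi : (Omega -> Omega) -> LG R n) (gm z : 'M[C]_n).
Hypothesis tt_gen : tame_generator abs K tt.
Hypothesis phi_param : langlands_parameter abs K E phi.
Hypothesis phi_tame : tame abs K phi.
Hypothesis gm_unit : gm \in unitmx.
Hypothesis z_fixed : fixed_torus z.
Hypothesis phi_tt : Lconj gm phi tt = (z, true).
Hypothesis phi_Fr : weyl_image (Lconj gm phi Fr).1 omega.

Let psi s : 'M[C]_n := (Lconj gm phi s).1.
Let m := #[omega]%g.
Let N := (q ^ m).-1.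

(** The Weil group of $E$ inside that of $K$. On it the parameter lies in the identity component of
    the L-group, and [psi] is a homomorphism to $\mathrm{GL}_n$. *)
Definition weilE s : Prop := weil abs K s /\ fixes E s.

Lemma weilE_comp s t : weilE s -> weilE t -> weilE (s \o t).
Proof.
move=> [h1 h2] [h3 h4]; split; first exact: (weil_comp S).
by move=> x hx /=; rewrite h4 // h2.
Qed.

Lemma weilE_ginv s : weilE s -> weilE (ginv s).
Proof.
move=> [h1 h2]; split; first exact: (weil_ginv S).
have hs : Gal K s by case: h1.
by move=> x hx; rewrite -{1}(h2 _ hx) (ginvK hs).
Qed.

Lemma weilE_id : weilE id.
Proof. by split; [exact: (weil_id S) | ]. Qed.

Lemma weilE_iter s i : weilE s -> weilE (iter i s).
Proof.
move=> hs; elim: i => [|i IH]; first exact: weilE_id.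
exact: (weilE_comp hs IH).
Qed.

Lemma weilE_Fr : weilE Fr.
Proof. by split; [exact: (Frn_weil S 1) | exact: ts_Fr_E S]. Qed.

Lemma weilE_inertia s : inertia abs K s -> fixes E s -> weilE s.
Proof. by move=> hs hE; split => //; exact: (inertia_weil S). Qed.

Lemma phi_unit s : weil abs K s -> (phi s).1 \in unitmx.
Proof. by case: phi_param => hu _ _ _; exact: hu. Qed.

Lemma phi_comp s t : weil abs K s -> weil abs K t ->
  phi (s \o t) = Lmul (phi s) (phi t).
Proof. by case: phi_param => _ hM _ _; exact: hM. Qed.

Lemma phi_comp2 s t : weil abs K s -> weil abs K t ->
  (phi (s \o t)).2 = (phi s).2 (+) (phi t).2.
Proof. by move=> hs ht; rewrite phi_comp. Qed.

Lemma phi_fixes s : weil abs K s -> (phi s).2 = false <-> fixes E s.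
Proof.
case: phi_param => _ _ hE _ hs; rewrite hE //; split.
  by move/negbFE/asboolP.
by move=> h0; apply/negbTE; rewrite negbK; apply/asboolP.
Qed.

Lemma Lconj_comp s t : weil abs K s -> weil abs K t ->
  Lconj gm phi (s \o t) = Lmul (Lconj gm phi s) (Lconj gm phi t).
Proof. by move=> hs ht; rewrite /Lconj phi_comp // conj_Lmul ?phi_unit. Qed.

Lemma psiE s : weilE s -> psi s = gm *m (phi s).1 *m invmx gm.
Proof.
by move=> [hs /(phi_fixes hs) hE]; rewrite /psi /Lconj LconjE hE.
Qed.

Lemma psi_comp s t : weilE s -> weilE t -> psi (s \o t) = psi s *m psi t.
Proof.
move=> hs ht; rewrite /psi Lconj_comp; [|by case: hs|by case: ht].
case: hs => [hs /(phi_fixes hs) hE].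
by rewrite /Lconj !LconjE /Lmul /= hE.
Qed.

Lemma psi_unit s : weilE s -> psi s \in unitmx.
Proof.
move=> hs; rewrite psiE // !unitmx_mul gm_unit unitmx_inv gm_unit andbT.
by apply: phi_unit; case: hs.
Qed.

Lemma psi_id : psi id = 1%:M.
Proof.
have u := psi_unit weilE_id.
have : psi id = psi id *m psi id by rewrite -psi_comp //; exact: weilE_id.
move: u; move: (psi id) => A u /(congr1 (mulmx (invmx A))).
by rewrite mulmxA mulVmx // mul1mx.
Qed.

Lemma psi_iter s i : weilE s -> psi (iter i s) = iter i (mulmx (psi s)) 1%:M.
Proof.
move=> hs; elim: i => [|i IH]; first exact: psi_id.
by rewrite -[iter i.+1 s]/(s \o iter i s) psi_comp ?IH //; exact: weilE_iter.
Qed.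

Lemma psi_ginv s : weilE s -> psi s *m psi (ginv s) = 1%:M.
Proof.
move=> hs; rewrite -psi_comp //; last exact: weilE_ginv.
by case: hs => -[hs _] _; rewrite (comp_ginv hs) psi_id.
Qed.

Lemma wild_inertia_sub s : wild_inertia abs K s -> inertia abs K s.
Proof.
move=> [hs hw]; split => // x x1; have [->|x0] := eqVneq x 0.
  by have [f ->] := Gal_rmorphism hs; rewrite rmorph0 subrr (abs0 cP).
by apply: lt_le_trans x1; exact: hw.
Qed.

Lemma wild_fixes s : wild_inertia abs K s -> fixes E s.
Proof.
move=> hs; apply/phi_fixes; last by rewrite phi_tame.
by apply: (inertia_weil S); exact: wild_inertia_sub.
Qed.

Lemma psi_wild s : wild_inertia abs K s -> psi s = 1%:M.
Proof.
move=> hs; rewrite psiE.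
  by rewrite phi_tame // /Lone mulmx1 mulmxV.
by apply: weilE_inertia; [exact: wild_inertia_sub | exact: wild_fixes].
Qed.

Lemma inertia_iter s i : inertia abs K s -> inertia abs K (iter i s).
Proof.
move=> hs; elim: i => [|i IH]; last exact: (inertia_comp S hs IH).
by split; [exact: Gal_id | move=> x _; rewrite subrr (abs0 cP) ltr01].
Qed.

(** The residue of $sx/x$ depends only on $|x|$, since inertia moves a unit within its residue
    class. This is the tame character of $s$. *)
Lemma inertia_rel s x y : inertia abs K s -> x != 0 -> abs y = abs x ->
  abs (s x / x - s y / y) < 1.
Proof.
move=> [hs hI] x0 xy.
have y0 : y != 0.
  by apply/eqP => h0; move: (abs_neq0 cP x0); rewrite -xy h0 (abs0 cP) eqxx.
pose e := y / x; have e1 : abs e = 1 by rewrite (absM cP) (absV cP) xy divff // (abs_neq0 cP).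
have e0 : e != 0 by rewrite mulf_neq0 ?invr_eq0.
have sx0 : abs (s x / x) = 1.
  by rewrite (absM cP) (absV cP) (abs_GalF cP _ QK hs) divff // (abs_neq0 cP).
have -> : s x / x - s y / y = - (s x / x) * ((s e - e) / e).
  have -> : y = x * e by rewrite /e mulrCA divff // mulr1.
  have [f ->] := Gal_rmorphism hs; rewrite rmorphM; field.
  by rewrite x0 e0.
rewrite !(absM cP) (absN cP) sx0 mul1r (absV cP) e1 invr1 mulr1.
by apply: hI; rewrite e1.
Qed.

Lemma inertia_iter_rel s x i : inertia abs K s -> x != 0 ->
  abs (iter i s x / x - (s x / x) ^+ i) < 1.
Proof.
move=> hs x0; elim: i => [|i IH]; first by rewrite divff // subrr (abs0 cP).
have hsG : Gal K s by case: hs.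
have xi0 : iter i s x != 0.
  have hi := Gal_iter i hsG; have [f ->] := Gal_rmorphism hi.
  by rewrite fmorph_eq0.
have ai : abs (iter i s x) = abs x by rewrite (abs_GalF cP _ QK (Gal_iter i hsG)).
have -> : iter i.+1 s x / x = (s (iter i s x) / iter i s x) * (iter i s x / x).
  by rewrite iterS; field; rewrite x0 xi0.
rewrite exprS; apply: (abs_congM_lt cP) => //.
- by rewrite (absM cP) (absV cP) (abs_GalF cP _ QK hsG) divff // (abs_neq0 cP).
- apply: (absX_le1 cP); rewrite (absM cP) (absV cP) (abs_GalF cP _ QK hsG) divff //.
  exact: (abs_neq0 cP).
- by rewrite (absB_sym cP); apply: inertia_rel.
Qed.

(* Frobenius raises tame inertia to the power [q]. *)
Lemma Fr_conj_inertia s : inertia abs K s ->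
  wild_inertia abs K (ginv (iter q s) \o (Fr \o s \o ginv Fr)).
Proof.
move=> hs; have hsG : Gal K s by case: hs.
have qG := Gal_iter q hsG.
have fG : Gal K (Fr \o s \o ginv Fr) := Gal_comp (Gal_comp FrG hsG) (Gal_ginv FrG).
split; first by apply: Gal_comp => //; exact: Gal_ginv.
move=> x x0 /=.
rewrite -{2}(ginvK qG x) (abs_GalB cP _ _ QK (Gal_ginv qG)).
pose y := ginv Fr x; have xE : x = Fr y by rewrite (ginvKV FrG).
have ay : abs y = abs x by rewrite (abs_GalF cP _ QK (Gal_ginv FrG)).
have y0 : y != 0 by apply/eqP => h0; move: (abs_neq0 cP x0); rewrite -ay h0 (abs0 cP) eqxx.
suff : abs (Fr (s y) / x - iter q s x / x) < 1.
  rewrite -mulrBl (absM cP) (absV cP) ltr_pdivrMr ?(abs_gt0 cP) // mul1r; exact.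
have u1 : abs (s y / y) <= 1.
  by rewrite (absM cP) (absV cP) (abs_GalF cP _ QK hsG) divff // (abs_neq0 cP).
have -> : Fr (s y) / x = Fr (s y / y).
  by rewrite {1}xE; have [f ->] := Gal_rmorphism FrG; rewrite fmorph_div.
apply: (absB_trans_lt cP (Fr_cong cP (ts_integers S) (ts_residue S) Fr_frob u1)).
apply: (@absB_trans_lt _ _ abs p Qp cP _ ((s x / x) ^+ q)).
  by apply: (abs_congX_lt cP) => //; exact: inertia_rel.
by rewrite (absB_sym cP); exact: inertia_iter_rel.
Qed.

Lemma psi_Fr_conj s : inertia abs K s -> fixes E s ->
  psi Fr *m psi s = iter q (mulmx (psi s)) 1%:M *m psi Fr.
Proof.
move=> hs hE; have hsG : Gal K s by case: hs.
have ws := weilE_inertia hs hE.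
have wv := Fr_conj_inertia hs; set v := (ginv _ \o _) in wv.
have vE := weilE_inertia (wild_inertia_sub wv) (wild_fixes wv).
have wq := weilE_iter q ws.
have e : Fr \o s = (iter q s \o v) \o Fr.
  rewrite /v; apply/funext => x /=.
  by rewrite (ginvKV (Gal_iter q hsG)) (ginvK FrG).
rewrite -psi_comp //; last exact: weilE_Fr.
rewrite e psi_comp; [|exact: weilE_comp|exact: weilE_Fr].
by rewrite (psi_comp wq vE) (psi_wild wv) mulmx1 (psi_iter _ ws).
Qed.

(** As [psi Fr] is monomial with permutation $\omega$, the relation of [psi_Fr_conj] says
    $D_j=D_{\omega j}^q$ for the diagonal entries. After $m$ steps, $m$ being the order of $\omega$,
    it closes up to $D_i=D_i^{q^m}$. *)
Lemma psi_root_of_unity s i : inertia abs K s -> fixes E s -> is_diag_mx (psi s) ->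
  psi s i i ^+ N = 1.
Proof.
move=> hs hE dD; have [uW hW] := phi_Fr; rewrite -/(psi Fr) in hW.
have step j : psi s j j = psi s (omega j) (omega j) ^+ q.
  move: dD (psi_Fr_conj hs hE) hW; move: (psi s) (psi Fr) => D W dD e hW.
  have := congr1 (fun A : 'M_n => A (omega j) j) e; rewrite !mxE.
  rewrite (bigD1 j) //= big1 => [|l ne]; last first.
    by move/is_diag_mxP: dD => ->; rewrite ?mulr0.
  have [dq eq] := diag_iter q (omega j) dD.
  rewrite [RHS](bigD1 (omega j)) //= [X in _ = _ + X]big1 => [|l ne]; last first.
    by move/is_diag_mxP: dq => ->; rewrite ?mul0r // eq_sym.
  rewrite eq !addr0 [LHS]mulrC => e1; apply: (mulIf _ e1).
  by apply/hW.
have iter_step l : psi s i i = psi s ((omega ^+ l)%g i) ((omega ^+ l)%g i) ^+ (q ^ l).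
  elim: l => [|l IH]; first by rewrite expg0 perm1 expr1.
  by rewrite IH step -exprM -expnS expgSr permM.
have := iter_step m; rewrite expg_order perm1 => e.
have d0 : psi s i i != 0 := (diag_unit_neq0 i dD (psi_unit (weilE_inertia hs hE))).
apply: (mulfI d0); rewrite mulr1 -exprS /N prednK //.
by rewrite expn_gt0 ltnW.
Qed.

Lemma m_gt0 : (0 < m)%N.
Proof. exact: order_gt0. Qed.

Let ttI : inertia abs K tt := ts_tt S.

Lemma ttW : weil abs K tt.
Proof. exact: (inertia_weil S ttI). Qed.

Lemma tt2_fixes : fixes E (tt \o tt).
Proof.
have w := ttW; apply/phi_fixes; first exact: (weil_comp S).
by rewrite phi_comp2 // addbb.
Qed.

Lemma psi_tt2 : is_diag_mx (psi (tt \o tt)).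
Proof.
have [dz uz tz] := z_fixed.
rewrite /psi Lconj_comp ?phi_tt; [|exact: ttW|exact: ttW].
by rewrite /Lmul /= tz; case: (@diag_mul _ _ z z (Ordinal (ts_dim S)) dz dz).
Qed.

(** The factor by which conjugation by [gm] can enlarge the deviation of a matrix from $1$;
    continuity is given for [phi] and used for its conjugate. *)
Definition conj_bound (i j : 'I_n) : C :=
  \sum_a \sum_b `|gm i a| * `|(invmx gm) b j|.

Lemma conj_bound_ge0 i j : 0 <= conj_bound i j.
Proof. by do 2!(apply: sumr_ge0 => ? _); rewrite mulr_ge0. Qed.

Lemma psi_continuous (e : C) : 0 < e -> exists b : seq Omega,
  forall s, inertia abs K s -> fixes E s -> (forall x, x \in b -> s x = x) ->
    forall i j, `|psi s i j - (i == j)%:R| <= conj_bound i j * e.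
Proof.
move=> e0; case: phi_param => _ _ _ /(_ e e0)[L [_ _ _ [b hb]] hL].
exists b => s hs hE hsb i j; have hsG : Gal K s by case: hs.
have fL : fixes L s.
  move=> x /hb[c hc ->]; have sc l : s (c l) = c l by exact: (Gal_fix hsG).
  have sb (l : 'I_(size b)) : s b`_l = b`_l by apply: hsb; rewrite mem_nth.
  move: sc sb; have [f ->] := Gal_rmorphism hsG => sc sb.
  by rewrite rmorph_sum; apply: eq_bigr => l _; rewrite rmorphM sc sb.
have lt := hL _ hs fL.
have -> : psi s i j - (i == j)%:R =
    \sum_a \sum_b gm i a * ((phi s).1 a b - (a == b)%:R) * (invmx gm) b j.
  rewrite (psiE (weilE_inertia hs hE)).
  have -> : (i == j)%:R = (gm *m 1%:M *m invmx gm) i j by rewrite mulmx1 mulmxV // mxE.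
  rewrite !mxE -sumrB exchange_big; apply: eq_bigr => b' _ /=.
  rewrite -mulrBl !mxE -sumrB mulr_suml; apply: eq_bigr => a _.
  by rewrite mxE mulrBr.
rewrite /conj_bound mulr_suml; apply: le_trans (ler_norm_sum _ _ _) _.
apply: ler_sum => a _; rewrite mulr_suml; apply: le_trans (ler_norm_sum _ _ _) _.
apply: ler_sum => b' _; rewrite !normrM mulrAC ler_wpM2l ?mulr_ge0 //.
exact: ltW.
Qed.

Lemma E_moved : exists2 e, E e & tt e <> e.
Proof.
apply: contrapT => no; apply: (ts_tt_E S) => x hx; apply: contrapT => ne.
by apply: no; exists x.
Qed.

(** Up to wild inertia and an element as close to $1$ as desired, $w$ is a power of [tt], and an
    even one because $w$ fixes $E$. So $\psi(w)$ is approximated by powers of the diagonal matrix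
    [psi (tt \o tt)]; its entries are roots of unity, and multiplication by their powers does not
    enlarge the error off the diagonal. *)
Lemma psi_diag_inertia w : inertia abs K w -> fixes E w -> is_diag_mx (psi w).
Proof.
move=> hw hE; apply/is_diag_mxP => i j /eqP ij.
have dY := psi_tt2; have Y2 := tt2_fixes.
have hY : inertia abs K (tt \o tt) by exact: (inertia_comp S).
have wY := weilE_inertia hY Y2.
apply: (small_eq0 (conj_bound_ge0 i j)) => e e0.
have [b hb] := psi_continuous e0; have [e1 he1 ne1] := E_moved.
(* An element [e1] of $E$ moved by [tt] joins the list in order to detect the parity of [kk]. *)
have [_ /(_ w hw (e1 :: b))[kk [v [hv hwX]]]] := tt_gen.
have hvI := wild_inertia_sub hv; have hvE := wild_fixes hv.
have kI := inertia_iter kk ttI; have kG : Gal K (iter kk tt) by case: kI.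
have hwG : Gal K w by case: hw.
have hvG : Gal K v by case: hvI.
have kfix : iter kk tt e1 = e1.
  have := hwX e1; rewrite inE eqxx => /(_ isT).
  by rewrite hE // hvE.
have par l : (phi (iter l tt)).2 = odd l.
  elim: l => [|l IH]; first by apply/(phi_fixes (weil_id S)).
  rewrite -[iter l.+1 tt]/(tt \o iter l tt) phi_comp2 ?IH; last 2 first.
  - exact: ttW.
  - by apply: (inertia_weil S); exact: inertia_iter.
  by have := congr1 snd phi_tt; rewrite /Lconj LconjE /= => ->.
have [l kE] : exists l, iter kk tt = iter l (tt \o tt).
  have dbl l : iter l.*2 tt = iter l (tt \o tt).
    by elim: l => // l IH; apply/funext => x; rewrite doubleS !iterS IH.
  exists kk./2; rewrite -dbl; rewrite -{1}(odd_double_half kk).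
  case od : (odd kk) => //; exfalso; apply: ne1.
  move: kfix; rewrite -{1}(odd_double_half kk) od add1n iterS dbl.
  by rewrite (weilE_iter kk./2 wY).2.
have wk : weilE (iter kk tt) by rewrite kE; exact: weilE_iter.
pose c := ginv v \o (ginv (iter kk tt) \o w).
have cI : inertia abs K c.
  apply: (inertia_comp S); first exact: (inertia_ginv S).
  by apply: (inertia_comp S) => //; exact: (inertia_ginv S).
have wv := weilE_inertia hvI hvE; have ww := weilE_inertia hw hE.
have wc : weilE c by do !apply: weilE_comp => //; exact: weilE_ginv.
have cX x : x \in b -> c x = x.
  move=> hx; rewrite /c /= (hwX x) ?inE ?hx ?orbT //.
  by rewrite (ginvK kG) (ginvK hvG).
have wE : w = iter kk tt \o (v \o c).
  by apply/funext => x; rewrite /c /= (ginvKV hvG) (ginvKV kG).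
have [dk ek] := diag_iter l i dY.
have -> : psi w = iter l (mulmx (psi (tt \o tt))) 1%:M *m psi c.
  rewrite -(psi_iter l wY) -kE {1}wE (psi_comp wk (weilE_comp wv wc)).
  by rewrite (psi_comp wv wc) (psi_wild hv) mul1mx.
rewrite mxE (bigD1 i) //= big1 => [|a ne]; last first.
  by move/is_diag_mxP: dk => ->; rewrite ?mul0r // eq_sym.
rewrite addr0 ek normrM normrX.
have y1 : `|psi (tt \o tt) i i| = 1.
  have := psi_root_of_unity i hY Y2 dY => /(congr1 Num.norm).
  have N0 : (0 < N)%N.
    by rewrite /N -subn1 subn_gt0; apply: leq_trans (ltn_expl _ q_gt1); exact: m_gt0.
  by rewrite normrX normr1 => /eqP; rewrite pexpr_eq1 ?normr_ge0 // => /eqP.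
rewrite y1 expr1n mul1r; have := hb c cI wc.2 cX i j.
by have /negPf-> : i != j; [apply/eqP => h0; apply: ij; rewrite h0 | rewrite subr0].
Qed.

(* The Weil group of the splitting field, as a subgroup of that of [K]. *)
Definition weilM s : Prop := weil abs K s /\ rho s = 1%:M.

Lemma weilM_comp s t : weilM s -> weilM t -> weilM (s \o t).
Proof.
move=> [hs h1] [ht h2]; split; first exact: (weil_comp S).
by rewrite (rho_comp S) ?h1 ?h2 ?mul1mx //; [case: hs|case: ht].
Qed.

Lemma weilM_ginv s : weilM s -> weilM (ginv s).
Proof.
move=> [hs h1]; split; first exact: (weil_ginv S).
by rewrite (rho_ginv S) ?h1 ?invmx1 //; case: hs.
Qed.

Lemma psi_Frn_monomial i a b : psi (iter i Fr) a b != 0 -> a = (omega ^+ i)%g b.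
Proof.
elim: i a b => [|i IH] a b.
  by rewrite psi_id mxE expg0 perm1; case: (a =P b) => // _; rewrite eqxx.
rewrite -[iter i.+1 Fr]/(Fr \o iter i Fr) psi_comp; last 2 first.
- exact: weilE_Fr.
- exact/weilE_iter/weilE_Fr.
rewrite mxE => h0; have [l hl] : exists l, psi Fr a l * psi (iter i Fr) l b != 0.
  apply: contrapT => no; move: h0; rewrite big1 ?eqxx // => l _.
  by apply/eqP; apply: contraT => h1; case: no; exists l.
move: hl; rewrite mulf_eq0 negb_or => /andP[h1 /IH lE].
have [_ hW] := phi_Fr; have /hW -> := h1.
by rewrite lE expgSr permM.
Qed.

(** Up to a power $\mathrm{Fr}^{\pm i}$ the element $s$ is some $t$ in inertia. As [rho t] is $1$ or
    minus the reversal, [rho s = 1] forces both [rho t] and $\omega^i$ to be trivial; then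
    $\psi(\mathrm{Fr}^i)$, monomial with trivial permutation, is diagonal as well. *)
Lemma weilM_psi s : weilM s -> weilE s /\ is_diag_mx (psi s).
Proof.
move=> [hs h1]; have [i hi] := weil_inertia_Fr S hs; have hsG : Gal K s by case: hs.
have wF : weilE (iter i Fr) by exact/weilE_iter/weilE_Fr.
have key t e : inertia abs K t -> rho t = signed_perm_mx false e ->
    rho t = 1%:M /\ e = 1%g.
  move=> ht et; have e1 : rho t = 1%:M.
    case: (rho_inertia S ht) => // eJ.
    have : signed_perm_mx true (perm (@rev_ord_inj n)) *m
           invmx (signed_perm_mx false e) = 1%:M.
      by rewrite -eJ et mulmxV // -et (rho_unit S) //; case: ht.
    by rewrite signed_perm_inv signed_perm_mul => /(signed_perm_neg (ts_dim S))[].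
  by move: et; rewrite e1 => /esym/(signed_perm_neg (ts_dim S))[].
have Fdiag : (omega ^+ i)%g = 1%g -> is_diag_mx (psi (iter i Fr)).
  move=> w1; apply/is_diag_mxP => a b /eqP ab; apply/eqP; apply: contraT => h0.
  by case: ab; rewrite (psi_Frn_monomial h0) w1 perm1.
case: hi => hI.
  have gG := Gal_ginv (FrnG i).
  have [|r1 w1] := key _ (omega ^+ i)^-1%g hI.
    by rewrite (rho_comp S) // h1 mul1mx (rho_ginv S) // (rho_Frn S) signed_perm_inv.
  have fE := inertia_fixes S hI r1; have wI := weilE_inertia hI fE.
  have sE : s = (s \o ginv (iter i Fr)) \o iter i Fr.
    by rewrite -compA (ginv_comp (FrnG i)).
  have ws : weilE s by rewrite sE; exact: weilE_comp.
  split => //; rewrite sE psi_comp //.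
  have wi1 : (omega ^+ i)%g = 1%g by rewrite -[LHS]invgK w1 invg1.
  exact: (diag_mul (Ordinal (ts_dim S)) (psi_diag_inertia hI fE) (Fdiag wi1)).1.
have [|r1 w1] := key _ (omega ^+ i)%g hI.
  by rewrite (rho_comp S) // h1 mul1mx (rho_Frn S).
have fE := inertia_fixes S hI r1; have wI := weilE_inertia hI fE.
have sE : s = (s \o iter i Fr) \o ginv (iter i Fr).
  by rewrite -compA (comp_ginv (FrnG i)).
have wF' := weilE_ginv wF.
have ws : weilE s by rewrite sE; exact: weilE_comp.
split => //; rewrite sE psi_comp //.
have dF' := diag_inv (Fdiag w1) (psi_ginv wF).
exact: (diag_mul (Ordinal (ts_dim S)) (psi_diag_inertia hI fE) dF').1.
Qed.

Lemma psi_inertiaM_root s i : inertia abs K s -> rho s = 1%:M -> psi s i i ^+ N = 1.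
Proof.
move=> hs h1; have fE := inertia_fixes S hs h1.
by apply: psi_root_of_unity => //; exact: psi_diag_inertia.
Qed.

Lemma weil_commute s t x : weil abs K s -> weil abs K t -> abs x <= 1 ->
  abs (s (t x) - t (s x)) < 1.
Proof.
move=> /(weilP S)[hs [i [j hij]]] /(weilP S)[ht [i' [j' hij']]] x1.
have half u v a b a' b' : Gal K u -> Gal K v ->
    (forall x, abs x <= 1 -> abs ((u x) ^+ (q ^ a) - x ^+ (q ^ b)) < 1) ->
    (forall x, abs x <= 1 -> abs ((v x) ^+ (q ^ a') - x ^+ (q ^ b')) < 1) ->
    abs (u (v x) ^+ (q ^ (a + a')) - x ^+ (q ^ (b + b'))) < 1.
  move=> hu hv h1 h2.
  have vx1 : abs (v x) <= 1 by rewrite (abs_GalF cP _ QK hv).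
  have uvx1 : abs (u (v x)) <= 1 by rewrite (abs_GalF cP _ QK hu).
  have -> : u (v x) ^+ (q ^ (a + a')) = (u (v x) ^+ (q ^ a)) ^+ (q ^ a').
    by rewrite expnD exprM.
  have -> : x ^+ (q ^ (b + b')) = (x ^+ (q ^ b')) ^+ (q ^ b).
    by rewrite addnC expnD exprM.
  apply: (@absB_trans_lt _ _ abs p Qp cP _ ((v x ^+ (q ^ b)) ^+ (q ^ a'))).
    by apply: (abs_congX_lt cP); [exact: (absX_le1 cP) | exact: h1].
  have -> : (v x ^+ (q ^ b)) ^+ (q ^ a') = (v x ^+ (q ^ a')) ^+ (q ^ b) by rewrite exprAC.
  by apply: (abs_congX_lt cP); [exact: (absX_le1 cP) | exact: h2].
have h1 := half _ _ _ _ _ _ hs ht hij hij'.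
have h2 := half _ _ _ _ _ _ ht hs hij' hij.
apply: (cong_q_inj cP (ts_finite S) (ts_integers S) (ts_residue S) Fr_frob (i := (i + i')%N)).
- by rewrite (abs_GalF cP _ QK hs) (abs_GalF cP _ QK ht).
- by rewrite (abs_GalF cP _ QK ht) (abs_GalF cP _ QK hs).
apply: (absB_trans_lt cP h1); rewrite (absB_sym cP).
by rewrite addnC (addnC j).
Qed.

(** On [weilM] the values of [psi] are diagonal and commute. Commutators lie in inertia because the
    Weil group acts on residues through powers of Frobenius. *)
Lemma commutator_weilM G c : (forall s, G s -> weilM s) -> commutators G c ->
  [/\ weilM c, inertia abs K c & psi c = 1%:M].
Proof.
move=> hG; elim=> {c} [|u u' v v' c hu hu' hv hv' uu' vv' _ [wc cI pc]].
  split; last exact: psi_id.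
    by split; [exact: (weil_id S) | exact: (rho_id S)].
  by split; [exact: Gal_id | move=> x _; rewrite subrr (abs0 cP) ltr01].
have [wu wu' wv wv'] := And4 (hG _ hu) (hG _ hu') (hG _ hv) (hG _ hv').
have wM : weilM (u \o v \o u' \o v') := weilM_comp (weilM_comp (weilM_comp wu wv) wu') wv'.
have wI : inertia abs K (u \o v \o u' \o v').
  split; first by case: wM => -[].
  move=> x x1 /=; set y := u' (v' x).
  have y1 : abs y <= 1.
    by rewrite /y (abs_GalF cP _ QK) ?(abs_GalF cP _ QK) //; [case: wv' => -[]|case: wu' => -[]].
  have -> : x = v (u y).
    rewrite /y; have := congr1 (@^~ (v' x)) uu' => /= ->.
    by have := congr1 (@^~ x) vv' => /= ->.
  exact: (weil_commute wu.1 wv.1 y1).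
split; [exact: (weilM_comp wM wc) | exact: (inertia_comp S wI cI) | ].
have [eu du] := weilM_psi wu; have [eu' _] := weilM_psi wu'.
have [ev dv] := weilM_psi wv; have [ev' _] := weilM_psi wv'.
have [ec _] := weilM_psi wc; have [eM _] := weilM_psi wM.
have -> : psi (u \o v \o u' \o v' \o c) = psi (u \o v \o u' \o v').
  by rewrite (psi_comp eM ec) pc mulmx1.
rewrite (psi_comp (weilE_comp (weilE_comp eu ev) eu') ev').
rewrite (psi_comp (weilE_comp eu ev) eu') (psi_comp eu ev) (diag_comm du dv).
rewrite -(mulmxA (psi v)) -(psi_comp eu eu') uu' psi_id mulmx1.
by rewrite -(psi_comp ev ev') vv' psi_id.
Qed.

(** The quotient $t^{-1}s$ agrees on any finite set with a product of commutators, on which $\psi$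
    is trivial. Like these it lies in inertia, where $\psi$ is continuous, so $\psi(t^{-1}s)=1$. *)
Lemma psi_eq_ab G s t : (forall s, G s -> weilM s) -> weilM s -> weilM t ->
  eq_ab G s t -> psi s = psi t.
Proof.
move=> hG hs ht e; have [es ds] := weilM_psi hs; have [et dt] := weilM_psi ht.
have hsG : Gal K s by case: hs => -[].
have htG : Gal K t by case: ht => -[].
pose u := ginv t \o s.
have eu : weilE u by apply: weilE_comp => //; exact: weilE_ginv.
have uX (X : seq Omega) : exists2 c, commutators G c & forall x, x \in X -> u x = c x.
  have [c hc hcX] := e X; exists c => // x hx.
  by rewrite /u /= hcX // (ginvK htG).
have uI : inertia abs K u.
  split; first by case: eu => -[].
  move=> x x1; have [c hc /(_ x)] := uX [:: x]; rewrite inE eqxx => -> //.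
  by have [_ [_ h1] _] := commutator_weilM hG hc; exact: h1.
suff u1 : psi u = 1%:M.
  have -> : s = t \o u by apply/funext => x; rewrite /u /= (ginvKV htG).
  by rewrite psi_comp // u1 mulmx1.
apply/matrixP => i j; rewrite [RHS]mxE; apply/eqP; rewrite -subr_eq0; apply/eqP.
apply: (small_eq0 (conj_bound_ge0 i j)) => e' e0.
have [b hb] := psi_continuous e0; have [c hc hcX] := uX b.
have [wc cI pc] := commutator_weilM hG hc; have [ec _] := weilM_psi wc.
have cG : Gal K c by case: cI.
pose v := ginv c \o u; have vI : inertia abs K v.
  by apply: (inertia_comp S) => //; exact: (inertia_ginv S).
have ev : weilE v by apply: weilE_comp => //; exact: weilE_ginv.
have -> : u = c \o v by apply/funext => x; rewrite /v /= (ginvKV cG).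
rewrite (psi_comp ec ev) pc mul1mx; apply: hb => //; first by case: ev.
by move=> x hx; rewrite /v /= hcX // (ginvK cG).
Qed.

End TameParameter.

Lemma perm_revV n : (perm (@rev_ord_inj n))^-1%g = perm (@rev_ord_inj n).
Proof.
apply/permP => i; apply: (@perm_inj _ (perm (@rev_ord_inj n))).
by rewrite permKV !permE rev_ordK.
Qed.

Section TorusAction.
Variables (Omega : closedFieldType) (n : nat).
Variable rho : (Omega -> Omega) -> 'M[int]_n.
Implicit Types (s : Omega -> Omega) (t : 'rV[Omega]_n).

Lemma tchar_signed_delta (e : bool) j t : tchar ((-1) ^+ e *: delta_mx j 0) t =
  if e then (t 0 j)^-1 else t 0 j.
Proof.
rewrite /tchar (bigD1 j) //= big1 => [|l /negPf ne]; last by rewrite !mxE ne mulr0 expr0z.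
by rewrite !mxE !eqxx !mulr1; case: e; rewrite ?expr1z.
Qed.

Lemma gactE s e w t i : rho s = signed_perm_mx e w ->
  gact rho s t 0 i = s (if e then (t 0 ((w^-1)%g i))^-1 else t 0 ((w^-1)%g i)).
Proof.
by move=> h; rewrite mxE h signed_perm_inv signed_perm_delta tchar_signed_delta.
Qed.

End TorusAction.

(** * Principal units *)

Section PrincipalUnits.
Variables (R : realType) (Omega : closedFieldType) (abs : Omega -> R).
Variables (p : nat) (Qp : set Omega).
Hypothesis cP : padic_closure abs p Qp.
Hypothesis p_prime : prime p.
Implicit Types (x y z u v : Omega).

Lemma principal_root m u : (0 < m)%N -> abs (m%:R : Omega) = 1 -> abs (u - 1) < 1 ->
  exists2 v, v ^+ m = u & abs (v - 1) < 1.
Proof.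
move=> m0 m1 hu; have [|v h1 h2] := @root_near1 _ _ abs p Qp cP u m m0.
  by rewrite m1 expr1n.
by exists v; rewrite -?m1.
Qed.

Lemma principal_root_unique m u v : (0 < m)%N -> abs (m%:R : Omega) = 1 ->
  abs (u - 1) < 1 -> abs (v - 1) < 1 -> u ^+ m = v ^+ m -> u = v.
Proof.
move=> m0 m1 hu hv; apply: (@root_near1_unique _ _ abs p Qp cP p_prime u v m m0);
  by rewrite m1.
Qed.

Lemma principalV u : abs (u - 1) < 1 -> abs (u^-1 - 1) < 1.
Proof.
move=> hu; have u0 := abs_princ_neq0 cP hu.
have -> : u^-1 - 1 = - ((u - 1) / u) by field.
by rewrite (absN cP) (absM cP) (absV cP) (abs_princ_unit cP hu) invr1 mulr1.
Qed.

Lemma principalM u v : abs (u - 1) < 1 -> abs (v - 1) < 1 -> abs (u * v - 1) < 1.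
Proof.
move=> hu hv; have -> : u * v - 1 = u * (v - 1) + (u - 1) by ring.
apply: (absD_lt cP) => //; apply: (absM_lt1 cP) => //.
by rewrite (abs_princ_unit cP).
Qed.

Lemma principal_Gal F s u : Qp `<=` F -> Gal F s -> abs (u - 1) < 1 ->
  abs (s u - 1) < 1.
Proof.
move=> QF hs; rewrite -(abs_GalB cP _ _ QF hs).
by have [f ->] := Gal_rmorphism hs; rewrite rmorph1.
Qed.

End PrincipalUnits.

(** * Equality in the abelianised Weil group *)

Lemma commutators_comp (Omega : closedFieldType) (G : set (Omega -> Omega)) c c' :
  commutators G c -> commutators G c' -> commutators G (c \o c').
Proof.
by move=> hc hc'; elim: hc => // u u' v v' c0 hu hu' hv hv' e1 e2 _ IH; exact: (CommS hu hu' hv hv' e1 e2 IH).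
Qed.

Lemma commutators_inv (Omega : closedFieldType) (G : set (Omega -> Omega)) c :
  (forall s, G s -> injective s) -> commutators G c ->
  exists2 c', commutators G c' & c' \o c = id.
Proof.
move=> inj; elim=> {c} [|u u' v v' c hu hu' hv hv' uu' vv' _ [c' hc' e]].
  by exists id => //; exact: Comm1.
have u'u : u' \o u = id.
  by apply/funext => x; apply: (inj _ hu); exact: (congr1 (@^~ (u x)) uu').
have v'v : v' \o v = id.
  by apply/funext => x; apply: (inj _ hv); exact: (congr1 (@^~ (v x)) vv').
exists (c' \o (v \o u \o v' \o u' \o id)).
  by apply: commutators_comp => //; apply: CommS => //; exact: Comm1.
apply/funext => x /=.
have -> : u' (u (v (u' (v' (c x))))) = v (u' (v' (c x))).
  exact: (congr1 (@^~ (v (u' (v' (c x))))) u'u).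
have -> : v' (v (u' (v' (c x)))) = u' (v' (c x)).
  exact: (congr1 (@^~ (u' (v' (c x)))) v'v).
have -> : u (u' (v' (c x))) = v' (c x) by exact: (congr1 (@^~ (v' (c x))) uu').
have -> : v (v' (c x)) = c x by exact: (congr1 (@^~ (c x)) vv').
exact: (congr1 (@^~ x) e).
Qed.

Section EqAb.
Variables (R : realType) (Omega : closedFieldType) (abs : Omega -> R).
Variables (p : nat) (Qp : set Omega).
Hypothesis cP : padic_closure abs p Qp.
Variable G : set (Omega -> Omega).
Hypothesis G_Gal : G `<=` Gal Qp.

Lemma commutators_Gal c : commutators G c -> Gal Qp c.
Proof.
elim=> {c} [|u u' v v' c hu hu' hv hv' _ _ _ hc]; first exact: Gal_id.
exact: (Gal_comp (Gal_comp (Gal_comp (Gal_comp (G_Gal hu) (G_Gal hv)) (G_Gal hu')) (G_Gal hv')) hc).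
Qed.

Lemma eq_ab_refl s : eq_ab G s s.
Proof. by move=> X; exists id => //; exact: Comm1. Qed.

(* A commutator permutes the finite set of conjugates of a given element. *)
Lemma eq_ab_sym s t : eq_ab G s t -> eq_ab G t s.
Proof.
move=> h X.
have orb x := @orbit_seq _ _ abs p Qp cP (Gal Qp) x (@subset_refl _ _).
have /choice[r hr] x : exists r : seq Omega, forall y, y \in r <-> exists2 s, Gal Qp s & y = s x.
  by have [r _ hr] := orb x; exists r.
have [c hc hcX] := h (flatten (map r X)).
have inj u : G u -> injective u by move/G_Gal; exact: Gal_inj.
have [c' hc' e] := commutators_inv inj hc.
exists c' => // x hx.
have e' y : c (c' y) = y.
  have cG := commutators_Gal hc; apply: (Gal_inj (commutators_Gal hc')).
  exact: (congr1 (@^~ (c' y)) e).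
rewrite -{1}(e' x) -hcX //; apply/flatten_mapP; exists x => //.
by apply/hr; exists c' => //; exact: commutators_Gal.
Qed.

End EqAb.

(** * The local Langlands character on principal points *)

Section PrincipalTrivial.
Variables (R : realType) (Omega : closedFieldType) (abs : Omega -> R).
Variables (p : nat) (Qp K E : set Omega).
Variables (OK : comNzRingType) (iota : {rmorphism OK -> Omega}).
Variables (k : finFieldType) (res : {rmorphism OK -> k}).
Variables (n : nat) (h : 'M[Omega]_n) (tt Fr : Omega -> Omega) (omega : 'S_n).
Variables (rho : (Omega -> Omega) -> 'M[int]_n) (art : Omega -> Omega -> Omega).
Hypothesis S :
  torus_setting abs p Qp K E iota res h tt Fr omega rho art.
Implicit Types (x y z : Omega) (s t g : Omega -> Omega).

Let cP := ts_closure S.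
Let p_prime := ts_prime S.
Let q := #|k|.
Let QK : Qp `<=` K := base_sub (ts_finite S).
Let M := splitting_field rho K.
Let ttG : Gal K tt. Proof. by case: (ts_tt S). Qed.
Let q_gt1 : (1 < q)%N := card_k_gt1 k.
Notation C := R[i].
Variables (phi : (Omega -> Omega) -> LG R n) (gm z : 'M[C]_n).
Hypothesis tt_gen : tame_generator abs K tt.
Hypothesis phi_param : langlands_parameter abs K E phi.
Hypothesis phi_tame : tame abs K phi.
Hypothesis gm_unit : gm \in unitmx.
Hypothesis z_fixed : fixed_torus z.
Hypothesis phi_tt : Lconj gm phi tt = (z, true).
Hypothesis phi_Fr : weyl_image (Lconj gm phi Fr).1 omega.
Variables (d : nat) (g0 : Omega -> Omega).
Hypothesis d_gt0 : (0 < d)%N.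
Hypothesis M_card : residue_card abs M (q ^ d).
Hypothesis g0_Gal : Gal M g0.
Hypothesis g0_cong : forall x, abs x <= 1 -> abs (g0 x - x ^+ (q ^ d)) < 1.

Let psi s : 'M[C]_n := (Lconj gm phi s).1.
Let N := (q ^ #[omega]%g).-1.
Let Mur := Mur K rho.
Let MF : is_subfield M := @M_subfield _ K _ rho.
Let artM' := ts_art S.

Let weilM_sub s : weil abs M s -> weilM abs K rho s := @weil_M_K _ _ _ _ _ _ _ _ _ _ _ _ _ _ _ _ _ _ S d M_card s.

Let kill s t (hs : weilM abs K rho s) (ht : weilM abs K rho t)
  (e : eq_ab (weil abs M) s t) : psi s = psi t := @psi_eq_ab _ _ _ _ _ _ _ _ _ _ _ _ _ _ _ _ _ _ S phi gm z
  tt_gen phi_param phi_tame gm_unit z_fixed phi_tt phi_Fr (weil abs M) s t weilM_sub hs ht e.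

Let weilM_psi' s (hs : weilM abs K rho s) := weilM_psi S tt_gen phi_param phi_tame
  gm_unit z_fixed phi_tt phi_Fr hs.

Let psi_comp' s t (hs : weilM abs K rho s) (ht : weilM abs K rho t) :
  psi (s \o t) = psi s *m psi t :=
  psi_comp phi_param gm_unit (weilM_psi' hs).1 (weilM_psi' ht).1.

(** [Phi _ j] is the character of $M^\times$ that the Artin map makes of the $j$-th diagonal entry
    of the parameter. *)
Let Phi x j := psi (art x) j j.

Let art_weilM x : M x -> x != 0 -> weilM abs K rho (art x).
Proof. by move=> hx x0; apply: weilM_sub; exact: (art_weil artM'). Qed.

Lemma PhiM x y j : M x -> x != 0 -> M y -> y != 0 ->
  Phi (x * y) j = Phi x j * Phi y j.
Proof.
move=> hx x0 hy y0; have wx := art_weilM hx x0; have wy := art_weilM hy y0.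
have wxy : weilM abs K rho (art (x * y)).
  by apply: art_weilM; [exact: (is_subfieldM MF) | rewrite mulf_neq0].
rewrite /Phi (kill wxy (weilM_comp S wx wy) (artM artM' hx x0 hy y0)).
rewrite psi_comp'; [|exact: wx|exact: wy].
exact: (diag_mul j (weilM_psi' wx).2 (weilM_psi' wy).2).2.
Qed.

Lemma PhiX x j i : M x -> x != 0 -> (0 < i)%N -> Phi (x ^+ i) j = Phi x j ^+ i.
Proof.
move=> hx x0; elim: i => // -[|i] IH _; first by rewrite !expr1.
have hxi : M (x ^+ i.+1) := is_subfieldX i.+1 MF hx.
have xi0 : x ^+ i.+1 != 0 by rewrite expf_neq0.
by rewrite exprS (PhiM j hx x0 hxi xi0) IH // [RHS]exprS.
Qed.

(** Units are quotients of uniformizers: $xw$ and $w$ both have Frobenius elements as Artin symbols.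
    These differ by an element of inertia, whose diagonal entries are $N$-th roots of unity. *)
Lemma Phi_unit x j : M x -> abs x = 1 -> Phi x j ^+ N = 1.
Proof.
move=> hx x1; have [w hw] := M_uniformizer S.
have [Mw w0 w1 wmax] := hw.
have x0 : x != 0.
  by apply/eqP => h0; move: x1; rewrite h0 (abs0 cP) => /eqP; rewrite eq_sym oner_eq0.
have hxw : uniformizer abs M (x * w).
  split; first exact: (is_subfieldM MF).
  - by rewrite mulf_neq0.
  - by rewrite (absM cP) x1 mul1r.
  - by move=> y hy y1; rewrite (absM cP) x1 mul1r; exact: wmax.
have [gG [Q1 hQ1 f1]] := art_uniformizer artM' hxw.
have [gG2 [Q2 hQ2 f2]] := art_uniformizer artM' hw.
rewrite -(residue_card_unique cP hQ1 hQ2) in f2.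
have Mxw : M (x * w) by case: hxw.
have xw0 : x * w != 0 by case: hxw.
have wxw := art_weilM Mxw xw0; have ww := art_weilM Mw w0.
have g1K : Gal K (art (x * w)) by case: wxw => -[].
have g2K : Gal K (art w) by case: ww => -[].
pose s := art (x * w) \o ginv (art w).
have ws : weilM abs K rho s by apply: (weilM_comp S) => //; exact: (weilM_ginv S).
have sI : inertia abs K s.
  split; first by case: ws => -[].
  move=> y y1; rewrite -{2}(ginvKV g2K y) /s /=.
  have gy1 : abs (ginv (art w) y) <= 1 by rewrite (abs_GalF cP _ QK (Gal_ginv g2K)).
  by apply: (absB_trans_lt cP (f1 _ gy1)); rewrite (absB_sym cP); exact: f2.
have e : Phi (x * w) j = psi s j j * Phi w j.
  have -> : Phi (x * w) j = psi (s \o art w) j j.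
    by rewrite /Phi /s -compA (ginv_comp g2K).
  rewrite psi_comp' //; exact: (diag_mul j (weilM_psi' ws).2 (weilM_psi' ww).2).2.
have Pw0 : Phi w j != 0.
  apply: (diag_unit_neq0 j (weilM_psi' ww).2).
  exact: (psi_unit phi_param gm_unit (weilM_psi' ww).1).
move: e; rewrite PhiM // => /(mulIf Pw0) ->.
exact: (psi_inertiaM_root S tt_gen phi_param phi_tame gm_unit z_fixed phi_tt phi_Fr j sI ws.2).
Qed.

Let N_gt0 : (0 < N)%N.
Proof.
by rewrite /N -subn1 subn_gt0; apply: leq_trans (ltn_expl _ q_gt1); exact: m_gt0.
Qed.

Let N_unit : abs (N%:R : Omega) = 1.
Proof. by apply: (abs_card_pred cP (ts_residue S)); exact: m_gt0. Qed.

Lemma M_principal_root m u v : (0 < m)%N -> abs (m%:R : Omega) = 1 -> M u ->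
  v ^+ m = u -> abs (v - 1) < 1 -> M v.
Proof.
move=> m0 m1 hu vE hv s hs h1; have hM : Gal M s by apply/(Gal_M S).
apply: (principal_root_unique cP p_prime m0 m1) => //.
  exact: (principal_Gal cP QK hs).
have su : s u = u := hu _ hs h1.
by move: su; have [f ->] := Gal_rmorphism hs => su; rewrite -rmorphXn vE su.
Qed.

(** Since $N$ is a unit at $p$, a principal unit is the $N$-th power of a principal unit. *)
Lemma Phi_principal u j : M u -> abs (u - 1) < 1 -> Phi u j = 1.
Proof.
move=> hu u1; have [v vE v1] := principal_root cP N_gt0 N_unit u1.
have Mv := M_principal_root N_gt0 N_unit hu vE v1.
rewrite -vE PhiX //; first exact: (Phi_unit _ Mv (abs_princ_unit cP v1)).
exact: (abs_princ_neq0 cP v1).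
Qed.

Definition principal (t : 'rV[Omega]_n) := forall i, abs (t 0 i - 1) < 1.

Lemma principal_sqrt u : abs (u - 1) < 1 -> exists2 v, v ^+ 2 = u & abs (v - 1) < 1.
Proof. by apply: (principal_root cP) => //; exact: (abs2 S). Qed.

Lemma principal_sqrt_unique u v : abs (u - 1) < 1 -> abs (v - 1) < 1 ->
  u ^+ 2 = v ^+ 2 -> u = v.
Proof. by apply: (principal_root_unique cP p_prime) => //; exact: (abs2 S). Qed.

Lemma points_Mur_M (t : 'rV[Omega]_n) i : points rho Mur t -> M (t 0 i).
Proof.
move=> [_ ht] s hs h1.
have hsM : Gal Mur s by apply/(Gal_Mur S); split => //; left.
have /rowP/(_ i) := ht _ hsM; rewrite (@gactE _ _ rho s false 1%g).
  by rewrite invg1 perm1.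
by rewrite h1 signed_perm_1.
Qed.

Lemma points_Mur_tt (t : 'rV[Omega]_n) i : points rho Mur t -> t 0 i = (tt (t 0 (rev_ord i)))^-1.
Proof.
move=> [_ ht]; have /rowP/(_ i) := ht _ (tt_Gal_Mur S).
rewrite (gactE _ _ (rho_tt S)) perm_revV permE => <-.
by have [f ->] := Gal_rmorphism ttG; rewrite fmorphV.
Qed.

(* The point is the transfer of [sum_j delta_j [art u_j]], where [u_j] is the
   square root of its [j]-th coordinate: since [p] is odd, it is the norm from
   [M] of its square root. *)
Theorem llc_principal (chi : 'rV[Omega]_n -> C) (t : 'rV[Omega]_n) :
  llc_torus abs rho Mur M art (fun s i => (Lconj gm phi s).1 i i) chi ->
  points rho Mur t -> principal t -> chi t = 1.
Proof.
move=> [_ hchi] ht pt.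
have /choice[u hu] i : exists v, v ^+ 2 = t 0 i /\ abs (v - 1) < 1.
  by have [v h1 h2] := principal_sqrt (pt i); exists v.
have Mu i : M (u i).
  have [uE u1] := hu i; apply: (M_principal_root _ (abs2 S) (points_Mur_M i ht) uE u1) => //.
have u0 i : u i != 0 by case: (hu i) => _; exact: (abs_princ_neq0 cP).
have utt l : (tt (u (rev_ord l)))^-1 = u l.
  have [uE u1] := hu l; have [uE' u1'] := hu (rev_ord l).
  apply: principal_sqrt_unique => //.
    by apply: (principalV cP); exact: (principal_Gal cP QK ttG).
  rewrite uE (points_Mur_tt l ht) -uE' exprVn; congr (_^-1).
  by have [f ->] := Gal_rmorphism ttG; rewrite rmorphXn.
pose w (j : 'I_n) := art (u j).
pose x (j : 'I_n) : 'cV[int]_n := delta_mx j 0.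
(* The transfer along the representatives [id] and [tt]: the second one turns [art (u j)] into its
   conjugate by [tt], which is the Artin symbol of [tt (u j)] by equivariance. *)
pose b (i : 'I_2) (j : 'I_n) := if i == 0 then u j else tt (u j).
have ww j : weil abs M (w j) := art_weil artM' (Mu j) (u0 j).
have artG : weil abs M `<=` Gal Qp.
  by move=> s /weilM_sub[hs _]; apply: Gal_sub QK _; case: hs.
have -> : chi t = \prod_j \prod_l (Lconj gm phi (w j)).1 l l ^ (x j) l 0.
  apply: (hchi 2 n (fun i => if i == 0 then id else tt) w x b t).
  - exact: (coset_reps_weil S M_card).
  - by move=> j; exact: (weil_M_Mur S M_card).
  - rewrite big1 // => j _; have [_ ->] := weilM_sub (ww j).
    by rewrite trmx1 mul1mx subrr.
  - move=> i j; rewrite /b; case: ifP => _.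
      split => //; exists 0, (w j); split => //; exact: eq_ab_refl.
    have Mtt : M (tt (u j)) := M_stable S ttG (Mu j).
    split => //.
      by have [f ->] := Gal_rmorphism ttG; rewrite fmorph_eq0.
    exists 1, (tt \o w j \o ginv tt); split.
    + exact: (weil_M_conj S).
    + by rewrite -[RHS]compA /= (ginv_comp ttG).
    apply: (eq_ab_sym cP artG).
    apply: (art_equivariant artM' (D := Mur)) => //.
    + exact: finite_ext_Mur_M S.
    + exact: tt_Gal_Mur S.
    + apply: Gal_ginv; exact: tt_Gal_Mur S.
    + exact: (comp_ginv ttG).
    + by move=> y hy; exact: (M_stable S ttG hy).
    + exact: Mu.
  - move=> l; rewrite !big_ord_recl big_ord0 mulr1 /b /=.
    rewrite (bigD1 l) //= big1 => [|j /negPf ne]; last first.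
      by rewrite /corho (rho_id S) invmx1 trmx1 mul1mx !mxE eq_sym ne expr0z.
    rewrite /corho (rho_id S) invmx1 trmx1 mul1mx {1}/x !mxE !eqxx expr1z mulr1.
    have JT : (invmx (rho tt))^T = signed_perm_mx true (perm (@rev_ord_inj n)).
      rewrite (rho_tt S) signed_perm_inv perm_revV; apply/matrixP => a c; rewrite !mxE.
      by rewrite !permE [c == _]eq_sym (can2_eq (@rev_ordK n) (@rev_ordK n)).
    rewrite (bigD1 (rev_ord l)) //= JT big1 => [|j /negPf ne]; last first.
      rewrite signed_perm_delta permE !mxE [l == _]eq_sym (can2_eq (@rev_ordK n) (@rev_ordK n)).
      by rewrite ne mulr0 expr0z.
    rewrite signed_perm_delta permE rev_ordK !mxE !eqxx !mulr1 expr1 exprN1 utt.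
    by rewrite -expr2; case: (hu l).
rewrite big1 // => j _; rewrite big1 // => l _.
have [<-|ne] := eqVneq l j; last by rewrite !mxE (negPf ne) expr0z.
have := @Phi_principal (u l) l (Mu l) (hu l).2; rewrite /Phi /psi => ->.
by rewrite exp1rz.
Qed.

End PrincipalTrivial.

(** * Models of the torus *)

Section CharactersOfTorus.
Variables (Omega : closedFieldType) (n : nat).
Implicit Types (t : 'rV[Omega]_n) (l : 'cV[int]_n).

Lemma tcharD l l' t : torus t -> tchar (l + l') t = tchar l t * tchar l' t.
Proof.
move=> ht; rewrite /tchar -big_split; apply: eq_bigr => i _ /=.
by rewrite mxE expfzDr //; exact: ht.
Qed.

Lemma tchar0 t : tchar 0 t = 1.
Proof. by rewrite /tchar big1 // => i _; rewrite mxE expr0z. Qed.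

Lemma tchar_delta i t : tchar (delta_mx i 0) t = t 0 i.
Proof. by have := tchar_signed_delta false i t; rewrite expr0 scale1r. Qed.

Lemma tmul_torus t t' : torus t -> torus t' -> torus (tmul t t').
Proof. by move=> h h' i; rewrite mxE mulf_neq0 ?h ?h'. Qed.

Lemma tinv_torus t : torus t -> torus (tinv t).
Proof. by move=> h i; rewrite mxE invr_eq0; exact: h. Qed.

Lemma tone_torus : torus (tone Omega n).
Proof. by move=> i; rewrite mxE oner_neq0. Qed.

Lemma tmulV t : torus t -> tmul t (tinv t) = tone Omega n.
Proof. by move=> h; apply/rowP => i; rewrite !mxE divff //; exact: h. Qed.

Lemma tmulA t1 t2 t3 : tmul t1 (tmul t2 t3) = tmul (tmul t1 t2) t3.
Proof. by apply/rowP => i; rewrite !mxE mulrA. Qed.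

Lemma tmulC t1 t2 : tmul t1 t2 = tmul t2 t1.
Proof. by apply/rowP => i; rewrite !mxE mulrC. Qed.

Lemma tmul1 t : tmul t (tone Omega n) = t.
Proof. by apply/rowP => i; rewrite !mxE mulr1. Qed.

End CharactersOfTorus.

Section GaloisActionOnTorus.
Variables (R : realType) (Omega : closedFieldType) (abs : Omega -> R).
Variables (p : nat) (Qp K E : set Omega).
Variables (OK : comNzRingType) (iota : {rmorphism OK -> Omega}).
Variables (k : finFieldType) (res : {rmorphism OK -> k}).
Variables (n : nat) (h : 'M[Omega]_n) (tt Fr : Omega -> Omega) (omega : 'S_n).
Variables (rho : (Omega -> Omega) -> 'M[int]_n) (art : Omega -> Omega -> Omega).
Hypothesis S :
  torus_setting abs p Qp K E iota res h tt Fr omega rho art.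
Implicit Types (x y z : Omega) (s t g : Omega -> Omega).

Let cP := ts_closure S.
Let p_prime := ts_prime S.
Let q := #|k|.
Let KF : is_subfield K := base_field (ts_finite S).
Let QK : Qp `<=` K := base_sub (ts_finite S).
Let M := splitting_field rho K.
Let Fr_frob := ts_Fr S.
Let FrG : Gal K Fr := Fr_Gal (ts_Fr S).
Let FrnG i : Gal K (iter i Fr) := Gal_iter i FrG.
Let ttG : Gal K tt. Proof. by case: (ts_tt S). Qed.
Let q_gt1 : (1 < q)%N := card_k_gt1 k.
Implicit Types (P T : 'rV[Omega]_n) (l : 'cV[int]_n).

Lemma tchar_gact s l T : Gal K s -> torus T ->
  tchar l (gact rho s T) = s (tchar (invmx (rho s) *m l) T).
Proof.
move=> hs hT; have [e [w hw]] := rho_signed_perm S hs.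
rewrite hw signed_perm_inv /tchar (reindex_inj (@perm_inj _ w)) /=.
have [f fE] := Gal_rmorphism hs; rewrite [in RHS]fE rmorph_prod.
apply: eq_bigr => i _; rewrite (gactE _ _ hw) permK fE.
have -> : (signed_perm_mx e w^-1%g *m l) i 0 = (-1) ^+ e * l (w i) 0.
  rewrite mxE (bigD1 (w i)) //= mxE permK eqxx mulr1 big1 ?addr0 // => j ne.
  rewrite mxE; case: eqP => [h0|_]; last by rewrite mulr0 mul0r.
  by move: ne; rewrite h0 permKV eqxx.
rewrite fmorphXz; case: (e); last by rewrite expr0 mul1r.
by rewrite expr1 mulN1r fmorphV exprz_inv.
Qed.

Lemma gact_torus s T : Gal K s -> torus T -> torus (gact rho s T).
Proof.
move=> hs hT i; rewrite -tchar_delta tchar_gact //.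
have [f ->] := Gal_rmorphism hs; rewrite fmorph_eq0 /tchar.
by apply/prodf_neq0 => j _; rewrite expfz_neq0 //; exact: hT.
Qed.

Lemma gact_comp s t T : Gal K s -> Gal K t -> torus T ->
  gact rho (s \o t) T = gact rho s (gact rho t T).
Proof.
move=> hs ht hT; apply/rowP => i; rewrite [LHS]mxE [RHS]mxE tchar_gact //=.
congr (s (t (tchar _ T))); rewrite (rho_comp S) // mulmxA; congr (_ *m _).
have [e [w ->]] := rho_signed_perm S hs; have [e' [w' ->]] := rho_signed_perm S ht.
by rewrite signed_perm_mul !signed_perm_inv signed_perm_mul invMg addbC.
Qed.

Lemma gact_id T : gact rho id T = T.
Proof.
apply/rowP => i; rewrite (@gactE _ _ rho id false 1%g) ?invg1 ?perm1 //.
by rewrite (rho_id S) signed_perm_1.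
Qed.

Lemma gact_ginv s T : Gal K s -> torus T -> gact rho s (gact rho (ginv s) T) = T.
Proof.
move=> hs hT; rewrite -gact_comp //; last exact: Gal_ginv.
by rewrite (comp_ginv hs) gact_id.
Qed.

(* Coset representatives of the kernel of [rho] in [Gal K]. *)
Definition gal_rep (a : bool * 'I_#[omega]%g) : Omega -> Omega :=
  if a.1 then tt \o iter a.2 Fr else iter a.2 Fr.

Lemma gal_rep_Gal a : Gal K (gal_rep a).
Proof. by rewrite /gal_rep; case: ifP => _ //; exact: Gal_comp. Qed.

Lemma rho_gal_rep a : rho (gal_rep a) =
  signed_perm_mx a.1 (if a.1 then (omega ^+ a.2)%g * perm (@rev_ord_inj n) else (omega ^+ a.2))%g.
Proof.
rewrite /gal_rep; case: a => [[] i] /=; last exact: rho_Frn S i.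
by rewrite (rho_comp S) // (rho_tt S) (rho_Frn S) signed_perm_mul.
Qed.

Lemma signed_perm_inj e w e' w' :
  signed_perm_mx e w = signed_perm_mx e' w' :> 'M_n -> e = e' /\ w = w'.
Proof.
move=> h0; have : signed_perm_mx e w *m invmx (signed_perm_mx e' w') = 1%:M :> 'M_n.
  by rewrite h0 signed_perm_inv signed_perm_mul addbb mulVg signed_perm_1.
rewrite signed_perm_inv signed_perm_mul => /(signed_perm_neg (ts_dim S))[h1 h2].
split; first by move: h1; case: (e); case: (e').
by move/(congr1 (mulg w')): h2; rewrite mulKVg mulg1.
Qed.

Lemma rho_gal_rep_inj a b : rho (gal_rep a) = rho (gal_rep b) -> a = b.
Proof.
rewrite !rho_gal_rep => /signed_perm_inj[h1 h2]; case: a b h1 h2 => [e i] [e' j] /= <- h2.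
congr (_, _); apply/val_inj => /=.
have {}h2 : (omega ^+ i)%g = (omega ^+ j)%g by case: e h2 => // /mulIg.
by apply/eqP; have := eq_expg_mod_order omega i j; rewrite h2 eqxx !modn_small // => /esym/eqP ->.
Qed.

Lemma gal_rep_cover s : Gal K s -> exists a, rho s = rho (gal_rep a).
Proof.
move=> hs; have [t [i [ht ->]]] := rho_decomposition S hs.
have hi : (i %% #[omega]%g < #[omega]%g)%N by rewrite ltn_pmod // order_gt0.
have ei : rho (iter i Fr) = rho (iter (Ordinal hi) Fr).
  by rewrite !(rho_Frn S) /= expg_mod_order.
rewrite ei; case: (rho_inertia S ht) => ->.
  by exists (false, Ordinal hi); rewrite mul1mx.
by exists (true, Ordinal hi); rewrite /gal_rep /= (rho_comp S) // (rho_tt S).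
Qed.

Lemma rho_eq_M s t x : Gal K s -> Gal K t -> rho s = rho t -> M x -> s x = t x.
Proof.
move=> hs ht e hx; have : (ginv t \o s) x = x.
  apply: hx; first by apply: Gal_comp => //; exact: Gal_ginv.
  rewrite (rho_comp S) //; last exact: Gal_ginv.
  by rewrite (rho_ginv S) // e mulVmx // (rho_unit S).
by move/(congr1 t); rewrite /= (ginvKV ht).
Qed.

Lemma separating_M : exists2 th, M th & forall a b,
  gal_rep a th = gal_rep b th -> a = b.
Proof.
have MF : is_subfield M by exact: M_subfield.
have wit a b : a != b -> exists2 x, M x & gal_rep a x <> gal_rep b x.
  move=> ab; apply: contrapT => no; move/negP: ab; apply; apply/eqP.
  apply: rho_gal_rep_inj.
  have ha := gal_rep_Gal a; have hb := gal_rep_Gal b; have hib := Gal_ginv hb.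
  have : Gal M (ginv (gal_rep b) \o gal_rep a).
    case: (Gal_comp hib ha) => h1 h2 h3 _; split => // x hx /=.
    apply: (Gal_inj hb); rewrite (ginvKV hb); apply: contrapT => ne; apply: no.
    by exists x.
  move/(Gal_M S) => [_]; rewrite (rho_comp S) // (rho_ginv S) //.
  by move/(congr1 (mulmx (rho (gal_rep b)))); rewrite mulmxA mulmxV ?(rho_unit S) // mul1mx mulmx1.
have /choice[x hx] (ab : (bool * 'I_#[omega]%g) * (bool * 'I_#[omega]%g)) :
    exists x, M x /\ (ab.1 != ab.2 -> gal_rep ab.1 x <> gal_rep ab.2 x).
  have [_|ne] := eqVneq ab.1 ab.2; first by exists 0; split => //; exact: is_subfield0.
  by have [x h1 h2] := wit _ _ ne; exists x.
have [th [th1 th2]] := separating_element cP p_prime [seq x ab | ab <- enum predT].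
exists th; first by apply: th1 => // _ /mapP[ab _ ->]; case: (hx ab).
move=> a b e; apply/eqP; apply: contraT => ne.
have [_ /(_ ne)] := hx (a, b); case; apply: th2 => //.
- by apply: Gal_sub (gal_rep_Gal a).
- by apply: Gal_sub (gal_rep_Gal b).
- by apply: map_f; rewrite mem_enum.
Qed.

(** The trace from $M$ to $K$ of the function $c\,l$ on the torus, summed over representatives of
    $\mathrm{Gal}(M/K)$; such traces are regular functions over $K$. *)
Definition trace_char c l T : Omega :=
  \sum_a gal_rep a c * tchar (rho (gal_rep a) *m l) T.

Lemma trace_char_equivariant c l s T : M c -> Gal K s -> torus T ->
  trace_char c l (gact rho s T) = s (trace_char c l T).
Proof.
move=> hc hs hT.
have /choice[sg hsg] a : exists b, rho (s \o gal_rep a) = rho (gal_rep b).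
  by apply: gal_rep_cover; apply: Gal_comp => //; exact: gal_rep_Gal.
have rs a : rho (gal_rep (sg a)) = rho s *m rho (gal_rep a).
  by rewrite -hsg (rho_comp S) //; exact: gal_rep_Gal.
have inj : injective sg.
  move=> a b e; apply: rho_gal_rep_inj; have := rs a; rewrite e rs.
  by move/(congr1 (mulmx (invmx (rho s)))); rewrite !mulmxA mulVmx ?(rho_unit S) // !mul1mx.
rewrite /trace_char (reindex_inj inj) /=.
have e a : gal_rep (sg a) c * tchar (rho (gal_rep (sg a)) *m l) (gact rho s T)
    = s (gal_rep a c * tchar (rho (gal_rep a) *m l) T).
  rewrite tchar_gact // rs !mulmxA mulVmx ?(rho_unit S) // mul1mx.
  have -> : gal_rep (sg a) c = s (gal_rep a c).
    apply/esym/(@rho_eq_M (s \o gal_rep a)) => //.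
    - by apply: Gal_comp => //; exact: gal_rep_Gal.
    - exact: gal_rep_Gal.
  by have [f ->] := Gal_rmorphism hs; rewrite rmorphM.
rewrite (eq_bigr _ (fun a _ => e a)).
by have [f ->] := Gal_rmorphism hs; rewrite rmorph_sum.
Qed.

Lemma trace_char_regular c l : M c -> regular_function rho K (trace_char c l).
Proof.
move=> hc; split; last by move=> s T hs hT; exact: trace_char_equivariant.
exists #|{: bool * 'I_#[omega]%g}|, (fun i => gal_rep (enum_val i) c),
  (fun i => rho (gal_rep (enum_val i)) *m l) => T _.
rewrite /trace_char (reindex (@enum_val _ predT)) //=.
by apply: onW_bij; exact: enum_val_bij.
Qed.

(* Lagrange interpolation at the conjugates of a separating element inverts
   the system of traces. *)
Lemma char_trace_span l : exists (m : nat) (d c : 'I_m -> Omega),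
  (forall i, M (c i)) /\
  forall T, torus T -> tchar l T = \sum_i d i * trace_char (c i) l T.
Proof.
have [th hth sep] := separating_M.
pose a0 : bool * 'I_#[omega]%g := (false, Ordinal (order_gt0 omega)).
pose Q : {poly Omega} := \prod_(a | a != a0)
  ((gal_rep a0 th - gal_rep a th)^-1 *: ('X - (gal_rep a th)%:P)).
have Qa a : Q.[gal_rep a th] = (a == a0)%:R.
  rewrite /Q horner_prod; have [->|ne] := eqVneq a a0.
    rewrite big1 // => b ne; rewrite hornerZ hornerXsubC mulVf //.
    by rewrite subr_eq0; apply: contra ne => /eqP/sep ->.
  by rewrite (bigD1 a) //= hornerZ hornerXsubC subrr mulr0 mul0r.
exists (size Q), (fun i => Q`_i), (fun i => th ^+ i); split.
  by move=> i; exact: (is_subfieldX i (M_subfield K rho) hth).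
move=> T hT; rewrite /trace_char.
under eq_bigr do rewrite mulr_sumr.
rewrite exchange_big /=.
rewrite (eq_bigr (fun a => Q.[gal_rep a th] * tchar (rho (gal_rep a) *m l) T)).
  rewrite (bigD1 a0) //= Qa eqxx mul1r big1 ?addr0 => [|a /negPf ne].
    by rewrite /gal_rep /= (rho_id S) mul1mx.
  by rewrite Qa ne mul0r.
move=> a _; rewrite horner_coef mulr_suml; apply: eq_bigr => i _.
by have [f ->] := Gal_rmorphism (gal_rep_Gal a); rewrite rmorphXn mulrA.
Qed.

Variables (A : comAlgType OK) (ev : A -> 'rV[Omega]_n -> Omega).
Hypothesis model : torus_model rho K iota ev.

Lemma ev1 T : torus T -> ev 1 T = 1.
Proof. by case: model => hh _ _ _ /hh[]. Qed.
Lemma evD a b T : torus T -> ev (a + b) T = ev a T + ev b T.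
Proof. by case: model => hh _ _ _ /hh[]. Qed.
Lemma evM a b T : torus T -> ev (a * b) T = ev a T * ev b T.
Proof. by case: model => hh _ _ _ /hh[]. Qed.
Lemma evZ c a T : torus T -> ev (c *: a) T = iota c * ev a T.
Proof. by case: model => hh _ _ _ /hh[]. Qed.
Lemma ev0 T : torus T -> ev 0 T = 0.
Proof. by move=> hT; rewrite -(scale0r 1) evZ // rmorph0 mul0r. Qed.

Lemma ev_inj a b : (forall T, torus T -> ev a T = ev b T) -> a = b.
Proof. by case: model => _ hh _ _; exact: hh. Qed.

Lemma ev_gact a s T : Gal K s -> torus T -> ev a (gact rho s T) = s (ev a T).
Proof. by case: model => _ _ /(_ a)[_ hh] _; exact: hh. Qed.

Definition lin_comb (r : seq (Omega * A)) T := \sum_(x <- r) x.1 * ev x.2 T.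

Lemma iota_inj : injective iota.
Proof. by case: (ts_integers S). Qed.

(** A character is in general not defined over $K$, but it is a combination over [Omega] of traces,
    which lie in the model up to denominators. Points are thus separated by the model and can be
    rebuilt from it. *)
Theorem char_span l : exists r, forall T, torus T -> tchar l T = lin_comb r T.
Proof.
have [m [d [c [hc span]]]] := char_trace_span l.
have /choice[ka hka] i : exists ka : OK * A, ka.1 != 0 /\
    forall T, torus T -> iota ka.1 * trace_char (c i) l T = ev ka.2 T.
  case: model => _ _ _ /(_ _ (trace_char_regular l (hc i)))[kap k0 [a ha]].
  by exists (kap, a).
exists [seq (d i / iota (ka i).1, (ka i).2) | i <- enum 'I_m] => T hT.
rewrite span // /lin_comb big_map big_enum /=; apply: eq_bigr => i _.
have [k0 <-] := hka i => //.
have n0 : iota (ka i).1 != 0 by rewrite -(rmorph0 iota) (inj_eq iota_inj).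
by rewrite mulrA divfK.
Qed.

Lemma torus_separated T T' : torus T -> torus T' ->
  (forall a, ev a T = ev a T') -> T = T'.
Proof.
move=> hT hT' e; apply/rowP => i.
have [r hr] := char_span (delta_mx i 0).
by rewrite -!tchar_delta !hr //; apply: eq_bigr => x _; rewrite e.
Qed.

Lemma clear_denominators (r : seq Omega) : (forall x, x \in r -> K x) ->
  exists2 w, w != 0 /\ K w & forall x, x \in r -> abs (w * x) <= 1.
Proof.
move=> hr; have [w [Kw w0 w1 _]] := K_uniformizer S.
have one x : exists N, forall j, (N <= j)%N -> abs (w ^+ j * x) <= 1.
  have [->|x0] := eqVneq x 0; first by exists 0%N => j _; rewrite mulr0 (abs0 cP).
  apply: contrapT => no.
  have : 1 <= abs w; last by rewrite leNgt w1.
  apply: (@expr_le_bound R 1 (abs w) (abs x)); rewrite ?(abs_ge0 cP) // => j.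
  rewrite expr1n leNgt; apply/negP => lt; apply: no; exists j => i hi.
  rewrite (absM cP) (absX cP) mulrC; apply: le_trans (ltW lt).
  by rewrite ler_wpM2l ?(abs_ge0 cP) // ler_wiXn2l ?(abs_ge0 cP) // ltW.
have [N hN] : exists N, forall x, x \in r -> abs (w ^+ N * x) <= 1.
  elim: r {hr} => [|x r [N IH]]; first by exists 0%N.
  have [N' hN'] := one x; exists (maxn N N') => y; rewrite inE => /orP[/eqP->|hy].
    by apply: hN'; exact: leq_maxr.
  rewrite -(subnK (leq_maxl N N')) exprD -mulrA; apply: (absM_le1 cP); last exact: IH.
  by apply: (absX_le1 cP); exact: ltW.
exists (w ^+ N) => //; split; first by rewrite expf_neq0.
exact: is_subfieldX.
Qed.

Section HomToPoint.
Variable g : A -> OK.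
Hypothesis g1 : g 1 = 1.
Hypothesis gD : forall a b, g (a + b) = g a + g b.
Hypothesis gM : forall a b, g (a * b) = g a * g b.
Hypothesis gZ : forall c a, g (c *: a) = c * g a.

Let g0' : g 0 = 0.
Proof. by rewrite -(scale0r 1) gZ mul0r. Qed.

(* Galois descent: a relation over [Omega] of minimal support on which the
   functional does not vanish would be defined over [K]. *)
Lemma relation_descent m (c : 'I_m -> Omega) (a : 'I_m -> A) :
  (forall T, torus T -> \sum_i c i * ev (a i) T = 0) ->
  \sum_i c i * iota (g (a i)) = 0.
Proof.
pose supp (c : 'I_m -> Omega) := [set i | c i != 0]%SET.
elim: {c}(#|supp c|) {-2}c (leqnn #|supp c|) => [|N IH] c.
  rewrite leqn0 cards_eq0 => /eqP c0 _; rewrite big1 // => i _.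
  have /eqP-> : c i == 0; last by rewrite mul0r.
  by apply: contraT => ci; rewrite -(finset.in_set0 i) -c0 inE.
move=> sN rel.
have [[j0 cj0]|all0] := pselect (exists j, c j != 0); last first.
  rewrite big1 // => i _; have /eqP-> : c i == 0; last by rewrite mul0r.
  by apply: contraT => ci; case: all0; exists i.
pose c1 i := c i / c j0.
have rel1 T : torus T -> \sum_i c1 i * ev (a i) T = 0.
  move=> hT; have -> : \sum_i c1 i * ev (a i) T = (\sum_i c i * ev (a i) T) / c j0.
    by rewrite mulr_suml; apply: eq_bigr => i _; rewrite /c1 mulrAC.
  by rewrite rel // mul0r.
suff e : \sum_i c1 i * iota (g (a i)) = 0.
  have -> : \sum_i c i * iota (g (a i)) = c j0 * \sum_i c1 i * iota (g (a i)).
    by rewrite mulr_sumr; apply: eq_bigr => i _; rewrite /c1 mulrA mulrCA divff // mulr1.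
  by rewrite e mulr0.
have supp_lt (c' : 'I_m -> Omega) j : c j != 0 -> c' j = 0 ->
    (forall i, c i = 0 -> c' i = 0) -> (#|supp c'| <= N)%N.
  move=> cj c'j sub; rewrite -ltnS; apply: leq_trans sN; apply: proper_card.
  apply/properP; split; last by exists j; rewrite inE ?cj // c'j eqxx.
  by apply/fintype.subsetP => i; rewrite !inE; apply: contra => /eqP/sub ->.
(* Over $K$ the relation, cleared of denominators, holds in [A] itself, and [g] can be applied to
   it. *)
have [KK|nK] := pselect (forall i, K (c1 i)).
  have [|w [w0 Kw] hw] := @clear_denominators [seq c1 i | i <- enum 'I_m].
    by move=> _ /mapP[i _ ->].
  have /choice[e he] i : exists e, iota e = w * c1 i.
    apply: (iota_surj (ts_integers S)); first exact: is_subfieldM.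
    by apply: hw; apply: map_f; rewrite mem_enum.
  have comb0 (J : seq 'I_m) T : torus T ->
      ev (\sum_(i <- J) e i *: a i) T = \sum_(i <- J) iota (e i) * ev (a i) T.
    move=> hT; elim: J => [|i J IHJ]; first by rewrite !big_nil ev0.
    by rewrite !big_cons evD // evZ // IHJ.
  have z : \sum_i e i *: a i = 0.
    apply: ev_inj => T hT; rewrite comb0 // ev0 //.
    transitivity (w * \sum_i c1 i * ev (a i) T); last by rewrite rel1 // mulr0.
    rewrite mulr_sumr; by apply: eq_bigr => i _; rewrite he mulrA.
  have gsum (J : seq 'I_m) : g (\sum_(i <- J) e i *: a i) = \sum_(i <- J) e i * g (a i).
    elim: J => [|i J IHJ]; first by rewrite !big_nil g0'.
    by rewrite !big_cons gD gZ IHJ.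
  apply: (mulfI w0); rewrite mulr0 mulr_sumr.
  transitivity (iota (g (\sum_i e i *: a i))); last by rewrite z g0' rmorph0.
  rewrite gsum rmorph_sum; by apply: eq_bigr => i _; rewrite rmorphM he mulrA.
have {nK}[j1 nKj] : exists j, ~ K (c1 j).
  by apply: contrapT => no; apply: nK => i; apply: contrapT => ni; apply: no; exists i.
have [s hs sc] : exists2 s, Gal K s & s (c1 j1) <> c1 j1.
  apply: contrapT => no; apply: nKj; apply: (Gal_fixed cP p_prime) => // s hs.
  by apply: contrapT => ne; apply: no; exists s.
(* The conjugate relation minus the relation itself: it vanishes at [j0], where [c1] is $1$, but not
   at [j1]. *)
pose c2 i := s (c1 i) - c1 i.
have rel2 T : torus T -> \sum_i c2 i * ev (a i) T = 0.
  move=> hT; under eq_bigr do rewrite mulrBl.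
  rewrite sumrB rel1 // subr0.
  have hT' : torus (gact rho (ginv s) T) by apply: gact_torus => //; exact: Gal_ginv.
  have := congr1 s (rel1 _ hT').
  have sev i : s (ev (a i) (gact rho (ginv s) T)) = ev (a i) T.
    by rewrite -ev_gact // gact_ginv.
  move: sev; have [f ->] := Gal_rmorphism hs => sev; rewrite rmorph0 rmorph_sum => e0.
  by rewrite -[RHS]e0; apply: eq_bigr => i _; rewrite rmorphM sev.
have c1z i : c i = 0 -> c1 i = 0 by move=> h0; rewrite /c1 h0 mul0r.
have c2z i : c i = 0 -> c2 i = 0.
  by move=> /c1z h0; rewrite /c2 h0; have [f ->] := Gal_rmorphism hs; rewrite rmorph0 subrr.
have c2j : c2 j1 != 0 by rewrite subr_eq0; apply/eqP.
have L2 : \sum_i c2 i * iota (g (a i)) = 0.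
  apply: IH => //; apply: (supp_lt _ j0) => //; rewrite /c2 /c1 divff //.
  by have [f ->] := Gal_rmorphism hs; rewrite rmorph1 subrr.
(* A multiple of [c2] is subtracted so as to cancel the coefficient at [j1]; both [c2] and [c3] have
   smaller support, and [c1] is a combination of them. *)
pose c3 i := c1 i - c1 j1 / c2 j1 * c2 i.
have L3 : \sum_i c3 i * iota (g (a i)) = 0.
  apply: IH.
    apply: (supp_lt _ j1); first by apply/eqP => /c2z/eqP; rewrite (negPf c2j).
      by rewrite /c3 divfK // subrr.
    by move=> i h0; rewrite /c3 (c1z i h0) (c2z i h0) mulr0 subrr.
  move=> T hT.
  have -> : \sum_i c3 i * ev (a i) T =
      \sum_i c1 i * ev (a i) T - c1 j1 / c2 j1 * \sum_i c2 i * ev (a i) T.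
    by rewrite mulr_sumr -sumrB; apply: eq_bigr => i _; rewrite /c3 mulrBl mulrA.
  by rewrite rel1 // rel2 // mulr0 subrr.
have -> : \sum_i c1 i * iota (g (a i)) =
    \sum_i c3 i * iota (g (a i)) + c1 j1 / c2 j1 * \sum_i c2 i * iota (g (a i)).
  by rewrite mulr_sumr -big_split; apply: eq_bigr => i _ /=; rewrite /c3; ring.
by rewrite L2 L3 mulr0 addr0.
Qed.

(** The extension of [g] to [Omega]-linear combinations of functions of the model, as a relation; it
    is single-valued by [relation_descent]. *)
Definition hom_value (f : 'rV[Omega]_n -> Omega) v : Prop :=
  exists2 r : seq (Omega * A), forall T, torus T -> f T = lin_comb r T
    & v = \sum_(x <- r) x.1 * iota (g x.2).

Lemma hom_value_unique f f' v v' : hom_value f v -> hom_value f' v' ->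
  (forall T, torus T -> f T = f' T) -> v = v'.
Proof.
move=> [r hr ->] [r' hr' ->] e; apply/eqP; rewrite -subr_eq0; apply/eqP.
pose R0 := r ++ [seq (- e1.1, e1.2) | e1 <- r'].
have comb (F : A -> Omega) : \sum_(x <- r) x.1 * F x.2 - \sum_(x <- r') x.1 * F x.2
   = \sum_(i < size R0) (nth (0, 0) R0 i).1 * F (nth (0, 0) R0 i).2.
  rewrite -(big_mkord xpredT (fun i => (nth (0, 0) R0 i).1 * F (nth (0, 0) R0 i).2)).
  rewrite -(big_nth (0, 0) xpredT (fun e1 : Omega * A => e1.1 * F e1.2)) big_cat big_map /= -sumrN.
  by congr (_ + _); apply: eq_bigr => x _; rewrite mulNr.
rewrite (comb (fun a => iota (g a))); apply: relation_descent => T hT.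
by rewrite -(comb (fun a => ev a T)) -!/(lin_comb _ _) -hr // -hr' // e // subrr.
Qed.

Lemma hom_value_ev a : hom_value (ev a) (iota (g a)).
Proof.
exists [:: (1, a)]; first by move=> T hT; rewrite /lin_comb big_seq1 mul1r.
by rewrite big_seq1 mul1r.
Qed.

Lemma hom_value_const c : hom_value (fun=> c) c.
Proof.
exists [:: (c, 1)]; first by move=> T hT; rewrite /lin_comb big_seq1 ev1 // mulr1.
by rewrite big_seq1 g1 rmorph1 mulr1.
Qed.

Lemma hom_valueD f f' v v' : hom_value f v -> hom_value f' v' ->
  hom_value (fun T => f T + f' T) (v + v').
Proof.
move=> [r hr ->] [r' hr' ->]; exists (r ++ r'); last by rewrite big_cat.
by move=> T hT; rewrite hr // hr' // /lin_comb big_cat.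
Qed.

Lemma hom_valueM f f' v v' : hom_value f v -> hom_value f' v' ->
  hom_value (fun T => f T * f' T) (v * v').
Proof.
move=> [r hr ->] [r' hr' ->].
exists [seq (e1.1 * e2.1, e1.2 * e2.2) | e1 <- r, e2 <- r'].
  move=> T hT; rewrite hr // hr' // /lin_comb big_allpairs_dep /= big_distrl.
  apply: eq_bigr => x _; rewrite big_distrr; apply: eq_bigr => y _ /=.
  by rewrite evM // mulrACA.
rewrite big_allpairs_dep /= big_distrl; apply: eq_bigr => x _; rewrite big_distrr.
by apply: eq_bigr => y _ /=; rewrite gM rmorphM mulrACA.
Qed.

Lemma hom_value_sum m (f : 'I_m -> 'rV[Omega]_n -> Omega) v :
  (forall i, hom_value (f i) (v i)) -> hom_value (fun T => \sum_i f i T) (\sum_i v i).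
Proof.
elim: m f v => [|m IH] f v hf.
  rewrite big_ord0; have [r hr e] := hom_value_const 0; exists r => // T hT.
  by rewrite big_ord0 -(hr _ hT).
rewrite big_ord_recl.
have [r hr e] := hom_valueD (hf ord0) (IH (fun i => f (lift ord0 i)) _ (fun i => hf _)).
by exists r => // T hT; rewrite big_ord_recl -(hr _ hT).
Qed.

(** The values of the extended [g] on characters are multiplicative and form a point of the torus.
    It is rational over $K$ because its conjugates have the same values on the model, which
    separates points. *)
Theorem point_of_hom : exists2 T, points rho K T & forall a, ev a T = iota (g a).
Proof.
have /choice[G hG] l : exists v, hom_value (tchar l) v.
  have [r hr] := char_span l; by exists (\sum_(x <- r) x.1 * iota (g x.2)), r.
have GD l l' : G (l + l') = G l * G l'.
  apply: (hom_value_unique (hG _) (hom_valueM (hG l) (hG l'))) => T hT.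
  exact: tcharD.
have G0 : G 0 = 1.
  by apply: (hom_value_unique (hG _) (hom_value_const 1)) => T hT; exact: tchar0.
have Gn0 l : G l != 0.
  apply/eqP => h0; have := GD (- l) l; rewrite addNr G0 h0 mulr0 => /eqP.
  by rewrite oner_eq0.
have GN l : G (- l) = (G l)^-1.
  by apply: (mulIf (Gn0 l)); rewrite -GD addNr G0 mulVf.
have Gn l (m : nat) : G (l *+ m) = G l ^+ m.
  by elim: m => [|m IH]; rewrite ?mulr0n ?G0 // mulrS GD IH exprS.
have GZ l (m : int) : G (m *: l) = G l ^ m.
  case: m => m; first by rewrite -[Posz m]natz scaler_nat Gn natz.
  by rewrite NegzE scaleNr GN -[Posz m.+1]natz scaler_nat Gn natz -exprnN.
pose T : 'rV[Omega]_n := \row_i G (delta_mx i 0).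
have hT : torus T by move=> i; rewrite mxE.
have charT l : tchar l T = G l.
  have lE : l = \sum_i l i 0 *: delta_mx i 0.
    apply/matrixP => i j; rewrite ord1 summxE (bigD1 i) //= !mxE !eqxx mulr1.
    by rewrite big1 ?addr0 // => a ne; rewrite !mxE eq_sym (negPf ne) mulr0.
  rewrite [in RHS]lE (big_morph G GD G0) /tchar; apply: eq_bigr => i _.
  by rewrite mxE GZ.
have evT a : ev a T = iota (g a).
  case: model => _ _ /(_ a)[[m [c [l hl]]] _] _.
  have hv := hom_value_sum (fun i => hom_valueM (hom_value_const (c i)) (hG (l i))).
  rewrite -(hom_value_unique hv (hom_value_ev a)) => [|T' hT'].
    by rewrite hl //; apply: eq_bigr => i _; rewrite charT.
  by rewrite hl.
exists T => //; split => // s hs; apply: torus_separated => //; first exact: gact_torus.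
move=> a; rewrite ev_gact // evT; apply: (Gal_fix hs).
by case: (iota_int (ts_integers S) (g a)).
Qed.

End HomToPoint.

End GaloisActionOnTorus.

(** * A curve through a principal point *)

Section FunctionAlgebra.
Variables (OK : comNzRingType) (F : fieldType) (iota : {rmorphism OK -> F}).
Variable T : Type.

(** The closure properties that make a set of functions an algebra over [OK]; the point keeps $1$
    distinct from $0$. *)
Record funset := Funset {
  funset_mem :> (T -> F) -> Prop;
  funset_point : T;
  funset1 : funset_mem (fun=> 1);
  funsetB : forall f g, funset_mem f -> funset_mem g -> funset_mem (fun x => f x - g x);
  funsetM : forall f g, funset_mem f -> funset_mem g -> funset_mem (fun x => f x * g x);
  funsetZ : forall c f, funset_mem f -> funset_mem (fun x => iota c * f x)
}.

Variable U : funset.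

Record funalg := Funalg { funval :> T -> F; funvalP : U funval }.

HB.instance Definition _ := gen_eqMixin funalg.
HB.instance Definition _ := gen_choiceMixin funalg.

Lemma funalg_ext (f g : funalg) : f =1 g -> f = g.
Proof.
case: f g => f hf [g hg] /= /funext e; subst g; congr Funalg; exact: Prop_irrelevance.
Qed.

Let U0 : U (fun=> 0).
Proof. by have := funsetB (funset1 U) (funset1 U); rewrite subrr. Qed.

Let UN f : U f -> U (fun x => - f x).
Proof.
by move=> /(funsetB U0); congr (funset_mem U _); apply: funext => x; rewrite sub0r.
Qed.

Let UD f g : U f -> U g -> U (fun x => f x + g x).
Proof.
move=> hf /UN/(funsetB hf); congr (funset_mem U _); apply: funext => x; by rewrite opprK.
Qed.

Definition fun_zero := Funalg U0.
Definition fun_opp (f : funalg) := Funalg (UN (funvalP f)).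
Definition fun_add (f g : funalg) := Funalg (UD (funvalP f) (funvalP g)).
Definition fun_one := Funalg (funset1 U).
Definition fun_mul (f g : funalg) := Funalg (funsetM (funvalP f) (funvalP g)).
Definition fun_scale c (f : funalg) := Funalg (funsetZ c (funvalP f)).

Program Definition funalg_zmod := GRing.isZmodule.Build funalg
  (zero := fun_zero) (opp := fun_opp) (add := fun_add) _ _ _ _.
Next Obligation. by move=> f g k; apply: funalg_ext => x; exact: addrA. Qed.
Next Obligation. by move=> f g; apply: funalg_ext => x; exact: addrC. Qed.
Next Obligation. by move=> f; apply: funalg_ext => x; exact: add0r. Qed.
Next Obligation. by move=> f; apply: funalg_ext => x; exact: addNr. Qed.
HB.instance Definition _ := funalg_zmod.

Program Definition funalg_ring := GRing.Zmodule_isComNzRing.Build funalg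
  (one := fun_one) (mul := fun_mul) _ _ _ _ _.
Next Obligation. by move=> f g k; apply: funalg_ext => x; exact: mulrA. Qed.
Next Obligation. by move=> f g; apply: funalg_ext => x; exact: mulrC. Qed.
Next Obligation. by move=> f; apply: funalg_ext => x; exact: mul1r. Qed.
Next Obligation. by move=> f g k; apply: funalg_ext => x; exact: mulrDl. Qed.
Next Obligation.
apply/eqP => /(congr1 (fun f : funalg => f (funset_point U))) /= /eqP.
by rewrite oner_eq0.
Qed.
HB.instance Definition _ := funalg_ring.

Program Definition funalg_lmod := GRing.Zmodule_isLmodule.Build OK funalg
  (scale := fun_scale) _ _ _ _.
Next Obligation. by move=> a b f; apply: funalg_ext => x /=; rewrite rmorphM mulrA. Qed.
Next Obligation. by move=> f; apply: funalg_ext => x /=; rewrite rmorph1 mul1r. Qed.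
Next Obligation. by move=> a f g; apply: funalg_ext => x; exact: mulrDr. Qed.
Next Obligation. by move=> f a b; apply: funalg_ext => x /=; rewrite rmorphD mulrDl. Qed.
HB.instance Definition _ := funalg_lmod.

Program Definition funalg_lalg := GRing.Lmodule_isLalgebra.Build OK funalg _.
Next Obligation. by move=> a f g; apply: funalg_ext => x; exact: mulrA. Qed.
HB.instance Definition _ := funalg_lalg.
HB.instance Definition _ := GRing.Lalgebra_isComAlgebra.Build OK funalg.

Lemma fun1E x : (1 : funalg) x = 1. Proof. by []. Qed.
Lemma funME (f g : funalg) x : (f * g) x = f x * g x. Proof. by []. Qed.
Lemma funZE c (f : funalg) x : (c *: f) x = iota c * f x. Proof. by []. Qed.
Lemma funXE (f : funalg) i x : (f ^+ i) x = f x ^+ i.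
Proof. by elim: i => [|i IH]; rewrite ?expr0 // !exprS -IH. Qed.

End FunctionAlgebra.

(** * Localization of the affine line *)

Section PolynomialLocalization.
Variables (OK : comNzRingType) (B : comAlgType OK) (X Y : B) (D : {poly OK}).
Hypothesis D_Y : horner_alg X D * Y = 1.
Hypothesis generated : forall b, exists P i, b = horner_alg X P * Y ^+ i.
Hypothesis X_free : forall P, horner_alg X P = 0 -> P = 0.

Let DXn i : horner_alg X D ^+ i * Y ^+ i = 1.
Proof. by rewrite -exprMn D_Y expr1n. Qed.

Lemma horner_algE (V : comAlgType OK) (x : V) P : horner_alg x P = \sum_(i < size P) P`_i *: x ^+ i.
Proof.
rewrite -[P in LHS]coefK poly_def linear_sum; apply: eq_bigr => i _.
rewrite linearZ rmorphXn /=. by rewrite horner_algX mulr_algl.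
Qed.

Lemma horner_algZ (V : comAlgType OK) (x : V) a P : horner_alg x (a *: P) = a *: horner_alg x P.
Proof. by rewrite -mul_polyC rmorphM /= horner_algC mulr_algl. Qed.

Lemma lrmorph_horner (V W : comAlgType OK) (f : {lrmorphism V -> W}) x P :
  f (horner_alg x P) = horner_alg (f x) P.
Proof.
elim/poly_ind: P => [|P c IH]; first by rewrite !rmorph0.
by rewrite !rmorphD !rmorphM /= IH !horner_algX !horner_algC rmorph_alg.
Qed.

Lemma loc_generated : algebra_generated B.
Proof.
exists [:: X; Y] => P hP P1 PD PM PZ b.
have [Q [i ->]] := generated b.
have PX z j : P z -> P (z ^+ j).
  by move=> hz; elim: j => [|j IH]; rewrite ?expr0 // exprS; exact: PM.
apply: PM; last by apply: PX; apply: hP; rewrite !inE eqxx orbT.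
rewrite horner_algE; elim/big_ind: _ => //.
  by rewrite -(scale0r 1); exact: PZ.
by move=> j _; apply/PZ/PX/hP; rewrite !inE eqxx.
Qed.

Lemma loc_eq P i Q j : horner_alg X P * Y ^+ i = horner_alg X Q * Y ^+ j ->
  P * D ^+ j = Q * D ^+ i.
Proof.
move=> e; apply/eqP; rewrite -subr_eq0; apply/eqP/X_free.
rewrite rmorphB !rmorphM !rmorphXn /=.
have := congr1 (fun z => z * (horner_alg X D ^+ i * horner_alg X D ^+ j)) e.
have -> : horner_alg X P * Y ^+ i * (horner_alg X D ^+ i * horner_alg X D ^+ j)
  = horner_alg X P * horner_alg X D ^+ j * (horner_alg X D ^+ i * Y ^+ i) by ring.
have -> : horner_alg X Q * Y ^+ j * (horner_alg X D ^+ i * horner_alg X D ^+ j)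
  = horner_alg X Q * horner_alg X D ^+ i * (horner_alg X D ^+ j * Y ^+ j) by ring.
by rewrite !DXn !mulr1 => ->; rewrite subrr.
Qed.

(* The universal property of [B] as the localization of [OK[X]] at [D]. *)
Lemma loc_hom (V : comAlgType OK) (c e : V) : horner_alg c D * e = 1 ->
  exists g : {lrmorphism B -> V}, g X = c /\ g Y = e.
Proof.
move=> hce.
have Dn i : horner_alg c D ^+ i * e ^+ i = 1 by rewrite -exprMn hce expr1n.
have val_eq P i Q j : horner_alg X P * Y ^+ i = horner_alg X Q * Y ^+ j ->
    horner_alg c P * e ^+ i = horner_alg c Q * e ^+ j.
  move=> /loc_eq/(congr1 (horner_alg c)); rewrite !rmorphM !rmorphXn /= => eq1.
  have := congr1 (fun z => z * (e ^+ i * e ^+ j)) eq1.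
  have -> : horner_alg c P * horner_alg c D ^+ j * (e ^+ i * e ^+ j)
    = horner_alg c P * e ^+ i * (horner_alg c D ^+ j * e ^+ j) by ring.
  have -> : horner_alg c Q * horner_alg c D ^+ i * (e ^+ i * e ^+ j)
    = horner_alg c Q * e ^+ j * (horner_alg c D ^+ i * e ^+ i) by ring.
  by rewrite !Dn !mulr1.
have /choice[N hN] b : exists Q : {poly OK} * nat, b = horner_alg X Q.1 * Y ^+ Q.2.
  by have [P [i ->]] := generated b; exists (P, i).
pose g b := horner_alg c (N b).1 * e ^+ (N b).2.
have gE P i : g (horner_alg X P * Y ^+ i) = horner_alg c P * e ^+ i.
  by apply: val_eq; rewrite -hN.
have g1 : g 1 = 1.
  by have := gE 1 0%N; rewrite !rmorph1 !expr0 !mulr1.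
have gM : {morph g : x y / x * y}.
  move=> x y; rewrite (hN x) (hN y); move: (N x) (N y) => [P i] [Q j] /=.
  rewrite mulrACA -rmorphM -exprD !gE rmorphM exprD /=; ring.
have gL : linear g.
  move=> a x y; rewrite (hN x) (hN y); move: (N x) (N y) => [P i] [Q j] /=.
  have -> : a *: (horner_alg X P * Y ^+ i) + horner_alg X Q * Y ^+ j
    = horner_alg X (a *: (P * D ^+ j) + Q * D ^+ i) * Y ^+ (i + j).
    rewrite rmorphD /= horner_algZ !rmorphM !rmorphXn /= exprD mulrDl scalerAl; congr (_ + _).
      by rewrite -!scalerAl -!mulrA; congr (_ *: (_ * _)); rewrite mulrCA DXn mulr1.
    by rewrite mulrA -(mulrA _ (_ ^+ i)) DXn mulr1.
  rewrite !gE rmorphD /= horner_algZ !rmorphM !rmorphXn /= exprD mulrDl scalerAl; congr (_ + _).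
    by rewrite -!scalerAl -!mulrA; congr (_ *: (_ * _)); rewrite mulrCA Dn mulr1.
  by rewrite mulrA -(mulrA _ (_ ^+ i)) Dn mulr1.
pose gl := HB.pack_for {lrmorphism B -> V} g (GRing.isLinear.Build OK B V _ g gL)
  (GRing.isMonoidMorphism.Build B V g (g1, gM)).
exists gl; split; rewrite /gl /=.
  by have := gE 'X 0%N; rewrite !horner_algX !expr0 !mulr1.
by have := gE 1 1%N; rewrite !rmorph1 !expr1 !mul1r.
Qed.

(** The images of [X] and [Y] are lifted arbitrarily to $c$ and $e_0$. The error $m=D(c)e_0-1$ has
    square zero, so that $e_0(1-m)$ is an exact inverse of $D(c)$, and the universal property
    applies. *)
Lemma loc_smooth : smooth B.
Proof.
split; first exact: loc_generated.
move=> C V f f_surj f_nil g.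
have [c hc] := f_surj (g X); have [e0 he0] := f_surj (g Y).
pose m := horner_alg c D * e0 - 1.
have fm : f m = 0.
  by rewrite rmorphB rmorphM /= lrmorph_horner hc he0 -lrmorph_horner -rmorphM D_Y !rmorph1 subrr.
have mm : m * m = 0 by exact: f_nil.
have [|g' [gX gY]] := @loc_hom C c (e0 * (1 - m)).
  rewrite mulrA; have -> : horner_alg c D * e0 = 1 + m by rewrite /m addrC subrK.
  by rewrite mulrC -subr_sqr expr1n expr2 mm subr0.
exists g' => b; have [P [i ->]] := generated b.
have fY : f (g' Y) = g Y by rewrite gY rmorphM rmorphB /= fm rmorph1 subr0 mulr1 he0.
have fX : f (g' X) = g X by rewrite gX hc.
by rewrite !rmorphM !rmorphXn /= fY !lrmorph_horner fX.
Qed.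

Section SpecialFibre.
Variables (R : realType) (Omega : closedFieldType) (abs : Omega -> R) (K : set Omega).
Variables (iota : {rmorphism OK -> Omega}) (k : finFieldType) (res : {rmorphism OK -> k}).
Hypothesis res_uniformizer : forall w, uniformizer abs K (iota w) ->
  res w = 0 /\ forall c, res c = 0 -> exists c', c = w * c'.
Hypothesis D_res : map_poly res D = 1.

Lemma res_poly w P : uniformizer abs K (iota w) -> map_poly res P = 0 ->
  exists Q, P = w *: Q.
Proof.
move=> /res_uniformizer[_ hw] /polyP P0.
have /choice[c hc] i : exists c', P`_i = w * c'.
  by apply: hw; have := P0 i; rewrite coef_map coef0.
exists (\poly_(i < size P) c i); apply/polyP => i; rewrite coefZ coef_poly.
by case: ltnP => [_|/(nth_default 0) ->]; rewrite ?hc ?mulr0.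
Qed.

(** Since $D$ reduces to $1$, inverting it changes nothing modulo the uniformizer: the special fibre
    is the affine line over [k], and the domain $k[X]$ has no idempotents besides $0$ and $1$. *)
Lemma loc_connected : special_fibre_connected abs K iota B.
Proof.
have res_w w Q : uniformizer abs K (iota w) -> map_poly res (w *: Q) = 0.
  by move=> /res_uniformizer[w0 _]; rewrite map_polyZ /= w0 scale0r.
have resD (P : {poly OK}) i : map_poly res (P * D ^+ i) = map_poly res P.
  by rewrite rmorphM rmorphXn /= D_res expr1n mulr1.
split=> [w hw b e|w hw e [b he]].
  have [P [i hb]] := generated b.
  have eq1 : horner_alg X (w *: P) * Y ^+ i = horner_alg X 1 * Y ^+ 0.
    by rewrite horner_algZ -scalerAl -hb e rmorph1 expr0 mulr1.
  have := congr1 (map_poly res) (loc_eq eq1); rewrite !resD res_w // rmorph1.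
  by move/eqP; rewrite eq_sym oner_eq0.
have [Q [j hQ]] := generated b.
have [P [i hP]] := generated e.
have DE : exists D', D - 1 = w *: D'.
  by apply: (res_poly hw); rewrite rmorphB /= D_res rmorph1 subrr.
have {DE}[D' hD'] := DE.
have hX : horner_alg X D - 1 = w *: horner_alg X D'.
  by rewrite -horner_algZ -hD' rmorphB rmorph1.
have Y_cong z : exists z', z * Y ^+ i = z + w *: z'.
  elim: i {hP} => [|m [z' IH]]; first by exists 0; rewrite expr0 mulr1 scaler0 addr0.
  exists (z' - horner_alg X D' * (z * Y ^+ m.+1)).
  have e1 : z * Y ^+ m.+1 = (z * Y ^+ m) * (horner_alg X D * Y)
      - (horner_alg X D - 1) * (z * Y ^+ m.+1) by rewrite exprS; ring.
  by rewrite {1}e1 D_Y mulr1 {1}IH hX -scalerAl -addrA -scalerBr.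
have [e' he'] := Y_cong (horner_alg X P); rewrite -hP in he'.
have eq1 : horner_alg X (P * P - P * D ^+ i) * Y ^+ (i + i) = horner_alg X (w *: Q) * Y ^+ j.
  rewrite horner_algZ -scalerAl -hQ -he hP rmorphB !rmorphM rmorphXn /= exprD.
  move: (horner_alg X P) (Y ^+ i) (DXn i) => a y dy.
  by transitivity (a * y * (a * y) - a * y * (horner_alg X D ^+ i * y)); [ring | rewrite dy mulr1].
have := congr1 (map_poly res) (loc_eq eq1).
rewrite !resD res_w // rmorphB /= resD rmorphM /= => /eqP.
have -> : forall u : {poly k}, u * u - u = u * (u - 1) by move=> u; ring.
rewrite mulf_eq0 => /orP[] /eqP h0.
  have [P' hP'] := res_poly hw h0; left; exists (horner_alg X P' + e').
  by rewrite he' hP' horner_algZ scalerDr.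
have [|P' hP'] := @res_poly w (P - 1) hw; first by rewrite rmorphB rmorph1.
right; exists (- horner_alg X P' - e'); rewrite he' opprD addrA.
rewrite scalerBr scalerN -horner_algZ -hP' rmorphB rmorph1 opprB; congr (_ + _).
Qed.

End SpecialFibre.
End PolynomialLocalization.

(** * Rational functions with a given denominator *)

Section RationalFunctions.
Variables (OK : comNzRingType) (Omega : closedFieldType) (iota : {rmorphism OK -> Omega}).
Variable D : {poly OK}.
Hypothesis D0 : D.[0] = 1.
Hypothesis natr_Omega_inj : forall i j, i%:R = j%:R :> Omega -> i = j.
Let DO : {poly Omega} := map_poly iota D.

(** Functions are compared on the points where [D] does not vanish; these are infinite in number, so
    that a polynomial is determined by its values there. *)
Definition nonpole := {x : Omega | DO.[x] != 0}.

Lemma nonpole0_subproof : DO.[0] != 0.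
Proof. by rewrite -{1}(rmorph0 iota) horner_map D0 rmorph1 oner_eq0. Qed.
Definition nonpole0 : nonpole := exist _ 0 nonpole0_subproof.

Section Coefficients.
Variable G : set Omega.
Hypothesis G_iota : forall c, G (iota c).
Hypothesis GB : forall x y, G x -> G y -> G (x - y).
Hypothesis GM : forall x y, G x -> G y -> G (x * y).

Definition coefs_in (P : {poly Omega}) := forall i, G P`_i.

Let G0 : G 0. Proof. by rewrite -(rmorph0 iota). Qed.

Let GD x y : G x -> G y -> G (x + y).
Proof. by move=> hx hy; rewrite -[y]opprK -[- y]sub0r; apply: GB => //; exact: GB. Qed.

Lemma over_iota P : coefs_in (map_poly iota P).
Proof. by move=> i; rewrite coef_map; exact: G_iota. Qed.

Lemma overB P Q : coefs_in P -> coefs_in Q -> coefs_in (P - Q).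
Proof. by move=> hP hQ i; rewrite coefB; exact: GB. Qed.

Lemma overD P Q : coefs_in P -> coefs_in Q -> coefs_in (P + Q).
Proof. by move=> hP hQ i; rewrite coefD; exact: GD. Qed.

Lemma overM P Q : coefs_in P -> coefs_in Q -> coefs_in (P * Q).
Proof. by move=> hP hQ i; rewrite coefM; elim/big_ind: _ => // j _; exact: GM. Qed.

Lemma overZ c P : G c -> coefs_in P -> coefs_in (c *: P).
Proof. by move=> hc hP i; rewrite coefZ; exact: GM. Qed.

Lemma over1 : coefs_in 1.
Proof. by rewrite -(rmorph1 (map_poly iota)); exact: over_iota. Qed.

Lemma overX P i : coefs_in P -> coefs_in (P ^+ i).
Proof.
by move=> hP; elim: i => [|i IH]; [rewrite expr0; exact: over1 | rewrite exprS; exact: overM].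
Qed.

(** The set [G] of coefficients will be all of [Omega], the field $K$ and the ring of integers in
    turn. *)
Definition ratfun (f : nonpole -> Omega) := exists P i, coefs_in P /\
  forall x, f x = P.[val x] / DO.[val x] ^+ i.

Lemma ratfun_common f g : ratfun f -> ratfun g -> exists P Q i,
  [/\ coefs_in P, coefs_in Q, forall x, f x = P.[val x] / DO.[val x] ^+ i
    & forall x, g x = Q.[val x] / DO.[val x] ^+ i].
Proof.
move=> [P [i [hP hf]]] [Q [j [hQ hg]]].
exists (P * DO ^+ j), (Q * DO ^+ i), (i + j)%N; split.
- by apply: overM => //; apply: overX; exact: over_iota.
- by apply: overM => //; apply: overX; exact: over_iota.
- move=> x; rewrite hf hornerM horner_exp exprD; have h := valP x.
  by field; rewrite !expf_neq0.
- move=> x; rewrite hg hornerM horner_exp exprD; have h := valP x.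
  by field; rewrite !expf_neq0.
Qed.

Lemma ratfun_poly P : coefs_in P -> ratfun (fun x => P.[val x]).
Proof. by move=> hP; exists P, 0%N; split => // x; rewrite expr0 divr1. Qed.

Lemma ratfun_const c : G c -> ratfun (fun=> c).
Proof.
move=> hc; have [|P [i [h1 h2]]] := @ratfun_poly (c *: 1).
  by apply: overZ => //; exact: over1.
by exists P, i; split => // x; rewrite -h2 hornerZ hornerC mulr1.
Qed.

Lemma ratfun1 : ratfun (fun=> 1).
Proof. by apply: ratfun_const; rewrite -(rmorph1 iota). Qed.

Lemma ratfunB f g : ratfun f -> ratfun g -> ratfun (fun x => f x - g x).
Proof.
move=> /ratfun_common h /h[P [Q [i [hP hQ hf hg]]]].
exists (P - Q), i; split; first exact: overB.
by move=> x; rewrite hf hg -mulrBl hornerD hornerN.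
Qed.

Lemma ratfunD f g : ratfun f -> ratfun g -> ratfun (fun x => f x + g x).
Proof.
move=> /ratfun_common h /h[P [Q [i [hP hQ hf hg]]]].
exists (P + Q), i; split; first exact: overD.
by move=> x; rewrite hf hg -mulrDl hornerD.
Qed.

Lemma ratfunM f g : ratfun f -> ratfun g -> ratfun (fun x => f x * g x).
Proof.
move=> [P [i [hP hf]]] [Q [j [hQ hg]]]; exists (P * Q), (i + j)%N; split.
  exact: overM.
move=> x; rewrite hf hg hornerM exprD; have h := valP x.
by field; rewrite !expf_neq0.
Qed.

Lemma ratfunZ c f : ratfun f -> ratfun (fun x => iota c * f x).
Proof. by apply: ratfunM; exact: ratfun_const. Qed.

Definition ratfun_set : funset iota nonpole :=
  Funset nonpole0 ratfun1 ratfunB ratfunM ratfunZ.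

Lemma ratfun_sum m (f : 'I_m -> nonpole -> Omega) :
  (forall i, ratfun (f i)) -> ratfun (fun x => \sum_i f i x).
Proof.
elim: m f => [|m IH] f hf.
  have [P [i [hP h]]] := ratfun_const G0; exists P, i; split => // x.
  by rewrite -h big_ord0.
have [P [i [hP h]]] := ratfunD (hf ord0) (IH (fun i => f (lift ord0 i)) (fun i => hf _)).
by exists P, i; split => // x; rewrite -h big_ord_recl.
Qed.

Lemma ratfun_prod m (f : 'I_m -> nonpole -> Omega) :
  (forall i, ratfun (f i)) -> ratfun (fun x => \prod_i f i x).
Proof.
elim: m f => [|m IH] f hf.
  have [P [i [hP h]]] := ratfun1; exists P, i; split => // x.
  by rewrite -h big_ord0.
have [P [i [hP h]]] := ratfunM (hf ord0) (IH (fun i => f (lift ord0 i)) (fun i => hf _)).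
by exists P, i; split => // x; rewrite -h big_ord_recl.
Qed.

Lemma ratfun_exp f i : ratfun f -> ratfun (fun x => f x ^+ i).
Proof.
move=> hf; have [P [j [hP h]]] := ratfun_prod (fun _ : 'I_i => hf).
by exists P, j; split => // x; rewrite -h prodr_const card_ord.
Qed.

End Coefficients.

Lemma poly_infinite (P : {poly Omega}) : (forall x, P.[x] = 0) -> P = 0.
Proof.
move=> h; apply/eqP; apply: contraT => P0.
have := @max_poly_roots _ P [seq i%:R | i <- seq.iota 0 (size P)] P0.
rewrite size_map size_iota ltnn; apply; last first.
  by rewrite map_inj_uniq ?iota_uniq // => i j; exact: natr_Omega_inj.
by apply/allP => x _; rewrite /root h.
Qed.

Lemma poly_nonpole (P : {poly Omega}) : (forall x : nonpole, P.[val x] = 0) -> P = 0.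
Proof.
move=> h; have DO0 : DO != 0.
  by apply/eqP => e; have := nonpole0_subproof; rewrite e horner0 eqxx.
apply/eqP; rewrite -(mulIr_eq0 _ (mulIf DO0)); apply/eqP/poly_infinite => x.
rewrite hornerM; have [->|n0] := eqVneq DO.[x] 0; first exact: mulr0.
by rewrite (h (exist _ x n0)) mul0r.
Qed.

End RationalFunctions.

(** * The curve and its denominator *)

Section Curve.
Variables (R : realType) (Omega : closedFieldType) (abs : Omega -> R).
Variables (p : nat) (Qp K E : set Omega).
Variables (OK : comNzRingType) (iota : {rmorphism OK -> Omega}).
Variables (k : finFieldType) (res : {rmorphism OK -> k}).
Variables (n : nat) (h : 'M[Omega]_n) (tt Fr : Omega -> Omega) (omega : 'S_n).
Variables (rho : (Omega -> Omega) -> 'M[int]_n) (art : Omega -> Omega -> Omega).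
Hypothesis S :
  torus_setting abs p Qp K E iota res h tt Fr omega rho art.
Implicit Types (x y z : Omega) (s t g : Omega -> Omega).

Let cP := ts_closure S.
Let p_prime := ts_prime S.
Let q := #|k|.
Let KF : is_subfield K := base_field (ts_finite S).
Let QK : Qp `<=` K := base_sub (ts_finite S).
Let M := splitting_field rho K.
Let Fr_frob := ts_Fr S.
Let FrG : Gal K Fr := Fr_Gal (ts_Fr S).
Let FrnG i : Gal K (iter i Fr) := Gal_iter i FrG.
Let ttG : Gal K tt. Proof. by case: (ts_tt S). Qed.
Let q_gt1 : (1 < q)%N := card_k_gt1 k.
Implicit Types (P Q : {poly Omega}) (T : 'rV[Omega]_n).

Definition line (a : Omega) : {poly Omega} := 1 + (a - 1) *: 'X.

Lemma horner_line a x : (line a).[x] = 1 + (a - 1) * x.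
Proof. by rewrite /line hornerD hornerZ hornerX hornerC. Qed.

(* The curve joins [1] at [x = 0] to the coordinatewise square of [T] at [x = 1].
   Replacing [T] by its inverse inverts it, so that it is equivariant under the
   signed permutations by which the Galois group acts. *)
Definition curve T x : 'rV[Omega]_n :=
  \row_i ((line (T 0 i)).[x] / (line (T 0 i)^-1).[x]).

(** Both $T_i$ and its inverse enter, so that signed permutations of the coordinates preserve the
    product, and both the curve and its inverse are regular off its zeros. *)
Definition curve_denom T : {poly Omega} := \prod_i (line (T 0 i) * line (T 0 i)^-1).

Definition cong1 P := forall i, abs ((P - 1)`_i) < 1.

Lemma cong1_line a : abs (a - 1) < 1 -> cong1 (line a).
Proof.
move=> ha i; have -> : line a - 1 = (a - 1) *: 'X by rewrite /line addrC addKr.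
rewrite coefZ coefX; case: (_ == _); first by rewrite mulr1.
by rewrite mulr0 (abs0 cP).
Qed.

Lemma cong1_mul P Q : cong1 P -> cong1 Q -> cong1 (P * Q).
Proof.
move=> hP hQ i; have -> : P * Q - 1 = (P - 1) * (Q - 1) + (P - 1) + (Q - 1) by ring.
rewrite coefD; apply: (absD_lt cP); last exact: hQ.
rewrite coefD; apply: (absD_lt cP); last exact: hP.
rewrite coefM; apply: (abs_sum_lt cP) => // j _.
by apply: (absM_lt1 cP); [apply: ltW; exact: hP | exact: hQ].
Qed.

Lemma cong1_curve_denom T : principal abs T -> cong1 (curve_denom T).
Proof.
move=> hT; rewrite /curve_denom; elim/big_ind: _ => [i||i _].
- by rewrite subrr coef0 (abs0 cP).
- exact: cong1_mul.
- by apply: cong1_mul; apply: cong1_line => //; exact: (principalV cP).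
Qed.

Lemma cong1_horner P x : cong1 P -> abs x <= 1 -> abs (P.[x] - 1) < 1.
Proof.
move=> hP hx; have -> : P.[x] - 1 = (P - 1).[x] by rewrite hornerD hornerN hornerC.
rewrite horner_coef; apply: (abs_sum_lt cP) => // i _.
by apply: (absMr_lt1 cP) => //; exact: (absX_le1 cP).
Qed.

Lemma curve_denom_neq0 T x i : (curve_denom T).[x] != 0 ->
  (line (T 0 i)).[x] != 0 /\ (line (T 0 i)^-1).[x] != 0.
Proof.
rewrite /curve_denom horner_prod => /prodf_neq0 /(_ i isT).
by rewrite hornerM mulf_eq0 negb_or => /andP.
Qed.

Lemma curve_torus T x : (curve_denom T).[x] != 0 -> torus (curve T x).
Proof. by move=> hx i; have [h1 h2] := curve_denom_neq0 i hx; rewrite mxE mulf_neq0 ?invr_eq0. Qed.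

Lemma points_moved T s e w i : points rho K T -> Gal K s -> rho s = signed_perm_mx e w ->
  T 0 (w i) = s (if e then (T 0 i)^-1 else T 0 i).
Proof.
by move=> [_ hT] hs hw; rewrite -{1}(hT s hs) (gactE _ _ hw) permK.
Qed.

Lemma line_Gal s a x : Gal K s -> s (line a).[x] = (line (s a)).[s x].
Proof.
by move=> hs; have [f ->] := Gal_rmorphism hs; rewrite !horner_line rmorphD rmorphM rmorphB !rmorph1.
Qed.

Lemma curve_Gal T s x : points rho K T -> Gal K s ->
  gact rho s (curve T x) = curve T (s x).
Proof.
move=> hT hs; have [e [w hw]] := rho_signed_perm S hs.
apply/rowP => i; rewrite (gactE _ _ hw) ![curve _ _ _ _]mxE.
have := points_moved ((w^-1)%g i) hT hs hw; rewrite permKV => ->.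
have L a : s (line a).[x] = (line (s a)).[s x] by exact: line_Gal.
have sM u v : s (u * v) = s u * s v by case: hs.
have sV u : s u^-1 = (s u)^-1 by have [f ->] := Gal_rmorphism hs; exact: fmorphV.
case: e {hw}; last by rewrite sM !sV !L !sV.
by rewrite invfM invrK sM !sV !L !sV invrK mulrC.
Qed.

Lemma curve_denom_Gal T s x : points rho K T -> Gal K s ->
  s (curve_denom T).[x] = (curve_denom T).[s x].
Proof.
move=> hT hs; have [e [w hw]] := rho_signed_perm S hs.
rewrite /curve_denom !horner_prod [RHS](reindex_inj (@perm_inj _ w)) /=.
have L a : s (line a).[x] = (line (s a)).[s x] by exact: line_Gal.
have sM u v : s (u * v) = s u * s v by case: hs.
have sV u : s u^-1 = (s u)^-1 by have [f ->] := Gal_rmorphism hs; exact: fmorphV.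
have -> : forall F : 'I_n -> Omega, s (\prod_i F i) = \prod_i s (F i).
  by move=> F; have [f ->] := Gal_rmorphism hs; rewrite rmorph_prod.
apply: eq_bigr => i _; rewrite !hornerM sM !L sV (points_moved i hT hs hw).
by case: e {hw} => //; rewrite sV invrK mulrC.
Qed.

Lemma poly_fixed_over P : (forall s x, Gal K s -> s P.[x] = P.[s x]) -> coefs_in K P.
Proof.
move=> hP i; apply: (Gal_fixed cP p_prime) => // s hs.
have [f fE] := Gal_rmorphism hs.
have e : map_poly f P = P.
  apply/eqP; rewrite -subr_eq0; apply/eqP/poly_infinite; first exact: (natr_inj cP p_prime).
  move=> x; rewrite hornerD hornerN -{1}(ginvKV hs x) {1}fE horner_map /= -fE hP //.
  by rewrite (ginvKV hs) subrr.
by rewrite fE -coef_map /= e.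
Qed.

Lemma curve_denom_lift T : points rho K T -> principal abs T -> exists D : {poly OK},
  [/\ map_poly iota D = curve_denom T, D.[0] = 1 & map_poly res D = 1].
Proof.
move=> hT pT; have cD := cong1_curve_denom pT.
have /choice[c hc] i : exists c, iota c = (curve_denom T)`_i.
  apply: (iota_surj (ts_integers S)).
    by apply: poly_fixed_over => s x hs; exact: curve_denom_Gal.
  have -> : curve_denom T = curve_denom T - 1 + 1 by rewrite subrK.
  rewrite coefD; apply: (absD_le cP); first exact: ltW.
  by rewrite coef1; exact: (abs_nat_le1 cP).
exists (\poly_(i < size (curve_denom T)) c i).
have coefc i : (\poly_(i < size (curve_denom T)) c i)`_i = c i.
  rewrite coef_poly; case: ltnP => // hi; apply: (iota_inj S).
  by rewrite hc rmorph0 nth_default.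
split.
- by apply/polyP => i; rewrite coef_map /= coefc.
- rewrite horner_coef0 coefc; apply: (iota_inj S); rewrite hc rmorph1 -horner_coef0 /curve_denom horner_prod.
  by rewrite big1 // => i _; rewrite hornerM !horner_line !mulr0 !addr0 mulr1.
- apply/polyP => i; rewrite coef_map /= coefc; apply/eqP; rewrite -subr_eq0; apply/eqP.
  have -> : (1 : {poly k})`_i = res ((1 : {poly OK})`_i) by rewrite !coef1 rmorph_nat.
  rewrite -rmorphB; apply/(proj2 (ts_residue S)).
  by rewrite rmorphB /= hc !coef1 rmorph_nat; have := cD i; rewrite coefD coefN coef1.
Qed.

End Curve.

(** * Integrality along the curve *)

Section MappingProperty.
Variables (R : realType) (Omega : closedFieldType) (abs : Omega -> R).
Variables (p : nat) (Qp K E : set Omega).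
Variables (OK : comNzRingType) (iota : {rmorphism OK -> Omega}).
Variables (k : finFieldType) (res : {rmorphism OK -> k}).
Variables (n : nat) (h : 'M[Omega]_n) (tt Fr : Omega -> Omega) (omega : 'S_n).
Variables (rho : (Omega -> Omega) -> 'M[int]_n) (art : Omega -> Omega -> Omega).
Hypothesis S :
  torus_setting abs p Qp K E iota res h tt Fr omega rho art.
Implicit Types (x y z : Omega) (s t g : Omega -> Omega).

Let cP := ts_closure S.
Let p_prime := ts_prime S.
Let q := #|k|.
Let KF : is_subfield K := base_field (ts_finite S).
Let QK : Qp `<=` K := base_sub (ts_finite S).
Let M := splitting_field rho K.
Let Fr_frob := ts_Fr S.
Let FrG : Gal K Fr := Fr_Gal (ts_Fr S).
Let FrnG i : Gal K (iter i Fr) := Gal_iter i FrG.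
Let ttG : Gal K tt. Proof. by case: (ts_tt S). Qed.
Let q_gt1 : (1 < q)%N := card_k_gt1 k.
Variables (A : comAlgType OK) (ev : A -> 'rV[Omega]_n -> Omega).
Hypothesis neron : connected_neron_model abs rho K iota ev.
Implicit Types (P Q : {poly Omega}) (T : 'rV[Omega]_n).

Lemma neron_group : group_model rho K iota ev.
Proof. by case: neron. Qed.
Lemma neron_model : torus_model rho K iota ev.
Proof. by case: neron_group. Qed.

Let m := neron_model.

Lemma res_uniformizer w : uniformizer abs K (iota w) ->
  res w = 0 /\ forall c, res c = 0 -> exists c', c = w * c'.
Proof.
case=> Kw w0 w1 hw; split; first exact/(proj2 (ts_residue S)).
move=> c /(proj2 (ts_residue S)) hc.
have Kc : K (iota c) by case: (iota_int (ts_integers S) c).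
have [||c' hc'] := @iota_surj _ _ _ _ _ _ (ts_integers S) (iota c / iota w).
- by apply: is_subfieldM => //; exact: is_subfieldV.
- by rewrite (absM cP) (absV cP) ler_pdivrMr ?(abs_gt0 cP) // mul1r; exact: hw.
- by exists c'; apply: (iota_inj S); rewrite rmorphM hc' mulrCA divff // mulr1.
Qed.

Section AlongCurve.
Variables (T : 'rV[Omega]_n) (D : {poly OK}).
Hypothesis hT : points rho K T.
Hypothesis hD : map_poly iota D = curve_denom T.
Hypothesis D0 : D.[0] = 1.
Hypothesis Dres : map_poly res D = 1.

Let U := nonpole iota D.
Let f_tchar l (x : U) := tchar l (curve T (val x)).

Let dE y : (map_poly iota D).[y] = (curve_denom T).[y].
Proof. by rewrite hD. Qed.

Let nonpole_denom (x : U) : (curve_denom T).[val x] != 0.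
Proof. by rewrite -dE; exact: (valP x). Qed.

Let curve_torus' (x : U) : torus (curve T (val x)).
Proof. exact: curve_torus. Qed.

Let setT_iota c : [set: Omega] (iota c). Proof. by []. Qed.
Let setTB x y : [set: Omega] x -> [set: Omega] y -> [set: Omega] (x - y). Proof. by []. Qed.
Let setTM x y : [set: Omega] x -> [set: Omega] y -> [set: Omega] (x * y). Proof. by []. Qed.
Let in_setT P : coefs_in setT P. Proof. by []. Qed.

Lemma ratfun_inv P Q : P * Q = curve_denom T -> ratfun setT (fun x : U => (Q.[val x])^-1).
Proof.
move=> e; exists P, 1%N; split => // x; rewrite dE expr1 -e hornerM.
have := nonpole_denom x; rewrite -e hornerM mulf_eq0 negb_or => /andP[h1 h2].
by field; rewrite h1 h2.
Qed.

Lemma ratfun_tchar l : ratfun setT (f_tchar l).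
Proof.
apply: (ratfun_prod setT_iota setTB setTM) => i.
pose D' := \prod_(j | j != i) (line (T 0 j) * line (T 0 j)^-1).
have hD' : curve_denom T = line (T 0 i) * line (T 0 i)^-1 * D' by rewrite /curve_denom (bigD1 i).
have r1 : ratfun setT (fun x : U => curve T (val x) 0 i).
  have [|P [j [hP h1]]] := ratfunM setT_iota setTB setTM
    (ratfun_poly iota D (in_setT (line (T 0 i)))) (@ratfun_inv (line (T 0 i) * D') (line (T 0 i)^-1) _).
    by rewrite hD'; ring.
  by exists P, j; split => // x; rewrite -h1 mxE.
have r2 : ratfun setT (fun x : U => (curve T (val x) 0 i)^-1).
  have [|P [j [hP h1]]] := ratfunM setT_iota setTB setTM
    (ratfun_poly iota D (in_setT (line (T 0 i)^-1))) (@ratfun_inv (line (T 0 i)^-1 * D') (line (T 0 i)) _).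
    by rewrite hD'; ring.
  by exists P, j; split => // x; rewrite -h1 mxE invf_div.
case: (l i 0) => j; first exact: (ratfun_exp setT_iota setTB setTM).
have [P [a [hP h1]]] := ratfun_exp setT_iota setTB setTM j.+1 r2.
by exists P, a; split => // x; rewrite -h1 NegzE -exprnN exprVn.
Qed.

Let K_iota c : K (iota c).
Proof. by case: (iota_int (ts_integers S) c). Qed.
Let KB x y : K x -> K y -> K (x - y).
Proof. by move=> hx hy; exact: is_subfieldB. Qed.
Let KM x y : K x -> K y -> K (x * y).
Proof. by move=> hx hy; exact: is_subfieldM. Qed.

Lemma ratfun_ev a : ratfun K (fun x : U => ev a (curve T (val x))).
Proof.
have [P [i [_ hP]]] : ratfun setT (fun x : U => ev a (curve T (val x))).
  case: m => _ _ /(_ a)[[j [c [l hl]]] _] _.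
  have hc (b : 'I_j) : ratfun setT (fun _ : U => c b) by exact: (ratfun_const D setT_iota setTM).
  have [P [i [h1 h2]]] := ratfun_sum setT_iota setTB setTM
    (fun b : 'I_j => ratfunM setT_iota setTB setTM (hc b) (ratfun_tchar (l b))).
  by exists P, i; split => // x; rewrite hl // -h2.
(* The identity $sP(x)=P(sx)$ is known only off the zeros of $D$. One more factor $D$ makes both
   sides vanish at these zeros. *)
exists (P * map_poly iota D), i.+1; split; last first.
  move=> x; rewrite hP hornerM exprS; have /= h0 := valP x.
  by field; rewrite h0 expf_neq0.
apply: (poly_fixed_over S) => s x hs; rewrite !hornerM hD.
have sD := curve_denom_Gal S x hT hs.
have sM u v : s (u * v) = s u * s v by case: hs.
have s0 : s 0 = 0 by have [f ->] := Gal_rmorphism hs; exact: rmorph0.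
rewrite sM sD; have [e|n0] := eqVneq (curve_denom T).[x] 0.
  by rewrite -sD e s0 !mulr0.
have n1 : (curve_denom T).[s x] != 0.
  by rewrite -sD -s0 (inj_eq (Gal_inj hs)).
have [m0 m1] : (map_poly iota D).[x] != 0 /\ (map_poly iota D).[s x] != 0 by rewrite hD.
have e0 := hP (exist _ x m0); have e1 := hP (exist _ (s x) m1); rewrite /= in e0 e1.
have e2 : ev a (curve T (s x)) = s (ev a (curve T x)).
  by rewrite -(curve_Gal S x hT hs) (ev_gact m) //; exact: curve_torus.
have sD' y : s (map_poly iota D).[y] = (map_poly iota D).[s y].
  by rewrite !dE; exact: (curve_denom_Gal S y hT hs).
have sX y j : s (y ^+ j) = s y ^+ j.
  by have [f ->] := Gal_rmorphism hs; rewrite rmorphXn.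
have sV y : s y^-1 = (s y)^-1.
  by have [f ->] := Gal_rmorphism hs; rewrite fmorphV.
move: e2; rewrite e0 e1 sM sV sX sD' => e2.
by congr (_ * _); apply/esym; move/mulIf: e2; apply; rewrite invr_eq0 expf_neq0.
Qed.

Definition integral := [set x | exists c, iota c = x].

Let O_iota c : integral (iota c). Proof. by exists c. Qed.
Let OB x y : integral x -> integral y -> integral (x - y).
Proof. by move=> [c <-] [c' <-]; exists (c - c'); rewrite rmorphB. Qed.
Let OM x y : integral x -> integral y -> integral (x * y).
Proof. by move=> [c <-] [c' <-]; exists (c * c'); rewrite rmorphM. Qed.

Lemma integral_lift P : coefs_in integral P -> exists P0 : {poly OK}, map_poly iota P0 = P.
Proof.
move=> /choice[c hc]; exists (\poly_(i < size P) c i); apply/polyP => i.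
rewrite coef_map coef_poly /=; case: ltnP => [_|/(nth_default 0) ->]; first exact: hc.
exact: rmorph0.
Qed.

(** [B] is $O_K[X,1/D]$ and [BK] is $K[X,1/D]$, realised as algebras of functions on the complement
    of the zeros of $D$. *)
Let Oset := ratfun_set D0 O_iota OB OM.
Let Kset := ratfun_set D0 K_iota KB KM.
Let B := funalg Oset.
Let BK := funalg Kset.
Let mkB f (hf : ratfun integral f) : B := Funalg (U := Oset) hf.
Let mkBK f (hf : ratfun K f) : BK := Funalg (U := Kset) hf.

Let B_ratfun (b : B) : ratfun integral b. Proof. exact: (funvalP b). Qed.

Let X_ratfun : ratfun integral (val : U -> Omega).
Proof.
have [|P [i [h1 h2]]] := @ratfun_poly _ _ iota D integral 'X.
  by rewrite -(map_polyX iota); exact: over_iota.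
by exists P, i; split => // x; rewrite -h2 hornerX.
Qed.

Let Y_ratfun : ratfun integral (fun x : U => (map_poly iota D).[val x]^-1).
Proof.
exists 1, 1%N; split; first exact: (over1 O_iota).
by move=> x; rewrite hornerC expr1 mul1r.
Qed.

Let X : B := mkB X_ratfun.
Let Y : B := mkB Y_ratfun.

Let horner_X (P : {poly OK}) (x : U) : (horner_alg X P : B) x = (map_poly iota P).[val x].
Proof.
elim/poly_ind: P => [|P c IH]; first by rewrite !rmorph0 horner0.
rewrite !rmorphD !rmorphM /= horner_algX horner_algC map_polyX map_polyC /=.
by rewrite hornerD hornerMX hornerC -IH mulr1.
Qed.

Let D_Y : horner_alg X D * Y = 1.
Proof.
apply: funalg_ext => x; rewrite funME horner_X fun1E /= divff //; exact: (valP x).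
Qed.

Let generated (b : B) : exists (P : {poly OK}) i, b = horner_alg X P * Y ^+ i.
Proof.
have [P [i [/integral_lift[P0 <-] hb]]] := B_ratfun b.
exists P0, i; apply: funalg_ext => x.
by rewrite funME horner_X funXE hb /= exprVn.
Qed.

Let X_free (P : {poly OK}) : horner_alg X P = 0 -> P = 0.
Proof.
move=> e; have : map_poly iota P = 0.
  apply: (poly_nonpole D0); first exact: (natr_inj cP p_prime).
  by move=> x; have := horner_X P x; rewrite e => <-.
move/polyP => h0; apply/polyP => i; apply: (iota_inj S).
by have := h0 i; rewrite coef_map coef0 /= => ->; rewrite coef0 rmorph0.
Qed.

Let KI (b : U -> Omega) : ratfun integral b -> ratfun K b.
Proof.
move=> [P [i [h1 h2]]]; exists P, i; split => // j.
by have [c <-] := h1 j; exact: K_iota.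
Qed.

Let j_fun (b : B) : BK := mkBK (KI (B_ratfun b)).

Let u_fun (a : A) : BK := mkBK (ratfun_ev a).

Let u_linear : linear u_fun.
Proof.
move=> c a b; apply: funalg_ext => x; have tx := curve_torus' x.
by apply: (etrans (evD m _ _ tx)); rewrite (evZ m c a tx).
Qed.

Let u_mul : {morph u_fun : a b / a * b}.
Proof. by move=> a b; apply: funalg_ext => x; exact: (evM m). Qed.

Let u_one : u_fun 1 = 1.
Proof. by apply: funalg_ext => x; exact: (ev1 m). Qed.

Let u : {lrmorphism A -> BK} := HB.pack_for {lrmorphism A -> BK} u_fun
  (GRing.isLinear.Build OK A BK _ u_fun u_linear)
  (GRing.isMonoidMorphism.Build A BK u_fun (u_one, u_mul)).

Let j_linear : linear j_fun.
Proof. by move=> c a b; apply: funalg_ext. Qed.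
Let j_mul : {morph j_fun : a b / a * b}.
Proof. by move=> a b; apply: funalg_ext. Qed.
Let j_one : j_fun 1 = 1.
Proof. by apply: funalg_ext. Qed.

Let j : {lrmorphism B -> BK} := HB.pack_for {lrmorphism B -> BK} j_fun
  (GRing.isLinear.Build OK B BK _ j_fun j_linear)
  (GRing.isMonoidMorphism.Build B BK j_fun (j_one, j_mul)).

Let generic_B : generic_fibre j.
Proof.
split.
- move=> b b' /(congr1 (fun f : BK => f : U -> Omega)) e; apply: funalg_ext => x.
  by have := congr1 (fun f => f x) e.
- move=> c c0; have hc : ratfun K (fun _ : U => (iota c)^-1).
    by apply: (ratfun_const D K_iota KM); exact: is_subfieldV.
  exists (mkBK hc); apply: funalg_ext => x; rewrite funME funZE !fun1E mulr1 /= divff //.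
  by rewrite -(rmorph0 iota) (inj_eq (iota_inj S)).
move=> y; have [P [i [hP hy]]] := funvalP y.
have [|w [w0 Kw] hw] := clear_denominators S (r := 1 :: P).
  move=> x; rewrite inE => /orP[/eqP->|/(nthP 0)[a _ <-]]; [exact: is_subfield1 | exact: hP].
have [||c hc] := @iota_surj _ _ _ _ _ _ (ts_integers S) w => //.
  by rewrite -[w]mulr1; apply: hw; rewrite inE eqxx.
exists c; first by apply/eqP => c0; move: w0; rewrite -hc c0 rmorph0 eqxx.
have hb : ratfun integral (fun x : U => (w *: P).[val x] / (map_poly iota D).[val x] ^+ i).
  exists (w *: P), i; split => // a; rewrite coefZ.
  apply: (iota_surj (ts_integers S)); first exact: is_subfieldM.
  have [/(nth_default 0) ->|lt] := leqP (size P) a; first by rewrite mulr0 (abs0 cP).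
  by apply: hw; rewrite inE mem_nth ?orbT.
exists (mkB hb); apply: funalg_ext => x.
by rewrite funZE hy hc /= hornerZ mulrA.
Qed.

Let v_value (b : B) : exists c, iota c = b (nonpole0 iota D0).
Proof.
have [P [i [/integral_lift[P0 <-] hb]]] := B_ratfun b.
exists P0.[0]; rewrite hb /= -(rmorph0 iota) !horner_map /= D0 rmorph1 expr1n divr1.
by [].
Qed.

Lemma curve0 : curve T 0 = tone Omega n.
Proof. by apply/rowP => i; rewrite !mxE !horner_line !mulr0 !addr0 divr1. Qed.

(* The mapping property is applied to the open subscheme of the affine line
   where [D] is invertible, with the origin, which goes to the unit of the
   torus, as the point of the special fibre. *)
Theorem curve_integral a x : principal abs T -> abs x <= 1 ->
  abs (ev a (curve T x)) <= 1.
Proof.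
move=> pT hx.
have /choice[v hv] := v_value.
have v_linear : linear (v : B -> OK^o).
  move=> c b b'; apply: (iota_inj S); rewrite hv rmorphD rmorphM /= !hv; by [].
have v_mul : {morph (v : B -> OK^o) : b b' / b * b'}.
  by move=> b b'; apply: (iota_inj S); rewrite rmorphM /= !hv.
have v_one : (v : B -> OK^o) 1 = 1 by apply: (iota_inj S); rewrite hv rmorph1.
pose vl : {lrmorphism B -> OK^o} := HB.pack_for {lrmorphism B -> OK^o} (v : B -> OK^o)
  (GRing.isLinear.Build OK B OK^o _ (v : B -> OK^o) v_linear)
  (GRing.isMonoidMorphism.Build B OK^o (v : B -> OK^o) (v_one, v_mul)).
have /choice[y hy] : forall a', exists c, iota c = ev a' (tone Omega n).
  by move=> a'; case: neron_group => _ _ _ /(_ a')[c hc]; exists c.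
have t1 := @tone_torus Omega n.
have y_linear : linear (y : A -> OK^o).
  by move=> c b b'; apply: (iota_inj S); rewrite hy rmorphD rmorphM /= !hy (evD m) // (evZ m).
have y_mul : {morph (y : A -> OK^o) : b b' / b * b'}.
  by move=> b b'; apply: (iota_inj S); rewrite rmorphM /= !hy (evM m).
have y_one : (y : A -> OK^o) 1 = 1 by apply: (iota_inj S); rewrite hy rmorph1 (ev1 m).
pose yl : {lrmorphism A -> OK^o} := HB.pack_for {lrmorphism A -> OK^o} (y : A -> OK^o)
  (GRing.isLinear.Build OK A OK^o _ (y : A -> OK^o) y_linear)
  (GRing.isMonoidMorphism.Build A OK^o (y : A -> OK^o) (y_one, y_mul)).
have [_ _ _ /(_ B BK j u OK^o vl yl)] := neron; case.
- exact: loc_smooth D_Y generated X_free.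
- exact: (loc_connected D_Y generated X_free res_uniformizer Dres).
- exact: generic_B.
- move=> c c' c0 e; apply: (iota_inj S); rewrite rmorph0.
  have : iota c * iota c' = 0 by rewrite -rmorphM -(rmorph0 iota) -e.
  move/eqP; rewrite mulf_eq0 -{1}(rmorph0 iota) (inj_eq (iota_inj S)) (negPf c0).
  by move/eqP.
- move=> w [_ _ w1 _] c e; have := congr1 iota e; rewrite rmorph1 => e1.
  have : abs (iota (w * c)) < 1.
    by rewrite rmorphM; apply: (absMr_lt1 cP) => //; case: (iota_int (ts_integers S) c).
  by rewrite e1 (abs1 cP) ltxx.
- move=> c a' b e; apply: (iota_inj S).
  have := congr1 (fun f : BK => f (nonpole0 iota D0)) e.
  rewrite funZE /= curve0 -hy -hv -rmorphM; by [].
(* The extension [u'] writes $a$ along the curve as a quotient $P/D^i$ with integral $P$, and $D(x)$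
   is a principal unit. *)
move=> u' hu'.
have cd := cong1_horner S (cong1_curve_denom S pT) hx.
have nz := abs_princ_neq0 cP cd.
have hxU : (map_poly iota D).[x] != 0 by rewrite dE.
have := congr1 (fun f : BK => f (exist _ x hxU)) (hu' a).
have [P [i [hP hb]]] := B_ratfun (u' a).
rewrite /= hb /= => ->.
rewrite dE (absM cP) (absV cP) (absX cP) (abs_princ_unit cP cd) expr1n invr1 mulr1.
rewrite horner_coef; apply: (abs_sum_le cP) => // l _.
apply: (absM_le1 cP); last exact: (absX_le1 cP).
by have [c <-] := hP l; case: (iota_int (ts_integers S) c).
Qed.

End AlongCurve.

End MappingProperty.

(** * Norms of principal points *)

Section PrincipalPoints.
Variables (R : realType) (Omega : closedFieldType) (abs : Omega -> R).
Variables (p : nat) (Qp K E : set Omega).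
Variables (OK : comNzRingType) (iota : {rmorphism OK -> Omega}).
Variables (k : finFieldType) (res : {rmorphism OK -> k}).
Variables (n : nat) (h : 'M[Omega]_n) (tt Fr : Omega -> Omega) (omega : 'S_n).
Variables (rho : (Omega -> Omega) -> 'M[int]_n) (art : Omega -> Omega -> Omega).
Hypothesis S :
  torus_setting abs p Qp K E iota res h tt Fr omega rho art.
Implicit Types (x y z : Omega) (s t g : Omega -> Omega).

Let cP := ts_closure S.
Let p_prime := ts_prime S.
Let q := #|k|.
Let QK : Qp `<=` K := base_sub (ts_finite S).
Let M := splitting_field rho K.
Let FrG : Gal K Fr := Fr_Gal (ts_Fr S).
Let FrnG i : Gal K (iter i Fr) := Gal_iter i FrG.
Let Mur := Mur K rho.
Implicit Types (T : 'rV[Omega]_n).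

Lemma gact_prod s (r : seq nat) (c : nat -> 'rV[Omega]_n) : Gal K s ->
  gact rho s (\row_i \prod_(j <- r) c j 0 i) = \row_i \prod_(j <- r) gact rho s (c j) 0 i.
Proof.
move=> hs; have [e [w hw]] := rho_signed_perm S hs; apply/rowP => i.
rewrite (gactE _ _ hw) !mxE; under [RHS]eq_bigr do rewrite (gactE _ _ hw).
have [f ->] := Gal_rmorphism hs; case: e {hw}; last by rewrite rmorph_prod.
by rewrite -prodfV rmorph_prod.
Qed.

(** Where roots are unique in a domain [P] stable under Galois and inversion, their extraction
    commutes with the Galois action, so that a root of a rational point is rational. *)
Lemma points_unique_root (T T' : 'rV[Omega]_n) (P : Omega -> Prop) e :
  (forall u v, P u -> P v -> u ^+ e = v ^+ e -> u = v) ->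
  (forall s u, Gal K s -> P u -> P (s u)) -> (forall u, P u -> P u^-1) ->
  points rho K T -> (forall i, T' 0 i != 0 /\ P (T' 0 i)) ->
  (forall i, T' 0 i ^+ e = T 0 i) -> points rho K T'.
Proof.
move=> P_inj P_Gal PV hT hT' root; split; first by move=> i; case: (hT' i).
move=> s hs; have [e' [w hw]] := rho_signed_perm S hs.
have hP i : P (gact rho s T' 0 i).
  by rewrite (gactE _ _ hw); apply: P_Gal => //; case: e' {hw}; [apply: PV|]; case: (hT' ((w^-1)%g i)).
apply/rowP => i; apply: P_inj => //; first by case: (hT' i).
rewrite root -[in RHS](proj2 hT s hs) !(gactE _ _ hw) -root.
by have [f ->] := Gal_rmorphism hs; rewrite -rmorphXn; case: e' {hw hP} => //; rewrite exprVn.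
Qed.

Lemma principal_sqrt_point T : points rho K T -> principal abs T -> exists T',
  [/\ points rho K T', principal abs T' & forall i, T' 0 i ^+ 2 = T 0 i].
Proof.
move=> hT pT; have /choice[s hs] i : exists v, v ^+ 2 = T 0 i /\ abs (v - 1) < 1.
  by have [v h1 h2] := principal_sqrt S (pT i); exists v.
have p1 : principal abs (\row_i s i) by move=> i; rewrite mxE; case: (hs i).
have r1 i : (\row_i s i) 0 i ^+ 2 = T 0 i by rewrite mxE; case: (hs i).
exists (\row_i s i); split => //.
apply: (@points_unique_root T _ (fun u => abs (u - 1) < 1) 2) => //.
- by move=> u v hu hv; exact: (principal_sqrt_unique S).
- by move=> g u hg; exact: (principal_Gal cP QK hg).
- exact: (principalV cP).
- by move=> i; split => //; apply: (abs_princ_neq0 cP); exact: p1.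
Qed.

Lemma curve1 T T' : (forall i, T 0 i ^+ 2 = T' 0 i) -> torus T -> curve T 1 = T'.
Proof.
move=> r hT; apply/rowP => i; rewrite mxE !horner_line -r !mulr1 !(addrC 1) !subrK.
by rewrite invrK expr2.
Qed.

Lemma curve_principal T x : principal abs T -> abs x <= 1 -> principal abs (curve T x).
Proof.
move=> pT hx i; rewrite mxE; apply: (principalM cP); last apply: (principalV cP).
  by apply: (cong1_horner S) => //; exact: (cong1_line S).
by apply: (cong1_horner S) => //; apply: (cong1_line S); exact: (principalV cP).
Qed.

(** With $s$ the coordinate of [T], the difference is exactly $(s-1)^2$ times an integral factor;
    and $|s-1|=|s^2-1|\le r$ because $s+1$ is congruent to the unit $2$. *)
Lemma curve_near T x (r : R) i : principal abs T -> abs x <= 1 ->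
  abs (T 0 i ^+ 2 - 1) <= r -> abs (curve T x 0 i - (1 + x * (T 0 i ^+ 2 - 1))) <= r ^+ 2.
Proof.
move=> pT hx; have := pT i; set s := T 0 i => ps hr.
have s1 := abs_princ_unit cP ps; have s0 := abs_princ_neq0 cP ps.
have sp1 : abs (s + 1) = 1.
  have -> : s + 1 = 2%:R + (s - 1) by ring.
  by rewrite (abs_addl cP) (abs2 S).
have hs : abs (s - 1) <= r.
  have e : s ^+ 2 - 1 = (s - 1) * (s + 1) by ring.
  by move: hr; rewrite e (absM cP) sp1 mulr1.
have d1 : abs ((line s^-1).[x] - 1) < 1.
  by apply: (cong1_horner S) => //; apply: (cong1_line S); exact: (principalV cP).
have d0 := abs_princ_neq0 cP d1.
have -> : curve T x 0 i - (1 + x * (s ^+ 2 - 1)) =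
    (s - 1) ^+ 2 * (x * (x - 1) * (s + 1) / s / (line s^-1).[x]).
  rewrite mxE -/s; move: d0; rewrite !horner_line => d0.
  have d2 : s + (1 - s) * x != 0.
    have -> : s + (1 - s) * x = s * (1 + (s^-1 - 1) * x) by field.
    by rewrite mulf_neq0.
  by field; rewrite s0 mulN1r d2.
rewrite (absM cP) (absX cP) -[_ ^+ 2 in leRHS]mulr1.
apply: ler_pM; rewrite ?exprn_ge0 ?(abs_ge0 cP) //.
  by rewrite ler_pXn2r ?nnegrE ?(abs_ge0 cP) //; exact: le_trans (abs_ge0 cP _) hs.
rewrite !(absM cP) !(absV cP) s1 sp1 (abs_princ_unit cP d1) invr1 !mulr1.
by rewrite -(absM cP); apply: (absM_le1 cP) => //; apply: (absB_le cP) => //; rewrite (abs1 cP).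
Qed.

(** All terms beyond the first order carry a factor $c^2$. *)
Lemma prod_near (r : R) c (x : seq Omega) : r < 1 -> abs c <= r ->
  (forall y, y \in x -> abs y <= 1) ->
  abs (\prod_(y <- x) (1 + y * c) - (1 + (\sum_(y <- x) y) * c)) <= r ^+ 2.
Proof.
move=> r1 hc; have r0 := le_trans (abs_ge0 cP c) hc.
elim: x => [|y x IH] hx; first by rewrite !big_nil mul0r addr0 subrr (abs0 cP) exprn_ge0.
rewrite !big_cons; set Pr := \prod_(j <- x) _; set Sm := \sum_(j <- x) _.
have hy : abs y <= 1 by apply: hx; rewrite inE eqxx.
have hx' z : z \in x -> abs z <= 1 by move=> hz; apply: hx; rewrite inE hz orbT.
have {IH}hP := IH hx'; rewrite -/Pr -/Sm in hP.
have -> : (1 + y * c) * Pr - (1 + (y + Sm) * c) =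
    (1 + y * c) * (Pr - (1 + Sm * c)) + c * c * (y * Sm) by ring.
have hyc : abs (y * c) <= 1 by apply: (absM_le1 cP) => //; exact: le_trans hc (ltW r1).
have hS : abs Sm <= 1.
  rewrite /Sm big_seq; apply: (abs_sum_le cP) => // z hz; exact: hx'.
apply: (absD_le cP); rewrite (absM cP).
  rewrite -[leRHS]mul1r; apply: ler_pM; rewrite ?(abs_ge0 cP) //.
  by apply: (absD_le cP) => //; rewrite (abs1 cP).
rewrite -[leRHS]mulr1; apply: ler_pM; rewrite ?(abs_ge0 cP) //.
  by rewrite (absM cP) expr2; apply: ler_pM; rewrite ?(abs_ge0 cP).
exact: (absM_le1 cP).
Qed.

Lemma bounded_away T : principal abs T -> exists r : R, [/\ 0 <= r, r < 1 &
  forall i, abs (T 0 i - 1) <= r].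
Proof.
move=> pT; exists (\big[Num.max/0]_i abs (T 0 i - 1)); split.
- by elim/big_ind: _ => // [x y hx hy|i _]; [rewrite le_max hx | exact: (abs_ge0 cP)].
- by elim/big_ind: _ => // x y hx hy; rewrite gt_max hx hy.
by move=> i; rewrite (bigD1 i) //= le_max lexx.
Qed.

Variables (A : comAlgType OK) (ev : A -> 'rV[Omega]_n -> Omega).
Hypothesis neron : connected_neron_model abs rho K iota ev.

Lemma principal_curve_integral T x a : points rho K T -> principal abs T ->
  abs x <= 1 -> abs (ev a (curve T x)) <= 1.
Proof.
move=> hT pT hx; have [D [h1 h2 h3]] := curve_denom_lift S hT pT.
exact: (curve_integral S neron hT h1 h2 h3).
Qed.

Lemma principal_points0 T : points rho K T -> principal abs T -> points0 abs rho ev K T.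
Proof.
move=> hT pT; split => // a.
have [T' [hT' pT' r]] := principal_sqrt_point hT pT.
rewrite -(curve1 r (proj1 hT')); apply: principal_curve_integral => //.
by rewrite (abs1 cP).
Qed.

Variables (d : nat) (g0 : Omega -> Omega).
Hypothesis d_gt0 : (0 < d)%N.
Hypothesis M_card : residue_card abs M (q ^ d).
Hypothesis g0_Gal : Gal M g0.
Hypothesis g0_cong : forall x, abs x <= 1 -> abs (g0 x - x ^+ (q ^ d)) < 1.
Variables (chi psi : 'rV[Omega]_n -> R[i]).
Hypothesis chi_char : is_character (points0 abs rho ev K) chi.
Hypothesis psi_principal : forall T, points rho Mur T -> principal abs T -> psi T = 1.
Hypothesis chi_norm : forall T, points0 abs rho ev Mur T ->
  chi (tnorm rho (fun i : 'I_d => iter i Fr) T) = psi T.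

Let Mur_K s : Gal Mur s -> Gal K s.
Proof. exact: Gal_sub (@K_Mur _ K _ rho). Qed.

Lemma tnorm_row T : tnorm rho (fun i : 'I_d => iter i Fr) T =
  \row_i \prod_(j <- seq.iota 0 d) gact rho (iter j Fr) T 0 i.
Proof.
have -> : seq.iota 0 d = index_iota 0 d by rewrite /index_iota subn0.
by apply/rowP => i; rewrite mxE [RHS]mxE big_mkord.
Qed.

(* Multiplying [T] by the inverse of the norm of the point with parameter
   [theta] of the curve, where [theta] has trace [1], squares the distance to
   [1]; [chi] of that norm is [1]. *)
Lemma chi_near1 T (r : R) : points rho K T -> r < 1 -> (forall i, abs (T 0 i - 1) <= r) ->
  exists T', [/\ points rho K T', chi T' = chi T & forall i, abs (T' 0 i - 1) <= r ^+ 2].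
Proof.
move=> hT r1 hr.
have pT : principal abs T by move=> i; exact: le_lt_trans (hr i) r1.
have [U [hU pU sq]] := principal_sqrt_point hT pT.
have [th [thM th1 thS]] := trace_one S d_gt0 M_card g0_Gal g0_cong.
have Frth j : abs (iter j Fr th) <= 1 by rewrite (abs_GalF cP _ QK (FrnG j)).
have cur_t x : abs x <= 1 -> torus (curve U x).
  move=> hx i; apply: (abs_princ_neq0 cP); exact: curve_principal.
have c_Mur : points0 abs rho ev Mur (curve U th).
  split; last by move=> a; exact: principal_curve_integral.
  split; first exact: cur_t.
  by move=> s hs; rewrite (curve_Gal S) //; [rewrite (Gal_fix hs) | exact: Mur_K].
pose N := \row_i \prod_(j <- seq.iota 0 d) curve U (iter j Fr th) 0 i.
have NE : tnorm rho (fun i : 'I_d => iter i Fr) (curve U th) = N.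
  rewrite tnorm_row; apply/rowP => i; rewrite !mxE; apply: eq_bigr => j _.
  by rewrite (curve_Gal S).
have chiN : chi N = 1.
  by rewrite -NE chi_norm // psi_principal //; [case: c_Mur | exact: curve_principal].
have near i : abs (N 0 i - T 0 i) <= r ^+ 2.
  (* Trace $1$ makes $T_i$ itself the first-order expansion of the norm. *)
  have -> : T 0 i = 1 + (\sum_(y <- [seq iter j Fr th | j <- seq.iota 0 d]) y) * (T 0 i - 1).
    have -> : seq.iota 0 d = index_iota 0 d by rewrite /index_iota subn0.
    by rewrite big_map big_mkord thS mul1r addrC subrK.
  rewrite mxE -(subrKA (\prod_(y <- [seq iter j Fr th | j <- seq.iota 0 d]) (1 + y * (T 0 i - 1)))).
  apply: (absD_le cP); last first.
    by apply: prod_near => // y /mapP[j _ ->].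
  rewrite big_map; apply: (abs_cong_prod_le cP).
  - by rewrite exprn_ge0 // (le_trans (abs_ge0 cP _) (hr i)).
  - by move=> j; rewrite (abs_princ_unit cP) //; exact: curve_principal.
  - move=> j; rewrite -sq; apply: (absD_le cP); rewrite ?(abs1 cP) //.
    apply: (absM_le1 cP) => //; rewrite sq; exact: ltW.
  - by move=> j; rewrite -sq; apply: curve_near => //; rewrite sq.
have pN : principal abs N.
  move=> i; rewrite -(subrKA (T 0 i)); apply: (absD_lt cP) => //.
  apply: le_lt_trans (near i) _; have r0 := le_trans (abs_ge0 cP _) (hr i).
  by rewrite expr_lt1.
have hN : points rho K N.
  split; first by move=> i; exact: (abs_princ_neq0 cP).
  move=> s hs; rewrite /N gact_prod //; have [a _ ha] := Gal_on_Mur S d_gt0 g0_Gal g0_cong hs.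
  pose F j i := curve U (iter j Fr th) 0 i.
  have Fd i : F d i = F 0%N i by rewrite /F (Frd_Mur S g0_Gal g0_cong).
  (* On [Mur] the Galois group of $K$ acts by powers of Frobenius, which shift the factors of the
     norm cyclically. *)
  have shift i b : \prod_(j <- seq.iota 0 d) F (b + j)%N i = \prod_(j <- seq.iota 0 d) F j i.
    elim: b => [|b <-]; first by [].
    have per j : F (d + j)%N i = F j i.
      by rewrite /F addnC iterD (Frd_Mur S g0_Gal g0_cong).
    have [d' ed] : exists d', d = d'.+1 by exists d.-1; rewrite prednK.
    have -> : seq.iota 0 d = index_iota 0 d'.+1 by rewrite /index_iota subn0 ed.
    rewrite big_nat_recr //= [RHS]big_nat_recl //= mulrC; congr (_ * _).
      by rewrite addn0 -[RHS]per ed addSnnS addnC.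
    by apply: eq_bigr => j _; rewrite addSnnS.
  apply/rowP => i; rewrite !mxE -[RHS](shift i a); apply: eq_bigr => j _.
  rewrite (curve_Gal S) // ha; last exact: (Mur_Frn S).
  by rewrite /F iterD.
clearbody N.
have N0 : points0 abs rho ev K N by exact: principal_points0.
exists (\row_i (T 0 i / N 0 i)).
have pQ : principal abs (\row_i (T 0 i / N 0 i)).
  by move=> i; rewrite mxE; apply: (principalM cP) => //; exact: (principalV cP).
have hQ : points rho K (\row_i (T 0 i / N 0 i)).
  split; first by move=> i; exact: (abs_princ_neq0 cP).
  move=> s hs; have [e [w hw]] := rho_signed_perm S hs; apply/rowP => i.
  rewrite (gactE _ _ hw) !mxE -[in RHS](proj2 hT s hs) -[in RHS](proj2 hN s hs) !(gactE _ _ hw).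
  have [f ->] := Gal_rmorphism hs; rewrite -fmorph_div.
  by case: e {hw} => //; rewrite invf_div mulrC invrK.
split => //.
  have := chi_char.2 _ _ (principal_points0 hQ pQ) N0; rewrite chiN mulr1 => <-.
  congr chi; apply/rowP => i; rewrite !mxE divfK //.
  exact: (abs_princ_neq0 cP (pN i)).
move=> i; rewrite mxE; have n0 := abs_princ_neq0 cP (pN i).
have -> : T 0 i / N 0 i - 1 = - (N 0 i - T 0 i) / N 0 i by field.
by rewrite (absM cP) (absN cP) (absV cP) (abs_princ_unit cP (pN i)) invr1 mulr1.
Qed.

(** Each use of [chi_near1] squares the radius; the slower rate $r^{N+1}$ already reaches every
    positive radius. *)
Lemma chi_near T (r : R) N : points rho K T -> 0 <= r -> r < 1 ->
  (forall i, abs (T 0 i - 1) <= r) ->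
  exists T', [/\ points rho K T', chi T' = chi T & forall i, abs (T' 0 i - 1) <= r ^+ N.+1].
Proof.
move=> hT r0 r1 hr; elim: N => [|N [T1 [h1 h2 h3]]]; first by exists T; rewrite expr1.
have [|T' [h4 h5 h6]] := chi_near1 h1 _ h3; first by rewrite expr_lt1.
exists T'; split=> //; first by rewrite h5.
move=> i; apply: le_trans (h6 i) _.
by rewrite -exprM ler_wiXn2l // ?(ltW r1) //; lia.
Qed.

(* Once [T] is close to [1] it is the [d]-th power, hence the norm, of a
   principal point over [K]. *)
Theorem chi_principal T : points rho K T -> principal abs T -> chi T = 1.
Proof.
move=> hT pT; have [r [r0 r1 hr]] := bounded_away pT.
have d1 : 0 < abs (d%:R : Omega) ^+ d.
  by rewrite exprn_gt0 // (abs_gt0 cP) // (natr_Omega_neq0 cP p_prime).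
(* The radius within which [root_near1] yields $d$-th roots; $d$ may be divisible by $p$. *)
have [N hN] : exists N, r ^+ N.+1 < abs (d%:R : Omega) ^+ d.
  apply: contrapT => no; have : 1 <= r; last by rewrite leNgt r1.
  apply: (@expr_le_bound R 1 r (abs (d%:R : Omega) ^+ d)^-1) => // j.
  rewrite expr1n mulrC ler_pdivlMr // mul1r; apply: (@le_trans _ _ (r ^+ j.+1)).
    by rewrite leNgt; apply/negP => lt; apply: no; exists j.
  by rewrite exprS ler_piMl ?exprn_ge0 // ltW.
have [T1 [hT1 <- near]] := chi_near N hT r0 r1 hr.
have /choice[y hy] i : exists v, v ^+ d = T1 0 i /\ abs (v - 1) < abs (d%:R : Omega).
  have [|v h1 h2] := root_near1 cP (u := T1 0 i) d_gt0; last by exists v.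
  exact: le_lt_trans (near i) hN.
have d_le1 := abs_nat_le1 cP d.
have pY : principal abs (\row_i y i).
  by move=> i; rewrite mxE; have [_ h1] := hy i; exact: lt_le_trans d_le1.
have rY i : (\row_i y i) 0 i ^+ d = T1 0 i by rewrite mxE; case: (hy i).
have hY : points rho K (\row_i y i).
  apply: (@points_unique_root T1 _ (fun u => abs (u - 1) < abs (d%:R : Omega)) d) => //.
  - by move=> u v hu hv; exact: (root_near1_unique cP p_prime).
  - move=> g u hg hu; have g1 : g 1 = 1 by have [f ->] := Gal_rmorphism hg; exact: rmorph1.
    by rewrite -{1}g1 (abs_GalB cP _ _ QK hg).
  - move=> u hu; have pu : abs (u - 1) < 1 by exact: lt_le_trans d_le1.
    have u0 := abs_princ_neq0 cP pu.
    have -> : u^-1 - 1 = - (u - 1) / u by field.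
    by rewrite (absM cP) (absN cP) (absV cP) (abs_princ_unit cP pu) invr1 mulr1.
  - by move=> i; split; [exact: (abs_princ_neq0 cP (pY i)) | rewrite mxE; case: (hy i)].
have hYM : points rho Mur (\row_i y i).
  by split; [exact: hY.1 | move=> s hs; apply: hY.2; exact: Mur_K].
have hY0 : points0 abs rho ev Mur (\row_i y i).
  by split => //; case: (principal_points0 hY pY).
rewrite -(psi_principal hYM pY) -(chi_norm hY0); congr chi.
rewrite tnorm_row; apply/rowP => i; rewrite [RHS]mxE -rY.
rewrite (eq_bigr (fun=> (\row_i y i) 0 i)) => [|j _]; last by rewrite hY.2.
by rewrite big_const_seq count_predT size_iota -Monoid.iteropE.
Qed.

End PrincipalPoints.

(** A copy of [Q] on which [OK] acts through [f]; the morphism is kept in the type so that the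
    algebra structure can be inferred from it. *)
Definition ralg (OK Q : comNzRingType) (f : {rmorphism OK -> Q}) : Type := Q.

Section RingAsAlgebra.
Variables (OK Q : comNzRingType) (f : {rmorphism OK -> Q}).
Local Notation T := (ralg f).

HB.instance Definition _ := GRing.ComNzRing.copy T Q.

Program Definition ralg_lmod := GRing.Zmodule_isLmodule.Build OK T
  (scale := fun c (x : T) => (f c : T) * x) _ _ _ _.
Next Obligation. by move=> a b x /=; rewrite mulrA -rmorphM. Qed.
Next Obligation. by move=> x /=; rewrite rmorph1 mul1r. Qed.
Next Obligation. by move=> a x y /=; exact: mulrDr. Qed.
Next Obligation. by move=> x a b /=; rewrite rmorphD mulrDl. Qed.
HB.instance Definition _ := ralg_lmod.

Program Definition ralg_lalg := GRing.Lmodule_isLalgebra.Build OK T _.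
Next Obligation. by move=> a x y; exact: mulrA. Qed.
HB.instance Definition _ := ralg_lalg.
HB.instance Definition _ := GRing.Lalgebra_isComAlgebra.Build OK T.

Lemma ralg_scale c (x : T) : c *: x = (f c : T) * x. Proof. by []. Qed.
End RingAsAlgebra.

(** * Lifting special points *)

Section LiftModuloIdeals.
Variables (OK : comNzRingType) (A : comAlgType OK).
Implicit Types (I : set OK) (g : A -> OK).

(** Homomorphisms modulo an ideal are kept as maps into [OK] that satisfy the axioms up to it, so
    that approximations at different levels can be compared and have a limit. *)
Definition hom_mod I g := [/\ I (g 1 - 1), forall a b, I (g (a + b) - (g a + g b)),
  forall a b, I (g (a * b) - g a * g b) & forall c a, I (g (c *: a) - c * g a)].

(* Smoothness is applied to the square-zero extension [Q'] of [Q]. *)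
Lemma lift_mod (Q Q' : comNzRingType) (pi : {rmorphism OK -> Q}) (pi' : {rmorphism OK -> Q'}) g :
  smooth A ->
  (forall x, exists c, pi c = x) -> (forall x, exists c, pi' c = x) ->
  (forall c, pi' c = 0 -> pi c = 0) ->
  (forall c c', pi c = 0 -> pi c' = 0 -> pi' (c * c') = 0) ->
  hom_mod [set c | pi c = 0] g ->
  exists2 g', hom_mod [set c | pi' c = 0] g' & forall a, pi (g' a - g a) = 0.
Proof.
move=> [_ smA] pi_surj pi'_surj ker_sub ker_nil [/= g1 gD gM gZ].
have sub0 (V : zmodType) (x y : V) : x - y = 0 -> x = y by move/eqP; rewrite subr_eq0 => /eqP.
have /choice[s hs] := pi'_surj.
have s_pi c : pi (s (pi' c)) = pi c.
  by apply: sub0; rewrite -rmorphB; apply: ker_sub; rewrite rmorphB /= hs subrr.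
pose C := ralg pi'; pose V := ralg pi.
pose f (x : C) : V := pi (s x).
have f_linear : linear f.
  move=> c x y; rewrite -[x]hs -[y]hs /f ralg_scale -rmorphM -rmorphD !s_pi.
  by rewrite rmorphD rmorphM.
have f_mul : {morph f : x y / x * y}.
  by move=> x y; rewrite -[x]hs -[y]hs /f -[X in s X](rmorphM pi') !s_pi rmorphM.
have f_one : f 1 = 1 by rewrite /f -[X in s X](rmorph1 pi') s_pi rmorph1.
pose fl : {lrmorphism C -> V} := HB.pack_for {lrmorphism C -> V} f
  (GRing.isLinear.Build OK C V _ f f_linear)
  (GRing.isMonoidMorphism.Build C V f (f_one, f_mul)).
pose h (a : A) : V := pi (g a).
have h_linear : linear h.
  move=> c a b; rewrite /h ralg_scale -rmorphM -rmorphD; apply: sub0; rewrite -rmorphB.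
  have -> : g (c *: a + b) - (c * g a + g b) =
    (g (c *: a + b) - (g (c *: a) + g b)) + (g (c *: a) - c * g a) by ring.
  by rewrite rmorphD /= gD gZ addr0.
have h_mul : {morph h : x y / x * y}.
  by move=> x y; rewrite /h -rmorphM; apply: sub0; rewrite -rmorphB.
have h_one : h 1 = 1.
  by rewrite /h -[RHS](rmorph1 pi); apply: sub0; rewrite -rmorphB.
pose hl : {lrmorphism A -> V} := HB.pack_for {lrmorphism A -> V} h
  (GRing.isLinear.Build OK A V _ h h_linear)
  (GRing.isMonoidMorphism.Build A V h (h_one, h_mul)).
have [||g' hg'] := smA C V fl _ _ hl.
- by move=> x; have [c <-] := pi_surj x; exists (pi' c); exact: s_pi.
- move=> x y; rewrite -[x]hs -[y]hs /fl /= /f !s_pi => hx hy.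
  by rewrite -[LHS](rmorphM pi'); exact: ker_nil.
exists (fun a => s (g' a)); last first.
  by move=> a; rewrite rmorphB; have := hg' a; rewrite /fl /hl /= /f /h => ->; rewrite subrr.
split => /= [|a b|a b|c a]; rewrite rmorphB ?rmorphD ?rmorphM /= !hs.
- by rewrite !rmorph1 subrr.
- by rewrite ?rmorphD /= subrr.
- by rewrite ?rmorphM /= subrr.
- by rewrite linearZ /= subrr.
Qed.

End LiftModuloIdeals.

Section LiftSpecialPoints.
Local Open Scope quotient_scope.
Variables (R : realType) (Omega : closedFieldType) (abs : Omega -> R).
Variables (p : nat) (Qp K E : set Omega).
Variables (OK : comNzRingType) (iota : {rmorphism OK -> Omega}).
Variables (k : finFieldType) (res : {rmorphism OK -> k}).
Variables (n : nat) (h : 'M[Omega]_n) (tt Fr : Omega -> Omega) (omega : 'S_n).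
Variables (rho : (Omega -> Omega) -> 'M[int]_n) (art : Omega -> Omega -> Omega).
Hypothesis S :
  torus_setting abs p Qp K E iota res h tt Fr omega rho art.
Implicit Types (x y z : Omega) (s t g : Omega -> Omega).

Let cP := ts_closure S.
Let p_prime := ts_prime S.
Implicit Types (c : OK).

Lemma ball_quotient (r : R) : 0 <= r -> r < 1 ->
  exists (Q : comNzRingType) (pi : {rmorphism OK -> Q}),
    (forall y : Q, exists c, pi c = y) /\ forall c, pi c = 0 <-> abs (iota c) <= r.
Proof.
move=> r0 r1; pose I : pred OK := fun c => abs (iota c) <= r.
have Iz : zmod_closed I.
  split; first by rewrite unfold_in /I rmorph0 (abs0 cP).
  by move=> a b; rewrite !unfold_in /I rmorphB; exact: (absB_le cP).
have Ip : 1 \notin I /\ forall a, {in I, forall u, a * u \in I}.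
  split; first by rewrite unfold_in /I rmorph1 (abs1 cP) -ltNge.
  move=> a b; rewrite !unfold_in /I rmorphM /= (absM cP) => hb.
  apply: le_trans hb; rewrite ler_piMl ?(abs_ge0 cP) //.
  by case: (iota_int (ts_integers S) a).
pose Id : idealr OK := HB.pack_for (idealr OK) I
  (GRing.isZmodClosed.Build OK I Iz) (isProperIdeal.Build OK I Ip).
pose Q : comNzRingType := {ideal_quot Id}.
exists Q, (\pi_({ideal_quot Id}) : {rmorphism OK -> {ideal_quot Id}}); split.
  by move=> x; exists (repr (x : {ideal_quot Id})); exact: reprK.
move=> c; have e := Quotient.idealrBE Id c 0; rewrite subr0 in e.
split=> [h0|hc]; first by have : c \in Id by rewrite e; apply/eqP; rewrite [LHS]h0 rmorph0.
have hI : c \in Id by []; rewrite hI in e.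
by move/esym/eqP: e => /= ->; exact: rmorph0.
Qed.

Variable A : comAlgType OK.
Hypothesis smooth_A : smooth A.

Definition ball (r : R) : set OK := [set c | abs (iota c) <= r].

(** The elements of absolute value at most $r$ form an ideal whose square lies in the ideal of
    radius $r^2$, so that one use of smoothness doubles the precision. *)
Lemma lift_step (r : R) (g : A -> OK) : 0 <= r -> r < 1 -> hom_mod (ball r) g ->
  exists g' : A -> OK, hom_mod (ball (r * r)) g' /\ forall a, abs (iota (g' a) - iota (g a)) <= r.
Proof.
move=> r0 r1 hg.
have rr1 : r * r < 1 by rewrite -expr2 expr_lt1.
have [Q [pi [surj ker]]] := ball_quotient r0 r1.
have [Q' [pi' [surj' ker']]] := ball_quotient (mulr_ge0 r0 r0) rr1.
have kE : [set c | pi c = 0] = ball r by apply/seteqP; split => c /= /ker.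
have kE' : [set c | pi' c = 0] = ball (r * r) by apply/seteqP; split => c /= /ker'.
have [|||g' hg' near] := @lift_mod OK A Q Q' pi pi' g smooth_A surj surj' _ _ _.
- by move=> c /ker' hc; apply/ker; apply: le_trans hc _; rewrite ler_piMl // ltW.
- move=> c c' /ker hc /ker hc'; apply/ker'; rewrite rmorphM (absM cP).
  by apply: ler_pM; rewrite ?(abs_ge0 cP).
- by rewrite kE.
exists g'; rewrite -kE'; split => // a; rewrite -rmorphB; exact/ker.
Qed.

(** The precision passes from $r^{2^m}$ to $r^{2^{m+1}}$ at each step, where $r$ is the absolute
    value of a uniformizer. The values converge by completeness of $K$, and the limit satisfies the
    axioms exactly since its error is below every bound. *)
Lemma lift_special_point (f : A -> k) : special_points res f -> exists g : A -> OK,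
  [/\ g 1 = 1, forall a b, g (a + b) = g a + g b, forall a b, g (a * b) = g a * g b,
      forall c a, g (c *: a) = c * g a & forall a, res (g a) = f a].
Proof.
move=> [[f' ff'] fZ]; have [w [Kw w0 w1 wmax]] := K_uniformizer S.
set r := abs w in w1 wmax.
have r0 : 0 <= r by exact: (abs_ge0 cP).
have res0 c : res c = 0 -> ball r c.
  move=> /(proj2 (ts_residue S)) hc; apply: wmax => //.
  by case: (iota_int (ts_integers S) c).
have /choice[G0 hG0] a : exists c, res c = f a by exact: (proj1 (ts_residue S)).
have G0_hom : hom_mod (ball r) G0.
  by split=> [|a b|a b|c a]; apply: res0; rewrite rmorphB ?rmorphD ?rmorphM /= !hG0 ?fZ ff'
    ?rmorph1 ?rmorphD ?rmorphM subrr.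
pose rr m := r ^+ (2 ^ m).
have rr0 m : 0 <= rr m by rewrite exprn_ge0.
have rr1 m : rr m < 1 by rewrite expr_lt1 // expn_gt0.
have rrS m : rr m.+1 = rr m * rr m by rewrite /rr -exprD expnS mul2n addnn.
(* One step is chosen for every pair of a level and a map, with no condition when the map is not an
   approximate homomorphism of that level. *)
have /choice[next hnext] (mg : nat * (A -> OK)) : exists g' : A -> OK,
    hom_mod (ball (rr mg.1)) mg.2 -> hom_mod (ball (rr mg.1.+1)) g' /\
      forall a, abs (iota (g' a) - iota (mg.2 a)) <= rr mg.1.
  have [hg|nh] := pselect (hom_mod (ball (rr mg.1)) mg.2); last by exists mg.2.
  by have [g' h1] := lift_step (rr0 _) (rr1 _) hg; exists g'; rewrite rrS.
pose fix G m := if m is m'.+1 then next (m', G m') else G0.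
have G_hom m : hom_mod (ball (rr m)) (G m).
  elim: m => [|m IH] /=; first by rewrite /rr expr1.
  by have [] := hnext (m, G m) IH.
have G_step m a : abs (iota (G m.+1 a) - iota (G m a)) <= rr m.
  by have [_ ] := hnext (m, G m) (G_hom m); apply.
have rr_le m j : (m <= j)%N -> rr j <= rr m.
  by move=> mj; rewrite ler_wiXn2l // ?ltW // leq_exp2l.
have rr_small (e : R) : 0 < e -> exists m, rr m < e.
  move=> e0; apply: contrapT => no; have : 1 <= r; last by rewrite leNgt w1.
  apply: (@expr_le_bound R 1 r e^-1) => // j.
  rewrite expr1n mulrC ler_pdivlMr // mul1r; apply: (@le_trans _ _ (rr j)).
    by rewrite leNgt; apply/negP => lt; apply: no; exists j.
  by rewrite ler_wiXn2l // ?ltW // ltnW // ltn_expl.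
have G_near a m j : (m <= j)%N -> abs (iota (G j a) - iota (G m a)) <= rr m.
  elim: j => [|j IH]; first by rewrite leqn0 => /eqP ->; rewrite subrr (abs0 cP).
  rewrite leq_eqVlt => /orP[/eqP <-|]; first by rewrite subrr (abs0 cP).
  rewrite ltnS => mj; rewrite -(subrKA (iota (G j a))); apply: (absD_le cP); last exact: IH.
  exact: le_trans (G_step j a) (rr_le _ _ mj).
have int c : K (iota c) /\ abs (iota c) <= 1 by exact: (iota_int (ts_integers S)).
have /choice[g hg] a : exists c, forall m, abs (iota c - iota (G m a)) <= rr m.
  have [||l Kl tl] := finite_ext_complete cP p_prime (y := fun m => iota (G m a)) (ts_finite S).
  - by move=> m; case: (int (G m a)).
  - move=> e /rr_small[m hm]; exists m => j mj.
    exact: le_lt_trans (le_trans (G_step j a) (rr_le _ _ mj)) hm.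
  have near m : abs (l - iota (G m a)) <= rr m.
    rewrite leNgt; apply/negP => lt.
    have [N hN] := tl (abs (l - iota (G m a))) (le_lt_trans (rr0 m) lt).
    have h1 := hN (maxn N m) (leq_maxl _ _); have h2 := G_near a m _ (leq_maxr N m).
    have := absD_lt cP (e := abs (l - iota (G m a))) (x := l - iota (G (maxn N m) a))
      (y := iota (G (maxn N m) a) - iota (G m a)).
    rewrite subrKA ltxx; move=> hf; suff: false by []; apply: hf.
      by rewrite (absB_sym cP).
    exact: le_lt_trans lt.
  have [||c hc] := @iota_surj _ _ _ _ _ _ (ts_integers S) l => //; last first.
    by exists c => m; rewrite hc.
  rewrite -(subrK (iota (G 0%N a)) l); apply: (absD_le cP); last by case: (int (G 0%N a)).
  exact: le_trans (near 0%N) (ltW (rr1 0%N)).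
have zero c : (forall m, ball (rr m) c) -> c = 0.
  move=> hc; apply: (iota_inj S); rewrite rmorph0; apply/eqP; apply: contraT => n0.
  by have [m hm] := rr_small _ (abs_gt0 cP n0); have := hc m; rewrite /ball /= leNgt hm.
have ballD m c c' : ball (rr m) c -> ball (rr m) c' -> ball (rr m) (c + c').
  by rewrite /ball /= rmorphD; exact: (absD_le cP).
have ballM m c c' : ball (rr m) c' -> ball (rr m) (c * c').
  rewrite /ball /= rmorphM /= (absM cP) => hc; apply: le_trans hc.
  by rewrite ler_piMl ?(abs_ge0 cP) //; case: (int c).
have hg1 m a : ball (rr m) (g a - G m a) by rewrite /ball /= rmorphB.
have hg2 m a : ball (rr m) (G m a - g a) by rewrite /ball /= rmorphB (absB_sym cP).
exists g; split.
- apply/eqP; rewrite -subr_eq0; apply/eqP/zero => m; have [h1 _ _ _] := G_hom m.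
  have -> : g 1 - 1 = (g 1 - G m 1) + (G m 1 - 1) by ring.
  exact: ballD.
- move=> a b; apply/eqP; rewrite -subr_eq0; apply/eqP/zero => m; have [_ h1 _ _] := G_hom m.
  have -> : g (a + b) - (g a + g b) = ((g (a + b) - G m (a + b)) + (G m (a + b) - (G m a + G m b)))
    + ((G m a - g a) + (G m b - g b)) by ring.
  by apply: (ballD) => //; apply: ballD.
- move=> a b; apply/eqP; rewrite -subr_eq0; apply/eqP/zero => m; have [_ _ h1 _] := G_hom m.
  have -> : g (a * b) - g a * g b = ((g (a * b) - G m (a * b)) + (G m (a * b) - G m a * G m b))
    + (G m b * (G m a - g a) + g a * (G m b - g b)) by ring.
  by apply: (ballD) => //; apply: ballD => //; exact: ballM.
- move=> c a; apply/eqP; rewrite -subr_eq0; apply/eqP/zero => m; have [_ _ _ h1] := G_hom m.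
  have -> : g (c *: a) - c * g a = ((g (c *: a) - G m (c *: a)) + (G m (c *: a) - c * G m a))
    + c * (G m a - g a) by ring.
  by apply: (ballD) => //; [apply: ballD | exact: ballM].
move=> a; rewrite -hG0; apply/(res_cong (ts_residue S)).
exact: le_lt_trans (hg a 0%N) (rr1 0%N).
Qed.

End LiftSpecialPoints.

(** * Reduction of integral points *)

Section IntegralPoints.
Variables (R : realType) (Omega : closedFieldType) (abs : Omega -> R).
Variables (p : nat) (Qp K E : set Omega).
Variables (OK : comNzRingType) (iota : {rmorphism OK -> Omega}).
Variables (k : finFieldType) (res : {rmorphism OK -> k}).
Variables (n : nat) (h : 'M[Omega]_n) (tt Fr : Omega -> Omega) (omega : 'S_n).
Variables (rho : (Omega -> Omega) -> 'M[int]_n) (art : Omega -> Omega -> Omega).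
Hypothesis S :
  torus_setting abs p Qp K E iota res h tt Fr omega rho art.
Implicit Types (x y z : Omega) (s t g : Omega -> Omega).

Let cP := ts_closure S.
Let p_prime := ts_prime S.
Let q := #|k|.
Let KF : is_subfield K := base_field (ts_finite S).
Let QK : Qp `<=` K := base_sub (ts_finite S).
Let M := splitting_field rho K.
Let Fr_frob := ts_Fr S.
Let FrG : Gal K Fr := Fr_Gal (ts_Fr S).
Let FrnG i : Gal K (iter i Fr) := Gal_iter i FrG.
Let ttG : Gal K tt. Proof. by case: (ts_tt S). Qed.
Let q_gt1 : (1 < q)%N := card_k_gt1 k.
Variables (A : comAlgType OK) (ev : A -> 'rV[Omega]_n -> Omega).
Hypothesis group_A : group_model rho K iota ev.
Implicit Types (T : 'rV[Omega]_n) (l : 'cV[int]_n).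

Let model : torus_model rho K iota ev. Proof. by case: group_A. Qed.
Let t1 := @tone_torus Omega n.
Let P0 := points0 abs rho ev K.

Lemma points0_torus T : P0 T -> torus T.
Proof. by case=> [[]]. Qed.

Lemma points0_value T a : P0 T -> exists c, iota c = ev a T.
Proof.
move=> [[hT fT] int]; apply: (iota_surj (ts_integers S)) => //.
apply: (Gal_fixed cP p_prime) => // s hs.
by rewrite -(ev_gact model) // fT.
Qed.

Lemma comul a : exists D : seq (A * A), comultiplication ev a D.
Proof. by case: group_A. Qed.

Lemma points_tmul T T' : points rho K T -> points rho K T' -> points rho K (tmul T T').
Proof.
move=> [hT fT] [hT' fT']; split; first exact: tmul_torus.
move=> s hs; have [e [w hw]] := rho_signed_perm S hs; apply/rowP => i.
rewrite (gactE _ _ hw) !mxE -[in RHS](fT s hs) -[in RHS](fT' s hs) !(gactE _ _ hw).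
have [f ->] := Gal_rmorphism hs; rewrite -rmorphM.
by case: e {hw} => //; rewrite invfM.
Qed.

Lemma points_tinv T : points rho K T -> points rho K (tinv T).
Proof.
move=> [hT fT]; split; first exact: tinv_torus.
move=> s hs; have [e [w hw]] := rho_signed_perm S hs; apply/rowP => i.
rewrite (gactE _ _ hw) !mxE -[in RHS](fT s hs) !(gactE _ _ hw).
have [f ->] := Gal_rmorphism hs; rewrite -fmorphV.
by case: e {hw}.
Qed.

Lemma points0_tmul T T' : P0 T -> P0 T' -> P0 (tmul T T').
Proof.
move=> [pT iT] [pT' iT']; split; first exact: points_tmul.
move=> a; have [D hD] := comul a; rewrite hD; [|exact: pT.1|exact: pT'.1].
by apply: (abs_sum_le cP) => // b _; exact: (absM_le1 cP).
Qed.

Lemma points0_tinv T : P0 T -> P0 (tinv T).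
Proof.
move=> [pT iT]; split; first exact: points_tinv.
by move=> a; case: group_A => _ _ /(_ a)[b hb] _; rewrite hb //; exact: pT.1.
Qed.

Lemma points0_tone : P0 (tone Omega n).
Proof.
split; last by move=> a; case: group_A => _ _ _ /(_ a)[c ->]; case: (iota_int (ts_integers S) c).
split=> // s hs; have [e [w hw]] := rho_signed_perm S hs; apply/rowP => i.
rewrite (gactE _ _ hw) !mxE invr1 if_same.
by have [f ->] := Gal_rmorphism hs; rewrite rmorph1.
Qed.

(* The augmentation ideal maps [a] to [ev a t - ev a 1], and comultiplication
   makes this additive in [t] up to a product of two such differences. *)
Lemma ev_tmul_near (r r' : R) T T' a : torus T -> torus T' ->
  (forall b, abs (ev b T - ev b (tone Omega n)) <= r) ->
  (forall b, abs (ev b T' - ev b (tone Omega n)) <= r') ->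
  abs (ev a (tmul T T') - ev a (tone Omega n) -
    ((ev a T - ev a (tone Omega n)) + (ev a T' - ev a (tone Omega n)))) <= r * r'.
Proof.
move=> hT hT' hr hr'; have [D hD] := comul a.
have r0 : 0 <= r by exact: le_trans (abs_ge0 cP _) (hr a).
have r0' : 0 <= r' by exact: le_trans (abs_ge0 cP _) (hr' a).
have e1 : ev a T = \sum_(b <- D) ev b.1 T * ev b.2 (tone Omega n).
  by rewrite -hD // tmul1.
have e2 : ev a T' = \sum_(b <- D) ev b.1 (tone Omega n) * ev b.2 T'.
  by rewrite -hD // tmulC tmul1.
have e3 : ev a (tone Omega n) = \sum_(b <- D) ev b.1 (tone Omega n) * ev b.2 (tone Omega n).
  by rewrite -hD // tmul1.
have -> : ev a (tmul T T') - ev a (tone Omega n) -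
    ((ev a T - ev a (tone Omega n)) + (ev a T' - ev a (tone Omega n))) =
    \sum_(b <- D) (ev b.1 T - ev b.1 (tone Omega n)) * (ev b.2 T' - ev b.2 (tone Omega n)).
  rewrite hD // e1 e2 e3 -!sumrB -!big_split -sumrB /=; apply: eq_bigr => b _; ring.
apply: (abs_sum_le cP); first exact: mulr_ge0.
by move=> b _; rewrite (absM cP); apply: ler_pM; rewrite ?(abs_ge0 cP).
Qed.

Definition tpow T i : 'rV[Omega]_n := \row_j T 0 j ^+ i.

Lemma tpowS T i : tpow T i.+1 = tmul T (tpow T i).
Proof. by apply/rowP => j; rewrite !mxE exprS. Qed.

Lemma tpow_torus T i : torus T -> torus (tpow T i).
Proof. by move=> hT j; rewrite mxE expf_neq0 //; exact: hT. Qed.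

(** To first order the $i$-th power multiplies the difference from the unit by $i$; for $i=q$ this
    is a contraction. *)
Lemma ev_tpow_near (r : R) T i : torus T -> r <= 1 ->
  (forall b, abs (ev b T - ev b (tone Omega n)) <= r) ->
  forall a, abs (ev a (tpow T i) - ev a (tone Omega n) -
    (ev a T - ev a (tone Omega n)) *+ i) <= r * r.
Proof.
move=> hT r1 hr; have r0 : 0 <= r by exact: le_trans (abs_ge0 cP _) (hr 0).
have rr : r * r <= r by rewrite ler_piMr.
elim: i => [|i IH] a.
  have -> : tpow T 0 = tone Omega n by apply/rowP => j; rewrite !mxE.
  by rewrite subrr mulr0n subrr (abs0 cP) mulr_ge0.
have hi b : abs (ev b (tpow T i) - ev b (tone Omega n)) <= r.
  rewrite -(subrK ((ev b T - ev b (tone Omega n)) *+ i) (ev b (tpow T i) - _)).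
  apply: (absD_le cP); first exact: le_trans (IH b) rr.
  by rewrite -mulr_natl (absM cP); apply: le_trans (hr b); rewrite ler_piMl ?(abs_ge0 cP) // (abs_nat_le1 cP).
have h1 := ev_tmul_near a hT (tpow_torus i hT) hr hi; have h2 := IH a.
rewrite tpowS mulrS.
have e (x y u v : Omega) : x - (y + u) = (x - (y + v)) + (v - u) by ring.
by rewrite (e _ _ _ (ev a (tpow T i) - ev a (tone Omega n))); exact: (absD_le cP).
Qed.

(* Raising to the power [q] contracts the kernel of reduction, and is injective
   on residues. *)
Theorem kernel_principal T : P0 T ->
  (forall a, abs (ev a T - ev a (tone Omega n)) < 1) -> principal abs T.
Proof.
move=> hT near; have hT0 := points0_torus hT.
have [w [Kw w0 w1 wmax]] := K_uniformizer S.
set r := abs w in w1 wmax; have r0 : 0 <= r by exact: (abs_ge0 cP).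
have K_ev T' b : P0 T' -> K (ev b T').
  by move=> /(points0_value b)[c <-]; case: (iota_int (ts_integers S) c).
have hr a : abs (ev a T - ev a (tone Omega n)) <= r.
  apply: wmax => //; apply: is_subfieldB => //; first exact: K_ev.
  by apply: K_ev; exact: points0_tone.
(* The rate of contraction: a $q$-th power multiplies the difference from the unit by $q$, up to an
   error of the order of its square. *)
pose s := Num.max (abs (q%:R : Omega)) r.
have s0 : 0 <= s by rewrite le_max r0 orbT.
have s1 : s < 1 by rewrite gt_max w1 (abs_card_lt1 (ts_residue S)).
have rs : r <= s by rewrite le_max lexx orbT.
have it j a : abs (ev a (tpow T (q ^ j)) - ev a (tone Omega n)) <= s ^+ j.+1.
  elim: j a => [|j IH] a.
    have -> : tpow T (q ^ 0) = T by apply/rowP => i; rewrite mxE expn0 expr1.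
    by rewrite expr1; exact: le_trans (hr a) rs.
  have -> : tpow T (q ^ j.+1) = tpow (tpow T (q ^ j)) q.
    by apply/rowP => i; rewrite !mxE -exprM expnSr.
  have sj : s ^+ j.+1 <= 1 by rewrite exprn_ile1 // ltW.
  have := ev_tpow_near q (tpow_torus (q ^ j) hT0) sj IH a.
  set x := ev a (tpow (tpow T _) _) - _; set y := ev a (tpow T _) - _ => hxy.
  rewrite -(subrK (y *+ q) x); apply: (absD_le cP).
    apply: le_trans hxy _; rewrite -exprD ler_wiXn2l // ?(ltW s1) //; lia.
  rewrite -mulr_natl (absM cP) exprS; apply: ler_pM; rewrite ?(abs_ge0 cP) //.
    by rewrite /s le_max lexx.
  exact: IH.
move=> i; have [D hD] := char_span S model (delta_mx i 0).
have [C C0 hC] : exists2 C : R, 0 < C & forall x : Omega * A, x \in D -> abs x.1 <= C.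
  elim: D {hD} => [|x D [C C0 hC]]; first by exists 1.
  exists (Num.max C (abs x.1)); first by rewrite lt_max C0.
  move=> y; rewrite inE => /orP[/eqP->|/hC h1]; rewrite le_max ?lexx ?orbT //.
  by rewrite h1.
have [j hj] : exists j, C * s ^+ j.+1 < 1.
  apply: contrapT => no; have : 1 <= s; last by rewrite leNgt s1.
  apply: (@expr_le_bound R 1 s C) => // j; rewrite expr1n.
  apply: (@le_trans _ _ (C * s ^+ j.+1)).
    by rewrite leNgt; apply/negP => lt; apply: no; exists j.
  by rewrite ler_pM2l // exprS ler_piMl ?exprn_ge0 // ltW.
(* The unit is written as $1^{q^j}$ so that [cong_q_inj] can cancel the exponent. *)
have close : abs (T 0 i ^+ (q ^ j) - 1 ^+ (q ^ j)) < 1.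
  have e : T 0 i ^+ (q ^ j) - 1 ^+ (q ^ j) =
      \sum_(x <- D) x.1 * (ev x.2 (tpow T (q ^ j)) - ev x.2 (tone Omega n)).
    under eq_bigr do rewrite mulrBr.
    rewrite sumrB -!/(lin_comb _ _ _) -!hD //; last exact: tpow_torus.
    by rewrite !tchar_delta !mxE expr1n.
  rewrite e big_seq; apply: (abs_sum_lt cP) => // x hx; apply: le_lt_trans hj.
  by rewrite (absM cP); apply: ler_pM; rewrite ?(abs_ge0 cP) //; exact: hC.
apply: (cong_q_inj cP (ts_finite S) (ts_integers S) (ts_residue S) Fr_frob _ _ close); last by rewrite (abs1 cP).
rewrite expr1n in close; have := abs_princ_unit cP close; rewrite (absX cP) => /eqP.
rewrite pexpr_eq1 ?(abs_ge0 cP) //; last by rewrite expn_gt0 (ltnW q_gt1).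
by move=> /eqP ->.
Qed.

Hypothesis smooth_A : smooth A.
Variable chi : 'rV[Omega]_n -> R[i].
Hypothesis chi_char : is_character P0 chi.
Hypothesis chi_principal : forall T, points rho K T -> principal abs T -> chi T = 1.

Lemma trivial_on_plus : depth_zero abs rho K ev chi.
Proof.
move=> T [r r_gt0 [[hT iT] hr]]; apply: chi_principal => // i.
have [w hw] := K_uniformizer S; case: (hw) => _ w0 w1 _.
rewrite -tchar_delta; apply: le_lt_trans (hr w _ hw) _.
have w_gt0 := abs_gt0 cP w0.
have -> : 1 = powR (1 : R) r by rewrite powR1.
by apply: gt0_ltr_powR; rewrite ?nnegrE // ltW.
Qed.

Lemma plus_tone : points0plus abs rho K ev K (tone Omega n).
Proof.
exists 1 => //; split; first exact: points0_tone.
move=> w l _; rewrite /tchar big1 => [|i _]; last by rewrite mxE exp1rz.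
by rewrite subrr (abs0 cP) powR_ge0.
Qed.

Lemma descends_to_quotient : induces_on_quotient abs rho K ev chi.
Proof.
(* A representative is picked by choice; the default [tone] does not occur on cosets of integral
   points. *)
pose chibar (X : set 'rV[Omega]_n) :=
  chi (xget (tone Omega n) [set T | P0 T /\ coset0plus abs rho K ev T = X]).
have chibarE T : P0 T -> chibar (coset0plus abs rho K ev T) = chi T.
  move=> hT; rewrite /chibar; case: xgetP => [T' _ [hT' e]|no]; last by case: (no T).
  have : coset0plus abs rho K ev T T'.
    by rewrite -e; exists (tone Omega n); [exact: plus_tone | rewrite tmul1].
  case=> T1 h1 ->; rewrite chi_char.2 //; first by rewrite (trivial_on_plus h1) mulr1.
  by case: h1 => r _ [].
exists chibar => // T T' hT hT'; rewrite !chibarE //; last exact: points0_tmul.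
by split; [exact: chi_char.1 | exact: chi_char.2].
Qed.

Lemma reduces_value T f a : P0 T -> reduces_to iota ev res T f ->
  exists2 c, iota c = ev a T & f a = res c.
Proof. by move=> hT hf; have [c hc] := points0_value a hT; exists c => //; exact: hf. Qed.

Lemma reduction_lift f : special_points res f ->
  exists2 T, P0 T & reduces_to iota ev res T f.
Proof.
move=> hf; have [g [g1 gD gM gZ gf]] := lift_special_point S smooth_A hf.
have [T hT evT] := point_of_hom S model g1 gD gM gZ.
exists T; first by split => // a; rewrite evT; case: (iota_int (ts_integers S) (g a)).
by move=> a c; rewrite evT -gf => /(iota_inj S) ->.
Qed.

(** The quotient of two points with the same reduction lies in the kernel of reduction; it is
    principal, hence killed by [chi]. *)
Lemma chi_reduction f T T' : P0 T -> P0 T' ->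
  reduces_to iota ev res T f -> reduces_to iota ev res T' f -> chi T = chi T'.
Proof.
move=> hT hT' fT fT'; have hV := points0_tinv hT'.
have hQ := points0_tmul hT hV.
have -> : T = tmul (tmul T (tinv T')) T'.
  by rewrite -tmulA (tmulC (tinv T')) tmulV ?tmul1 //; exact: points0_torus.
rewrite chi_char.2 // (chi_principal hQ.1) ?mul1r //; apply: kernel_principal => // a.
have [D hD] := comul a.
have -> : tone Omega n = tmul T' (tinv T') by rewrite tmulV //; exact: points0_torus.
rewrite !hD; try exact: points0_torus.
rewrite -sumrB; apply: (abs_sum_lt cP) => // b _; rewrite -mulrBl.
apply: (absMr_lt1 cP); last exact: hV.2.
have [c <- h1] := reduces_value b.1 hT fT; have [c' <- h2] := reduces_value b.1 hT' fT'.
by apply/(res_cong (ts_residue S)); rewrite -h1.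
Qed.

Lemma descends_to_special_fibre : induces_on_special_fibre abs rho K iota ev res chi.
Proof.
pose chibar (f : A -> k) := chi (xget (tone Omega n) [set T | P0 T /\ reduces_to iota ev res T f]).
have chibarE T f : P0 T -> reduces_to iota ev res T f -> chibar f = chi T.
  move=> hT fT; rewrite /chibar; case: xgetP => [T' _ [hT' fT']|no]; last by case: (no T).
  exact: chi_reduction fT' fT.
exists chibar; split; last by move=> T f hT _; exact: chibarE.
  by move=> f /reduction_lift[T hT fT]; rewrite (chibarE T) //; exact: chi_char.1.
move=> f f' f'' /reduction_lift[T hT fT] /reduction_lift[T' hT' fT'] _ mul.
rewrite (chibarE T f) // (chibarE T' f') // -chi_char.2 //; apply: chibarE.
  exact: points0_tmul.
move=> a c; have [D hD] := comul a; rewrite hD; try exact: points0_torus.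
have /choice[v hv] (b : A) : exists c, iota c = ev b T /\ f b = res c.
  by have [c' h1 h2] := reduces_value b hT fT; exists c'.
have /choice[v' hv'] (b : A) : exists c, iota c = ev b T' /\ f' b = res c.
  by have [c' h1 h2] := reduces_value b hT' fT'; exists c'.
rewrite (mul a D hD) => e; have -> : c = \sum_(b <- D) v b.1 * v' b.2.
  apply: (iota_inj S); rewrite -e rmorph_sum; apply: eq_bigr => b _.
  by rewrite rmorphM (proj1 (hv _)) (proj1 (hv' _)).
rewrite rmorph_sum; apply: eq_bigr => b _.
by rewrite rmorphM (proj2 (hv _)) (proj2 (hv' _)).
Qed.

End IntegralPoints.

Theorem corollary8p4
  (R : realType) (Omega : closedFieldType) (abs : Omega -> R)
  (p : nat) (Qp K E : set Omega)
  (p_prime : prime p) (p_odd : p != 2%N)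
  (closureP : padic_closure abs p Qp)
  (K_finite : finite_ext Qp K) (E_ramified : ramified_quadratic abs K E)
  (* integers and residue field of K *)
  (OK : comNzRingType) (iota : {rmorphism OK -> Omega})
  (OK_integers : ring_of_integers abs K iota)
  (k : finFieldType) (res : {rmorphism OK -> k})
  (k_residue : residue_field abs iota res)
  (* the Hermitian space V *)
  (n : nat) (n_gt0 : (0 < n)%N) (h : 'M[Omega]_n)
  (V_quasi_split : quasi_split_hermitian K E h)
  (* the elements tau~ and Fr *)
  (tautilde Fr : Omega -> Omega)
  (tautilde_gen : tame_generator abs K tautilde)
  (tautilde_E : ~ fixes E tautilde)
  (Fr_frobenius : frobenius abs K Fr) (Fr_E : fixes E Fr)
  (* the parameter *)
  (phi : (Omega -> Omega) -> LG R n)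
  (phi_param : langlands_parameter abs K E phi)
  (phi_tame : tame abs K phi)
  (phi_discrete : discrete abs K phi)
  (phi_regular : regular abs K phi)
  (* its normalisation by conjugation *)
  (g : 'M[R[i]]_n) (g_unit : g \in unitmx)
  (z : 'M[R[i]]_n) (z_fixed : fixed_torus z)
  (phi_tautilde : Lconj g phi tautilde = (z, true))
  (omega : 'S_n) (phi_Fr : weyl_image (Lconj g phi Fr).1 omega)
  (* the torus T, given by the Galois action on its characters *)
  (rho : (Omega -> Omega) -> 'M[int]_n)
  (rho_T : twisted_torus abs K E h Fr omega rho)
  (* the identity component of its Neron model *)
  (A : comAlgType OK) (ev : A -> 'rV[Omega]_n -> Omega)
  (A_neron : connected_neron_model abs rho K iota ev)
  (* the Artin map of the splitting field of T *)
  (art : Omega -> Omega -> Omega)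
  (art_M : artin_map abs (splitting_field rho K) art)
  (* the character attached to phi *)
  (chi : 'rV[Omega]_n -> R[i])
  (chi_phi :
     let M := splitting_field rho K in
     let Kf := max_unramified abs K M in
     attached_character abs rho K ev Kf M art (Lconj g phi) chi) :
  [/\ depth_zero abs rho K ev chi,
      induces_on_quotient abs rho K ev chi
    & induces_on_special_fibre abs rho K iota ev res chi].

Proof.
have S : torus_setting abs p Qp K E iota res h tautilde Fr omega rho art.
  by split => //; case: tautilde_gen.
have [d [g0 [d_gt0 M_card g0_Gal g0_cong]]] := M_frobenius S.
have [chi_char [psi llc norm]] := chi_phi.
(* From here on $K_f$ is the concrete field [Mur], with the powers $\mathrm{Fr}^i$, $i<d$, as
   representatives of its Galois group over $K$. *)
rewrite (max_unramifiedE S d_gt0 M_card g0_Gal g0_cong) in llc norm.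
have [group_A smooth_A _ _] := A_neron.
have chi_1 T : points rho K T -> principal abs T -> chi T = 1.
  apply: (chi_principal S A_neron d_gt0 M_card g0_Gal g0_cong chi_char) => [T'|T' hT'].
    exact: (llc_principal S tautilde_gen phi_param phi_tame g_unit z_fixed phi_tautilde phi_Fr M_card llc).
  exact: norm (coset_reps_Mur S d_gt0 M_card g0_Gal g0_cong) T' hT'.
split; [exact: (trivial_on_plus S chi_1) | | ].
  exact: (descends_to_quotient S group_A chi_char chi_1).
exact: (descends_to_special_fibre S group_A smooth_A chi_char chi_1).
Qed.
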